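(* Assume GCH. Suppose that $\kappa$ is $H(\kappa^{+3})$-strong and $S$ is a discrete set of measurable cardinals less than $\kappa$, with a fixed normal measure $U_\alpha$ on $\alpha$ for each $\alpha\in S$. Then after forcing with the Prikry product $\mathbb{P}_S$, $\kappa$ remains $H(\kappa^{+3})$-strong.
   Context: A cardinal $\kappa$ is $H(\kappa^{+3})$-strong if there is an elementary embedding $j: V \to M$, $M$ transitive, with critical point $\kappa$ and $H(\kappa^{+3}) \subseteq M$. A set $S$ of cardinals is discrete if it contains none of its limit points. For a measurable $\alpha$ with normal measure $U_\alpha$, the Prikry forcing $\mathbb{P}_\alpha$ consists of pairs $(s,A)$ with $s$ a finite subset of $\alpha$, $A \in U_\alpha$ and $\max s < \min A$, ordered by $(s,A) \le (t,B)$ iff $s$ end-extends $t$, $s\setminus t \subseteq B$ and $A \subseteq B$. The Prikry product $\mathbb{P}_S$ is the set of sequences $\langle (s_\alpha, A_\alpha) : \alpha \in S\rangle \in \prod_{\alpha\in S}\mathbb{P}_\alpha$ with $s_\alpha = \emptyset$ for all but finitely many $\alpha\in S$, ordered coordinatewise: $p \le q$ iff $p(\alpha) \le q(\alpha)$ in $\mathbb{P}_\alpha$ for all $\alpha \in S$. *)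

(* Defs.v *)
(* "V" is an arbitrary structure (carrier, membership) satisfying
   first-order ZFC.  Set-theoretic notions are interpreted in such a structure,
   all quantifiers ranging over its carrier; "classes" are the subsets of the
   carrier that are first-order definable with parameters. *)

Record structure : Type := Structure {
  carrier :> Type;
  mem : carrier -> carrier -> Prop
}.

Arguments mem {s} _ _.

Declare Scope set_scope.
Delimit Scope set_scope with set.
Open Scope set_scope.
Notation "x ∈ y" := (mem x y) (at level 70, no associativity) : set_scope.
Notation "x ∉ y" := (~ mem x y) (at level 70, no associativity) : set_scope.

(* First-order formulas of the language of set theory, with de Bruijn indices;
   the omitted connectives are classically definable. *)
Inductive formula : Type :=
| FMem (m n : nat)
| FEq (m n : nat)
| FFalse
| FImp (phi psi : formula)
| FAll (phi : formula).

Definition scons {A : Type} (x : A) (e : nat -> A) (n : nat) : A :=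
  match n with O => x | S m => e m end.

Fixpoint sat (V : structure) (e : nat -> V) (phi : formula) : Prop :=
  match phi with
  | FMem m n => e m ∈ e n
  | FEq m n => e m = e n
  | FFalse => False
  | FImp p q => sat V e p -> sat V e q
  | FAll p => forall x : V, sat V (scons x e) p
  end.

Definition definable_class {V : structure} (C : V -> Prop) : Prop :=
  exists (phi : formula) (e : nat -> V),
    forall x, C x <-> sat V (scons x e) phi.

Definition definable_relation {V : structure} (R : V -> V -> Prop) : Prop :=
  exists (phi : formula) (e : nat -> V),
    forall x y, R x y <-> sat V (scons x (scons y e)) phi.

Section Basic.
Context {V : structure}.
Implicit Types a b c f p s t u v w x y z : V.

Definition subset x y : Prop := forall z, z ∈ x -> z ∈ y.
Definition empty x : Prop := forall z, z ∉ x.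
Definition is_singleton a x : Prop := forall z, z ∈ x <-> z = a.
Definition is_upair a b x : Prop := forall z, z ∈ x <-> z = a \/ z = b.
Definition is_union x u : Prop := forall z, z ∈ u <-> exists y, y ∈ x /\ z ∈ y.
Definition is_powerset x p : Prop := forall z, z ∈ p <-> subset z x.
Definition is_succ x y : Prop := forall z, z ∈ y <-> z ∈ x \/ z = x.

Definition inductive x : Prop :=
  (exists z, empty z /\ z ∈ x) /\
  (forall y, y ∈ x -> exists z, is_succ y z /\ z ∈ x).

(* Kuratowski pairs *)
Definition is_opair a b x : Prop :=
  exists s d, is_singleton a s /\ is_upair a b d /\ is_upair s d x.

Definition pair_mem a b f : Prop := exists x, is_opair a b x /\ x ∈ f.

Definition function_on f a : Prop :=
  (forall x, x ∈ f -> exists y z, y ∈ a /\ is_opair y z x) /\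
  (forall y, y ∈ a -> exists! z, pair_mem y z f).

Definition function_from_to f a b : Prop :=
  function_on f a /\ forall y z, pair_mem y z f -> z ∈ b.

Definition injection f a b : Prop :=
  function_from_to f a b /\
  forall y y' z, pair_mem y z f -> pair_mem y' z f -> y = y'.

Definition bijection f a b : Prop :=
  injection f a b /\ forall z, z ∈ b -> exists y, pair_mem y z f.

Definition card_le a b : Prop := exists f, injection f a b.
Definition card_lt a b : Prop := card_le a b /\ ~ card_le b a.
Definition equinumerous a b : Prop := exists f, bijection f a b.

Definition transitive x : Prop := forall y, y ∈ x -> subset y x.

(* Under Foundation this is the usual notion of von Neumann ordinal. *)
Definition ordinal x : Prop := transitive x /\ forall y, y ∈ x -> transitive y.

Definition natural x : Prop := forall i, inductive i -> x ∈ i.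
Definition is_omega w : Prop := forall x, x ∈ w <-> natural x.
Definition finite x : Prop := exists n, natural n /\ card_le x n.

Definition cardinal x : Prop := ordinal x /\ forall a, a ∈ x -> ~ card_le x a.

Definition is_succ_card x y : Prop :=
  cardinal y /\ x ∈ y /\ forall z, cardinal z -> x ∈ z -> subset y z.

Definition is_plus3 x y : Prop :=
  exists x1 x2, is_succ_card x x1 /\ is_succ_card x1 x2 /\ is_succ_card x2 y.

Definition is_trcl x t : Prop :=
  transitive t /\ subset x t /\
  forall u, transitive u -> subset x u -> subset t u.

(* x ∈ H(l) *)
Definition in_H l x : Prop := exists t, is_trcl x t /\ card_lt t l.

End Basic.

Record ZFC (V : structure) : Prop := {
  zfc_extensionality : forall x y : V, (forall z, z ∈ x <-> z ∈ y) -> x = y;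
  zfc_foundation : forall x : V, (exists y, y ∈ x) ->
    exists y, y ∈ x /\ forall z, z ∈ y -> z ∉ x;
  zfc_pairing : forall a b : V, exists x, is_upair a b x;
  zfc_union : forall x : V, exists u, is_union x u;
  zfc_powerset : forall x : V, exists p, is_powerset x p;
  zfc_infinity : exists x : V, inductive x;
  zfc_separation : forall C : V -> Prop, definable_class C ->
    forall a, exists b, forall x, x ∈ b <-> x ∈ a /\ C x;
  zfc_replacement : forall R : V -> V -> Prop, definable_relation R ->
    forall a, (forall x y y', x ∈ a -> R x y -> R x y' -> y = y') ->
    exists b, forall y, y ∈ b <-> exists x, x ∈ a /\ R x y;
  zfc_choice : forall x : V,
    (forall y, y ∈ x -> exists z, z ∈ y) ->
    (forall y y' z, y ∈ x -> y' ∈ x -> z ∈ y -> z ∈ y' -> y = y') ->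
    exists c, forall y, y ∈ x -> exists! z, z ∈ y /\ z ∈ c
}.

Definition GCH (V : structure) : Prop :=
  forall k l p : V, cardinal k -> ~ finite k ->
    is_succ_card k l -> is_powerset k p -> equinumerous p l.

Definition substructure (V : structure) (M : V -> Prop) : structure :=
  Structure {x : V | M x} (fun x y => proj1_sig x ∈ proj1_sig y).

Definition elementary_embedding (A B : structure) (j : A -> B) : Prop :=
  forall (phi : formula) (e : nat -> A),
    sat A e phi <-> sat B (fun n => j (e n)) phi.

Definition critical_point (V : structure) (j : V -> V) (k : V) : Prop :=
  ordinal k /\ (forall a, a ∈ k -> j a = a) /\ j k <> k.

(* k is H(k^{+3})-strong in V *)
Definition H3_strong (V : structure) (k : V) : Prop :=
  cardinal k /\
  exists (M : V -> Prop) (j : V -> substructure V M),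
    definable_class M /\
    definable_relation (fun x y => proj1_sig (j x) = y) /\
    (forall x y, M x -> y ∈ x -> M y) /\
    elementary_embedding V (substructure V M) j /\
    critical_point V (fun x => proj1_sig (j x)) k /\
    (forall l x, is_plus3 k l -> in_H l x -> M x).

Section Prikry.
Context {V : structure}.
Implicit Types a b c f p q s t u x A B F S U D : V.

Definition ultrafilter_on U a : Prop :=
  (forall A, A ∈ U -> subset A a) /\
  a ∈ U /\
  (forall A, empty A -> A ∉ U) /\
  (forall A B, A ∈ U -> subset A B -> subset B a -> B ∈ U) /\
  (forall A B D, A ∈ U -> B ∈ U ->
    (forall x, x ∈ D <-> x ∈ A /\ x ∈ B) -> D ∈ U) /\
  (forall A B, subset A a -> (forall x, x ∈ B <-> x ∈ a /\ x ∉ A) ->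
    A ∈ U \/ B ∈ U).

Definition nonprincipal U : Prop := forall x A, is_singleton x A -> A ∉ U.

(* a-complete: closed under intersections of fewer than a members *)
Definition complete U a : Prop :=
  forall F D, subset F U -> card_lt F a ->
    (forall x, x ∈ D <-> x ∈ a /\ forall A, A ∈ F -> x ∈ A) -> D ∈ U.

Definition measure_on U a : Prop :=
  ultrafilter_on U a /\ nonprincipal U /\ complete U a.

Definition measurable a : Prop :=
  cardinal a /\ (exists w, is_omega w /\ w ∈ a) /\ exists U, measure_on U a.

(* D is the diagonal intersection of the sequence f : a -> U *)
Definition normal_measure U a : Prop :=
  measure_on U a /\
  forall f D, function_from_to f a U ->
    (forall b, b ∈ D <->
       b ∈ a /\ forall c A, c ∈ b -> pair_mem c A f -> b ∈ A) ->
    D ∈ U.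

(* No element of S is a limit point of S. *)
Definition discrete S : Prop :=
  forall a, a ∈ S -> ~ (forall b, b ∈ a -> exists c, c ∈ S /\ c ∈ a /\ b ∈ c).

(* (s, A) is a condition of the Prikry forcing at a for the measure u *)
Definition prikry_cond a u s A : Prop :=
  finite s /\ subset s a /\ A ∈ u /\
  forall b c, b ∈ s -> c ∈ A -> b ∈ c.

Definition end_extends s t : Prop :=
  subset t s /\ forall b c, b ∈ s -> b ∉ t -> c ∈ t -> c ∈ b.

Definition prikry_le s A t B : Prop :=
  end_extends s t /\ (forall b, b ∈ s -> b ∉ t -> b ∈ B) /\ subset A B.

(* p(a) = (s, A) *)
Definition coord p a s A : Prop := exists c, is_opair s A c /\ pair_mem a c p.

Definition prikry_product_cond S U p : Prop :=
  function_on p S /\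
  (forall a, a ∈ S ->
    exists u s A, pair_mem a u U /\ coord p a s A /\ prikry_cond a u s A) /\
  (exists F, finite F /\
    forall a s A, a ∈ S -> a ∉ F -> coord p a s A -> empty s).

Definition is_prikry_product S U P : Prop :=
  forall p, p ∈ P <-> prikry_product_cond S U p.

Definition prikry_product_le S p q : Prop :=
  forall a s A t B, a ∈ S -> coord p a s A -> coord q a t B ->
    prikry_le s A t B.

Definition dense (P : V) (le : V -> V -> Prop) D : Prop :=
  subset D P /\ forall p, p ∈ P -> exists d, d ∈ D /\ le d p.

End Prikry.

(* In W, the evaluation by G of the name x is y, where evaluation is the
   recursion val(x) = {val(z) : (z, p) ∈ x for some p ∈ G}.  It is meaningful
   for every set x, not just for names; f is its restriction to a transitive t. *)
Definition evaluates {W : structure} (G x y : W) : Prop :=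
  exists f t, transitive t /\ function_on f t /\
    (forall u v, pair_mem u v f ->
      forall z, z ∈ v <->
        exists r p, p ∈ G /\ pair_mem r p u /\ pair_mem r z f) /\
    x ∈ t /\ pair_mem x y f.

(* W = V[G], where V is identified with a transitive part of W via i and G is
   a filter on (P, le) meeting every dense set of V.  Everything in W is the
   evaluation of some element of V; as the recursion is carried out inside
   W |= ZFC, this determines W also when V is not externally well-founded. *)
Record generic_extension (V : structure) (P : V) (le : V -> V -> Prop)
    (W : structure) (i : V -> W) (G : W) : Prop := {
  ge_ZFC : ZFC W;
  ge_inj : forall x y, i x = i y -> x = y;
  ge_mem : forall x y, i x ∈ i y <-> x ∈ y;
  ge_trans : forall (x : V) (w : W), w ∈ i x -> exists y, w = i y;
  ge_sub : subset G (i P);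
  ge_nonempty : exists p, p ∈ P /\ i p ∈ G;
  ge_up : forall p q, p ∈ P -> q ∈ P -> i p ∈ G -> le p q -> i q ∈ G;
  ge_directed : forall p q, i p ∈ G -> i q ∈ G ->
    exists r, i r ∈ G /\ le r p /\ le r q;
  ge_generic : forall D, dense P le D -> exists d, d ∈ D /\ i d ∈ G;
  ge_generated : forall w : W, exists x : V, evaluates G (i x) w
}.

(* Main.v *)
Require Import Defs.
From Stdlib Require Import Classical ClassicalEpsilon FunctionalExtensionality ProofIrrelevance Arith Lia.

(* Let [j : V -> M] witness the strength of [kappa] and let [X] be the set
   [H(kappa^{+3})] of [V].  As [S] is discrete, [kappa] is not in [j S], so a
   condition of [j P] splits into a part below [kappa], which lies in [P], and an
   upper part; upper parts with empty stems ("pure" ones) have lower bounds for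
   families as large as [X].  Together with the Prikry property this decides, for
   a name [y] of a subset of [D = H(kappa)] and all [a] in [X] simultaneously,
   whether [a] is in [j y], below [p ⌢ u] for densely many [p] in [P] and a pure
   upper part [u].  So in [W = V[G]] the rule
     A is in E_a  iff  for some name [y] of [A], some [p] in [G] and some pure [u],
     [j y] contains [a] densely below [p ⌢ u]
   defines ultrafilters on [D] which cohere, and whose ultrapower of [W] is
   well-founded.  Its transitive collapse [N] satisfies Łoś's theorem, its
   embedding has critical point [kappa], and the class of [(id, a)] is [a] for
   every [a] in [X].  Hence [X] is included in [N]; also [G] is in [N], being
   recovered from its image.  Conditions with the same stem are compatible and
   there are only [kappa] many stems, so [kappa^+], [kappa^{++}] and [kappa^{+3}] are
   preserved and every element of [H(kappa^{+3})] of [W] has a name in [X], which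
   can be evaluated in [N]. *)

(* Pure upper parts are directed, but their stems stay empty, so they give no generic filter for
   [j P]; this is why ultrafilters are read off from decisions instead of lifting [j] through a
   generic. GCH makes the second successor of [kappa] equinumerous with the double power set of
   [kappa]; hence [P] and all elements of [X] are small below every measurable of [M] above [kappa],
   as the lower bounds require. The structure [V] is arbitrary and may be ill-founded from outside,
   so every class and every recursion has to be definable, and well-foundedness is proved inside
   [W]: the seeds of a descending sequence have a name in [X], which the elementarity of [j] pulls
   back to a name of a sequence in [D]. One special case stands in for the forcing theorem, namely
   names for subsets of ground model sets; forcing over [M] is expressed by density of sets of
   conditions. Since [j] and [M] may fail to be classes of [W], the part of them that the
   ultrafilters use is stored in a set of [V]. *)
Existing Class ZFC.

(** * Environments and renaming of variables *)

Lemma sat_ext (V : structure) (phi : formula) : forall e e' : nat -> V,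
  (forall n, e n = e' n) -> sat V e phi <-> sat V e' phi.
Proof.
  intros e e' H. replace e' with e; [tauto|]. now apply functional_extensionality.
Qed.

Definition up_ren (r : nat -> nat) (n : nat) : nat :=
  match n with O => O | S m => S (r m) end.

Fixpoint ren (r : nat -> nat) (phi : formula) : formula :=
  match phi with
  | FMem m n => FMem (r m) (r n)
  | FEq m n => FEq (r m) (r n)
  | FFalse => FFalse
  | FImp p q => FImp (ren r p) (ren r q)
  | FAll p => FAll (ren (up_ren r) p)
  end.

Lemma sat_ren (V : structure) (phi : formula) : forall r (e : nat -> V),
  sat V e (ren r phi) <-> sat V (fun n => e (r n)) phi.
Proof.
  induction phi; intros r e; simpl; try tauto.
  - rewrite IHphi1, IHphi2. tauto.
  - split; intros H x; specialize (H x); revert H; rewrite IHphi;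
      apply sat_ext; intros [|n]; reflexivity.
Qed.

(** * Definability over families of structures *)

Section Definability.
Context {I : Type} {Vs : I -> structure} {Cst : (forall i, Vs i) -> Prop}.

(* The same formula has to define [P i] in every member of the family; the
   constants in [Cst] may occur in it as parameters. *)
Inductive Dfn : (forall i, (nat -> Vs i) -> Prop) -> Prop :=
| D_mem0 m n : Dfn (fun i e => e m ∈ e n)
| D_eq0 m n : Dfn (fun i e => e m = e n)
| D_cst0 (c : forall i, Vs i) m : Cst c -> Dfn (fun i e => e m = c i)
| D_False : Dfn (fun i e => False)
| D_imp P Q : Dfn P -> Dfn Q -> Dfn (fun i e => P i e -> Q i e)
| D_all0 P : Dfn P -> Dfn (fun i e => forall x, P i (scons x e))
| D_ren P (r : nat -> nat) : Dfn P -> Dfn (fun i e => P i (fun n => e (r n)))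
| D_ext P Q : (forall i e, P i e <-> Q i e) -> Dfn P -> Dfn Q.

(** Variables sit at even positions and parameters at odd ones, so one environment carries both
    without fixing the number of either. *)
Definition mix {A} (e c : nat -> A) (n : nat) : A :=
  if Nat.even n then e (Nat.div2 n) else c (Nat.div2 n).

Lemma mix_even A (e c : nat -> A) n : mix e c (2 * n) = e n.
Proof. unfold mix. now rewrite Nat.even_mul, Nat.div2_double. Qed.

Lemma mix_odd A (e c : nat -> A) n : mix e c (S (2 * n)) = c n.
Proof.
  unfold mix. rewrite Nat.even_succ, Nat.odd_mul, Nat.div2_succ_double. reflexivity.
Qed.

(** Formula and parameters are found before the member [i] and the environment are given; this
    uniformity is what later makes predicates transferable. [c0] only pads the list of
    parameters. *)
Lemma Dfn_formula P : Dfn P -> forall c0 : (forall i, Vs i),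
  exists phi (c : nat -> forall i, Vs i),
    (forall n, Cst (c n) \/ c n = c0) /\
    forall i e, P i e <-> sat (Vs i) (mix e (fun n => c n i)) phi.
Proof.
  intros HP c0. induction HP as [m n|m n|c m Hc| |P Q _ IHP _ IHQ|P _ IHP|P r _ IHP|P Q E _ IHP].
  - exists (FMem (2*m) (2*n)), (fun _ => c0). split; [auto|].
    intros i e. unfold sat. rewrite !mix_even. tauto.
  - exists (FEq (2*m) (2*n)), (fun _ => c0). split; [auto|].
    intros i e. unfold sat. rewrite !mix_even. tauto.
  - exists (FEq (2*m) 1), (fun _ => c). split; [auto|].
    intros i e. unfold sat. rewrite !mix_even. unfold mix; simpl. tauto.
  - exists FFalse, (fun _ => c0). split; [auto|]. simpl; tauto.
  - destruct IHP as (p & c1 & H1 & E1), IHQ as (q & c2 & H2 & E2).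
    (* The two parameter lists are interleaved once more: parameter [n] of the premise gets number
       [2 * n], that of the conclusion [2 * n + 1], and variables keep their places. *)
    exists (FImp (ren (fun n => if Nat.even n then n else S (2 * (2 * Nat.div2 n))) p)
                 (ren (fun n => if Nat.even n then n else S (2 * S (2 * Nat.div2 n))) q)).
    exists (mix c1 c2). split.
    + intros n. unfold mix. destruct (Nat.even n); auto.
    + intros i e. cbn [sat]. rewrite E1, E2, !sat_ren.
      enough (sat (Vs i) (mix e (fun n => c1 n i)) p <->
        sat (Vs i) (fun n => mix e (fun n => mix c1 c2 n i)
           (if Nat.even n then n else S (2 * (2 * Nat.div2 n)))) p) as ->.
      * enough (sat (Vs i) (mix e (fun n => c2 n i)) q <->
        sat (Vs i) (fun n => mix e (fun n => mix c1 c2 n i)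
           (if Nat.even n then n else S (2 * S (2 * Nat.div2 n)))) q) as ->; [tauto|].
        apply sat_ext. intros n. destruct (Nat.even n) eqn:En.
        -- unfold mix. now rewrite En.
        -- rewrite mix_odd, mix_odd. unfold mix. now rewrite En.
      * apply sat_ext. intros n. destruct (Nat.even n) eqn:En.
        -- unfold mix. now rewrite En.
        -- rewrite mix_odd, mix_even. unfold mix. now rewrite En.
  - destruct IHP as (p & c & H & E).
    (* The quantified variable becomes index 0. An outer variable at an even position moves down one
       even slot and then up past the binder; a parameter only moves past the binder. *)
    exists (FAll (ren (fun n => if Nat.eqb n 0 then 0 else
              if Nat.even n then S (n - 2) else S n) p)), c.
    split; [auto|]. intros i e. cbn [sat].
    split; intros K x; specialize (K x); revert K; rewrite E, sat_ren;
      apply sat_ext; intros n; (destruct n as [|[|n]]; [reflexivity|reflexivity|]);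
      cbn [Nat.eqb]; change (Nat.even (S (S n))) with (Nat.even n);
      (destruct (Nat.even n) eqn:En; unfold mix; cbn [Nat.even Nat.div2]; rewrite En;
       [replace (S (S n) - 2) with n by lia|]; cbn [scons]; cbn [Nat.even Nat.div2]; rewrite ?En; reflexivity).
  - destruct IHP as (p & c & H & E).
    exists (ren (fun n => if Nat.even n then 2 * r (Nat.div2 n) else n) p), c.
    split; [auto|]. intros i e. rewrite E, sat_ren. apply sat_ext. intros n.
    destruct (Nat.even n) eqn:En.
    + rewrite mix_even. unfold mix. now rewrite En.
    + unfold mix. now rewrite En.
  - destruct IHP as (p & c & H & E').
    exists p, c. split; [auto|]. intros i e. now rewrite <- E, E'.
Qed.

(** A term counts as definable when its graph is, so operations given by description fit in without
    a syntax of terms. *)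
Definition Dt (t : forall i, (nat -> Vs i) -> Vs i) : Prop :=
  Dfn (fun i e => e 0 = t i (fun n => e (S n))).

Lemma D_all (P : forall i, Vs i -> (nat -> Vs i) -> Prop) :
  Dfn (fun i e => P i (e 0) (fun n => e (S n))) -> Dfn (fun i e => forall x, P i x e).
Proof. intros H. apply D_all0 in H. exact H. Qed.

Lemma D_not P : Dfn P -> Dfn (fun i e => ~ P i e).
Proof. intros H. apply (D_imp P (fun i e => False)); auto using D_False. Qed.

Lemma D_and P Q : Dfn P -> Dfn Q -> Dfn (fun i e => P i e /\ Q i e).
Proof.
  intros HP HQ. apply D_ext with (fun i e => ~ (P i e -> ~ Q i e)).
  - intros; tauto.
  - apply D_not, D_imp; auto using D_not.
Qed.

Lemma D_or P Q : Dfn P -> Dfn Q -> Dfn (fun i e => P i e \/ Q i e).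
Proof.
  intros HP HQ. apply D_ext with (fun i e => ~ P i e -> Q i e).
  - intros; tauto.
  - apply D_imp; auto using D_not.
Qed.

Lemma D_iff P Q : Dfn P -> Dfn Q -> Dfn (fun i e => P i e <-> Q i e).
Proof. intros. apply D_and; apply D_imp; auto. Qed.

Lemma D_ex (P : forall i, Vs i -> (nat -> Vs i) -> Prop) :
  Dfn (fun i e => P i (e 0) (fun n => e (S n))) -> Dfn (fun i e => exists x, P i x e).
Proof.
  intros H. apply D_ext with (fun i e => ~ forall x, ~ P i x e).
  - intros i e. split.
    + intros K. now apply not_all_not_ex.
    + intros [x Hx] K. exact (K x Hx).
  - apply D_not, (D_all (fun i x e => ~ P i x e)), D_not, H.
Qed.

Lemma D_True : Dfn (fun i e => True).
Proof. apply D_ext with (fun i e => False -> False); [tauto|]. apply D_imp; apply D_False. Qed.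

Lemma Dt_var n : Dt (fun i e => e n).
Proof. exact (D_eq0 0 (S n)). Qed.

Lemma Dt_cst (c : forall i, Vs i) : Cst c -> Dt (fun i e => c i).
Proof. intros H. exact (D_cst0 c 0 H). Qed.

Lemma Dt_ren t (r : nat -> nat) : Dt t -> Dt (fun i e => t i (fun n => e (r n))).
Proof.
  intros H. apply (D_ren _ (up_ren r)) in H. exact H.
Qed.

(** Formulas contain no terms; substitution is expressed by quantifying over an element equal to the
    term. *)
Lemma D_sub1 (R : forall i, Vs i -> (nat -> Vs i) -> Prop) t :
  Dt t -> Dfn (fun i e => R i (e 0) (fun n => e (S n))) -> Dfn (fun i e => R i (t i e) e).
Proof.
  intros Ht HR.
  apply D_ext with (fun i e => exists x, x = t i e /\ R i x e).
  - intros i e. split; [now intros (x & -> & H)|eauto].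
  - apply (D_ex (fun i x e => x = t i e /\ R i x e)). apply D_and; auto.
Qed.

Lemma D_eq t u : Dt t -> Dt u -> Dfn (fun i e => t i e = u i e).
Proof.
  intros Ht Hu. apply (D_sub1 (fun i x e => x = u i e)); auto.
Qed.

Lemma D_mem t u : Dt t -> Dt u -> Dfn (fun i e => t i e ∈ u i e).
Proof.
  intros Ht Hu. apply (D_sub1 (fun i x e => x ∈ u i e) t Ht).
  apply (D_sub1 (fun i y e => e 0 ∈ y) (fun i e => u i (fun n => e (S n)))).
  - now apply Dt_ren.
  - apply (D_mem0 1 0).
Qed.

Lemma D_ex_unique (P : forall i, Vs i -> (nat -> Vs i) -> Prop) :
  Dfn (fun i e => P i (e 0) (fun n => e (S n))) -> Dfn (fun i e => exists! x, P i x e).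
Proof.
  intros H. unfold unique. apply D_ex, D_and; [exact H|].
  apply D_all, D_imp; [|apply D_eq0].
  exact (D_ren _ (fun n => match n with 0 => 0 | S n => S (S n) end) H).
Qed.

Lemma D_sub1' (R : forall i, Vs i -> Prop) t :
  Dfn (fun i e => R i (e 0)) -> Dt t -> Dfn (fun i e => R i (t i e)).
Proof. intros HR Ht. now apply (D_sub1 (fun i x e => R i x)). Qed.

Lemma D_sub2 (R : forall i, Vs i -> Vs i -> Prop) t u :
  Dfn (fun i e => R i (e 0) (e 1)) -> Dt t -> Dt u -> Dfn (fun i e => R i (t i e) (u i e)).
Proof.
  intros HR Ht Hu. apply (D_sub1 (fun i x e => R i x (u i e))); auto.
  apply (D_sub1 (fun i y e => R i (e 0) y) (fun i e => u i (fun n => e (S n)))).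
  - now apply Dt_ren.
  - exact (D_ren _ (fun n => match n with 0 => 1 | 1 => 0 | _ => n end) HR).
Qed.

Lemma D_sub3 (R : forall i, Vs i -> Vs i -> Vs i -> Prop) t u v :
  Dfn (fun i e => R i (e 0) (e 1) (e 2)) -> Dt t -> Dt u -> Dt v ->
  Dfn (fun i e => R i (t i e) (u i e) (v i e)).
Proof.
  intros HR Ht Hu Hv. apply (D_sub1 (fun i x e => R i x (u i e) (v i e))); auto.
  apply (D_sub1 (fun i y e => R i (e 0) y (v i (fun n => e (S n)))) (fun i e => u i (fun n => e (S n)))).
  - now apply Dt_ren.
  - apply (D_sub1 (fun i y e => R i (e 1) (e 0) y) (fun i e => v i (fun n => e (S (S n))))).
    + exact (Dt_ren _ (fun n => S (S n)) Hv).
    + exact (D_ren _ (fun n => match n with 0 => 2 | 1 => 1 | 2 => 0 | _ => n end) HR).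
Qed.

Lemma Dt_sub1 (F : forall i, Vs i -> Vs i) t :
  Dt (fun i e => F i (e 0)) -> Dt t -> Dt (fun i e => F i (t i e)).
Proof.
  intros HF Ht. apply (D_sub2 (fun i x y => x = F i y) (fun i e => e 0) (fun i e => t i (fun n => e (S n)))).
  - exact HF.
  - apply Dt_var.
  - now apply Dt_ren.
Qed.

Lemma Dt_sub2 (F : forall i, Vs i -> Vs i -> Vs i) t u :
  Dt (fun i e => F i (e 0) (e 1)) -> Dt t -> Dt u -> Dt (fun i e => F i (t i e) (u i e)).
Proof.
  intros HF Ht Hu.
  apply (D_sub3 (fun i x y z => x = F i y z) (fun i e => e 0) (fun i e => t i (fun n => e (S n))) (fun i e => u i (fun n => e (S n)))).
  - exact HF.
  - apply Dt_var.
  - now apply Dt_ren.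
  - now apply Dt_ren.
Qed.

Lemma Dt_spec (t : forall i, (nat -> Vs i) -> Vs i) (P : forall i, Vs i -> (nat -> Vs i) -> Prop) :
  (forall i e x, x = t i e <-> P i x e) ->
  Dfn (fun i e => P i (e 0) (fun n => e (S n))) -> Dt t.
Proof.
  intros H HP. unfold Dt. eapply D_ext; [|exact HP]. intros i e. symmetry. apply H.
Qed.

Lemma Dt_if (P : forall i, (nat -> Vs i) -> Prop) t u :
  Dfn P -> Dt t -> Dt u ->
  Dt (fun i e => if excluded_middle_informative (P i e) then t i e else u i e).
Proof.
  intros HP Ht Hu. apply Dt_spec with (fun i x e => (P i e /\ x = t i e) \/ (~ P i e /\ x = u i e)).
  - intros i e x. destruct (excluded_middle_informative (P i e)); tauto.
  - apply D_or; apply D_and; auto using D_not, Dt_ren.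
    + exact (D_ren _ S HP).
    + apply D_not. exact (D_ren _ S HP).
Qed.

(** Brings formulas given from outside, as in the axiom schemas and in Łoś's theorem, into the
    calculus. *)
Lemma Dfn_sat (phi : formula) : forall t : nat -> forall i, (nat -> Vs i) -> Vs i,
  (forall n, Dt (t n)) -> Dfn (fun i e => sat (Vs i) (fun n => t n i e) phi).
Proof.
  induction phi; intros t Ht; cbn [sat].
  - apply D_mem; auto.
  - apply D_eq; auto.
  - apply D_False.
  - apply D_imp; auto.
  - apply D_all.
    eapply D_ext; [|apply (IHphi (fun n i e => match n with 0 => e 0 | S m => t m i (fun k => e (S k)) end))].
    + intros i e. apply sat_ext. intros [|n]; reflexivity.
    + intros [|n]; [apply Dt_var|]. apply Dt_ren, Ht.
Qed.

Lemma Dfn_sub_all P (t : nat -> forall i, (nat -> Vs i) -> Vs i) : Dfn P -> (forall n, Dt (t n)) ->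
  Dfn (fun i e => P i (fun n => t n i e)).
Proof.
  intros HP. revert t. induction HP as [m n|m n|c m Hc| |P Q _ IHP _ IHQ|P _ IHP|P r _ IHP|P Q E _ IHP]; intros t Ht.
  - apply D_mem; auto.
  - apply D_eq; auto.
  - apply D_eq; auto using Dt_cst.
  - apply D_False.
  - apply D_imp; auto.
  - apply D_all. eapply D_ext; [|apply (IHP (fun n i e => match n with 0 => e 0 | S m => t m i (fun k => e (S k)) end))].
    + intros i e. cbv beta.
      replace (fun n => match n with 0 => e 0 | S m => t m i (fun k => e (S k)) end)
        with (scons (e 0) (fun n => t n i (fun k => e (S k)))); [tauto|].
      apply functional_extensionality. intros [|n]; reflexivity.
    + intros [|n]; [apply Dt_var|]. apply Dt_ren, Ht.
  - apply (IHP (fun n => t (r n))). auto.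
  - eapply D_ext; [|apply (IHP t Ht)]. intros i e. apply E.
Qed.

Lemma Dfn_class P (c0 : forall i, Vs i) i (e : nat -> Vs i) :
  Dfn P -> definable_class (fun x => P i (scons x e)).
Proof.
  intros HP. destruct (Dfn_formula P HP c0) as (phi & c & _ & E).
  (* [c0 i] fills the slot that [x] had among the variables, so all other indices shift by exactly
     one. *)
  exists (ren (fun n => if Nat.eqb n 0 then 0 else S n) phi).
  exists (mix (scons (c0 i) e) (fun n => c n i)).
  intros x. rewrite E, sat_ren. apply sat_ext.
  intros [|[|n]]; reflexivity.
Qed.

Lemma Dfn_relation P (c0 : forall i, Vs i) i (e : nat -> Vs i) :
  Dfn P -> definable_relation (fun x y => P i (scons x (scons y e))).
Proof.
  intros HP. destruct (Dfn_formula P HP c0) as (phi & c & _ & E).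
  exists (ren (fun n => if Nat.eqb n 0 then 0 else if Nat.eqb n 2 then 1 else S (S n)) phi).
  exists (mix (scons (c0 i) (scons (c0 i) e)) (fun n => c n i)).
  intros x y. rewrite E, sat_ren. apply sat_ext.
  intros [|[|[|[|n]]]]; reflexivity.
Qed.

End Definability.

(** Hooks, redefined whenever a group of operations has obtained its closure lemmas, so that [dfn]
    follows the growing vocabulary. *)
Ltac dt_user := fail.
Ltac dfn_user := fail.

Ltac dfn_step :=
  lazymatch goal with
  | |- Dt (fun _ e => e _) => apply Dt_var
  | |- Dt (fun _ _ => if excluded_middle_informative _ then _ else _) => apply Dt_if
  | |- Dt _ => first [ assumption | apply (Dt_cst (Cst := fun _ => True)); exact I | dt_user | apply Dt_ren; assumption
      | match goal with
        | H : Dt (fun _ e => ?F (e 0)) |- Dt (fun _ _ => ?F _) => apply (Dt_sub1 (fun _ => F) _ H)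
        | H : Dt (fun _ e => ?F (e 0) (e 1)) |- Dt (fun _ _ => ?F _ _) => apply (Dt_sub2 (fun _ => F) _ _ H)
        end ]
  | |- Dfn (fun _ _ => _ ∈ _) => apply D_mem
  | |- Dfn (fun _ _ => _ = _) => apply D_eq
  | |- Dfn (fun _ _ => _ /\ _) => apply D_and
  | |- Dfn (fun _ _ => _ \/ _) => apply D_or
  | |- Dfn (fun _ _ => _ <-> _) => apply D_iff
  | |- Dfn (fun _ _ => ~ _) => apply D_not
  | |- Dfn (fun _ _ => ex (unique _)) => apply D_ex_unique
  | |- Dfn (fun _ _ => ex _) => apply D_ex
  | |- Dfn (fun _ _ => False) => apply D_False
  | |- Dfn (fun _ _ => True) => apply D_True
  | |- Dfn _ => first
      [ assumption
      | dfn_user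
      | match goal with
        | H : Dfn (fun _ e => ?R (e 0)) |- Dfn (fun _ _ => ?R _) => apply (D_sub1' (fun _ => R) _ H)
        | H : Dfn (fun _ e => ?R (e 0) (e 1)) |- Dfn (fun _ _ => ?R _ _) => apply (D_sub2 (fun _ => R) _ _ H)
        | H : Dfn (fun _ e => ?R (e 0) (e 1) (e 2)) |- Dfn (fun _ _ => ?R _ _ _) => apply (D_sub3 (fun _ => R) _ _ _ H)
        | H : Dfn ?P |- Dfn (fun i e => ?P i (fun n => e _)) => apply D_ren; exact H
        end
      | apply D_imp | apply D_all ]
  end; cbv beta.

Ltac dfn := cbv beta; repeat dfn_step.

(** One structure, every element allowed as a parameter: definability in the sense of the axiom
    schemas. *)
Notation Dfn1 V := (@Dfn unit (fun _ => V) (fun _ => True)).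
Notation Dt1 V := (@Dt unit (fun _ => V) (fun _ => True)).

(** * Set operations *)

Lemma ZFC_inhabited (V : structure) : ZFC V -> inhabited V.
Proof. intros Z. destruct (zfc_infinity V Z) as [x _]. exact (inhabits x). Qed.

(** Hilbert's epsilon turns the existence axioms into total functions; where nothing satisfies the
    predicate the value is arbitrary. *)
Definition the {V : structure} {Z : ZFC V} (P : V -> Prop) : V :=
  epsilon (ZFC_inhabited V Z) P.

Lemma the_spec {V : structure} {Z : ZFC V} (P : V -> Prop) : (exists x, P x) -> P (the P).
Proof. apply epsilon_spec. Qed.

Lemma dclass_intro {V : structure} {Z : ZFC V} (C : V -> Prop) :
  Dfn1 V (fun _ e => C (e 0)) -> definable_class C.
Proof.
  intros H. destruct (ZFC_inhabited V Z) as [v].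
  exact (Dfn_class _ (fun _ => v) tt (fun _ => v) H).
Qed.

Lemma drel_intro {V : structure} {Z : ZFC V} (C : V -> V -> Prop) :
  Dfn1 V (fun _ e => C (e 0) (e 1)) -> definable_relation C.
Proof.
  intros H. destruct (ZFC_inhabited V Z) as [v].
  exact (Dfn_relation _ (fun _ => v) tt (fun _ => v) H).
Qed.

Lemma class_Dfn {V : structure} (C : V -> Prop) :
  definable_class C -> Dfn1 V (fun _ e => C (e 0)).
Proof.
  intros (phi & e & E). eapply D_ext with (fun _ e' => sat V (scons (e' 0) e) phi).
  - intros i e'. symmetry. apply E.
  - eapply D_ext; [|apply (Dfn_sat phi (fun n _ e' => match n with 0 => e' 0 | S m => e m end))].
    + intros i e'. apply sat_ext. intros [|n]; reflexivity.
    + intros [|n]; dfn.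
Qed.

Lemma relation_Dfn {V : structure} (R : V -> V -> Prop) :
  definable_relation R -> Dfn1 V (fun _ e => R (e 0) (e 1)).
Proof.
  intros (phi & e & E). eapply D_ext with (fun _ e' => sat V (scons (e' 0) (scons (e' 1) e)) phi).
  - intros i e'. symmetry. apply E.
  - eapply D_ext; [|apply (Dfn_sat phi (fun n _ e' => match n with 0 => e' 0 | 1 => e' 1 | S (S m) => e m end))].
    + intros i e'. apply sat_ext. intros [|[|n]]; reflexivity.
    + intros [|[|n]]; dfn.
Qed.

Ltac dclass := first [assumption | apply dclass_intro; solve [dfn] | apply drel_intro; solve [dfn] | solve [dfn]].

Section FamilyThe.
Context {I : Type} {Vs : I -> structure} {Cst : (forall i, Vs i) -> Prop} {Zf : forall i, ZFC (Vs i)}.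
Local Notation Dfn := (@Dfn I Vs Cst).
Local Notation Dt := (@Dt I Vs Cst).

Definition fam_pt : forall i, Vs i := fun i => @the (Vs i) (Zf i) (fun _ => True).

Lemma Dt_the (P : forall i, Vs i -> (nat -> Vs i) -> Prop) :
  (forall i e, exists x, P i x e) -> (forall i e x y, P i x e -> P i y e -> x = y) ->
  Dfn (fun i e => P i (e 0) (fun n => e (S n))) ->
  Dt (fun i e => @the (Vs i) (Zf i) (fun x => P i x e)).
Proof.
  intros HE HU HP. apply Dt_spec with P; [|exact HP].
  intros i e x. split.
  - intros ->. apply (the_spec (fun x => P i x e)), HE.
  - intros Hx. apply HU with (i := i) (e := e); [exact Hx|]. apply (the_spec (fun x => P i x e)), HE.
Qed.

Lemma Dfn_sep (C : forall i, Vs i -> (nat -> Vs i) -> Prop) i e :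
  Dfn (fun i e => C i (e 0) (fun n => e (S n))) -> definable_class (fun x => C i x e).
Proof. intros H. exact (Dfn_class _ fam_pt i e H). Qed.

Lemma Dfn_rel (C : forall i, Vs i -> Vs i -> (nat -> Vs i) -> Prop) i e :
  Dfn (fun i e => C i (e 0) (e 1) (fun n => e (S (S n)))) -> definable_relation (fun x y => C i x y e).
Proof. intros H. exact (Dfn_relation _ fam_pt i e H). Qed.

End FamilyThe.

Section Ops.
Context {V : structure} {Z : ZFC V}.
Implicit Types a b c f x y z : V.

Lemma ext_eq x y : (forall z, z ∈ x <-> z ∈ y) -> x = y.
Proof. apply (zfc_extensionality V Z). Qed.

(** For a class that is not definable the value is unspecified; hence the side condition in [in_sep]
    and in every later unfolding of a comprehension. *)
Definition sep a (C : V -> Prop) : V := the (fun b => forall x, x ∈ b <-> x ∈ a /\ C x).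
Lemma in_sep a (C : V -> Prop) x : definable_class C -> x ∈ sep a C <-> x ∈ a /\ C x.
Proof. intros H. revert x. apply (the_spec (fun b => forall x, x ∈ b <-> x ∈ a /\ C x)). now apply (zfc_separation V Z). Qed.

Definition emp : V := the (fun x => empty x).
Lemma in_emp x : ~ x ∈ emp.
Proof.
  revert x. apply (the_spec (fun x => empty x)).
  destruct (ZFC_inhabited V Z) as [v].
  destruct (zfc_separation V Z (fun _ => False)) with (a := v) as [b Hb].
  - dclass.
  - exists b. intros z Hz. now apply Hb in Hz.
Qed.

Definition upair a b : V := the (is_upair a b).
Lemma in_upair a b z : z ∈ upair a b <-> z = a \/ z = b.
Proof. revert z. apply (the_spec (is_upair a b)), (zfc_pairing V Z). Qed.

Definition sing a : V := upair a a.
Lemma in_sing a z : z ∈ sing a <-> z = a.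
Proof. unfold sing. rewrite in_upair. tauto. Qed.

Definition un x : V := the (is_union x).
Lemma in_un x z : z ∈ un x <-> exists y, y ∈ x /\ z ∈ y.
Proof. revert z. apply (the_spec (is_union x)), (zfc_union V Z). Qed.

Definition cup a b : V := un (upair a b).
Lemma in_cup a b z : z ∈ cup a b <-> z ∈ a \/ z ∈ b.
Proof.
  unfold cup. rewrite in_un. setoid_rewrite in_upair. split.
  - intros (y & [-> | ->] & H); auto.
  - intros [H|H]; eauto.
Qed.

Definition pow x : V := the (is_powerset x).
Lemma in_pow x z : z ∈ pow x <-> subset z x.
Proof. revert z. apply (the_spec (is_powerset x)), (zfc_powerset V Z). Qed.

Definition succ x : V := cup x (sing x).
Lemma in_succ x z : z ∈ succ x <-> z ∈ x \/ z = x.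
Proof. unfold succ. now rewrite in_cup, in_sing. Qed.

Definition diff a b : V := sep a (fun x => ~ x ∈ b).
Lemma in_diff a b x : x ∈ diff a b <-> x ∈ a /\ ~ x ∈ b.
Proof. unfold diff. rewrite in_sep; [tauto|dclass]. Qed.

Definition cap a b : V := sep a (fun x => x ∈ b).
Lemma in_cap a b x : x ∈ cap a b <-> x ∈ a /\ x ∈ b.
Proof. unfold cap. rewrite in_sep; [tauto|dclass]. Qed.

Definition opair a b : V := upair (sing a) (upair a b).

Lemma is_opair_iff a b x : is_opair a b x <-> x = opair a b.
Proof.
  split.
  - intros (s & d & Hs & Hd & Hx). apply ext_eq. intros z. unfold opair.
    rewrite (Hx z), in_upair.
    replace s with (sing a). 2:{ apply ext_eq; intros w; now rewrite in_sing, (Hs w). }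
    replace d with (upair a b). 2:{ apply ext_eq; intros w; now rewrite in_upair, (Hd w). }
    tauto.
  - intros ->. exists (sing a), (upair a b).
    split; [|split]; intros z; unfold opair; rewrite ?in_sing, ?in_upair; tauto.
Qed.

Lemma opair_inj a b c d : opair a b = opair c d -> a = c /\ b = d.
Proof.
  unfold opair. intros H.
  assert (H1 : sing a = sing c \/ sing a = upair c d).
  { apply in_upair. rewrite <- H. apply in_upair. auto. }
  assert (H2 : upair a b = sing c \/ upair a b = upair c d).
  { apply in_upair. rewrite <- H. apply in_upair. auto. }
  assert (H3 : upair c d = sing a \/ upair c d = upair a b).
  { apply in_upair. rewrite H. apply in_upair. auto. }
  assert (Hac : a = c).
  { assert (K : c ∈ sing a); [|apply in_sing in K; auto].
    destruct H1 as [-> | ->]; [apply in_sing | apply in_upair]; auto. }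
  subst c. split; [auto|].
  assert (Hb : b = a \/ b = d).
  { assert (K : b ∈ upair a b) by (apply in_upair; auto).
    destruct H2 as [E|E]; rewrite E in K; [apply in_sing in K | apply in_upair in K]; auto. }
  assert (Hd : d = a \/ d = b).
  { assert (K : d ∈ upair a d) by (apply in_upair; auto).
    destruct H3 as [E|E]; rewrite E in K; [apply in_sing in K | apply in_upair in K]; auto. }
  destruct Hb as [-> | ->]; destruct Hd as [Hd|Hd]; auto.
Qed.

Lemma pair_mem_iff a b f : pair_mem a b f <-> opair a b ∈ f.
Proof.
  unfold pair_mem. setoid_rewrite is_opair_iff. split.
  - now intros (x & -> & H).
  - eauto.
Qed.

Definition img a (F : V -> V) : V := the (fun b => forall y, y ∈ b <-> exists x, x ∈ a /\ y = F x).
Lemma in_img a (F : V -> V) y : definable_relation (fun x y => y = F x) ->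
  y ∈ img a F <-> exists x, x ∈ a /\ y = F x.
Proof.
  intros H. revert y. apply (the_spec (fun b => forall y, y ∈ b <-> exists x, x ∈ a /\ y = F x)).
  apply (zfc_replacement V Z _ H). intros; congruence.
Qed.

Definition prod a b : V :=
  sep (pow (pow (cup a b))) (fun z => exists x y, x ∈ a /\ y ∈ b /\ z = opair x y).

Lemma opair_pow u x y : x ∈ u -> y ∈ u -> opair x y ∈ pow (pow u).
Proof.
  intros Hx Hy. rewrite in_pow. intros z Hz. apply in_upair in Hz.
  rewrite in_pow. destruct Hz as [-> | ->]; intros w Hw.
  - apply in_sing in Hw. now subst.
  - apply in_upair in Hw as [-> | ->]; auto.
Qed.

Lemma in_prod a b z : z ∈ prod a b <-> exists x y, x ∈ a /\ y ∈ b /\ z = opair x y.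
Proof.
  unfold prod. rewrite in_sep.
  - split; [tauto|]. intros (x & y & Hx & Hy & ->). split; [|eauto].
    apply opair_pow; apply in_cup; auto.
  - apply dclass_intro. dfn. unfold opair, sing.
    apply Dt_spec with (fun _ z e => is_opair (e 1) (e 0) z).
    + intros _ e w. now rewrite is_opair_iff.
    + unfold is_opair, is_singleton, is_upair. dfn.
Qed.

Lemma opair_in_prod a b x y : opair x y ∈ prod a b <-> x ∈ a /\ y ∈ b.
Proof.
  rewrite in_prod. split; [|intros []; exists x, y; auto].
  intros (x' & y' & Hx & Hy & E). apply opair_inj in E as [-> ->]. auto.
Qed.

(* The unions make these operations total and definable; on a non-pair, or
   outside the domain, the value is [emp]. *)
Definition fst x : V := un (sep (un x) (fun a => exists b, is_opair a b x)).
Definition snd x : V := un (sep (un x) (fun b => exists a, is_opair a b x)).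
Definition app f x : V := un (sep (un (un f)) (fun y => pair_mem x y f)).

End Ops.

Section DfnOps.
Context {I : Type} {Vs : I -> structure} {Cst : (forall i, Vs i) -> Prop} {Zf : forall i, ZFC (Vs i)}.
Local Notation Dfn := (@Dfn I Vs Cst).
Local Notation Dt := (@Dt I Vs Cst).
Implicit Types t u v : forall i, (nat -> Vs i) -> Vs i.

Lemma D_subset t u : Dt t -> Dt u -> Dfn (fun i e => subset (t i e) (u i e)).
Proof. intros. unfold subset. dfn. Qed.

Lemma D_empty t : Dt t -> Dfn (fun i e => empty (t i e)).
Proof. intros. unfold empty. dfn. Qed.

Lemma Dt_sep t (C : forall i, Vs i -> (nat -> Vs i) -> Prop) :
  Dt t -> Dfn (fun i e => C i (e 0) (fun n => e (S n))) ->
  Dt (fun i e => sep (t i e) (fun x => C i x e)).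
Proof.
  intros Ht HC. apply Dt_spec with (fun i b e => forall x, x ∈ b <-> x ∈ t i e /\ C i x e).
  - intros i e b. split.
    + intros -> x. exact (in_sep _ _ x (Dfn_sep C i e HC)).
    + intros H. apply ext_eq. intros x. rewrite H. symmetry. exact (in_sep _ _ x (Dfn_sep C i e HC)).
  - dfn. exact (D_ren _ (fun n => match n with 0 => 0 | S n => S (S n) end) HC).
Qed.

Lemma Dt_img t (F : forall i, Vs i -> (nat -> Vs i) -> Vs i) :
  Dt t -> Dt (fun i e => F i (e 0) (fun n => e (S n))) ->
  Dt (fun i e => img (t i e) (fun x => F i x e)).
Proof.
  intros Ht HF.
  assert (HR : forall i e, definable_relation (fun x y => y = F i x e)).
  { intros i e. apply (Dfn_rel (Cst := Cst) (fun i x y e => y = F i x e)).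
    exact (D_ren _ (fun n => match n with 0 => 1 | 1 => 0 | _ => n end) HF). }
  apply Dt_spec with (fun i b e => forall y, y ∈ b <-> exists x, x ∈ t i e /\ y = F i x e).
  - intros i e b. split.
    + intros -> x. exact (in_img _ _ x (HR i e)).
    + intros H. apply ext_eq. intros x. rewrite H. symmetry. exact (in_img _ _ x (HR i e)).
  - dfn. exact (Dt_ren _ (fun n => match n with 0 => 0 | S n => S (S (S n)) end) HF).
Qed.

Lemma Dt_emp : Dt (fun i e => emp).
Proof.
  apply Dt_spec with (fun i b e => forall x, ~ x ∈ b).
  - intros i e b. split; [intros -> x; apply in_emp|].
    intros H. apply ext_eq. intros x. generalize (H x) (in_emp x). tauto.
  - dfn.
Qed.

Lemma Dt_upair t u : Dt t -> Dt u -> Dt (fun i e => upair (t i e) (u i e)).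
Proof.
  intros. apply Dt_spec with (fun i b e => forall x, x ∈ b <-> x = t i e \/ x = u i e).
  - intros i e b. split; [intros -> x; apply in_upair|].
    intros K. apply ext_eq. intros x. now rewrite K, in_upair.
  - dfn.
Qed.

Lemma Dt_sing t : Dt t -> Dt (fun i e => sing (t i e)).
Proof. intros. unfold sing. now apply Dt_upair. Qed.

Lemma Dt_un t : Dt t -> Dt (fun i e => un (t i e)).
Proof.
  intros. apply Dt_spec with (fun i b e => forall x, x ∈ b <-> exists y, y ∈ t i e /\ x ∈ y).
  - intros i e b. split; [intros -> x; apply in_un|].
    intros K. apply ext_eq. intros x. now rewrite K, in_un.
  - dfn.
Qed.

Lemma Dt_cup t u : Dt t -> Dt u -> Dt (fun i e => cup (t i e) (u i e)).
Proof. intros. unfold cup. now apply Dt_un, Dt_upair. Qed.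

Lemma Dt_pow t : Dt t -> Dt (fun i e => pow (t i e)).
Proof.
  intros. apply Dt_spec with (fun i b e => forall x, x ∈ b <-> forall y, y ∈ x -> y ∈ t i e).
  - intros i e b. split; [intros -> x; apply in_pow|].
    intros K. apply ext_eq. intros x. now rewrite K, in_pow.
  - dfn.
Qed.

Lemma Dt_succ t : Dt t -> Dt (fun i e => succ (t i e)).
Proof. intros. unfold succ. now apply Dt_cup, Dt_sing. Qed.

Lemma Dt_opair t u : Dt t -> Dt u -> Dt (fun i e => opair (t i e) (u i e)).
Proof. intros. unfold opair. apply Dt_upair; [now apply Dt_sing|now apply Dt_upair]. Qed.

Lemma Dt_diff t u : Dt t -> Dt u -> Dt (fun i e => diff (t i e) (u i e)).
Proof. intros. apply (Dt_sep t (fun i x e => ~ x ∈ u i e)); dfn. Qed.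

Lemma Dt_cap t u : Dt t -> Dt u -> Dt (fun i e => cap (t i e) (u i e)).
Proof. intros. apply (Dt_sep t (fun i x e => x ∈ u i e)); dfn. Qed.

Lemma D_is_opair t u v : Dt t -> Dt u -> Dt v -> Dfn (fun i e => is_opair (t i e) (u i e) (v i e)).
Proof.
  intros. apply D_ext with (fun i e => v i e = opair (t i e) (u i e)).
  - intros. now rewrite is_opair_iff.
  - apply D_eq; auto using Dt_opair.
Qed.

Lemma D_pair_mem t u v : Dt t -> Dt u -> Dt v -> Dfn (fun i e => pair_mem (t i e) (u i e) (v i e)).
Proof.
  intros. apply D_ext with (fun i e => opair (t i e) (u i e) ∈ v i e).
  - intros. now rewrite pair_mem_iff.
  - apply D_mem; auto using Dt_opair.
Qed.

Lemma Dt_prod t u : Dt t -> Dt u -> Dt (fun i e => prod (t i e) (u i e)).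
Proof.
  intros. unfold prod.
  apply (Dt_sep (fun i e => pow (pow (cup (t i e) (u i e))))
     (fun i z e => exists x y, x ∈ t i e /\ y ∈ u i e /\ z = opair x y)).
  - now apply Dt_pow, Dt_pow, Dt_cup.
  - dfn. apply Dt_opair; dfn.
Qed.

Lemma Dt_fst t : Dt t -> Dt (fun i e => fst (t i e)).
Proof.
  intros. unfold fst. apply Dt_un, (Dt_sep _ (fun i x e => exists b, is_opair x b (t i e))).
  - now apply Dt_un.
  - apply D_ex. apply D_is_opair; dfn.
Qed.

Lemma Dt_snd t : Dt t -> Dt (fun i e => snd (t i e)).
Proof.
  intros. unfold snd. apply Dt_un, (Dt_sep _ (fun i x e => exists b, is_opair b x (t i e))).
  - now apply Dt_un.
  - apply D_ex. apply D_is_opair; dfn.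
Qed.

Lemma Dt_app t u : Dt t -> Dt u -> Dt (fun i e => app (t i e) (u i e)).
Proof.
  intros. unfold app. apply Dt_un, (Dt_sep _ (fun i x e => pair_mem (u i e) x (t i e))).
  - now apply Dt_un, Dt_un.
  - apply D_pair_mem; dfn.
Qed.

End DfnOps.

Ltac dt_userB :=
  lazymatch goal with
  | |- Dt (fun _ _ => emp) => apply Dt_emp
  | |- Dt (fun _ _ => upair _ _) => apply Dt_upair
  | |- Dt (fun _ _ => sing _) => apply Dt_sing
  | |- Dt (fun _ _ => un _) => apply Dt_un
  | |- Dt (fun _ _ => cup _ _) => apply Dt_cup
  | |- Dt (fun _ _ => cap _ _) => apply Dt_cap
  | |- Dt (fun _ _ => diff _ _) => apply Dt_diff
  | |- Dt (fun _ _ => pow _) => apply Dt_pow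
  | |- Dt (fun _ _ => succ _) => apply Dt_succ
  | |- Dt (fun _ _ => opair _ _) => apply Dt_opair
  | |- Dt (fun _ _ => prod _ _) => apply Dt_prod
  | |- Dt (fun _ _ => fst _) => apply Dt_fst
  | |- Dt (fun _ _ => snd _) => apply Dt_snd
  | |- Dt (fun _ _ => app _ _) => apply Dt_app
  | |- Dt (fun _ _ => sep _ _) => apply Dt_sep
  | |- Dt (fun _ _ => img _ _) => apply Dt_img
  end.
Ltac dfn_userB :=
  lazymatch goal with
  | |- Dfn (fun _ _ => subset _ _) => apply D_subset
  | |- Dfn (fun _ _ => empty _) => apply D_empty
  | |- Dfn (fun _ _ => is_opair _ _ _) => apply D_is_opair
  | |- Dfn (fun _ _ => pair_mem _ _ _) => apply D_pair_mem
  end.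
Ltac dt_user ::= dt_userB.
Ltac dfn_user ::= dfn_userB.

Section Functions.
Context {V : structure} {Z : ZFC V}.
Implicit Types a b c f g x y z : V.

(** Explains the shape of [fst], [snd] and [app]: the union of a set with one element is that
    element. *)
Lemma un_sing_sep a (C : V -> Prop) x : definable_class C -> x ∈ a -> C x ->
  (forall y, C y -> y = x) -> un (sep a C) = x.
Proof.
  intros HC Hx Hc HU. apply ext_eq. intros z. rewrite in_un. split.
  - intros (y & Hy & Hz). rewrite in_sep in Hy by auto. destruct Hy as [_ Hy].
    apply HU in Hy. now subst.
  - intros Hz. exists x. rewrite in_sep by auto. auto.
Qed.

Lemma upair_in_opair x y : upair x y ∈ opair x y.
Proof. unfold opair. apply in_upair. auto. Qed.

Lemma opair_un x y : x ∈ un (opair x y) /\ y ∈ un (opair x y).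
Proof.
  split; apply in_un; exists (upair x y); unfold opair; rewrite !in_upair; auto.
Qed.

Lemma fst_opair a b : fst (opair a b) = a.
Proof.
  apply un_sing_sep.
  - dclass.
  - apply opair_un.
  - exists b. now apply is_opair_iff.
  - intros y [b' H]. apply is_opair_iff in H. now apply opair_inj in H as [].
Qed.

Lemma snd_opair a b : snd (opair a b) = b.
Proof.
  apply un_sing_sep.
  - dclass.
  - apply opair_un.
  - exists a. now apply is_opair_iff.
  - intros y [b' H]. apply is_opair_iff in H. now apply opair_inj in H as [].
Qed.

Lemma app_eq f x y : opair x y ∈ f -> (forall z, opair x z ∈ f -> z = y) -> app f x = y.
Proof.
  intros H HU. apply un_sing_sep.
  - dclass.
  - apply in_un. exists (upair x y). rewrite in_upair. split; [|auto].
    apply in_un. exists (opair x y). auto using upair_in_opair.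
  - now apply pair_mem_iff.
  - intros z Hz. apply HU. now apply pair_mem_iff.
Qed.

Lemma function_on_elem f a z : function_on f a -> z ∈ f -> exists x y, x ∈ a /\ z = opair x y.
Proof.
  intros [H _] Hz. destruct (H z Hz) as (x & y & Hx & E). apply is_opair_iff in E. eauto.
Qed.

Lemma function_on_dom f a x y : function_on f a -> opair x y ∈ f -> x ∈ a.
Proof.
  intros H Hx. destruct (function_on_elem f a _ H Hx) as (x' & y' & Hx' & E).
  apply opair_inj in E as [-> _]. auto.
Qed.

Lemma function_on_uniq f a x y y' : function_on f a -> opair x y ∈ f -> opair x y' ∈ f -> y = y'.
Proof.
  intros H Hy Hy'. pose proof (function_on_dom _ _ _ _ H Hy) as Hx.
  destruct H as [_ H]. destruct (H x Hx) as (w & _ & HU).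
  rewrite <- (HU y), <- (HU y'); auto; now apply pair_mem_iff.
Qed.

Lemma app_val f a x y : function_on f a -> opair x y ∈ f -> app f x = y.
Proof. intros H Hy. apply app_eq; [auto|]. intros z Hz. eapply function_on_uniq; eauto. Qed.

Lemma app_mem f a x : function_on f a -> x ∈ a -> opair x (app f x) ∈ f.
Proof.
  intros H Hx. destruct (proj2 H x Hx) as (y & Hy & _). apply pair_mem_iff in Hy.
  now rewrite (app_val _ _ _ _ H Hy).
Qed.

Lemma function_on_intro f a : (forall z, z ∈ f -> exists x y, x ∈ a /\ z = opair x y) ->
  (forall x, x ∈ a -> exists y, opair x y ∈ f) ->
  (forall x y y', opair x y ∈ f -> opair x y' ∈ f -> y = y') -> function_on f a.
Proof.
  intros H1 H2 H3. split.
  - intros z Hz. destruct (H1 z Hz) as (x & y & Hx & ->). exists x, y.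
    split; [auto|now apply is_opair_iff].
  - intros x Hx. destruct (H2 x Hx) as [y Hy]. exists y. split; [now apply pair_mem_iff|].
    intros y' Hy'. apply pair_mem_iff in Hy'. eauto.
Qed.

Lemma function_ext f g a : function_on f a -> function_on g a ->
  (forall x, x ∈ a -> app f x = app g x) -> f = g.
Proof.
  intros Hf Hg H. apply ext_eq. intros z. split; intros Hz.
  - destruct (function_on_elem _ _ _ Hf Hz) as (x & y & Hx & ->).
    rewrite <- (app_val _ _ _ _ Hf Hz), H by auto. now apply app_mem with a.
  - destruct (function_on_elem _ _ _ Hg Hz) as (x & y & Hx & ->).
    rewrite <- (app_val _ _ _ _ Hg Hz), <- H by auto. now apply app_mem with a.
Qed.

Definition lam a (F : V -> V) : V := img a (fun x => opair x (F x)).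

Lemma lam_dfn (F : V -> V) : Dt1 V (fun _ e => F (e 0)) ->
  definable_relation (fun x y => y = opair x (F x)).
Proof. intros H. dclass. Qed.

Lemma in_lam a (F : V -> V) x y : Dt1 V (fun _ e => F (e 0)) ->
  opair x y ∈ lam a F <-> x ∈ a /\ y = F x.
Proof.
  intros H. unfold lam. rewrite in_img by now apply lam_dfn. split.
  - intros (x' & Hx & E). apply opair_inj in E as [-> ->]. auto.
  - intros [Hx ->]. eauto.
Qed.

Lemma lam_function a (F : V -> V) : Dt1 V (fun _ e => F (e 0)) -> function_on (lam a F) a.
Proof.
  intros H. apply function_on_intro.
  - intros z Hz. unfold lam in Hz. rewrite in_img in Hz by now apply lam_dfn.
    destruct Hz as (x & Hx & ->). eauto.
  - intros x Hx. exists (F x). now apply in_lam.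
  - intros x y y' H1 H2. rewrite in_lam in H1, H2 by auto. destruct H1, H2. congruence.
Qed.

Lemma app_lam a (F : V -> V) x : Dt1 V (fun _ e => F (e 0)) -> x ∈ a -> app (lam a F) x = F x.
Proof.
  intros H Hx. apply app_val with a; [now apply lam_function|]. now apply in_lam.
Qed.

Definition ran f : V := sep (un (un f)) (fun y => exists x, opair x y ∈ f).
Lemma in_ran f y : y ∈ ran f <-> exists x, opair x y ∈ f.
Proof.
  unfold ran. rewrite in_sep by dclass. split; [tauto|]. intros [x H]. split; [|eauto].
  apply in_un. exists (upair x y). rewrite in_upair. split; [|auto].
  apply in_un. exists (opair x y). auto using upair_in_opair.
Qed.

Definition rel_dom f : V := sep (un (un f)) (fun x => exists y, opair x y ∈ f).
Definition restr f a : V := sep f (fun z => exists x y, x ∈ a /\ z = opair x y).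
Lemma in_restr f a x y : opair x y ∈ restr f a <-> opair x y ∈ f /\ x ∈ a.
Proof.
  unfold restr. rewrite in_sep by dclass. split.
  - intros (H & x' & y' & Hx & E). apply opair_inj in E as [-> _]. auto.
  - intros [H Hx]. eauto.
Qed.

Lemma in_restr_iff f a z : z ∈ restr f a <-> z ∈ f /\ exists x y, x ∈ a /\ z = opair x y.
Proof. unfold restr. rewrite in_sep by dclass. tauto. Qed.

Lemma restr_sub f a : subset (restr f a) f.
Proof. intros z Hz. unfold restr in Hz. rewrite in_sep in Hz by dclass. tauto. Qed.

Lemma restr_function f a b : function_on f a -> subset b a -> function_on (restr f b) b.
Proof.
  intros Hf Hb. apply function_on_intro.
  - intros z Hz. unfold restr in Hz. rewrite in_sep in Hz by dclass.
    destruct Hz as (_ & x & y & Hx & ->). eauto.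
  - intros x Hx. exists (app f x). apply in_restr. split; [|auto]. apply app_mem with a; auto.
  - intros x y y' H1 H2. apply in_restr in H1 as [H1 _], H2 as [H2 _].
    eapply function_on_uniq; eauto.
Qed.

Lemma app_restr f a b x : function_on f a -> subset b a -> x ∈ b -> app (restr f b) x = app f x.
Proof.
  intros Hf Hb Hx. apply app_val with b; [now apply restr_function with a|].
  apply in_restr. split; [|auto]. apply app_mem with a; auto.
Qed.

Lemma subset_antisym a b : subset a b -> subset b a -> a = b.
Proof. intros H K. apply ext_eq. intros z. split; auto. Qed.

End Functions.

Section DfnFunctions.
Context {I : Type} {Vs : I -> structure} {Cst : (forall i, Vs i) -> Prop} {Zf : forall i, ZFC (Vs i)}.
Local Notation Dfn := (@Dfn I Vs Cst).
Local Notation Dt := (@Dt I Vs Cst).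
Implicit Types t u v : forall i, (nat -> Vs i) -> Vs i.

Lemma Dt_lam t (F : forall i, Vs i -> (nat -> Vs i) -> Vs i) :
  Dt t -> Dt (fun i e => F i (e 0) (fun n => e (S n))) ->
  Dt (fun i e => lam (t i e) (fun x => F i x e)).
Proof. intros. unfold lam. apply (Dt_img t (fun i x e => opair x (F i x e))); dfn. Qed.

Lemma Dt_ran t : Dt t -> Dt (fun i e => ran (t i e)).
Proof. intros. unfold ran. apply (Dt_sep _ (fun i y e => exists x, opair x y ∈ t i e)); dfn. Qed.

Lemma Dt_rel_dom t : Dt t -> Dt (fun i e => rel_dom (t i e)).
Proof. intros. unfold rel_dom. apply (Dt_sep _ (fun i y e => exists x, opair y x ∈ t i e)); dfn. Qed.

Lemma Dt_restr t u : Dt t -> Dt u -> Dt (fun i e => restr (t i e) (u i e)).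
Proof.
  intros. unfold restr.
  apply (Dt_sep _ (fun i z e => exists x y, x ∈ u i e /\ z = opair x y)); dfn.
Qed.

Lemma D_function_on t u : Dt t -> Dt u -> Dfn (fun i e => function_on (t i e) (u i e)).
Proof.
  intros. unfold function_on. dfn.
Qed.

Lemma D_function_from_to t u v : Dt t -> Dt u -> Dt v -> Dfn (fun i e => function_from_to (t i e) (u i e) (v i e)).
Proof. intros. unfold function_from_to. dfn. now apply D_function_on. Qed.

Lemma D_injection t u v : Dt t -> Dt u -> Dt v -> Dfn (fun i e => injection (t i e) (u i e) (v i e)).
Proof. intros. unfold injection. dfn. now apply D_function_from_to. Qed.

Lemma D_bijection t u v : Dt t -> Dt u -> Dt v -> Dfn (fun i e => bijection (t i e) (u i e) (v i e)).
Proof. intros. unfold bijection. dfn. now apply D_injection. Qed.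

Lemma D_card_le t u : Dt t -> Dt u -> Dfn (fun i e => card_le (t i e) (u i e)).
Proof. intros. unfold card_le. dfn. apply D_injection; dfn. Qed.

Lemma D_card_lt t u : Dt t -> Dt u -> Dfn (fun i e => card_lt (t i e) (u i e)).
Proof. intros. unfold card_lt. dfn; apply D_card_le; dfn. Qed.

Lemma D_transitive t : Dt t -> Dfn (fun i e => transitive (t i e)).
Proof. intros. unfold transitive. dfn. Qed.

Lemma D_ordinal t : Dt t -> Dfn (fun i e => ordinal (t i e)).
Proof. intros. unfold ordinal. dfn; apply D_transitive; dfn. Qed.

Lemma D_inductive t : Dt t -> Dfn (fun i e => inductive (t i e)).
Proof. intros. unfold inductive, is_succ. dfn. Qed.

Lemma D_natural t : Dt t -> Dfn (fun i e => natural (t i e)).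
Proof. intros. unfold natural. dfn. apply D_inductive; dfn. Qed.

Lemma D_finite t : Dt t -> Dfn (fun i e => finite (t i e)).
Proof. intros. unfold finite. dfn; [apply D_inductive | apply D_card_le]; dfn. Qed.

Lemma D_cardinal t : Dt t -> Dfn (fun i e => cardinal (t i e)).
Proof. intros. unfold cardinal. dfn; [apply D_ordinal|apply D_card_le]; dfn. Qed.

End DfnFunctions.

Ltac dt_userB2 :=
  lazymatch goal with
  | |- Dt (fun _ _ => lam _ _) => apply Dt_lam
  | |- Dt (fun _ _ => ran _) => apply Dt_ran
  | |- Dt (fun _ _ => rel_dom _) => apply Dt_rel_dom
  | |- Dt (fun _ _ => restr _ _) => apply Dt_restr
  end.
Ltac dfn_userB2 :=
  lazymatch goal with
  | |- Dfn (fun _ _ => function_on _ _) => apply D_function_on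
  | |- Dfn (fun _ _ => function_from_to _ _ _) => apply D_function_from_to
  | |- Dfn (fun _ _ => injection _ _ _) => apply D_injection
  | |- Dfn (fun _ _ => bijection _ _ _) => apply D_bijection
  | |- Dfn (fun _ _ => card_le _ _) => apply D_card_le
  | |- Dfn (fun _ _ => card_lt _ _) => apply D_card_lt
  | |- Dfn (fun _ _ => transitive _) => apply D_transitive
  | |- Dfn (fun _ _ => ordinal _) => apply D_ordinal
  | |- Dfn (fun _ _ => inductive _) => apply D_inductive
  | |- Dfn (fun _ _ => natural _) => apply D_natural
  | |- Dfn (fun _ _ => finite _) => apply D_finite
  | |- Dfn (fun _ _ => cardinal _) => apply D_cardinal
  end.
Ltac dt_user ::= first [dt_userB | dt_userB2].
Ltac dfn_user ::= first [dfn_userB | dfn_userB2].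
Global Opaque sep emp upair sing un cup pow succ diff cap opair img prod fst snd app lam ran rel_dom restr.

(** * Recursion, induction and ordinals *)

Section Recursion.
Context {V : structure} {Z : ZFC V}.
Implicit Types a b c d f g h x y z K : V.

Section WfRec.
Variables (K : V) (R : V -> V -> Prop) (G : V -> V -> V).
Hypothesis (HR : Dfn1 V (fun _ e => R (e 0) (e 1))).
Hypothesis (HG : Dt1 V (fun _ e => G (e 0) (e 1))).
Hypothesis (wf : forall b, subset b K -> (exists x, x ∈ b) ->
  exists m, m ∈ b /\ forall y, y ∈ b -> ~ R y m).

Local Definition rpred x : V := sep K (fun y => R y x).

Lemma in_rpred x y : y ∈ rpred x <-> y ∈ K /\ R y x.
Proof. unfold rpred. rewrite in_sep; [tauto|dclass]. Qed.

Lemma Dt_rpred : Dt1 V (fun _ e => rpred (e 0)).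
Proof. unfold rpred. dfn. Qed.

Local Definition approx f d : Prop :=
  function_on f d /\ subset d K /\
  (forall x y, x ∈ d -> y ∈ K -> R y x -> y ∈ d) /\
  forall x, x ∈ d -> app f x = G x (restr f (rpred x)).

Lemma D_approx : Dfn1 V (fun _ e => approx (e 0) (e 1)).
Proof. pose proof Dt_rpred. unfold approx. dfn. Qed.

Lemma approx_agree f d f' d' : approx f d -> approx f' d' ->
  forall x, x ∈ d -> x ∈ d' -> app f x = app f' x.
Proof.
  intros (F1 & S1 & C1 & E1) (F2 & S2 & C2 & E2).
  set (B := sep K (fun x => x ∈ d /\ x ∈ d' /\ app f x <> app f' x)).
  assert (HB : forall x, x ∈ B <-> x ∈ K /\ x ∈ d /\ x ∈ d' /\ app f x <> app f' x).
  { intros x. unfold B. rewrite in_sep; [tauto|]. dclass. }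
  intros x H1 H2. apply NNPP. intros N.
  destruct (wf B) as (m & Hm & Hmin).
  - intros y Hy. now apply HB in Hy.
  - exists x. apply HB. auto.
  - apply HB in Hm as (mK & m1 & m2 & Hne). apply Hne. rewrite E1, E2 by auto.
    assert (P1 : subset (rpred m) d). { intros y Hy. apply in_rpred in Hy as []. eauto. }
    assert (P2 : subset (rpred m) d'). { intros y Hy. apply in_rpred in Hy as []. eauto. }
    f_equal. apply function_ext with (rpred m); try (eapply restr_function; eauto).
    intros y Hy. rewrite (app_restr f d), (app_restr f' d') by auto.
    apply NNPP. intros N'. apply (Hmin y); [|now apply in_rpred in Hy].
    apply HB. apply in_rpred in Hy as Hy'. destruct Hy'. auto.
Qed.

(** Well-foundedness is assumed for subsets of the set [K] only, and [R] may fail to be transitive;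
    so one statement serves for [∈], for the order of pairs, for names and for the ultrapower.
    Approximations on downward closed domains agree, by looking at a minimal disagreement, and
    Replacement collects their values. *)
Theorem wf_rec : exists F, function_on F K /\
  forall x, x ∈ K -> app F x = G x (restr F (sep K (fun y => R y x))).
Proof.
  pose proof D_approx as DA.
  set (Q := fun x z => exists f d, approx f d /\ x ∈ d /\ z = opair x (app f x)).
  destruct (zfc_replacement V Z Q) with (a := K) as [F HF].
  { apply drel_intro. unfold Q. dfn. }
  { intros x y y' _ (f & d & A & Hx & ->) (f' & d' & A' & Hx' & ->).
    f_equal. eapply approx_agree; eauto. }
  set (D := sep K (fun x => exists f d, approx f d /\ x ∈ d)).
  assert (HD : forall x, x ∈ D <-> exists f d, approx f d /\ x ∈ d).
  { intros x. unfold D. rewrite in_sep by (clear HF; dclass). split; [tauto|].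
    intros (f & d & A & Hx). split; [|eauto]. now apply A. }
  assert (HFv : forall f d x, approx f d -> x ∈ d -> opair x (app f x) ∈ F).
  { intros f d x A Hx. apply HF. exists x. split; [now apply A|]. exists f, d. auto. }
  assert (HFe : forall z, z ∈ F -> exists f d x, approx f d /\ x ∈ d /\ z = opair x (app f x)).
  { intros z Hz. apply HF in Hz as (x & _ & f & d & H). eauto 6. }
  assert (FF : function_on F D).
  { apply function_on_intro.
    - intros z Hz. destruct (HFe z Hz) as (f & d & x & A & Hx & ->).
      exists x, (app f x). split; [apply HD; eauto|auto].
    - intros x Hx. apply HD in Hx as (f & d & A & Hx). eauto.
    - intros x y y' Hy Hy'. destruct (HFe _ Hy) as (f & d & w & A & Hx & E).
      apply opair_inj in E as [-> ->].
      destruct (HFe _ Hy') as (f' & d' & w' & A' & Hx' & E).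
      apply opair_inj in E as [-> ->]. eapply approx_agree; eauto. }
  assert (FA : forall f d x, approx f d -> x ∈ d -> app F x = app f x).
  { intros. apply app_val with D; eauto. }
  assert (AF : approx F D).
  { split; [auto|]. split; [|split].
    - intros x Hx. apply HD in Hx as (f & d & A & Hx). now apply A.
    - intros x y Hx Hy Hyx. apply HD in Hx as (f & d & A & Hx). apply HD. exists f, d.
      split; [auto|]. destruct A as (_ & _ & A & _). eauto.
    - intros x Hx. apply HD in Hx as (f & d & A & Hx). rewrite (FA f d) by auto.
      pose proof A as (A1 & A2 & A3 & A4). rewrite A4 by auto. f_equal.
      assert (P1 : subset (rpred x) d). { intros y Hy. apply in_rpred in Hy as []. eauto. }
      assert (P2 : subset (rpred x) D). { intros y Hy. apply HD. eauto. }
      apply function_ext with (rpred x); try (eapply restr_function; eauto).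
      intros y Hy. rewrite (app_restr f d), (app_restr F D) by auto. symmetry. eapply FA; eauto. }
  enough (E : D = K) by (rewrite E in *; exists F; split; [apply FF|]; apply AF).
  apply NNPP. intros N.
  destruct (wf (diff K D)) as (m & Hm & Hmin).
  - intros y Hy. now apply in_diff in Hy.
  - apply NNPP. intros NE. apply N. apply subset_antisym; [apply AF|].
    intros x Hx. apply NNPP. intros Hx'. apply NE. exists x. now apply in_diff.
  - apply in_diff in Hm as [mK mD]. apply mD.
    assert (Hp : subset (rpred m) D).
    { intros y Hy. apply in_rpred in Hy as [Hy Hym]. apply NNPP. intros Hy'.
      apply (Hmin y); [now apply in_diff|auto]. }
    (* A minimal missing point [m] has all its predecessors in [D], so the union of the
       approximations can be extended by one pair to an approximation containing [m]. *)
    set (v := G m (restr F (rpred m))).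
    set (F1 := cup F (sing (opair m v))).
    assert (HF1 : forall z, z ∈ F1 <-> z ∈ F \/ z = opair m v).
    { intros z. unfold F1. now rewrite in_cup, in_sing. }
    assert (FF1 : function_on F1 (cup D (sing m))).
    { apply function_on_intro.
      - intros z Hz. apply HF1 in Hz as [Hz | ->].
        + destruct (function_on_elem _ _ _ FF Hz) as (x & y & Hx & ->).
          exists x, y. split; [apply in_cup; auto|auto].
        + exists m, v. split; [apply in_cup; right; now apply in_sing|auto].
      - intros x Hx. apply in_cup in Hx as [Hx|Hx].
        + exists (app F x). apply HF1. left. now apply app_mem with D.
        + apply in_sing in Hx as ->. exists v. apply HF1. auto.
      - intros x y y' Hy Hy'. apply HF1 in Hy as [Hy|Hy], Hy' as [Hy'|Hy'].
        + eapply function_on_uniq; eauto.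
        + apply opair_inj in Hy' as [-> ->]. now apply (function_on_dom _ _ _ _ FF) in Hy.
        + apply opair_inj in Hy as [-> ->]. now apply (function_on_dom _ _ _ _ FF) in Hy'.
        + apply opair_inj in Hy as [_ ->], Hy' as [_ ->]. auto. }
    assert (FA1 : forall x, x ∈ D -> app F1 x = app F x).
    { intros x Hx. apply app_val with (cup D (sing m)); [auto|]. apply HF1. left. now apply app_mem with D. }
    assert (Hr : forall x, subset (rpred x) D -> restr F1 (rpred x) = restr F (rpred x)).
    { intros x Hx. apply function_ext with (rpred x).
      - eapply restr_function; [apply FF1|]. intros y Hy. apply in_cup; auto.
      - eapply restr_function; eauto.
      - intros y Hy. rewrite (app_restr F1 (cup D (sing m))), (app_restr F D); auto.
        intros w Hw. apply in_cup; auto. }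
    apply HD. exists F1, (cup D (sing m)). split; [|apply in_cup; right; now apply in_sing].
    split; [auto|split; [|split]].
    + intros x Hx. apply in_cup in Hx as [Hx|Hx]; [now apply AF|]. apply in_sing in Hx. now subst.
    + intros x y Hx Hy Hyx. apply in_cup. left. apply in_cup in Hx as [Hx|Hx].
      * destruct AF as (_ & _ & A & _). eauto.
      * apply in_sing in Hx. subst. apply Hp. now apply in_rpred.
    + intros x Hx. apply in_cup in Hx as [Hx|Hx].
      * rewrite FA1, Hr by (auto; intros y Hy; apply in_rpred in Hy as []; destruct AF as (_ & _ & A & _); eauto).
        now apply AF.
      * apply in_sing in Hx as ->. rewrite Hr by auto. apply app_val with (cup D (sing m)); [auto|].
        apply HF1. auto.
Qed.

End WfRec.

Lemma foundation b : (exists x, x ∈ b) -> exists m, m ∈ b /\ forall y, y ∈ b -> ~ y ∈ m.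
Proof.
  intros H. destruct (zfc_foundation V Z b H) as (m & Hm & Hmin). exists m. split; [auto|].
  intros y Hy Hym. now apply (Hmin y).
Qed.

Lemma mem_irrefl x : ~ x ∈ x.
Proof.
  intros H. destruct (foundation (sing x)) as (m & Hm & Hmin).
  - exists x. now apply in_sing.
  - apply in_sing in Hm as ->. apply (Hmin x); [now apply in_sing|auto].
Qed.

Lemma mem_asym x y : x ∈ y -> ~ y ∈ x.
Proof.
  intros H H'. destruct (foundation (upair x y)) as (m & Hm & Hmin).
  - exists x. apply in_upair; auto.
  - apply in_upair in Hm as [-> | ->].
    + apply (Hmin y); [apply in_upair|]; auto.
    + apply (Hmin x); [apply in_upair|]; auto.
Qed.

Definition omega : V := sep (the inductive) natural.

Lemma in_omega x : x ∈ omega <-> natural x.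
Proof.
  unfold omega. rewrite in_sep by dclass. split; [tauto|]. intros H. split; [|auto].
  apply H. apply the_spec, (zfc_infinity V Z).
Qed.

Lemma nat_0 : emp ∈ omega.
Proof.
  apply in_omega. intros i [(z & Hz & Hi) _]. replace emp with z; [auto|].
  apply ext_eq. intros w. generalize (Hz w) (in_emp w). tauto.
Qed.

Lemma is_succ_iff x y : is_succ x y <-> y = succ x.
Proof.
  split.
  - intros H. apply ext_eq. intros z. now rewrite (H z), in_succ.
  - intros -> z. apply in_succ.
Qed.

Lemma nat_succ n : n ∈ omega -> succ n ∈ omega.
Proof.
  rewrite !in_omega. intros H i Hi. destruct Hi as [H0 HS].
  destruct (HS n) as (z & Hz & Hzi).
  - apply H. now split.
  - apply is_succ_iff in Hz. now subst.
Qed.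

Lemma nat_ind_set a : emp ∈ a -> (forall n, n ∈ omega -> n ∈ a -> succ n ∈ a) -> subset omega a.
Proof.
  intros H0 HS n Hn. apply in_omega in Hn.
  enough (n ∈ cap omega a) by (now apply in_cap in H). apply Hn. split.
  - exists emp. split; [exact in_emp|]. apply in_cap. auto using nat_0.
  - intros y Hy. apply in_cap in Hy as [Hy Ha]. exists (succ y). split; [now apply is_succ_iff|].
    apply in_cap. auto using nat_succ.
Qed.

Lemma nat_induction (C : V -> Prop) : definable_class C -> C emp ->
  (forall n, n ∈ omega -> C n -> C (succ n)) -> forall n, n ∈ omega -> C n.
Proof.
  intros HC H0 HS n Hn.
  enough (n ∈ sep omega C) by (rewrite in_sep in H by auto; tauto).
  apply nat_ind_set; [| |auto].
  - rewrite in_sep by auto. auto using nat_0.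
  - intros m Hm H. rewrite in_sep in * by auto. destruct H. auto using nat_succ.
Qed.

Lemma nat_transitive n : n ∈ omega -> transitive n.
Proof.
  revert n. apply nat_induction; [dclass| |].
  - intros y Hy. now apply in_emp in Hy.
  - intros n Hn IH y Hy z Hz. apply in_succ in Hy as [Hy | ->]; apply in_succ; left; auto.
    now apply (IH y).
Qed.

Lemma omega_transitive : transitive omega.
Proof.
  intros n Hn. revert n Hn. apply nat_induction; [dclass| |].
  - intros y Hy. now apply in_emp in Hy.
  - intros n Hn IH y Hy. apply in_succ in Hy as [Hy | ->]; auto.
Qed.

(** [F n] consists of the elements of [x] and the elements of elements of earlier values. So
    [F (n + 1)] contains the union of [F n], and the union of the range is transitive. *)
Lemma trcl_exists x : exists t, is_trcl x t.
Proof.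
  destruct (wf_rec omega (fun y x => y ∈ x) (fun _ h => cup x (un (un (ran h))))) as (F & FF & HF).
  { dfn. } { dfn. } { intros b _. apply foundation. }
  assert (HF' : forall n y, n ∈ omega -> y ∈ app F n <-> y ∈ x \/ exists m w, m ∈ n /\ w ∈ app F m /\ y ∈ w).
  { intros n y Hn. rewrite HF by auto.
    set (h := restr F (sep omega (fun y => y ∈ n))).
    assert (Hh : forall m w, opair m w ∈ h <-> m ∈ n /\ w = app F m).
    { intros m w. unfold h. rewrite in_restr, in_sep by dclass. split.
      - intros (H1 & H2 & H3). split; [auto|]. symmetry. eapply app_val; eauto.
      - intros (H1 & ->). assert (m ∈ omega) by (eapply omega_transitive; eauto).
        split; [|auto]. eapply app_mem; eauto. }
    rewrite in_cup, in_un. setoid_rewrite in_un. setoid_rewrite in_ran. split.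
    - intros [H|(w & (v & (m & H) & Hw) & Hy)]; [auto|]. apply Hh in H as [Hm ->]. right. exists m, w. auto.
    - intros [H|(m & w & Hm & Hw & Hy)]; [auto|]. right. exists w. split; [|auto].
      exists (app F m). split; [|auto]. exists m. apply Hh. auto. }
  exists (un (ran F)). split; [|split].
  - intros y Hy z Hz. apply in_un in Hy as (w & Hw & Hy). apply in_ran in Hw as (n & Hn).
    pose proof (function_on_dom _ _ _ _ FF Hn) as Hno. apply (app_val _ _ _ _ FF) in Hn. subst w.
    apply in_un. exists (app F (succ n)). split.
    + apply in_ran. exists (succ n). apply app_mem with omega; auto using nat_succ.
    + apply HF'; [auto using nat_succ|]. right. exists n, y. split; [apply in_succ; auto|auto].
  - intros y Hy. apply in_un. exists (app F emp). split.
    + apply in_ran. exists emp. apply app_mem with omega; auto using nat_0.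
    + apply HF'; auto using nat_0.
  - intros u Hu Hx y Hy. apply in_un in Hy as (w & Hw & Hy). apply in_ran in Hw as (n & Hn).
    pose proof (function_on_dom _ _ _ _ FF Hn) as Hno. apply (app_val _ _ _ _ FF) in Hn. subst w.
    revert y Hy. change (subset (app F n) u). apply NNPP. intros N.
    destruct (foundation (sep omega (fun n => ~ subset (app F n) u))) as (m & Hm & Hmin).
    + exists n. rewrite in_sep by dclass. auto.
    + rewrite in_sep in Hm by dclass. destruct Hm as [Hm Hm']. apply Hm'. intros y Hy.
      apply HF' in Hy as [Hy|(k & w & Hk & Hw & Hy)]; auto.
      apply (Hu w); [|auto]. assert (Hko : k ∈ omega) by (eapply omega_transitive; eauto).
      apply NNPP. intros Hwu. apply (Hmin k); [|auto]. rewrite in_sep by dclass.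
      split; [auto|]. intros Hs. auto.
Qed.

Definition trcl x : V := the (is_trcl x).
Lemma trcl_spec x : is_trcl x (trcl x).
Proof. apply (the_spec (is_trcl x)), trcl_exists. Qed.

Lemma is_trcl_iff x t : is_trcl x t <-> t = trcl x.
Proof.
  split.
  - intros (H1 & H2 & H3). destruct (trcl_spec x) as (K1 & K2 & K3).
    apply subset_antisym; auto.
  - intros ->. apply trcl_spec.
Qed.

Lemma trcl_trans x : transitive (trcl x). Proof. apply trcl_spec. Qed.
Lemma trcl_sub x : subset x (trcl x). Proof. apply trcl_spec. Qed.
Lemma trcl_min x u : transitive u -> subset x u -> subset (trcl x) u.
Proof. apply trcl_spec. Qed.

(** The search for a minimal counterexample takes place in the transitive closure of [{x}], which
    reduces the schema to Foundation for a set. *)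
Lemma mem_induction (C : V -> Prop) : definable_class C ->
  (forall x, (forall y, y ∈ x -> C y) -> C x) -> forall x, C x.
Proof.
  intros HC H x. apply NNPP. intros N.
  assert (HC' : definable_class (fun y => ~ C y)).
  { destruct HC as (phi & e & E). exists (FImp phi FFalse), e. intros y. simpl. now rewrite <- E. }
  destruct (foundation (sep (trcl (sing x)) (fun y => ~ C y))) as (m & Hm & Hmin).
  - exists x. rewrite in_sep by auto. split; [|auto]. apply trcl_sub. now apply in_sing.
  - rewrite in_sep in Hm by auto. destruct Hm as [Hm Nm]. apply Nm, H. intros y Hy.
    apply NNPP. intros Ny. apply (Hmin y); [|auto]. rewrite in_sep by auto. split; [|auto].
    eapply trcl_trans; eauto.
Qed.

Lemma mem_min (C : V -> Prop) : definable_class C -> (exists x, C x) ->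
  exists m, C m /\ forall y, y ∈ m -> ~ C y.
Proof.
  intros HC [x Hx]. apply NNPP. intros N. revert Hx.
  assert (HC' : definable_class (fun y => ~ C y)).
  { destruct HC as (phi & e & E). exists (FImp phi FFalse), e. intros y. simpl. now rewrite <- E. }
  revert x. apply (mem_induction (fun x => ~ C x) HC'). intros x H Hx. apply N. eauto.
Qed.

Lemma ord_elem a x : ordinal a -> x ∈ a -> ordinal x.
Proof.
  intros [Ha Hb] Hx. split; [auto|]. intros y Hy. apply Hb. eapply Ha; eauto.
Qed.

Lemma ord_mem_trans a x y : ordinal a -> x ∈ y -> y ∈ a -> x ∈ a.
Proof. intros [Ha _] Hx Hy. eapply Ha; eauto. Qed.

Lemma ord_trichotomy a b : ordinal a -> ordinal b -> a ∈ b \/ a = b \/ b ∈ a.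
Proof.
  intros Ha Hb. revert a Ha b Hb.
  apply (mem_induction (fun a => ordinal a -> forall b, ordinal b -> a ∈ b \/ a = b \/ b ∈ a)).
  { dclass. }
  intros x IHx Hx. apply (mem_induction (fun b => ordinal b -> x ∈ b \/ x = b \/ b ∈ x)).
  { dclass. }
  intros y IHy Hy. apply NNPP. intros N. apply N. right. left. apply subset_antisym.
  - intros z Hz. destruct (IHx z Hz (ord_elem _ _ Hx Hz) y Hy) as [H|[->|H]]; auto.
    + exfalso. tauto.
    + exfalso. apply N. right. right. eapply ord_mem_trans; eauto.
  - intros z Hz. destruct (IHy z Hz (ord_elem _ _ Hy Hz)) as [H|[->|H]]; auto.
    + exfalso. apply N. left. eapply ord_mem_trans; eauto.
    + exfalso. tauto.
Qed.

Lemma ord_subset_mem a b : ordinal a -> ordinal b -> subset a b -> a = b \/ a ∈ b.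
Proof.
  intros Ha Hb S. destruct (ord_trichotomy a b Ha Hb) as [H|[H|H]]; auto.
  exfalso. exact (mem_irrefl b (S _ H)).
Qed.

Lemma ord_mem_or_subset a b : ordinal a -> ordinal b -> a ∈ b \/ subset b a.
Proof.
  intros Ha Hb. destruct (ord_trichotomy a b Ha Hb) as [H|[->|H]]; auto.
  - right. intros x; auto.
  - right. destruct Ha as [Ha _]. apply Ha, H.
Qed.

Lemma ord_succ a : ordinal a -> ordinal (succ a).
Proof.
  intros [H1 H2]. split.
  - intros y Hy z Hz. apply in_succ in Hy as [Hy | ->]; apply in_succ; left; auto. eapply H1; eauto.
  - intros y Hy. apply in_succ in Hy as [Hy | ->]; auto.
Qed.

Lemma ord_un a : (forall x, x ∈ a -> ordinal x) -> ordinal (un a).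
Proof.
  intros H. split.
  - intros y Hy z Hz. apply in_un in Hy as (x & Hx & Hy). apply in_un. exists x. split; [auto|].
    eapply ord_mem_trans; eauto.
  - intros y Hy. apply in_un in Hy as (x & Hx & Hy). apply (ord_elem x); auto.
Qed.

Lemma ord_omega : ordinal omega.
Proof. split; [exact omega_transitive|exact nat_transitive]. Qed.

Lemma ord_max a b : ordinal a -> ordinal b -> exists c, (c = a \/ c = b) /\ subset a c /\ subset b c.
Proof.
  intros Ha Hb. destruct (ord_mem_or_subset a b Ha Hb) as [H|H].
  - exists b. split; [auto|]. split; [exact (proj1 Hb a H)|intros x Hx; exact Hx].
  - exists a. split; [auto|]. split; [intros x Hx; exact Hx|exact H].
Qed.

Lemma ord_least (C : V -> Prop) : definable_class C -> (exists a, ordinal a /\ C a) ->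
  exists a, ordinal a /\ C a /\ forall b, b ∈ a -> ~ C b.
Proof.
  intros HC [a [Ha Hc]].
  destruct (foundation (sep (succ a) C)) as (m & Hm & Hmin).
  - exists a. rewrite in_sep by auto. split; [apply in_succ|]; auto.
  - rewrite in_sep in Hm by auto. destruct Hm as [Hm Cm]. exists m.
    pose proof (ord_succ a Ha) as Ho. split; [eapply ord_elem; eauto|]. split; [auto|].
    intros b Hb Cb. apply (Hmin b); [|auto]. rewrite in_sep by auto. split; [|auto].
    eapply ord_mem_trans; eauto.
Qed.

Lemma succ_subset a b : ordinal b -> a ∈ b -> subset (succ a) b.
Proof. intros Hb H x Hx. apply in_succ in Hx as [Hx | ->]; [eapply ord_mem_trans|]; eauto. Qed.

(** The axiom selects from pairwise disjoint sets, so the candidates for [x] are tagged with [x]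
    itself. *)
Lemma choice_fun a b (R : V -> V -> Prop) : Dfn1 V (fun _ e => R (e 0) (e 1)) ->
  (forall x, x ∈ a -> exists y, y ∈ b /\ R x y) ->
  exists f, function_on f a /\ forall x, x ∈ a -> app f x ∈ b /\ R x (app f x).
Proof.
  intros HR H.
  set (F := fun x => sep (prod (sing x) b) (fun z => exists y, z = opair x y /\ R x y)).
  assert (HF : forall x z, z ∈ F x <-> exists y, y ∈ b /\ R x y /\ z = opair x y).
  { intros x z. unfold F. rewrite in_sep by dclass. split.
    - intros (H1 & y & -> & Hy). apply opair_in_prod in H1 as []. eauto.
    - intros (y & Hy & Hxy & ->). split; [|eauto]. apply opair_in_prod. split; [now apply in_sing|auto]. }
  assert (DF : Dt1 V (fun _ e => F (e 0))) by (unfold F; dfn).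
  destruct (zfc_choice V Z (img a F)) as [c Hc].
  - intros y Hy. rewrite in_img in Hy by dclass. destruct Hy as (x & Hx & ->).
    destruct (H x Hx) as (y & Hy & Hxy). exists (opair x y). apply HF. eauto.
  - intros y y' z Hy Hy' Hz Hz'. rewrite in_img in Hy, Hy' by dclass.
    destruct Hy as (x & Hx & ->), Hy' as (x' & Hx' & ->).
    apply HF in Hz as (w & _ & _ & ->). apply HF in Hz' as (w' & _ & _ & E).
    apply opair_inj in E as [-> _]. auto.
  - set (f := sep c (fun z => exists x y, x ∈ a /\ y ∈ b /\ R x y /\ z = opair x y)).
    assert (Hf : forall x y, opair x y ∈ f <-> x ∈ a /\ y ∈ b /\ R x y /\ opair x y ∈ c).
    { intros x y. unfold f. rewrite in_sep by dclass. split.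
      - intros (Hz & x' & y' & H1 & H2 & H3 & E). apply opair_inj in E as [-> ->]. auto.
      - intros (H1 & H2 & H3 & H4). split; [auto|]. exists x, y. auto. }
    assert (FF : function_on f a).
    { apply function_on_intro.
      - intros z Hz. unfold f in Hz. rewrite in_sep in Hz by dclass.
        destruct Hz as (_ & x & y & Hx & _ & _ & ->). eauto.
      - intros x Hx. destruct (Hc (F x)) as (z & (Hz & Hzc) & _).
        + rewrite in_img by dclass. eauto.
        + apply HF in Hz as (y & Hy & Hxy & ->). exists y. apply Hf. auto.
      - intros x y y' Hy Hy'. apply Hf in Hy as (Hx & Hy & Hxy & Hyc), Hy' as (_ & Hy' & Hxy' & Hyc').
        destruct (Hc (F x)) as (z & _ & HU).
        + rewrite in_img by dclass. eauto.
        + assert (E : opair x y = opair x y').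
          { rewrite <- (HU (opair x y)), <- (HU (opair x y')); auto; (split; [apply HF; eauto|auto]). }
          now apply opair_inj in E. }
    exists f. split; [auto|]. intros x Hx. pose proof (app_mem _ _ _ FF Hx) as K.
    apply Hf in K. tauto.
Qed.

(** * The cumulative hierarchy and Collection *)

Local Definition hierarchy F a : Prop := function_on F (succ a) /\
  forall b, b ∈ succ a -> app F b = un (img b (fun c => pow (app F c))).
Local Definition stage a v : Prop := exists F, hierarchy F a /\ v = app F a.

Lemma D_stage : Dfn1 V (fun _ e => stage (e 0) (e 1)).
Proof. unfold stage, hierarchy. dfn. Qed.

Lemma hierarchy_exists a : ordinal a -> exists F, hierarchy F a.
Proof.
  intros Ha. destruct (wf_rec (succ a) (fun y x => y ∈ x) (fun _ h => un (img (ran h) pow))) as (F & FF & HF).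
  { dfn. } { dfn. } { intros b _. apply foundation. }
  exists F. split; [auto|]. intros b Hb. rewrite HF by auto. f_equal. apply ext_eq. intros z.
  rewrite !in_img by dclass. setoid_rewrite in_ran.
  set (p := sep (succ a) (fun y => y ∈ b)).
  assert (Hp : forall x, x ∈ p <-> x ∈ b).
  { intros x. unfold p. rewrite in_sep by dclass. split; [tauto|]. intros Hx. split; [|auto].
    eapply ord_mem_trans; eauto using ord_succ. }
  assert (Sp : subset p (succ a)). { intros x Hx. unfold p in Hx. rewrite in_sep in Hx by dclass. tauto. }
  split.
  - intros (x & (c & Hc) & ->). apply in_restr in Hc as [Hc Hcp]. apply Hp in Hcp.
    exists c. split; [auto|]. now rewrite (app_val _ _ _ _ FF Hc).
  - intros (c & Hc & ->). apply Hp in Hc. exists (app F c). split; [|auto]. exists c.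
    apply in_restr. split; [|auto]. eapply app_mem; eauto.
Qed.

Lemma hierarchy_agree F a F' a' : ordinal a -> ordinal a' -> hierarchy F a -> hierarchy F' a' ->
  forall b, b ∈ succ a -> b ∈ succ a' -> app F b = app F' b.
Proof.
  intros Ha Ha' [FF HF] [FF' HF'].
  apply (mem_induction (fun b => b ∈ succ a -> b ∈ succ a' -> app F b = app F' b)); [dclass|].
  intros b IH Hb Hb'. rewrite HF, HF' by auto. f_equal. apply ext_eq. intros z.
  rewrite !in_img by dclass.
  assert (E : forall c, c ∈ b -> app F c = app F' c).
  { intros c Hc. apply IH; auto; eapply ord_mem_trans; eauto using ord_succ. }
  split; intros (c & Hc & ->); exists c; rewrite E by auto; auto.
Qed.

Lemma in_stage a v : ordinal a -> stage a v ->
  forall x, x ∈ v <-> exists b w, b ∈ a /\ stage b w /\ subset x w.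
Proof.
  intros Ha (F & HF & ->) x. pose proof HF as [FF E]. rewrite E by (apply in_succ; auto).
  rewrite in_un. setoid_rewrite in_img; [|dclass].
  assert (Hst : forall b, b ∈ a -> stage b (app F b)).
  { intros b Hb. assert (Ho := ord_elem _ _ Ha Hb). destruct (hierarchy_exists b Ho) as [F' HF'].
    exists F'. split; [auto|]. apply (hierarchy_agree F a F' b); auto; apply in_succ; auto. }
  split.
  - intros (y & (b & Hb & ->) & Hx). apply in_pow in Hx. exists b, (app F b). auto.
  - intros (b & w & Hb & (F' & HF' & ->) & Hx). exists (pow (app F b)). split; [eauto|].
    apply in_pow. rewrite (hierarchy_agree F a F' b); auto; try (apply in_succ; auto).
    eapply ord_elem; eauto.
Qed.

Lemma stage_exists a : ordinal a -> exists v, stage a v.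
Proof. intros Ha. destruct (hierarchy_exists a Ha) as [F HF]. exists (app F a), F. auto. Qed.

Lemma stage_mono a b v w : ordinal b -> (a = b \/ a ∈ b) -> stage a v -> stage b w -> subset v w.
Proof.
  intros Hb [->|H] Hv Hw x Hx.
  - rewrite (in_stage b v) in Hx by auto. rewrite (in_stage b w); auto.
  - assert (Ha := ord_elem _ _ Hb H). rewrite (in_stage a v) in Hx by auto.
    destruct Hx as (c & u & Hc & Hu & Hx). rewrite (in_stage b w) by auto.
    exists c, u. split; [|auto]. eapply ord_mem_trans; eauto.
Qed.

Lemma least_stage (C : V -> Prop) : definable_class C -> (exists a v, ordinal a /\ stage a v /\ exists y, C y /\ y ∈ v) ->
  exists a, ordinal a /\ (exists v, stage a v /\ exists y, C y /\ y ∈ v) /\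
    forall b, b ∈ a -> ~ exists v, stage b v /\ exists y, C y /\ y ∈ v.
Proof.
  intros HC (a & v & Ha & H). pose proof D_stage.
  apply class_Dfn in HC.
  destruct (ord_least (fun a => exists v, stage a v /\ exists y, C y /\ y ∈ v)) as (a' & Ha' & H1 & H2).
  - dclass.
  - exists a. eauto.
  - exists a'. auto.
Qed.

(** Scott's trick: Replacement is applied to the least rank of a witness, which is unique although
    the witness is not. *)
Lemma collection_aux a (R : V -> V -> Prop) : Dfn1 V (fun _ e => R (e 0) (e 1)) ->
  (forall x, x ∈ a -> exists b v, ordinal b /\ stage b v /\ exists y, R x y /\ y ∈ v) ->
  exists c w, ordinal c /\ stage c w /\ forall x, x ∈ a -> exists y, R x y /\ y ∈ w.
Proof.
  intros HR H. pose proof D_stage as DS.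
  set (Q := fun x b => ordinal b /\ (exists v, stage b v /\ exists y, R x y /\ y ∈ v) /\
    forall b', b' ∈ b -> ~ exists v, stage b' v /\ exists y, R x y /\ y ∈ v).
  destruct (zfc_replacement V Z Q) with (a := a) as [B HB].
  { apply drel_intro. unfold Q. dfn. }
  { intros x b b' _ (O1 & E1 & M1) (O2 & E2 & M2).
    destruct (ord_trichotomy b b' O1 O2) as [K|[K|K]]; auto; exfalso; [apply (M2 b)|apply (M1 b')]; auto. }
  assert (OB : forall x, x ∈ B -> ordinal x).
  { intros x Hx. apply HB in Hx as (y & _ & Hy). apply Hy. }
  set (c := un (img B succ)).
  assert (Hc : ordinal c).
  { apply ord_un. intros x Hx. rewrite in_img in Hx by dclass. destruct Hx as (y & Hy & ->).
    apply ord_succ; auto. }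
  destruct (stage_exists c Hc) as [w Hw]. exists c, w. split; [auto|]. split; [auto|].
  intros x Hx. destruct (least_stage (fun y => R x y)) as (b & Hb).
  { dclass. }
  { destruct (H x Hx) as (b & v & K). eauto 8. }
  assert (HbB : b ∈ B) by (apply HB; exists x; auto).
  destruct Hb as (Ob & (v & Hv & y & Hy & Hyv) & _). exists y. split; [auto|].
  apply (stage_mono b c v w); auto. right. apply in_un. exists (succ b).
  rewrite in_img by dclass. split; [eauto|]. apply in_succ; auto.
Qed.

Lemma in_some_stage x : exists a v, ordinal a /\ stage a v /\ x ∈ v.
Proof.
  pose proof D_stage. revert x. apply mem_induction; [dclass|]. intros x IH.
  destruct (collection_aux x (fun y z => y = z)) as (c & w & Hc & Hw & K).
  - dfn.
  - intros y Hy. destruct (IH y Hy) as (a & v & Ha & Hv & Hyv). exists a, v. eauto.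
  - destruct (stage_exists (succ c) (ord_succ c Hc)) as [v Hv].
    exists (succ c), v. split; [now apply ord_succ|]. split; [auto|].
    rewrite (in_stage (succ c)) by auto using ord_succ. exists c, w. split; [apply in_succ; auto|].
    split; [auto|]. intros y Hy. destruct (K y Hy) as (z & -> & Hz). auto.
Qed.

Lemma collection a (R : V -> V -> Prop) : Dfn1 V (fun _ e => R (e 0) (e 1)) ->
  (forall x, x ∈ a -> exists y, R x y) -> exists b, forall x, x ∈ a -> exists y, y ∈ b /\ R x y.
Proof.
  intros HR H. destruct (collection_aux a R HR) as (c & w & Hc & Hw & K).
  - intros x Hx. destruct (H x Hx) as [y Hy]. destruct (in_some_stage y) as (b & v & Hb & Hv & Hyv).
    eauto 8.
  - exists w. intros x Hx. destruct (K x Hx) as (y & H1 & H2). eauto.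
Qed.

Lemma choice_class a (R : V -> V -> Prop) : Dfn1 V (fun _ e => R (e 0) (e 1)) ->
  (forall x, x ∈ a -> exists y, R x y) ->
  exists f, function_on f a /\ forall x, x ∈ a -> R x (app f x).
Proof.
  intros HR H. destruct (collection a R HR H) as [b Hb].
  destruct (choice_fun a b R HR Hb) as (f & Hf & K). exists f. split; [auto|].
  intros x Hx. now apply K.
Qed.

End Recursion.

Section DfnRecursion.
Context {I : Type} {Vs : I -> structure} {Cst : (forall i, Vs i) -> Prop} {Zf : forall i, ZFC (Vs i)}.
Local Notation Dfn := (@Dfn I Vs Cst).
Local Notation Dt := (@Dt I Vs Cst).

Lemma Dt_omega : Dt (fun i e => omega).
Proof.
  apply Dt_spec with (fun i b e => forall x, x ∈ b <-> natural x).
  - intros i e b. split; [intros -> x; apply in_omega|].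
    intros H. apply ext_eq. intros x. now rewrite H, in_omega.
  - dfn.
Qed.

Lemma D_is_trcl t u : Dt t -> Dt u -> Dfn (fun i e => is_trcl (t i e) (u i e)).
Proof. intros. unfold is_trcl. dfn. Qed.

Lemma Dt_trcl t : Dt t -> Dt (fun i e => trcl (t i e)).
Proof.
  intros. apply Dt_spec with (fun i b e => is_trcl (t i e) b).
  - intros. now rewrite is_trcl_iff.
  - apply D_is_trcl; dfn.
Qed.

Lemma D_in_H t u : Dt t -> Dt u -> Dfn (fun i e => in_H (t i e) (u i e)).
Proof. intros. unfold in_H. dfn. apply D_is_trcl; dfn. Qed.

Lemma D_is_succ_card t u : Dt t -> Dt u -> Dfn (fun i e => is_succ_card (t i e) (u i e)).
Proof. intros. unfold is_succ_card. dfn. Qed.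

Lemma D_is_plus3 t u : Dt t -> Dt u -> Dfn (fun i e => is_plus3 (t i e) (u i e)).
Proof. intros. unfold is_plus3. dfn; apply D_is_succ_card; dfn. Qed.

End DfnRecursion.

Ltac dt_userC :=
  lazymatch goal with
  | |- Dt (fun _ _ => omega) => apply Dt_omega
  | |- Dt (fun _ _ => trcl _) => apply Dt_trcl
  end.
Ltac dfn_userC :=
  lazymatch goal with
  | |- Dfn (fun _ _ => is_trcl _ _) => apply D_is_trcl
  | |- Dfn (fun _ _ => in_H _ _) => apply D_in_H
  | |- Dfn (fun _ _ => is_succ_card _ _) => apply D_is_succ_card
  | |- Dfn (fun _ _ => is_plus3 _ _) => apply D_is_plus3
  end.
Ltac dt_user ::= first [dt_userB | dt_userB2 | dt_userC].
Ltac dfn_user ::= first [dfn_userB | dfn_userB2 | dfn_userC].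
Global Opaque omega trcl.

(** * Cardinality *)

Section Card.
Context {V : structure} {Z : ZFC V}.
Implicit Types a b c d f g h x y z K : V.

Lemma subset_refl a : subset a a. Proof. intros x Hx; exact Hx. Qed.
Lemma subset_trans a b c : subset a b -> subset b c -> subset a c.
Proof. intros H K x Hx. auto. Qed.

Lemma injection_iff f a b : injection f a b <-> function_on f a /\ (forall x, x ∈ a -> app f x ∈ b) /\
  forall x x', x ∈ a -> x' ∈ a -> app f x = app f x' -> x = x'.
Proof.
  split.
  - intros [[Hf Hb] Hi]. split; [auto|]. split.
    + intros x Hx. apply Hb with x. apply pair_mem_iff. eapply app_mem; eauto.
    + intros x x' Hx Hx' E. apply Hi with (app f x).
      * apply pair_mem_iff. eapply app_mem; eauto.
      * rewrite E. apply pair_mem_iff. eapply app_mem; eauto.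
  - intros (Hf & Hb & Hi). split; [split; [auto|]|].
    + intros y z H. apply pair_mem_iff in H. rewrite <- (app_val _ _ _ _ Hf H). apply Hb.
      eapply function_on_dom; eauto.
    + intros y y' z H H'. apply pair_mem_iff in H, H'. apply Hi; try (eapply function_on_dom; eauto).
      rewrite (app_val _ _ _ _ Hf H), (app_val _ _ _ _ Hf H'). auto.
Qed.

Lemma card_le_fun a b (F : V -> V) : Dt1 V (fun _ e => F (e 0)) ->
  (forall x, x ∈ a -> F x ∈ b) -> (forall x x', x ∈ a -> x' ∈ a -> F x = F x' -> x = x') -> card_le a b.
Proof.
  intros HF H1 H2. exists (lam a F). apply injection_iff. split; [now apply lam_function|]. split.
  - intros x Hx. rewrite app_lam; auto.
  - intros x x' Hx Hx'. rewrite !app_lam; auto.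
Qed.

Lemma card_le_sub a b : subset a b -> card_le a b.
Proof. intros H. apply card_le_fun with (fun x => x); [dfn|auto|auto]. Qed.

Lemma card_le_refl a : card_le a a.
Proof. apply card_le_sub, subset_refl. Qed.

Lemma card_le_trans a b c : card_le a b -> card_le b c -> card_le a c.
Proof.
  intros [f Hf] [g Hg]. apply injection_iff in Hf as (F1 & F2 & F3), Hg as (G1 & G2 & G3).
  apply card_le_fun with (fun x => app g (app f x)); [dfn|auto|auto].
Qed.

Lemma card_le_surj f a b : function_on f a -> (forall y, y ∈ b -> exists x, x ∈ a /\ app f x = y) -> card_le b a.
Proof.
  intros Hf H. destruct (choice_fun b a (fun y x => app f x = y)) as (g & Hg & K).
  - dfn.
  - auto.
  - exists g. apply injection_iff. split; [auto|]. split.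
    + intros x Hx. now apply K.
    + intros x x' Hx Hx' E. destruct (K x Hx) as [_ <-], (K x' Hx') as [_ <-]. now rewrite E.
Qed.

Lemma card_le_img a (F : V -> V) : Dt1 V (fun _ e => F (e 0)) -> card_le (img a F) a.
Proof.
  intros HF. apply card_le_surj with (lam a F); [now apply lam_function|].
  intros y Hy. rewrite in_img in Hy by dclass. destruct Hy as (x & Hx & ->). exists x.
  split; [auto|]. now apply app_lam.
Qed.

Lemma card_le_pow a b : card_le a b -> card_le (pow a) (pow b).
Proof.
  intros [f Hf]. apply injection_iff in Hf as (F1 & F2 & F3).
  assert (DF : Dt1 V (fun _ e => app f (e 0))) by dfn.
  apply card_le_fun with (fun x => img x (app f)).
  - dfn.
  - intros x Hx. rewrite in_pow in *. intros y Hy. rewrite in_img in Hy by dclass.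
    destruct Hy as (z & Hz & ->). auto.
  - enough (K : forall x x', x ∈ pow a -> x' ∈ pow a -> img x (app f) = img x' (app f) -> subset x x').
    { intros. apply subset_antisym; apply K; auto. }
    intros x x' Hx Hx' E z Hz. rewrite in_pow in *.
    assert (H : app f z ∈ img x' (app f)). { rewrite <- E, in_img by dclass. eauto. }
    rewrite in_img in H by dclass. destruct H as (w & Hw & E'). apply F3 in E'; auto. now subst.
Qed.

Lemma card_le_prod a b a' b' : card_le a a' -> card_le b b' -> card_le (prod a b) (prod a' b').
Proof.
  intros [f Hf] [g Hg]. apply injection_iff in Hf as (F1 & F2 & F3), Hg as (G1 & G2 & G3).
  apply card_le_fun with (fun z => opair (app f (fst z)) (app g (snd z))).
  - dfn.
  - intros z Hz. apply in_prod in Hz as (x & y & Hx & Hy & ->). rewrite fst_opair, snd_opair.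
    apply opair_in_prod. auto.
  - intros z z' Hz Hz'. apply in_prod in Hz as (x & y & Hx & Hy & ->), Hz' as (x' & y' & Hx' & Hy' & ->).
    rewrite !fst_opair, !snd_opair. intros E. apply opair_inj in E as [E1 E2]. f_equal; auto.
Qed.

(* A transitive set embedded in [x] can be read off from the image of its
   membership relation, so these sets form a set. *)
Local Definition coded x w T : Prop := transitive T /\ exists h, injection h T x /\
  forall z, z ∈ w <-> exists a b, a ∈ T /\ b ∈ T /\ (a ∈ b \/ a = b) /\ z = opair (app h a) (app h b).

(** The two embeddings induce an isomorphism, and ∈-induction shows that an isomorphism of
    transitive sets is the identity. The diagonal pairs in the code record which points are used;
    without them an isolated point would leave no trace. *)
Lemma coded_uniq x w T T' : coded x w T -> coded x w T' -> T = T'.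
Proof.
  enough (K : forall T T', coded x w T -> coded x w T' -> subset T T').
  { intros. apply subset_antisym; apply K; auto. }
  clear T T'. intros T T' (HT & h & Hh & Hw) (HT' & h' & Hh' & Hw').
  apply injection_iff in Hh as (F1 & F2 & F3), Hh' as (G1 & G2 & G3).
  assert (D1 : forall a b, a ∈ T -> b ∈ T -> (a ∈ b \/ a = b) <-> opair (app h a) (app h b) ∈ w).
  { intros a b Ha Hb. rewrite Hw. split; [intros; exists a, b; auto|].
    intros (a' & b' & Ha' & Hb' & K & E). apply opair_inj in E as [E1 E2].
    apply F3 in E1, E2; auto. now subst. }
  assert (D2 : forall a b, a ∈ T' -> b ∈ T' -> (a ∈ b \/ a = b) <-> opair (app h' a) (app h' b) ∈ w).
  { intros a b Ha Hb. rewrite Hw'. split; [intros; exists a, b; auto|].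
    intros (a' & b' & Ha' & Hb' & K & E). apply opair_inj in E as [E1 E2].
    apply G3 in E1, E2; auto. now subst. }
  assert (X1 : forall a, a ∈ T -> exists a', a' ∈ T' /\ app h' a' = app h a).
  { intros a Ha. assert (K : opair (app h a) (app h a) ∈ w) by (apply D1; auto).
    apply Hw' in K as (a' & b' & Ha' & _ & _ & E). apply opair_inj in E as [E _]. eauto. }
  assert (X2 : forall a, a ∈ T' -> exists a', a' ∈ T /\ app h a' = app h' a).
  { intros a Ha. assert (K : opair (app h' a) (app h' a) ∈ w) by (apply D2; auto).
    apply Hw in K as (a' & b' & Ha' & _ & _ & E). apply opair_inj in E as [E _]. eauto. }
  assert (E : forall a, a ∈ T -> forall a', a' ∈ T' -> app h' a' = app h a -> a = a').
  { apply (mem_induction (fun a => a ∈ T -> forall a', a' ∈ T' -> app h' a' = app h a -> a = a')); [dclass|].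
    intros a IH Ha a' Ha' E. apply ext_eq. intros b. split; intros Hb.
    - assert (HbT : b ∈ T) by (eapply HT; eauto). destruct (X1 b HbT) as (b' & Hb' & Eb).
      assert (b = b') by (apply IH; auto). subst b'.
      assert (K : opair (app h' b) (app h' a') ∈ w). { rewrite Eb, E. apply D1; auto. }
      apply D2 in K as [K|K]; auto. subst b. rewrite E in Eb. apply F3 in Eb; auto. subst a'.
      exfalso. exact (mem_irrefl _ Hb).
    - assert (HbT : b ∈ T') by (eapply HT'; eauto). destruct (X2 b HbT) as (b' & Hb' & Eb).
      assert (K : opair (app h b') (app h a) ∈ w). { rewrite Eb, <- E. apply D2; auto. }
      apply D1 in K as [K|K]; auto.
      + rewrite <- (IH b' K Hb' b HbT); auto.
      + subst b'. rewrite <- E in Eb. apply G3 in Eb; auto. subst b. exfalso. exact (mem_irrefl _ Hb). }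
  intros a Ha. destruct (X1 a Ha) as (a' & Ha' & Ea). now rewrite (E a Ha a' Ha' Ea).
Qed.

(** Replacement over the subsets of [x × x], each of which codes at most one transitive set. Hartogs
    numbers and the sets [H(l)] both come from this. *)
Lemma tsets_exists x : exists s, forall T, T ∈ s <-> transitive T /\ card_le T x.
Proof.
  destruct (zfc_replacement V Z (coded x)) with (a := pow (prod x x)) as [s Hs].
  { apply drel_intro. unfold coded. dfn. }
  { intros w T T' _. apply coded_uniq. }
  exists s. intros T. rewrite Hs. split.
  - intros (w & _ & HT & h & Hh & _). split; [auto|]. now exists h.
  - intros [HT [h Hh]].
    set (w := sep (prod x x) (fun z => exists a b, a ∈ T /\ b ∈ T /\ (a ∈ b \/ a = b) /\ z = opair (app h a) (app h b))).
    assert (Hw : forall z, z ∈ w <-> exists a b, a ∈ T /\ b ∈ T /\ (a ∈ b \/ a = b) /\ z = opair (app h a) (app h b)).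
    { intros z. unfold w. rewrite in_sep by dclass. split; [tauto|]. intros H. split; [|auto].
      destruct H as (a & b & Ha & Hb & _ & ->). apply injection_iff in Hh as (F1 & F2 & F3).
      apply opair_in_prod. auto. }
    exists w. split.
    + apply in_pow. intros z Hz. unfold w in Hz. rewrite in_sep in Hz by dclass. tauto.
    + split; [auto|]. exists h. auto.
Qed.

(** * Hartogs numbers, well-orderings and hereditarily small sets *)

Definition hartogs x : V := the (fun s => forall b, b ∈ s <-> ordinal b /\ card_le b x).

Lemma in_hartogs x b : b ∈ hartogs x <-> ordinal b /\ card_le b x.
Proof.
  revert b. apply (the_spec (fun s => forall b, b ∈ s <-> ordinal b /\ card_le b x)).
  destruct (tsets_exists x) as [s Hs]. exists (sep s ordinal). intros b. rewrite in_sep by dclass.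
  rewrite Hs. unfold ordinal. tauto.
Qed.

Lemma hartogs_ord x : ordinal (hartogs x).
Proof.
  split.
  - intros y Hy z Hz. apply in_hartogs in Hy as [Hy Hc]. apply in_hartogs. split; [eapply ord_elem; eauto|].
    eapply card_le_trans; [|eauto]. apply card_le_sub. apply (proj1 Hy z Hz).
  - intros y Hy. apply in_hartogs in Hy as [Hy Hc]. exact (proj1 Hy).
Qed.

Lemma hartogs_not_le x : ~ card_le (hartogs x) x.
Proof. intros H. apply (mem_irrefl (hartogs x)). apply in_hartogs. auto using hartogs_ord. Qed.

(** Zermelo's argument: new elements of [x] are chosen along its Hartogs number, which would embed
    into [x] if [x] were never exhausted. Choice from an empty remainder is junk, so [Hg] speaks
    only of stages at which something is left. *)
Lemma well_order x : exists b f, ordinal b /\ function_on f b /\ (forall y, y ∈ b -> app f y ∈ x) /\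
  (forall y y', y ∈ b -> y' ∈ b -> app f y = app f y' -> y = y') /\
  forall y, y ∈ x -> exists z, z ∈ b /\ app f z = y.
Proof.
  destruct (choice_fun (diff (pow x) (sing emp)) x (fun s y => y ∈ s)) as (c & Hc & Kc).
  { dfn. }
  { intros s Hs. apply in_diff in Hs as [Hs Ne]. rewrite in_pow in Hs.
    apply NNPP. intros N. apply Ne. apply in_sing. apply ext_eq. intros y. split; intros Hy.
    - exfalso. apply N. eauto.
    - now apply in_emp in Hy. }
  set (th := hartogs x).
  destruct (wf_rec th (fun y x => y ∈ x) (fun _ h => app c (diff x (ran h)))) as (F & FF & HF).
  { dfn. } { dfn. } { intros b _. apply foundation. }
  assert (Hp : forall b y, b ∈ th -> y ∈ ran (restr F (sep th (fun y => y ∈ b))) <-> exists z, z ∈ b /\ app F z = y).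
  { intros b y Hb. rewrite in_ran. setoid_rewrite in_restr. setoid_rewrite in_sep; [|dclass]. split.
    - intros (z & H1 & H2 & H3). exists z. split; [auto|]. eapply app_val; eauto.
    - intros (z & H1 & <-). assert (z ∈ th) by (eapply ord_mem_trans; eauto using hartogs_ord).
      exists z. split; [|auto]. eapply app_mem; eauto. }
  assert (Hg : forall b, b ∈ th -> (exists y, y ∈ x /\ forall z, z ∈ b -> app F z <> y) ->
     app F b ∈ x /\ forall z, z ∈ b -> app F z <> app F b).
  { intros b Hb (y & Hy & Hn). rewrite HF by auto.
    set (r := ran (restr F (sep th (fun y => y ∈ b)))).
    destruct (Kc (diff x r)) as [K1 K2].
    - apply in_diff. split.
      + apply in_pow. intros z Hz. now apply in_diff in Hz.
      + rewrite in_sing. intros E. apply (in_emp y). rewrite <- E. apply in_diff. split; [auto|].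
        unfold r. rewrite Hp by auto. intros (z & Hz & Ez). now apply (Hn z).
    - split; [auto|]. intros z Hz Ez. apply in_diff in K2 as [_ K2]. apply K2. apply (Hp b _ Hb). eauto. }
  destruct (classic (exists b, b ∈ th /\ forall y, y ∈ x -> exists z, z ∈ b /\ app F z = y)) as [Ex|Nx].
  - destruct (ord_least (fun b => b ∈ th /\ forall y, y ∈ x -> exists z, z ∈ b /\ app F z = y)) as (b & Ob & (Hb & Hs) & Hmin).
    + dclass.
    + destruct Ex as (b & Hb & K). exists b. split; [|auto]. eapply ord_elem; eauto using hartogs_ord.
    + assert (G : forall z, z ∈ b -> app F z ∈ x /\ forall w, w ∈ z -> app F w <> app F z).
      { intros z Hz. assert (Hzt : z ∈ th) by (eapply ord_mem_trans; eauto using hartogs_ord).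
        apply Hg; [auto|]. apply NNPP. intros N. apply (Hmin z Hz). split; [auto|].
        intros y Hy. apply NNPP. intros N'. apply N. exists y. split; [auto|]. intros w Hw Ew. eauto. }
      assert (Sb : subset b th) by (apply hartogs_ord; auto).
      exists b, (restr F b). split; [auto|]. split; [eapply restr_function; eauto|]. split; [|split].
      * intros y Hy. rewrite (app_restr F th) by auto. now apply G.
      * intros y y' Hy Hy'. rewrite !(app_restr F th) by auto. intros E.
        destruct (ord_trichotomy y y') as [K|[K|K]]; eauto using ord_elem; exfalso.
        -- now apply (proj2 (G y' Hy') y).
        -- now apply (proj2 (G y Hy) y').
      * intros y Hy. destruct (Hs y Hy) as (z & Hz & Ez). exists z. rewrite (app_restr F th) by auto. auto.
  - exfalso. apply (hartogs_not_le x). exists F.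
    assert (G : forall z, z ∈ th -> app F z ∈ x /\ forall w, w ∈ z -> app F w <> app F z).
    { intros z Hz. apply Hg; [auto|]. apply NNPP. intros N. apply Nx. exists z. split; [auto|].
      intros y Hy. apply NNPP. intros N'. apply N. exists y. split; [auto|]. intros w Hw Ew. eauto. }
    apply injection_iff. split; [auto|]. split; [intros y Hy; now apply G|].
    intros y y' Hy Hy' E. pose proof (hartogs_ord x) as Oth.
    destruct (ord_trichotomy y y') as [K|[K|K]]; eauto using ord_elem; exfalso.
    + now apply (proj2 (G y' Hy') y).
    + now apply (proj2 (G y Hy) y').
Qed.

Lemma card_ord x : exists b, ordinal b /\ card_le x b /\ card_le b x.
Proof.
  destruct (well_order x) as (b & f & Ob & Hf & H1 & H2 & H3). exists b. split; [auto|]. split.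
  - apply card_le_surj with f; auto.
  - exists f. apply injection_iff. auto.
Qed.

Lemma card_le_total a b : card_le a b \/ card_le b a.
Proof.
  destruct (card_ord a) as (x & Ox & A1 & A2), (card_ord b) as (y & Oy & B1 & B2).
  destruct (ord_mem_or_subset x y Ox Oy) as [H|H].
  - left. eapply card_le_trans; [eauto|]. eapply card_le_trans; [|eauto]. apply card_le_sub, (proj1 Oy x H).
  - right. eapply card_le_trans; [eauto|]. eapply card_le_trans; [|eauto]. now apply card_le_sub.
Qed.

(** For a cardinal [k] this is [card_lt x k], see [card_lt_small], in a form without negation that
    exhibits the bound as an element of [k]. *)
Definition small k x : Prop := exists m, m ∈ k /\ card_le x m.

Lemma card_lt_small k x : cardinal k -> card_lt x k <-> small k x.
Proof.
  intros [Ok Hk]. split.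
  - intros [H1 H2]. destruct (card_ord x) as (b & Ob & B1 & B2).
    destruct (ord_mem_or_subset b k Ob Ok) as [H|H]; [now exists b|].
    exfalso. apply H2. eapply card_le_trans; [apply card_le_sub; exact H|eauto].
  - intros (m & Hm & Hx). split.
    + eapply card_le_trans; [eauto|]. apply card_le_sub, (proj1 Ok m Hm).
    + intros H. apply (Hk m Hm). eapply card_le_trans; eauto.
Qed.

Lemma small_not_le k x : cardinal k -> small k x -> ~ card_le k x.
Proof. intros Hk H. apply card_lt_small in H as []; auto. Qed.

Lemma not_le_small k x : cardinal k -> ~ card_le k x -> small k x.
Proof.
  intros Hk H. apply card_lt_small; [auto|]. split; [|auto].
  destruct (card_le_total x k); tauto.
Qed.

Lemma small_le k x y : card_le x y -> small k y -> small k x.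
Proof. intros H (m & Hm & K). exists m. split; [auto|]. eapply card_le_trans; eauto. Qed.

Lemma small_mem k m : m ∈ k -> small k m.
Proof. intros H. exists m. auto using card_le_refl. Qed.

Lemma hartogs_succ_card x : ordinal x -> is_succ_card x (hartogs x).
Proof.
  intros Ox. split; [split; [apply hartogs_ord|]|split].
  - intros a Ha H. apply in_hartogs in Ha as [_ Ha]. apply (hartogs_not_le x). eapply card_le_trans; eauto.
  - apply in_hartogs. auto using card_le_refl.
  - intros z [Oz Hz] Hx b Hb. apply in_hartogs in Hb as [Ob Hb].
    destruct (ord_mem_or_subset b z Ob Oz) as [H|H]; [auto|]. exfalso. apply (Hz x Hx).
    eapply card_le_trans; [apply card_le_sub; exact H|eauto].
Qed.

Lemma succ_card_hartogs x y : ordinal x -> is_succ_card x y <-> y = hartogs x.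
Proof.
  intros Ox. pose proof (hartogs_succ_card x Ox) as (H1 & H2 & H3). split.
  - intros (K1 & K2 & K3). apply subset_antisym; auto.
  - intros ->. split; auto.
Qed.

Lemma hartogs_cardinal x : ordinal x -> cardinal (hartogs x).
Proof. intros H. apply hartogs_succ_card; auto. Qed.

Lemma small_hartogs k x : ordinal k -> small (hartogs k) x <-> card_le x k.
Proof.
  intros Ok. split.
  - intros (m & Hm & H). apply in_hartogs in Hm as [_ Hm]. eapply card_le_trans; eauto.
  - intros H. exists k. split; [|auto]. apply in_hartogs. auto using card_le_refl.
Qed.

Definition plus3 k : V := hartogs (hartogs (hartogs k)).

Lemma is_plus3_iff k l : ordinal k -> is_plus3 k l <-> l = plus3 k.
Proof.
  intros Ok. unfold is_plus3, plus3. split.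
  - intros (x1 & x2 & H1 & H2 & H3). apply succ_card_hartogs in H1; [|auto]. subst x1.
    apply succ_card_hartogs in H2; [|apply hartogs_ord]. subst x2.
    now apply succ_card_hartogs in H3; [|apply hartogs_ord].
  - intros ->. exists (hartogs k), (hartogs (hartogs k)).
    repeat split; try apply succ_card_hartogs; auto using hartogs_ord;
      apply hartogs_succ_card; auto using hartogs_ord.
Qed.

Lemma in_H_iff l x : cardinal l -> in_H l x <-> small l (trcl x).
Proof.
  intros Hl. unfold in_H. split.
  - intros (t & Ht & H). apply is_trcl_iff in Ht. subst t. now apply card_lt_small.
  - intros H. exists (trcl x). split; [apply trcl_spec|]. now apply card_lt_small.
Qed.

Lemma Hset_exists l : ordinal l -> exists s, forall x, x ∈ s <-> small l (trcl x).
Proof.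
  intros Ol. destruct (tsets_exists l) as [s Hs].
  exists (sep (pow (un s)) (fun x => small l (trcl x))).
  intros x. rewrite in_sep by (unfold small; dclass). split; [tauto|]. intros H. split; [|auto].
  apply in_pow. intros y Hy. apply in_un. exists (trcl x). split; [|now apply trcl_sub].
  apply Hs. split; [apply trcl_trans|]. destruct H as (m & Hm & H). eapply card_le_trans; [eauto|].
  apply card_le_sub, (proj1 Ol m Hm).
Qed.

Definition Hset l : V := the (fun s => forall x, x ∈ s <-> small l (trcl x)).
Lemma in_Hset l x : ordinal l -> x ∈ Hset l <-> small l (trcl x).
Proof.
  intros Ol. revert x. apply (the_spec (fun s => forall x, x ∈ s <-> small l (trcl x))). now apply Hset_exists.
Qed.

Lemma trcl_elem x y : y ∈ x -> subset (trcl y) (trcl x).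
Proof. intros H. apply trcl_min; [apply trcl_trans|]. apply trcl_trans. now apply trcl_sub. Qed.

Lemma Hset_intro l T x : ordinal l -> transitive T -> small l T -> subset x T -> x ∈ Hset l.
Proof.
  intros Ol HT HS Hx. apply in_Hset; [auto|]. eapply small_le; [|eauto]. apply card_le_sub. now apply trcl_min.
Qed.

Lemma Hset_trans l : ordinal l -> transitive (Hset l).
Proof.
  intros Ol y Hy z Hz. apply in_Hset in Hy; [|auto]. apply in_Hset; [auto|].
  eapply small_le; [|eauto]. apply card_le_sub. now apply trcl_elem.
Qed.

Lemma Hset_subset l x y : ordinal l -> subset x y -> y ∈ Hset l -> x ∈ Hset l.
Proof.
  intros Ol H Hy. apply in_Hset in Hy; [|auto]. eapply Hset_intro; eauto using trcl_trans.
  intros z Hz. apply trcl_sub. auto.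
Qed.

(** * Finite sets *)

Lemma finite_iff x : finite x <-> exists n, n ∈ omega /\ card_le x n.
Proof. unfold finite. now setoid_rewrite in_omega. Qed.

Lemma finite_emp : finite emp.
Proof. apply finite_iff. exists emp. split; [apply nat_0|apply card_le_refl]. Qed.

Lemma finite_le x y : card_le x y -> finite y -> finite x.
Proof. rewrite !finite_iff. intros H (n & Hn & K). exists n. split; [auto|]. eapply card_le_trans; eauto. Qed.

Lemma card_le_add x n y : card_le x n -> card_le (cup x (sing y)) (succ n).
Proof.
  intros [f Hf]. apply injection_iff in Hf as (F1 & F2 & F3).
  apply card_le_fun with (fun z => if excluded_middle_informative (z ∈ x) then app f z else n).
  - dfn.
  - intros z Hz. apply in_succ. destruct (excluded_middle_informative (z ∈ x)); auto.
  - intros z z' Hz Hz'. apply in_cup in Hz, Hz'. rewrite !in_sing in *.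
    destruct (excluded_middle_informative (z ∈ x)), (excluded_middle_informative (z' ∈ x)); auto.
    + intros E. exfalso. apply (mem_irrefl n). rewrite <- E at 1. auto.
    + intros E. exfalso. apply (mem_irrefl n). rewrite E at 1. auto.
    + intros _. destruct Hz, Hz'; try tauto. congruence.
Qed.

(** The element sent to [n] is redirected to the value that the removal of [y] has freed. *)
Lemma card_le_remove x n y : card_le x (succ n) -> y ∈ x -> card_le (diff x (sing y)) n.
Proof.
  intros [f Hf] Hy. apply injection_iff in Hf as (F1 & F2 & F3).
  apply card_le_fun with (fun z => if excluded_middle_informative (app f z = n) then app f y else app f z).
  - dfn.
  - intros z Hz. apply in_diff in Hz as [Hz Hn]. rewrite in_sing in Hn.
    destruct (excluded_middle_informative (app f z = n)) as [E|E].
    + specialize (F2 y Hy). apply in_succ in F2 as [F2|F2]; auto. exfalso. apply Hn. apply F3; congruence.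
    + specialize (F2 z Hz). apply in_succ in F2 as [F2|F2]; auto. contradiction.
  - intros z z' Hz Hz'. apply in_diff in Hz as [Hz Hn], Hz' as [Hz' Hn']. rewrite in_sing in *.
    destruct (excluded_middle_informative (app f z = n)), (excluded_middle_informative (app f z' = n)); intros E.
    + apply F3; congruence.
    + apply F3 in E; auto. congruence.
    + apply F3 in E; auto. congruence.
    + auto.
Qed.

Lemma card_le_emp x : card_le x emp -> x = emp.
Proof.
  intros [f Hf]. apply injection_iff in Hf as (F1 & F2 & F3). apply ext_eq. intros z. split; intros Hz.
  - apply F2 in Hz. now apply in_emp in Hz.
  - now apply in_emp in Hz.
Qed.

Lemma emp_or_inhabited x : x = emp \/ exists y, y ∈ x.
Proof.
  destruct (classic (exists y, y ∈ x)) as [H|H]; [auto|]. left. apply ext_eq. intros z. split; intros Hz.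
  - exfalso. eauto.
  - now apply in_emp in Hz.
Qed.

Lemma diff_cup_sing x y : y ∈ x -> x = cup (diff x (sing y)) (sing y).
Proof.
  intros Hy. apply ext_eq. intros z. rewrite in_cup, in_diff, in_sing. split.
  - intros Hz. destruct (classic (z = y)); auto.
  - intros [[H _]| ->]; auto.
Qed.

Lemma finite_induction (C : V -> Prop) : definable_class C -> C emp ->
  (forall x y, finite x -> C x -> C (cup x (sing y))) -> forall x, finite x -> C x.
Proof.
  intros HC H0 HS. apply class_Dfn in HC.
  assert (K : forall n, n ∈ omega -> forall x, card_le x n -> C x).
  { apply (nat_induction (fun n => forall x, card_le x n -> C x)); [dclass| |].
    - intros x Hx. apply card_le_emp in Hx. now subst.
    - intros n Hn IH x Hx. destruct (emp_or_inhabited x) as [->|[y Hy]]; [auto|].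
      rewrite (diff_cup_sing x y Hy). pose proof (card_le_remove x n y Hx Hy).
      apply HS; auto. apply finite_iff. eauto. }
  intros x Hx. apply finite_iff in Hx as (n & Hn & Hx). eauto.
Qed.

Lemma finite_add x y : finite x -> finite (cup x (sing y)).
Proof.
  intros H. apply finite_iff in H as (n & Hn & H). apply finite_iff. exists (succ n).
  split; [now apply nat_succ|]. now apply card_le_add.
Qed.

Lemma finite_sub x y : subset x y -> finite y -> finite x.
Proof. intros H. apply finite_le. now apply card_le_sub. Qed.

Lemma finite_cup x y : finite x -> finite y -> finite (cup x y).
Proof.
  intros Hx. revert y. apply (finite_induction (fun y => finite (cup x y))); [dclass| |].
  - eapply finite_sub; [|eauto]. intros z Hz. apply in_cup in Hz as [Hz|Hz]; [auto|]. now apply in_emp in Hz.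
  - intros y z Hy IH. eapply finite_sub; [|exact (finite_add _ z IH)].
    intros w. rewrite !in_cup. tauto.
Qed.

Lemma finite_bounded k x : ordinal k -> emp ∈ k -> (forall m, m ∈ k -> succ m ∈ k) ->
  finite x -> subset x k -> exists m, m ∈ k /\ subset x m.
Proof.
  intros Ok K0 KS Hx. revert x Hx.
  apply (finite_induction (fun x => subset x k -> exists m, m ∈ k /\ subset x m)); [dclass| |].
  - intros _. exists emp. split; [auto|apply subset_refl].
  - intros x y Hx IH H. destruct IH as (m & Hm & K).
    { intros z Hz. apply H, in_cup; auto. }
    assert (Hy : y ∈ k) by (apply H, in_cup; right; now apply in_sing).
    destruct (ord_max m (succ y)) as (c & Hc & C1 & C2).
    { eapply ord_elem; eauto. } { apply ord_succ. eapply ord_elem; eauto. }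
    exists c. split; [destruct Hc; subst; auto|]. intros z Hz. apply in_cup in Hz as [Hz|Hz]; [auto|].
    apply in_sing in Hz. subst z. apply C2, in_succ; auto.
Qed.

Lemma finite_max x : finite x -> (forall y, y ∈ x -> ordinal y) -> (exists y, y ∈ x) ->
  exists m, m ∈ x /\ forall y, y ∈ x -> y = m \/ y ∈ m.
Proof.
  intros Hx. revert x Hx.
  apply (finite_induction (fun x => (forall y, y ∈ x -> ordinal y) -> (exists y, y ∈ x) ->
    exists m, m ∈ x /\ forall y, y ∈ x -> y = m \/ y ∈ m)); [dclass| |].
  - intros _ [y Hy]. now apply in_emp in Hy.
  - intros x y Hx IH Ho _.
    assert (Oy : ordinal y) by (apply Ho, in_cup; right; now apply in_sing).
    destruct (emp_or_inhabited x) as [->|Hi].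
    + exists y. split; [apply in_cup; right; now apply in_sing|]. intros z Hz.
      apply in_cup in Hz as [Hz|Hz]; [now apply in_emp in Hz|]. apply in_sing in Hz; auto.
    + destruct IH as (m & Hm & K); [intros z Hz; apply Ho, in_cup; auto|auto|].
      assert (Om : ordinal m) by (apply Ho, in_cup; auto).
      destruct (ord_trichotomy m y Om Oy) as [H|[H|H]].
      * exists y. split; [apply in_cup; right; now apply in_sing|]. intros z Hz.
        apply in_cup in Hz as [Hz|Hz]; [|apply in_sing in Hz; auto].
        destruct (K z Hz) as [->|Hzm]; [auto|]. right. eapply ord_mem_trans; eauto.
      * subst y. exists m. split; [apply in_cup; auto|]. intros z Hz.
        apply in_cup in Hz as [Hz|Hz]; [auto|apply in_sing in Hz; auto].
      * exists m. split; [apply in_cup; auto|]. intros z Hz.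
        apply in_cup in Hz as [Hz|Hz]; [auto|]. apply in_sing in Hz. subst; auto.
Qed.

(** * Strong limit cardinals, products and unions *)

Definition strong_limit k : Prop := cardinal k /\ omega ∈ k /\ forall m, m ∈ k -> small k (pow m).

Lemma sl_ord k : strong_limit k -> ordinal k. Proof. intros H. apply H. Qed.

Lemma sl_pow k x : strong_limit k -> small k x -> small k (pow x).
Proof.
  intros (_ & _ & H) (m & Hm & K). apply small_le with (pow m); [now apply card_le_pow|auto].
Qed.

Lemma sl_nat k n : strong_limit k -> n ∈ omega -> n ∈ k.
Proof. intros H Hn. eapply ord_mem_trans; [now apply sl_ord|eauto|apply H]. Qed.

Lemma transitive_pow x : transitive x -> transitive (pow x) /\ subset x (pow x).
Proof.
  intros H. assert (K : subset x (pow x)). { intros y Hy. apply in_pow. auto. }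
  split; [|auto]. intros y Hy z Hz. apply in_pow in Hy. auto.
Qed.

Lemma sl_succ k m : strong_limit k -> m ∈ k -> succ m ∈ k.
Proof.
  intros H Hm. pose proof (sl_ord k H) as Ok.
  destruct (ord_mem_or_subset (succ m) k) as [K|K]; auto.
  { apply ord_succ. eapply ord_elem; eauto. }
  exfalso. apply (small_not_le k (pow m)); [apply H|now apply H|].
  eapply card_le_trans; [apply card_le_sub, K|]. apply card_le_sub. intros x Hx. apply in_pow.
  assert (Om : ordinal m) by (eapply ord_elem; eauto).
  apply in_succ in Hx as [Hx| ->]; [apply (proj1 Om x Hx)|apply subset_refl].
Qed.

Lemma small_trans_bound k x : strong_limit k -> small k x -> exists T, T ∈ k /\ card_le x T /\ omega ∈ T.
Proof.
  intros H (m & Hm & K). pose proof (sl_ord k H) as Ok. assert (Om : ordinal m) by (eapply ord_elem; eauto).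
  destruct (ord_max m (succ omega) Om) as (c & Hc & C1 & C2).
  { apply ord_succ, ord_omega. }
  exists c. split.
  - destruct Hc; subst; auto. apply sl_succ; [auto|apply H].
  - split; [|apply C2, in_succ; auto]. eapply card_le_trans; [eauto|]. now apply card_le_sub.
Qed.

(** The square of an ordinal lies in its double power set. *)
Lemma sl_prod k x y : strong_limit k -> small k x -> small k y -> small k (prod x y).
Proof.
  intros H Hx Hy. destruct (small_trans_bound k x H Hx) as (a & Ha & Ka & _), (small_trans_bound k y H Hy) as (b & Hb & Kb & _).
  pose proof (sl_ord k H) as Ok.
  destruct (ord_max a b) as (c & Hc & C1 & C2). { eapply ord_elem; eauto. } { eapply ord_elem; eauto. }
  assert (Hck : c ∈ k) by (destruct Hc; subst; auto).
  apply small_le with (prod a b); [now apply card_le_prod|].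
  apply small_le with (pow (pow c)); [|now apply sl_pow, sl_pow, small_mem].
  apply card_le_sub. intros z Hz. apply in_prod in Hz as (u & v & Hu & Hv & ->). apply opair_pow; auto.
Qed.

Lemma card_le_cup x y z w : card_le x z -> card_le y w -> card_le (cup x y) (prod (succ (succ emp)) (cup z w)).
Proof.
  intros [f Hf] [g Hg]. apply injection_iff in Hf as (F1 & F2 & F3), Hg as (G1 & G2 & G3).
  assert (E : emp <> succ emp :> V). { intros E. apply (in_emp emp). rewrite E at 2. apply in_succ; auto. }
  apply card_le_fun with (fun u => if excluded_middle_informative (u ∈ x) then opair emp (app f u) else opair (succ emp) (app g u)).
  - dfn.
  - intros u Hu. apply in_cup in Hu. destruct (excluded_middle_informative (u ∈ x)).
    + apply opair_in_prod. rewrite !in_succ, in_cup. auto.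
    + apply opair_in_prod. rewrite !in_succ, in_cup. destruct Hu; [tauto|auto].
  - intros u u' Hu Hu'. apply in_cup in Hu, Hu'.
    destruct (excluded_middle_informative (u ∈ x)), (excluded_middle_informative (u' ∈ x)); intros K;
      apply opair_inj in K as [K1 K2]; try congruence; auto.
    apply G3; tauto.
Qed.

Lemma sl_cup k x y : strong_limit k -> small k x -> small k y -> small k (cup x y).
Proof.
  intros H (a & Ha & Ka) (b & Hb & Kb). pose proof (sl_ord k H) as Ok.
  eapply small_le; [apply (card_le_cup x y a b); auto|]. apply sl_prod; [auto| |].
  - apply small_mem. apply sl_nat; auto using nat_succ, nat_0.
  - destruct (ord_max a b) as (c & Hc & C1 & C2). { eapply ord_elem; eauto. } { eapply ord_elem; eauto. }
    assert (Hck : c ∈ k) by (destruct Hc; subst; auto).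
    apply small_le with c; [|now apply small_mem]. apply card_le_sub. intros z Hz. apply in_cup in Hz as []; auto.
Qed.

Lemma sl_sing k x : strong_limit k -> small k (sing x).
Proof.
  intros H. exists (succ emp). split; [apply sl_nat; auto using nat_succ, nat_0|].
  apply card_le_fun with (fun _ => emp); [dfn| |].
  - intros; apply in_succ; auto.
  - intros y y' Hy Hy' _. apply in_sing in Hy, Hy'. congruence.
Qed.

Lemma Hset_small_trans k x : strong_limit k -> x ∈ Hset k -> exists T, transitive T /\ small k T /\ x ∈ T.
Proof.
  intros H Hx. apply in_Hset in Hx; [|now apply sl_ord]. exists (cup (trcl x) (sing x)). split; [|split].
  - intros y Hy z Hz. apply in_cup. left. apply in_cup in Hy as [Hy|Hy]; [eapply trcl_trans; eauto|].
    apply in_sing in Hy. subst. now apply trcl_sub.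
  - apply sl_cup; auto. now apply sl_sing.
  - apply in_cup. right. now apply in_sing.
Qed.

Lemma Hset_opair k x y : strong_limit k -> x ∈ Hset k -> y ∈ Hset k -> opair x y ∈ Hset k.
Proof.
  intros H Hx Hy. destruct (Hset_small_trans k x H Hx) as (T & T1 & T2 & T3), (Hset_small_trans k y H Hy) as (T' & T1' & T2' & T3').
  pose proof (sl_ord k H) as Ok.
  assert (HT : transitive (cup T T')).
  { intros u Hu v Hv. apply in_cup. apply in_cup in Hu as [Hu|Hu]; [left; eapply T1|right; eapply T1']; eauto. }
  destruct (transitive_pow _ HT) as [P1 P2].
  apply Hset_intro with (pow (cup T T')); auto.
  - apply sl_pow; auto. now apply sl_cup.
  - apply in_pow. apply opair_pow; apply in_cup; auto.
Qed.

Lemma Hset_pow k x : strong_limit k -> x ∈ Hset k -> pow x ∈ Hset k.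
Proof.
  intros H Hx. destruct (Hset_small_trans k x H Hx) as (T & T1 & T2 & T3).
  pose proof (sl_ord k H) as Ok. destruct (transitive_pow _ T1) as [P1 P2].
  apply Hset_intro with (pow T); auto using sl_pow.
  intros y Hy. apply in_pow. apply in_pow in Hy. intros z Hz. eapply T1; eauto.
Qed.

Lemma Hset_ord k m : strong_limit k -> m ∈ k -> m ∈ Hset k.
Proof.
  intros H Hm. pose proof (sl_ord k H) as Ok. apply Hset_intro with m; auto using small_mem, subset_refl.
  exact (proj1 (ord_elem _ _ Ok Hm)).
Qed.

(* [cup] is the maximum of two ordinals; pairs are ordered by maximum first *)
Local Definition pair_lt z z' : Prop := exists a b a' b', z = opair a b /\ z' = opair a' b' /\
  (cup a b ∈ cup a' b' \/ cup a b = cup a' b' /\ (a ∈ a' \/ a = a' /\ b ∈ b')).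

Lemma cup_ord a b : ordinal a -> ordinal b -> ordinal (cup a b) /\ (cup a b = a \/ cup a b = b).
Proof.
  intros Ha Hb. destruct (ord_max a b Ha Hb) as (c & Hc & C1 & C2).
  assert (E : cup a b = c).
  { apply subset_antisym; intros z Hz.
    - apply in_cup in Hz as []; auto.
    - apply in_cup. destruct Hc; subst; auto. }
  rewrite E. destruct Hc; subst; auto.
Qed.

Lemma pair_lt_wf k b : ordinal k -> subset b (prod k k) -> (exists x, x ∈ b) ->
  exists m, m ∈ b /\ forall y, y ∈ b -> ~ pair_lt y m.
Proof.
  intros Ok Hb [x Hx].
  assert (Hel : forall z, z ∈ b -> exists u v, ordinal u /\ ordinal v /\ z = opair u v).
  { intros z Hz. apply Hb in Hz. apply in_prod in Hz as (u & v & Hu & Hv & ->). exists u, v.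
    eauto using ord_elem. }
  destruct (mem_min (fun c => exists u v, opair u v ∈ b /\ c = cup u v)) as (c & (u0 & v0 & H0 & E0) & Hc).
  { dclass. } { destruct (Hel x Hx) as (u & v & _ & _ & ->). eauto 6. }
  destruct (mem_min (fun u => exists v, opair u v ∈ b /\ c = cup u v)) as (u & (v1 & H1 & E1) & Hu).
  { dclass. } { eauto. }
  destruct (mem_min (fun v => opair u v ∈ b /\ c = cup u v)) as (v & (H2 & E2) & Hv).
  { dclass. } { eauto. }
  exists (opair u v). split; [auto|]. intros y Hy (a1 & b1 & a2 & b2 & -> & E & H).
  apply opair_inj in E as [<- <-]. rewrite <- E2 in H. destruct H as [H|[H [K|[-> K]]]].
  - apply (Hc (cup a1 b1)); eauto.
  - apply (Hu a1); eauto.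
  - apply (Hv b1); auto.
Qed.

(** Gödel's pairing. Each pair is sent to the largest ordinal included in the set of earlier values;
    this value cannot be an earlier one, so comparability of pairs gives injectivity. The
    predecessors of [(a, b)] lie in the square of [succ (cup a b)], which is smaller than [k], and
    therefore the value is below [k]. *)
Lemma sl_square k : strong_limit k -> card_le (prod k k) k.
Proof.
  intros H. pose proof (sl_ord k H) as Ok.
  destruct (wf_rec (prod k k) pair_lt (fun _ h => sep (ran h) (fun b => ordinal b /\ subset b (ran h)))) as (F & FF & HF).
  { unfold pair_lt. dfn. } { dfn. } { intros b. apply pair_lt_wf; auto. }
  assert (DL : Dfn1 V (fun _ e => pair_lt (e 0) (e 1))) by (unfold pair_lt; dfn).
  set (pr := fun z => sep (prod k k) (fun y => pair_lt y z)) in *.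
  assert (Hr : forall z y, y ∈ ran (restr F (pr z)) <-> exists w, w ∈ prod k k /\ pair_lt w z /\ app F w = y).
  { intros z y. rewrite in_ran. setoid_rewrite in_restr. unfold pr. setoid_rewrite in_sep; [|dclass]. split.
    - intros (w & H1 & H2 & H3). exists w. split; [auto|]. split; [auto|]. eapply app_val; eauto.
    - intros (w & H1 & H2 & <-). exists w. split; [|auto]. eapply app_mem; eauto. }
  assert (Hm : forall z, z ∈ prod k k -> ordinal (app F z) /\ (forall w, w ∈ prod k k -> pair_lt w z -> app F w <> app F z) /\
     subset (app F z) (ran (restr F (pr z)))).
  { intros z Hz. rewrite HF by auto. set (r := ran (restr F (pr z))).
    assert (Hs : forall b, b ∈ sep r (fun b => ordinal b /\ subset b r) <-> b ∈ r /\ ordinal b /\ subset b r).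
    { intros b. rewrite in_sep by dclass. tauto. }
    assert (Os : ordinal (sep r (fun b => ordinal b /\ subset b r))).
    { split.
      - intros b Hb c Hc. apply Hs in Hb as (B1 & B2 & B3). apply Hs. split; [auto|].
        split; [eapply ord_elem; eauto|]. intros d Hd. apply B3. eapply ord_mem_trans; eauto.
      - intros b Hb. apply Hs in Hb as (B1 & B2 & B3). exact (proj1 B2). }
    split; [auto|]. split.
    - intros w Hw Hwz E. assert (K : app F w ∈ r). { apply Hr. eauto. }
      rewrite E in K. apply (mem_irrefl (sep r (fun b => ordinal b /\ subset b r))). apply Hs.
      split; [auto|]. split; [auto|]. intros b Hb. now apply Hs in Hb.
    - intros b Hb. now apply Hs in Hb. }
  exists F. apply injection_iff. split; [auto|]. split.
  - intros z Hz. destruct (Hm z Hz) as (O1 & _ & S1). destruct (ord_mem_or_subset _ k O1 Ok) as [K|K]; [auto|exfalso].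
    apply in_prod in Hz as (a & b & Ha & Hb & ->).
    assert (Oa : ordinal a) by (apply (ord_elem k); auto). assert (Ob : ordinal b) by (apply (ord_elem k); auto).
    destruct (cup_ord a b Oa Ob) as [Oc Ec].
    assert (Hck : succ (cup a b) ∈ k). { apply sl_succ; auto. destruct Ec as [-> | ->]; auto. }
    apply (small_not_le k (prod (succ (cup a b)) (succ (cup a b)))); [apply H|apply sl_prod; auto using small_mem|].
    eapply card_le_trans; [apply card_le_sub; eapply subset_trans; [exact K|exact S1]|].
    eapply card_le_trans; [apply card_le_surj with (f := restr F (pr (opair a b))) (a := pr (opair a b))|].
    + apply restr_function with (prod k k); auto. intros w Hw. unfold pr in Hw. rewrite in_sep in Hw by dclass. tauto.
    + intros y Hy. apply in_ran in Hy as (w & Hw). exists w. pose proof Hw as Hw'. apply in_restr in Hw' as [_ Hw'].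
      split; [auto|]. eapply app_val; [|eauto]. apply restr_function with (prod k k); auto.
      intros w' Hw''. unfold pr in Hw''. rewrite in_sep in Hw'' by dclass. tauto.
    + apply card_le_sub. intros w Hw. unfold pr in Hw. rewrite in_sep in Hw by dclass.
      destruct Hw as (Hw & a1 & b1 & a2 & b2 & -> & E & HL). apply opair_inj in E as [<- <-].
      apply opair_in_prod in Hw as [Ha1 Hb1].
      assert (Oa1 : ordinal a1) by (apply (ord_elem k); auto). assert (Ob1 : ordinal b1) by (apply (ord_elem k); auto).
      assert (Hx : subset (cup a1 b1) (cup a b)).
      { destruct HL as [HL|[-> _]]; [apply (proj1 Oc _ HL)|apply subset_refl]. }
      assert (Hy : forall x, ordinal x -> subset x (cup a1 b1) -> x ∈ succ (cup a b)).
      { intros x Ox Sx. apply in_succ. destruct (ord_subset_mem x (cup a b)); auto. eapply subset_trans; eauto. }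
      apply opair_in_prod. split; apply Hy; auto; intros w Hw; apply in_cup; auto.
  - intros z z' Hz Hz' E. apply NNPP. intros N.
    assert (T : pair_lt z z' \/ pair_lt z' z).
    { pose proof Hz as Hz0. pose proof Hz' as Hz0'.
      apply in_prod in Hz as (a & b & Ha & Hb & ->), Hz' as (a' & b' & Ha' & Hb' & ->).
      assert (Oa : ordinal a) by (apply (ord_elem k); auto). assert (Ob : ordinal b) by (apply (ord_elem k); auto).
      assert (Oa' : ordinal a') by (apply (ord_elem k); auto). assert (Ob' : ordinal b') by (apply (ord_elem k); auto).
      destruct (cup_ord a b Oa Ob) as [Oc _], (cup_ord a' b' Oa' Ob') as [Oc' _].
      destruct (ord_trichotomy _ _ Oc Oc') as [K|[K|K]].
      - left. exists a, b, a', b'. auto.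
      - destruct (ord_trichotomy a a' Oa Oa') as [L|[L|L]].
        + left. exists a, b, a', b'. auto 6.
        + subst a'. destruct (ord_trichotomy b b' Ob Ob') as [L|[L|L]].
          * left. exists a, b, a, b'. auto 7.
          * subst. tauto.
          * right. exists a, b', a, b. auto 8.
        + right. exists a', b', a, b. auto 7.
      - right. exists a', b', a, b. auto. }
    destruct T as [T|T].
    + now apply (proj1 (proj2 (Hm z' Hz')) z).
    + apply (proj1 (proj2 (Hm z Hz)) z'); auto.
Qed.

(** Two subsets [u] and [v] are packed into the single set [{a} × u ∪ {b} × v]. *)
Lemma card_le_pow_square x : (exists a b, a ∈ x /\ b ∈ x /\ a <> b) -> card_le (prod x x) x ->
  card_le (prod (pow x) (pow x)) (pow x).
Proof.
  intros (a & b & Ha & Hb & Nab) H. apply card_le_trans with (pow (prod x x)); [|now apply card_le_pow].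
  apply card_le_fun with (fun z => cup (prod (sing a) (fst z)) (prod (sing b) (snd z))).
  - dfn.
  - intros z Hz. apply in_prod in Hz as (u & v & Hu & Hv & ->). rewrite fst_opair, snd_opair.
    apply in_pow. intros w Hw. rewrite in_pow in *. apply in_cup in Hw as [Hw|Hw];
    apply in_prod in Hw as (p & q & Hp & Hq & ->); apply in_sing in Hp; subst p; apply opair_in_prod; auto.
  - intros z z' Hz Hz'. apply in_prod in Hz as (u & v & Hu & Hv & ->), Hz' as (u' & v' & Hu' & Hv' & ->).
    rewrite !fst_opair, !snd_opair. intros E.
    assert (K : forall s t q, q ∈ s <-> opair a q ∈ cup (prod (sing a) s) (prod (sing b) t)).
    { intros s t q. rewrite in_cup, !opair_in_prod, !in_sing. split; [auto|]. intros [[_ ?]|[? _]]; [auto|tauto]. }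
    assert (K' : forall s t q, q ∈ t <-> opair b q ∈ cup (prod (sing a) s) (prod (sing b) t)).
    { intros s t q. rewrite in_cup, !opair_in_prod, !in_sing. split; [auto|]. intros [[? _]|[_ ?]]; [|auto]. symmetry in H0. tauto. }
    f_equal; apply ext_eq; intros q.
    + now rewrite (K u v), (K u' v'), E.
    + now rewrite (K' u v), (K' u' v'), E.
Qed.

Lemma card_le_Union a n (F : V -> V) : Dt1 V (fun _ e => F (e 0)) -> card_le (prod n n) n ->
  card_le a n -> (forall x, x ∈ a -> card_le (F x) n) -> card_le (un (img a F)) n.
Proof.
  intros DF Hn [g Hg] H. apply injection_iff in Hg as (G1 & G2 & G3).
  destruct (choice_class a (fun x h => injection h (F x) n)) as (H' & HH & KH).
  { dfn. } { intros x Hx. destruct (H x Hx) as [h Hh]. eauto. }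
  destruct (choice_fun (un (img a F)) a (fun y x => y ∈ F x)) as (c & Hc & Kc).
  { dfn. } { intros y Hy. apply in_un in Hy as (z & Hz & Hy). rewrite in_img in Hz by dclass.
    destruct Hz as (x & Hx & ->). eauto. }
  eapply card_le_trans; [|exact Hn].
  apply card_le_fun with (fun y => opair (app g (app c y)) (app (app H' (app c y)) y)).
  - dfn.
  - intros y Hy. destruct (Kc y Hy) as [K1 K2]. specialize (KH _ K1). apply injection_iff in KH as (I1 & I2 & I3).
    apply opair_in_prod. auto.
  - intros y y' Hy Hy' E. destruct (Kc y Hy) as [K1 K2], (Kc y' Hy') as [K1' K2'].
    apply opair_inj in E as [E1 E2]. apply G3 in E1; auto. rewrite <- E1 in *.
    specialize (KH _ K1). apply injection_iff in KH as (I1 & I2 & I3). auto.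
Qed.

End Card.

Section DfnCard.
Context {I : Type} {Vs : I -> structure} {Cst : (forall i, Vs i) -> Prop} {Zf : forall i, ZFC (Vs i)}.
Local Notation Dfn := (@Dfn I Vs Cst).
Local Notation Dt := (@Dt I Vs Cst).
Implicit Types t u : forall i, (nat -> Vs i) -> Vs i.

Lemma D_small t u : Dt t -> Dt u -> Dfn (fun i e => small (t i e) (u i e)).
Proof. intros. unfold small. dfn. Qed.

Lemma D_strong_limit t : Dt t -> Dfn (fun i e => strong_limit (t i e)).
Proof. intros. unfold strong_limit. dfn. all: apply D_small; dfn. Qed.

End DfnCard.

Ltac dfn_userD :=
  lazymatch goal with
  | |- Dfn (fun _ _ => small _ _) => apply D_small
  | |- Dfn (fun _ _ => strong_limit _) => apply D_strong_limit
  end.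
Ltac dfn_user ::= first [dfn_userB | dfn_userB2 | dfn_userC | dfn_userD].
Global Opaque hartogs Hset.

(** * Prikry products *)

Section DfnPrikry.
Context {I : Type} {Vs : I -> structure} {Cst : (forall i, Vs i) -> Prop} {Zf : forall i, ZFC (Vs i)}.
Local Notation Dfn := (@Dfn I Vs Cst).
Local Notation Dt := (@Dt I Vs Cst).
Implicit Types t u v w : forall i, (nat -> Vs i) -> Vs i.

Lemma D_ultrafilter_on t u : Dt t -> Dt u -> Dfn (fun i e => ultrafilter_on (t i e) (u i e)).
Proof. intros. unfold ultrafilter_on. dfn. Qed.
Lemma D_measure_on t u : Dt t -> Dt u -> Dfn (fun i e => measure_on (t i e) (u i e)).
Proof. intros. unfold measure_on, nonprincipal, complete, is_singleton. dfn. all: apply D_ultrafilter_on; dfn. Qed.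
Lemma D_measurable t : Dt t -> Dfn (fun i e => measurable (t i e)).
Proof. intros. unfold measurable, is_omega. dfn. all: apply D_measure_on; dfn. Qed.
Lemma D_normal_measure t u : Dt t -> Dt u -> Dfn (fun i e => normal_measure (t i e) (u i e)).
Proof. intros. unfold normal_measure. dfn. all: apply D_measure_on; dfn. Qed.
Lemma D_discrete t : Dt t -> Dfn (fun i e => discrete (t i e)).
Proof. intros. unfold discrete. dfn. Qed.
Lemma D_prikry_cond t u v w : Dt t -> Dt u -> Dt v -> Dt w -> Dfn (fun i e => prikry_cond (t i e) (u i e) (v i e) (w i e)).
Proof. intros. unfold prikry_cond. dfn. Qed.
Lemma D_prikry_le t u v w : Dt t -> Dt u -> Dt v -> Dt w -> Dfn (fun i e => prikry_le (t i e) (u i e) (v i e) (w i e)).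
Proof. intros. unfold prikry_le, end_extends. dfn. Qed.
Lemma D_coord t u v w : Dt t -> Dt u -> Dt v -> Dt w -> Dfn (fun i e => coord (t i e) (u i e) (v i e) (w i e)).
Proof. intros. unfold coord. dfn. Qed.
Lemma D_prikry_product_cond t u v : Dt t -> Dt u -> Dt v -> Dfn (fun i e => prikry_product_cond (t i e) (u i e) (v i e)).
Proof. intros. unfold prikry_product_cond. dfn; first [apply D_coord | apply D_prikry_cond]; dfn. Qed.
Lemma D_is_prikry_product t u v : Dt t -> Dt u -> Dt v -> Dfn (fun i e => is_prikry_product (t i e) (u i e) (v i e)).
Proof. intros. unfold is_prikry_product. dfn. all: apply D_prikry_product_cond; dfn. Qed.
Lemma D_prikry_product_le t u v : Dt t -> Dt u -> Dt v -> Dfn (fun i e => prikry_product_le (t i e) (u i e) (v i e)).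
Proof. intros. unfold prikry_product_le. dfn; first [apply D_coord | apply D_prikry_le]; dfn. Qed.
End DfnPrikry.

Ltac dfn_userF :=
  lazymatch goal with
  | |- Dfn (fun _ _ => ultrafilter_on _ _) => apply D_ultrafilter_on
  | |- Dfn (fun _ _ => measure_on _ _) => apply D_measure_on
  | |- Dfn (fun _ _ => measurable _) => apply D_measurable
  | |- Dfn (fun _ _ => normal_measure _ _) => apply D_normal_measure
  | |- Dfn (fun _ _ => discrete _) => apply D_discrete
  | |- Dfn (fun _ _ => prikry_cond _ _ _ _) => apply D_prikry_cond
  | |- Dfn (fun _ _ => prikry_le _ _ _ _) => apply D_prikry_le
  | |- Dfn (fun _ _ => coord _ _ _ _) => apply D_coord
  | |- Dfn (fun _ _ => prikry_product_cond _ _ _) => apply D_prikry_product_cond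
  | |- Dfn (fun _ _ => is_prikry_product _ _ _) => apply D_is_prikry_product
  | |- Dfn (fun _ _ => prikry_product_le _ _ _) => apply D_prikry_product_le
  end.
Ltac dfn_user ::= first [dfn_userB | dfn_userB2 | dfn_userC | dfn_userD | dfn_userF].

Section Measures.
Context {V : structure} {Z : ZFC V}.
Implicit Types a b c f m s t u x y z A B L : V.

Section OneMeasure.
Variables u a : V.
Hypotheses (Ha : cardinal a) (Hw : omega ∈ a) (Hu : measure_on u a).

Lemma meas_sub A : A ∈ u -> subset A a. Proof. apply Hu. Qed.
Lemma meas_top : a ∈ u. Proof. apply Hu. Qed.
Lemma meas_up A B : A ∈ u -> subset A B -> subset B a -> B ∈ u. Proof. apply Hu. Qed.

Lemma meas_inhabited A : A ∈ u -> exists x, x ∈ A.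
Proof.
  intros HA. destruct (emp_or_inhabited A) as [->|H]; [|auto].
  exfalso. destruct Hu as [(_ & _ & H & _) _]. apply (H emp); auto. exact in_emp.
Qed.

Lemma meas_ultra A : subset A a -> A ∈ u \/ diff a A ∈ u.
Proof.
  intros HA. destruct Hu as [(_ & _ & _ & _ & _ & H) _]. apply H; [auto|].
  intros x. apply in_diff.
Qed.

Lemma meas_cap A B : A ∈ u -> B ∈ u -> cap A B ∈ u.
Proof.
  intros HA HB. destruct Hu as [(_ & _ & _ & _ & H & _) _]. apply (H A B); auto. intros x. apply in_cap.
Qed.

Lemma meas_inter I (C : V -> V) : Dt1 V (fun _ e => C (e 0)) -> small a I -> (forall x, x ∈ I -> C x ∈ u) ->
  sep a (fun b => forall x, x ∈ I -> b ∈ C x) ∈ u.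
Proof.
  intros DC HI HC. destruct Hu as (_ & _ & H). apply (H (img I C)).
  - intros y Hy. rewrite in_img in Hy by dclass. destruct Hy as (x & Hx & ->). auto.
  - apply card_lt_small; [auto|]. eapply small_le; [|eauto]. now apply card_le_img.
  - intros b. rewrite in_sep by dclass. split.
    + intros [Hb K]. split; [auto|]. intros A HA. rewrite in_img in HA by dclass.
      destruct HA as (x & Hx & ->). auto.
    + intros [Hb K]. split; [auto|]. intros x Hx. apply K. rewrite in_img by dclass. eauto.
Qed.

Lemma meas_not_sing x : x ∈ a -> diff a (sing x) ∈ u.
Proof.
  intros Hx. destruct (meas_ultra (sing x)) as [H|H]; [|exfalso|auto].
  - intros y Hy. apply in_sing in Hy. now subst.
  - destruct Hu as (_ & N & _). apply (N x (sing x)); [|auto]. intros z. apply in_sing.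
Qed.

(** Given [a] many distinct subsets of [m], let the measure decide for each point of [m] whether it
    belongs to them. By completeness all these decisions hold on one measure one set, which then has
    a single element, against nonprincipality. *)
Lemma measurable_strong_limit : strong_limit a.
Proof.
  split; [auto|]. split; [auto|]. intros m Hm. apply not_le_small; [auto|].
  intros [f Hf]. apply injection_iff in Hf as (F1 & F2 & F3).
  set (X := fun x => sep a (fun b => x ∈ app f b)).
  assert (DX : Dt1 V (fun _ e => X (e 0))) by (unfold X; dfn).
  assert (HX : forall x b, b ∈ X x <-> b ∈ a /\ x ∈ app f b).
  { intros. unfold X. rewrite in_sep by dclass. tauto. }
  set (C := fun x => if excluded_middle_informative (X x ∈ u) then X x else diff a (X x)).
  assert (DC : Dt1 V (fun _ e => C (e 0))) by (unfold C; dfn).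
  assert (HC : sep a (fun b => forall x, x ∈ m -> b ∈ C x) ∈ u).
  { apply meas_inter; [auto|now apply small_mem|]. intros x Hx. unfold C.
    destruct (excluded_middle_informative (X x ∈ u)); [auto|].
    destruct (meas_ultra (X x)); [|tauto|auto]. intros b Hb. now apply HX in Hb. }
  destruct (meas_inhabited _ HC) as [b Hb].
  assert (HbC := Hb). rewrite in_sep in Hb by dclass. destruct Hb as [Hb Kb].
  assert (E : forall b', b' ∈ sep a (fun b => forall x, x ∈ m -> b ∈ C x) -> b' = b).
  { intros b' Hb'. rewrite in_sep in Hb' by dclass. destruct Hb' as [Hb' Kb']. apply F3; auto.
    apply ext_eq. intros x.
    assert (Sx : forall c, c ∈ a -> x ∈ app f c -> x ∈ m).
    { intros c Hc Hx. apply F2 in Hc. apply in_pow in Hc. auto. }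
    assert (K : x ∈ m -> x ∈ app f b' <-> x ∈ app f b).
    { intros Hx. specialize (Kb x Hx). specialize (Kb' x Hx). unfold C in *.
      destruct (excluded_middle_informative (X x ∈ u)); rewrite ?in_diff, ?HX in *; tauto. }
    split; intros Hx; apply K; eauto. }
  destruct Hu as (_ & N & _). apply (N b (sep a (fun b => forall x, x ∈ m -> b ∈ C x))); [|auto].
  intros z. split; [apply E|]. intros ->. auto.
Qed.

(** Fewer than [a] points, those up to [b], are removed one by one. *)
Lemma meas_final b : b ∈ a -> sep a (fun c => b ∈ c) ∈ u.
Proof.
  intros Hb. assert (Oa : ordinal a) by apply Ha.
  apply (meas_up (sep a (fun c => forall x, x ∈ succ b -> c ∈ diff a (sing x)))).
  - apply meas_inter; [dfn| |].
    + apply small_mem, sl_succ; [apply measurable_strong_limit|auto].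
    + intros x Hx. apply meas_not_sing. apply (succ_subset b a); auto.
  - intros c Hc. rewrite in_sep in * by dclass. destruct Hc as [Hc K]. split; [auto|].
    destruct (ord_trichotomy b c) as [H|[H|H]]; try (apply (ord_elem a); auto); auto; exfalso.
    + subst c. specialize (K b). rewrite in_succ, in_diff, in_sing in K. tauto.
    + specialize (K c). rewrite in_succ, in_diff, in_sing in K. tauto.
  - intros c Hc. rewrite in_sep in Hc by dclass. tauto.
Qed.

End OneMeasure.

(** Normality for finite subsets in place of single ordinals. A finite subset of [b] lies in
    [succ c] for some [c] in [b], and [succ c] has fewer than [a] finite subsets; so the sets
    attached to these and to the elements of [L] are first intersected at [c], and then a diagonal
    intersection is taken. *)
Lemma normal_diag u a L (C : V -> V -> V) : cardinal a -> omega ∈ a -> normal_measure u a ->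
  Dt1 V (fun _ e => C (e 0) (e 1)) -> small a L ->
  (forall t r, finite t -> subset t a -> r ∈ L -> C t r ∈ u) ->
  sep a (fun b => forall t r, finite t -> subset t b -> r ∈ L -> b ∈ C t r) ∈ u.
Proof.
  intros Ha Hw [Hu Hn] DC HL HC. assert (Oa : ordinal a) by apply Ha.
  pose proof (measurable_strong_limit u a Ha Hw Hu) as SL.
  set (J := fun c => prod (sep (pow (succ c)) finite) L).
  assert (DJ : Dt1 V (fun _ e => J (e 0))) by (unfold J; dfn).
  set (f := fun c => sep a (fun b => forall z, z ∈ J c -> b ∈ C (fst z) (snd z))).
  assert (Df : Dt1 V (fun _ e => f (e 0))) by (unfold f; dfn).
  assert (Hf : forall c, c ∈ a -> f c ∈ u).
  { intros c Hc. unfold f. apply meas_inter with (C := fun z => C (fst z) (snd z)); auto.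
    - dfn.
    - unfold J. apply sl_prod; auto. apply small_le with (pow (succ c)).
      + apply card_le_sub. intros t Ht. rewrite in_sep in Ht by dclass. tauto.
      + apply sl_pow; auto. apply small_mem, sl_succ; auto.
    - intros z Hz. unfold J in Hz. apply in_prod in Hz as (t & r & Ht & Hr & ->).
      rewrite fst_opair, snd_opair. rewrite in_sep in Ht by dclass. destruct Ht as [Ht Hft].
      apply HC; auto. apply in_pow in Ht. intros x Hx. apply (succ_subset c a); auto. }
  set (D := sep a (fun b => forall c A, c ∈ b -> pair_mem c A (lam a f) -> b ∈ A)).
  assert (HD : D ∈ u).
  { apply (Hn (lam a f)).
    - split; [now apply lam_function|]. intros y z H. apply pair_mem_iff in H.
      rewrite in_lam in H by auto. destruct H as [Hy ->]. auto.
    - intros b. unfold D. rewrite in_sep; [tauto|dclass]. }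
  (* The empty [t] has no largest element; [emp] then plays the role of [c], so [emp ∈ b] has to be
     arranged. *)
  assert (H0 : sep a (fun c => emp ∈ c) ∈ u).
  { apply meas_final; auto. eapply ord_mem_trans; eauto using nat_0. }
  apply (meas_up u a Hu (cap D (sep a (fun c => emp ∈ c)))).
  - apply (meas_cap u a); auto.
  - intros b Hb. apply in_cap in Hb as [Hb Hb0]. rewrite in_sep in Hb0 by dclass. destruct Hb0 as [_ Hb0].
    unfold D in Hb. rewrite in_sep in Hb by dclass. destruct Hb as [Hb K].
    rewrite in_sep by dclass. split; [auto|]. intros t r Ht Htb Hr.
    assert (Ob : ordinal b) by (eapply ord_elem; eauto).
    assert (Ex : exists c, c ∈ b /\ subset t (succ c)).
    { destruct (emp_or_inhabited t) as [->|Hi].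
      - exists emp. split; [auto|]. intros x Hx. now apply in_emp in Hx.
      - destruct (finite_max t Ht) as (c & Hc & Mc); [intros y Hy; eapply ord_elem; eauto|auto|].
        exists c. split; [auto|]. intros x Hx. apply in_succ. destruct (Mc x Hx); auto. }
    destruct Ex as (c & Hc & Hct). assert (Hca : c ∈ a) by (eapply ord_mem_trans; eauto).
    specialize (K c (f c) Hc). rewrite pair_mem_iff, in_lam in K by auto. specialize (K (conj Hca eq_refl)).
    unfold f in K. rewrite in_sep in K by dclass. destruct K as [_ K].
    specialize (K (opair t r)). rewrite fst_opair, snd_opair in K. apply K.
    apply opair_in_prod. split; [|auto]. rewrite in_sep by dclass. split; [now apply in_pow|auto].
  - intros b Hb. rewrite in_sep in Hb by dclass. tauto.
Qed.

Lemma prikry_le_refl s A : prikry_le s A s A.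
Proof.
  split; [split; [apply subset_refl|]|split; [|apply subset_refl]]; tauto.
Qed.

Lemma prikry_le_trans s A t B r C : prikry_le s A t B -> prikry_le t B r C -> prikry_le s A r C.
Proof.
  intros ((E1 & E2) & H1 & S1) ((E1' & E2') & H1' & S1'). split; [split|split].
  - eapply subset_trans; eauto.
  - intros b c Hb Nb Hc. destruct (classic (b ∈ t)); auto.
  - intros b Hb Nb. destruct (classic (b ∈ t)); auto.
  - eapply subset_trans; eauto.
Qed.

Lemma finite_Union F (G : V -> V) : Dt1 V (fun _ e => G (e 0)) -> finite F -> (forall x, x ∈ F -> finite (G x)) ->
  finite (un (img F G)).
Proof.
  intros DG HF. revert F HF. apply (finite_induction (fun F => (forall x, x ∈ F -> finite (G x)) -> finite (un (img F G)))); [dclass| |].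
  - intros _. eapply finite_sub; [|apply finite_emp]. intros z Hz. apply in_un in Hz as (y & Hy & Hz).
    rewrite in_img in Hy by dclass. destruct Hy as (x & Hx & _). now apply in_emp in Hx.
  - intros F x HF IH H. eapply finite_sub; [|apply (finite_cup (un (img F G)) (G x))].
    + intros z Hz. apply in_un in Hz as (y & Hy & Hz). rewrite in_img in Hy by dclass.
      destruct Hy as (w & Hw & ->). apply in_cup. apply in_cup in Hw as [Hw|Hw].
      * left. apply in_un. exists (G w). split; [|auto]. rewrite in_img by dclass. eauto.
      * apply in_sing in Hw. subst. auto.
    + apply IH. intros y Hy. apply H, in_cup; auto.
    + apply H, in_cup. right. now apply in_sing.
Qed.

End Measures.

(* [st p a] and [ms p a] are the stem and the measure one set of [p] at [a] *)
Definition st {V : structure} {Z : ZFC V} (p a : V) : V := fst (app p a).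
Definition ms {V : structure} {Z : ZFC V} (p a : V) : V := snd (app p a).

Section DfnStem.
Context {I : Type} {Vs : I -> structure} {Cst : (forall i, Vs i) -> Prop} {Zf : forall i, ZFC (Vs i)}.
Local Notation Dt := (@Dt I Vs Cst).
Implicit Types t u : forall i, (nat -> Vs i) -> Vs i.
Lemma Dt_st t u : Dt t -> Dt u -> Dt (fun i e => st (t i e) (u i e)).
Proof. intros. unfold st. dfn. Qed.
Lemma Dt_ms t u : Dt t -> Dt u -> Dt (fun i e => ms (t i e) (u i e)).
Proof. intros. unfold ms. dfn. Qed.
End DfnStem.

Ltac dt_userF :=
  lazymatch goal with
  | |- Dt (fun _ _ => st _ _) => apply Dt_st
  | |- Dt (fun _ _ => ms _ _) => apply Dt_ms
  end.
Ltac dt_user ::= first [dt_userB | dt_userB2 | dt_userC | dt_userF].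

(** * The Prikry product in coordinates *)

Section Product.
Context {V : structure} {Z : ZFC V}.
Implicit Types a b c d f g p q r s t u x y z A B : V.

Lemma coord_iff p S a s A : function_on p S -> a ∈ S -> coord p a s A <-> app p a = opair s A.
Proof.
  intros Hp Ha. unfold coord. setoid_rewrite is_opair_iff. setoid_rewrite pair_mem_iff. split.
  - intros (c & -> & H). eapply app_val; eauto.
  - intros E. exists (opair s A). split; [auto|]. rewrite <- E. eapply app_mem; eauto.
Qed.

Variables S U P : V.
Hypothesis (HU : function_on U S).
Hypothesis (HP : is_prikry_product S U P).

Local Definition pcond a s A : Prop := prikry_cond a (app U a) s A.

Lemma in_P p : p ∈ P <-> function_on p S /\
  (forall a, a ∈ S -> app p a = opair (st p a) (ms p a) /\ pcond a (st p a) (ms p a)) /\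
  exists F, finite F /\ forall a, a ∈ S -> a ∉ F -> st p a = emp.
Proof.
  rewrite (HP p). unfold prikry_product_cond. split.
  - intros (F1 & H1 & F & HF & H2). split; [auto|].
    assert (K : forall a, a ∈ S -> app p a = opair (st p a) (ms p a) /\ pcond a (st p a) (ms p a)).
    { intros a Ha. destruct (H1 a Ha) as (u & s & A & Hu & Hc & Hpc).
      rewrite (coord_iff p S) in Hc by auto. apply pair_mem_iff in Hu.
      unfold pcond, st, ms. rewrite Hc, fst_opair, snd_opair, (app_val U S a u); auto. }
    split; [auto|]. exists F. split; [auto|]. intros a Ha Na.
    specialize (H2 a (st p a) (ms p a) Ha Na). rewrite (coord_iff p S) in H2 by auto.
    apply ext_eq. intros z. split; intros Hz.
    + destruct (H2 (proj1 (K a Ha)) z Hz).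
    + now apply in_emp in Hz.
  - intros (F1 & H1 & F & HF & H2). split; [auto|]. split.
    + intros a Ha. destruct (H1 a Ha) as [E K]. exists (app U a), (st p a), (ms p a).
      split; [apply pair_mem_iff; eapply app_mem; eauto|]. split; [now apply (coord_iff p S)|auto].
    + exists F. split; [auto|]. intros a s A Ha Na Hc. rewrite (coord_iff p S) in Hc by auto.
      specialize (H2 a Ha Na). unfold st in H2. rewrite Hc, fst_opair in H2. subst. exact in_emp.
Qed.

Lemma P_fun p : p ∈ P -> function_on p S. Proof. intros H. now apply in_P in H. Qed.
Lemma P_app p a : p ∈ P -> a ∈ S -> app p a = opair (st p a) (ms p a).
Proof. intros H Ha. apply in_P in H as (_ & H & _). now apply H. Qed.
Lemma P_cond p a : p ∈ P -> a ∈ S -> pcond a (st p a) (ms p a).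
Proof. intros H Ha. apply in_P in H as (_ & H & _). now apply H. Qed.
Lemma P_supp p : p ∈ P -> exists F, finite F /\ forall a, a ∈ S -> a ∉ F -> st p a = emp.
Proof. intros H. now apply in_P in H. Qed.

Local Notation le := (prikry_product_le S).

Lemma le_iff p q : p ∈ P -> q ∈ P ->
  le p q <-> forall a, a ∈ S -> prikry_le (st p a) (ms p a) (st q a) (ms q a).
Proof.
  intros Hp Hq. unfold prikry_product_le. split.
  - intros H a Ha. apply (H a); auto; apply (coord_iff _ S); auto using P_fun, P_app.
  - intros H a s A t B Ha C1 C2. apply (coord_iff _ S) in C1, C2; auto using P_fun.
    specialize (H a Ha). unfold st, ms in H. now rewrite C1, C2, !fst_opair, !snd_opair in H.
Qed.

Lemma le_refl p : p ∈ P -> le p p.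
Proof. intros H. apply le_iff; auto. intros; apply prikry_le_refl. Qed.

Lemma le_trans p q r : q ∈ P -> le p q -> le q r -> le p r.
Proof.
  intros Hq H1 H2 a s A t B Ha C1 C2. apply prikry_le_trans with (st q a) (ms q a).
  - apply (H1 a); auto. apply (coord_iff _ S); auto using P_fun, P_app.
  - apply (H2 a); auto. apply (coord_iff _ S); auto using P_fun, P_app.
Qed.

Lemma mk_cond (s A : V -> V) : Dt1 V (fun _ e => s (e 0)) -> Dt1 V (fun _ e => A (e 0)) ->
  (forall a, a ∈ S -> pcond a (s a) (A a)) ->
  (exists F, finite F /\ forall a, a ∈ S -> a ∉ F -> s a = emp) ->
  exists p, p ∈ P /\ forall a, a ∈ S -> st p a = s a /\ ms p a = A a.
Proof.
  intros Ds DA H1 (F & HF & H2). exists (lam S (fun a => opair (s a) (A a))).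
  assert (DL : Dt1 V (fun _ e => opair (s (e 0)) (A (e 0)))) by dfn.
  assert (E : forall a, a ∈ S -> st (lam S (fun a => opair (s a) (A a))) a = s a /\ ms (lam S (fun a => opair (s a) (A a))) a = A a).
  { intros a Ha. unfold st, ms. rewrite app_lam by auto. now rewrite fst_opair, snd_opair. }
  split; [|auto]. apply in_P. split; [now apply lam_function|]. split.
  - intros a Ha. destruct (E a Ha) as [-> ->]. rewrite app_lam by auto. auto.
  - exists F. split; [auto|]. intros a Ha Na. destruct (E a Ha) as [-> _]. auto.
Qed.

Lemma P_ext p q : p ∈ P -> q ∈ P -> (forall a, a ∈ S -> st p a = st q a /\ ms p a = ms q a) -> p = q.
Proof.
  intros Hp Hq H. apply function_ext with S; auto using P_fun. intros a Ha.
  rewrite (P_app p), (P_app q) by auto. destruct (H a Ha). congruence.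
Qed.

Hypothesis (HS : forall a, a ∈ S -> measurable a).
Hypothesis (Hn : forall a u, pair_mem a u U -> normal_measure u a).

Lemma S_card a : a ∈ S -> cardinal a. Proof. intros H. apply HS in H. apply H. Qed.
Lemma S_omega a : a ∈ S -> omega ∈ a.
Proof.
  intros H. apply HS in H as (_ & (w & Hw & K) & _). replace omega with w; [auto|].
  apply ext_eq. intros x. now rewrite (Hw x), in_omega.
Qed.
Lemma S_ord a : a ∈ S -> ordinal a. Proof. intros H. now apply S_card in H as []. Qed.
Lemma S_normal a : a ∈ S -> normal_measure (app U a) a.
Proof. intros H. apply Hn, pair_mem_iff. eapply app_mem; eauto. Qed.
Lemma S_meas a : a ∈ S -> measure_on (app U a) a.
Proof. intros H. now apply S_normal in H as []. Qed.
Lemma S_sl a : a ∈ S -> strong_limit a.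
Proof. intros H. eapply measurable_strong_limit; eauto using S_card, S_omega, S_meas. Qed.

Lemma ms_sub p a : p ∈ P -> a ∈ S -> subset (ms p a) a.
Proof.
  intros Hp Ha. destruct (P_cond p a Hp Ha) as (_ & _ & H & _). eapply meas_sub; eauto using S_meas.
Qed.
Lemma st_sub p a : p ∈ P -> a ∈ S -> subset (st p a) a.
Proof. intros Hp Ha. destruct (P_cond p a Hp Ha) as (K1 & K2 & K3 & K4). auto. Qed.
Lemma ms_in p a : p ∈ P -> a ∈ S -> ms p a ∈ app U a.
Proof. intros Hp Ha. destruct (P_cond p a Hp Ha) as (K1 & K2 & K3 & K4). auto. Qed.
Lemma st_fin p a : p ∈ P -> a ∈ S -> finite (st p a).
Proof. intros Hp Ha. destruct (P_cond p a Hp Ha) as (K1 & K2 & K3 & K4). auto. Qed.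
Lemma st_ms p a b c : p ∈ P -> a ∈ S -> b ∈ st p a -> c ∈ ms p a -> b ∈ c.
Proof. intros Hp Ha. destruct (P_cond p a Hp Ha) as (K1 & K2 & K3 & K4). auto. Qed.

(** Intersecting the measure one sets keeps the stems. Antichains can therefore be bounded by
    counting stems instead of conditions. *)
Lemma same_stem_compat p q : p ∈ P -> q ∈ P -> (forall a, a ∈ S -> st p a = st q a) ->
  exists r, r ∈ P /\ le r p /\ le r q.
Proof.
  intros Hp Hq E.
  destruct (mk_cond (fun a => st p a) (fun a => cap (ms p a) (ms q a))) as (r & Hr & Er).
  - dfn.
  - dfn.
  - intros a Ha. destruct (P_cond p a Hp Ha) as (K1 & K2 & K3 & K4). split; [auto|]. split; [auto|]. split.
    + apply (meas_cap _ a); auto using S_meas, ms_in.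
    + intros b c Hb Hc. apply in_cap in Hc as [Hc _]. auto.
  - now apply P_supp.
  - exists r. split; [auto|]. split; apply le_iff; auto; intros a Ha; destruct (Er a Ha) as [-> ->].
    + split; [split; [apply subset_refl|tauto]|]. split; [tauto|]. intros b Hb. now apply in_cap in Hb.
    + rewrite (E a Ha). split; [split; [apply subset_refl|tauto]|]. split; [tauto|]. intros b Hb. now apply in_cap in Hb.
Qed.

(** Used after a stem point has been removed: an extension of the new condition may not yet have a
    further point there, and this adds one. *)
Lemma add_point p a : p ∈ P -> a ∈ S -> exists q b, q ∈ P /\ le q p /\ b ∈ st q a /\ b ∉ st p a.
Proof.
  intros Hp Ha.
  destruct (meas_inhabited _ _ (S_meas a Ha) _ (ms_in p a Hp Ha)) as [b Hb].
  assert (Hba : b ∈ a) by (eapply ms_sub; eauto).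
  assert (Nb : b ∉ st p a). { intros K. apply (mem_irrefl b). apply (st_ms p a); auto. }
  destruct (mk_cond (fun c => if excluded_middle_informative (c = a) then cup (st p a) (sing b) else st p c)
    (fun c => if excluded_middle_informative (c = a) then sep (ms p a) (fun d => b ∈ d) else ms p c)) as (q & Hq & Eq).
  - dfn.
  - dfn.
  - intros c Hc. destruct (excluded_middle_informative (c = a)) as [->|_]; [|now apply P_cond].
    split; [|split; [|split]].
    + now apply finite_add, st_fin.
    + intros x Hx. apply in_cup in Hx as [Hx|Hx]; [eapply st_sub; eauto|]. apply in_sing in Hx. now subst.
    + apply (meas_up (app U a) a (S_meas a Ha) (cap (ms p a) (sep a (fun d => b ∈ d)))).
      * apply (meas_cap _ a); auto using S_meas, ms_in. apply meas_final; auto using S_card, S_omega, S_meas.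
      * intros d Hd. apply in_cap in Hd as [Hd Hd']. rewrite in_sep in Hd' by dclass. rewrite in_sep by dclass. tauto.
      * intros d Hd. rewrite in_sep in Hd by dclass. apply (ms_sub p a); tauto.
    + intros x d Hx Hd. rewrite in_sep in Hd by dclass. destruct Hd as [Hd Hbd].
      apply in_cup in Hx as [Hx|Hx]; [apply (st_ms p a); auto|]. apply in_sing in Hx. now subst.
  - destruct (P_supp p Hp) as (F & HF & K). exists (cup F (sing a)). split; [now apply finite_add|].
    intros c Hc Nc. rewrite in_cup, in_sing in Nc. destruct (excluded_middle_informative (c = a)); [tauto|]. apply K; tauto.
  - assert (E1 : st q a = cup (st p a) (sing b)).
    { destruct (Eq a Ha) as [-> _]. destruct (excluded_middle_informative (a = a)); tauto. }
    exists q, b. split; [auto|]. split; [|split; [|auto]].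
    + apply le_iff; auto. intros c Hc. destruct (Eq c Hc) as [-> ->].
      destruct (excluded_middle_informative (c = a)) as [->|_]; [|apply prikry_le_refl].
      split; [split|split].
      * intros x Hx. apply in_cup; auto.
      * intros x y Hx Nx Hy. apply in_cup in Hx as [Hx|Hx]; [tauto|]. apply in_sing in Hx. subst. apply (st_ms p a); auto.
      * intros x Hx Nx. apply in_cup in Hx as [Hx|Hx]; [tauto|]. apply in_sing in Hx. now subst.
      * intros d Hd. rewrite in_sep in Hd by dclass. tauto.
    + rewrite E1. apply in_cup. right. now apply in_sing.
Qed.

Hypothesis (Hd : discrete S).

(** For open [O] this says that [q] forces the generic filter to meet [O]. *)
Definition dense_below (O : V -> Prop) q : Prop :=
  forall r, r ∈ P -> le r q -> exists r', r' ∈ P /\ le r' r /\ O r'.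

Definition pure_above k q : Prop := forall a, a ∈ S -> k ∈ a -> st q a = emp.

(** The form in which discreteness is used. The coordinates below [a] are bounded in [a], so there
    are fewer than [a] lower parts, and completeness handles all of them at once. *)
Lemma S_bound a : a ∈ S -> exists m, m ∈ a /\ ordinal m /\ forall c, c ∈ S -> c ∈ a -> c ∈ m.
Proof.
  intros Ha. apply NNPP. intros N. apply (Hd a Ha). intros b Hb. apply NNPP. intros N'. apply N.
  pose proof (S_ord a Ha) as Oa. assert (Ob : ordinal b) by (apply (ord_elem a); auto).
  exists (succ b). split; [apply sl_succ; auto using S_sl|]. split; [now apply ord_succ|].
  intros c Hc Hca. apply in_succ. destruct (ord_trichotomy c b) as [H|[H|H]]; auto.
  - now apply S_ord.
  - exfalso. eauto.
Qed.

(** Stem and measure one set are in [pow m], their pair is three power sets above [m], a coordinate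
    paired with that pair five, and a set of such objects six. *)
Local Definition pow6 m := pow (pow (pow (pow (pow (pow m))))).

Lemma low_part_bound m q g : ordinal m -> q ∈ P -> (forall c, c ∈ S -> c ∈ g -> c ∈ m) -> restr q g ∈ pow6 m.
Proof.
  intros Om Hq H. unfold pow6. apply in_pow. intros z Hz.
  pose proof (proj1 Om) as T0.
  destruct (transitive_pow _ T0) as [T1 S1], (transitive_pow _ T1) as [T2 S2], (transitive_pow _ T2) as [T3 S3].
  assert (Hz' : exists x y, z = opair x y).
  { pose proof (restr_sub _ _ _ Hz) as Hzq.
    destruct (function_on_elem q S z) as (x & y & _ & ->); eauto using P_fun. }
  destruct Hz' as (x & y & ->). apply in_restr in Hz as [Hz Hx].
  pose proof (function_on_dom _ _ _ _ (P_fun q Hq) Hz) as HxS.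
  assert (Hxm : x ∈ m) by auto. assert (Ox : subset x m) by auto.
  apply (app_val _ _ _ _ (P_fun q Hq)) in Hz. rewrite (P_app q x) in Hz by auto. subst y.
  apply opair_pow; [now apply S3, S2, S1|]. apply opair_pow; apply in_pow.
  - eapply subset_trans; [apply (st_sub q x); auto|auto].
  - eapply subset_trans; [apply (ms_sub q x); auto|auto].
Qed.

Lemma pow6_small k m : strong_limit k -> m ∈ k -> small k (pow6 m).
Proof. intros H Hm. unfold pow6. repeat (apply sl_pow; [auto|]). now apply small_mem. Qed.

(** * The Prikry property of the product above [k] *)

Section PrikryProperty.
Variables (O : V -> Prop) (k p : V).
Hypotheses (DO : Dfn1 V (fun _ e => O (e 0)))
  (Oopen : forall q r, q ∈ P -> r ∈ P -> le r q -> O q -> O r)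
  (Hp : p ∈ P) (Hpure : pure_above k p).

(** Only the part [r] below [g] and the stem [t] at [g] are remembered of a condition forcing [O];
    its measure one sets from [g] on are quantified away. So few parameters remain that completeness
    and normality can treat all of them. *)
Local Definition good g r t : Prop := exists q, q ∈ P /\ restr q g = r /\ st q g = t /\
  pure_above g q /\ dense_below O q.

Lemma D_good : Dfn1 V (fun _ e => good (e 0) (e 1) (e 2)).
Proof. unfold good, pure_above, dense_below. dfn. Qed.

Local Notation wit f g r t := (app f (opair g (opair r t))).

Lemma good_witness : exists f, forall g r t, g ∈ S -> good g r t ->
  wit f g r t ∈ P /\ restr (wit f g r t) g = r /\ st (wit f g r t) g = t /\
  pure_above g (wit f g r t) /\ dense_below O (wit f g r t).
Proof.
  pose proof D_good as DG.
  set (J := sep (prod S (prod (pow (un P)) (pow (un S)))) (fun z => good (fst z) (fst (snd z)) (snd (snd z)))).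
  set (R := fun z q => restr q (fst z) = fst (snd z) /\ st q (fst z) = snd (snd z) /\
    pure_above (fst z) q /\ dense_below O q).
  destruct (choice_fun J P R) as (f & Hf & Kf).
  { unfold R, pure_above, dense_below. dfn. }
  { intros z Hz. unfold J in Hz. rewrite in_sep in Hz by dclass. destruct Hz as [_ (q & Hq & H)].
    exists q. auto. }
  exists f.
  intros g r t Hg H. destruct (Kf (opair g (opair r t))) as [K1 K2].
  - unfold J. rewrite in_sep by dclass. rewrite fst_opair, !snd_opair, fst_opair. split; [|auto].
    destruct H as (q & Hq & H1 & H2 & _). apply opair_in_prod. split; [auto|]. apply opair_in_prod. split; apply in_pow.
    + subst r. intros z Hz. apply in_un. exists q. split; [auto|]. now apply restr_sub in Hz.
    + subst t. intros z Hz. apply in_un. exists g. split; [auto|]. apply (st_sub q g); auto.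
  - unfold R in K2. rewrite fst_opair, !snd_opair, fst_opair in K2. auto.
Qed.

(** The measure one sets above [k] are shrunk so that they lie inside those of all relevant
    witnesses, and so that it no longer depends on the point whether adding it to a given finite
    stem yields a good one. If the result has an extension in [O], the finitely many stem points of
    that extension above [k] can be removed from the top down without losing density of [O]. *)
Lemma prikry_property : exists q, q ∈ P /\ le q p /\ pure_above k q /\
  (dense_below O q \/ forall r, r ∈ P -> le r q -> ~ O r).
Proof.
  pose proof D_good as DG. destruct good_witness as [f Hf].
  set (X := fun g r t => sep g (fun b => good g r (cup t (sing b)))).
  assert (HX : forall g r t b, b ∈ X g r t <-> b ∈ g /\ good g r (cup t (sing b))).
  { intros. unfold X. rewrite in_sep by dclass. tauto. }
  (* Three requirements at [g]: witnesses for lower coordinates, fewer than [g] of them, by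
     completeness; witnesses at [g] itself, diagonally over the stems below [b]; and homogeneity,
     every [b] above [t] lying on that side of [X g r t] which has measure one. *)
  set (A' := fun g => sep (ms p g) (fun b =>
    (forall c r t, c ∈ S -> c ∈ g -> good c r t -> b ∈ ms (wit f c r t) g) /\
    (forall t r, finite t -> subset t b -> good g r t -> b ∈ ms (wit f g r t) g) /\
    (forall t r, finite t -> subset t b -> (exists q, q ∈ P /\ restr q g = r) -> (b ∈ X g r t <-> X g r t ∈ app U g)))).
  assert (DX : forall t1 t2 t3 : unit -> (nat -> V) -> V, Dt1 V t1 -> Dt1 V t2 -> Dt1 V t3 -> Dt1 V (fun i e => X (t1 i e) (t2 i e) (t3 i e))).
  { intros. unfold X. dfn. }
  assert (DA : Dt1 V (fun _ e => A' (e 0))).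
  { unfold A'. dfn; apply DX; dfn. }
  assert (HA : forall g b, b ∈ A' g <-> b ∈ ms p g /\
    (forall c r t, c ∈ S -> c ∈ g -> good c r t -> b ∈ ms (wit f c r t) g) /\
    (forall t r, finite t -> subset t b -> good g r t -> b ∈ ms (wit f g r t) g) /\
    (forall t r, finite t -> subset t b -> (exists q, q ∈ P /\ restr q g = r) -> (b ∈ X g r t <-> X g r t ∈ app U g))).
  { intros g b. unfold A'. rewrite in_sep; [tauto|]. apply dclass_intro. dfn; apply DX; dfn. }
  assert (HAU : forall g, g ∈ S -> A' g ∈ app U g).
  { intros g Hg. pose proof (S_card g Hg) as Cg. pose proof (S_omega g Hg) as Wg. pose proof (S_meas g Hg) as Mg.
    pose proof (S_normal g Hg) as Ng. pose proof (S_sl g Hg) as SLg.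
    destruct (S_bound g Hg) as (m & Hm & Om & Bm).
    set (L := img P (fun q => restr q g)).
    assert (HL : forall r, r ∈ L <-> exists q, q ∈ P /\ restr q g = r).
    { intros r. unfold L. rewrite in_img by dclass. split; intros (q & Hq & E); eauto. }
    assert (SLL : small g L).
    { eapply small_le; [|apply (pow6_small g m); auto]. apply card_le_sub. intros r Hr.
      apply HL in Hr as (q & Hq & <-). apply low_part_bound; auto. }
    set (J := sep (prod m (prod (pow6 m) (pow m))) (fun z => fst z ∈ S /\ fst z ∈ g /\ good (fst z) (fst (snd z)) (snd (snd z)))).
    assert (K1 : sep g (fun b => forall z, z ∈ J -> b ∈ ms (app f z) g) ∈ app U g).
    { apply meas_inter with (C := fun z => ms (app f z) g); auto.
      - dfn.
      - eapply small_le; [apply card_le_sub with (b := prod m (prod (pow6 m) (pow m)))|].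
        + intros z Hz. unfold J in Hz. rewrite in_sep in Hz by dclass. tauto.
        + apply sl_prod; auto using small_mem. apply sl_prod; auto using pow6_small. apply sl_pow; auto using small_mem.
      - intros z Hz. unfold J in Hz. rewrite in_sep in Hz by dclass. destruct Hz as (Hz & Hs & _ & Hgd).
        apply in_prod in Hz as (c & y & Hc & Hy & ->). apply in_prod in Hy as (r & t & Hr & Ht & ->).
        rewrite fst_opair, !snd_opair, fst_opair in *. apply ms_in; auto. now apply Hf. }
    assert (K2 : sep g (fun b => forall t r, finite t -> subset t b -> r ∈ L ->
       b ∈ if excluded_middle_informative (good g r t) then ms (wit f g r t) g else g) ∈ app U g).
    { apply normal_diag with (C := fun t r => if excluded_middle_informative (good g r t) then ms (wit f g r t) g else g); auto.
      - dfn.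
      - intros t r Ht Htg Hr. destruct (excluded_middle_informative (good g r t)) as [Hgd|_].
        + apply ms_in; auto. now apply Hf.
        + now apply (meas_top _ g). }
    assert (K3 : sep g (fun b => forall t r, finite t -> subset t b -> r ∈ L ->
       b ∈ if excluded_middle_informative (X g r t ∈ app U g) then X g r t else diff g (X g r t)) ∈ app U g).
    { apply normal_diag with (C := fun t r => if excluded_middle_informative (X g r t ∈ app U g) then X g r t else diff g (X g r t)); auto.
      - dfn; apply DX; dfn.
      - intros t r Ht Htg Hr. destruct (excluded_middle_informative (X g r t ∈ app U g)); [auto|].
        destruct (meas_ultra (app U g) g Mg (X g r t)) as [K|K]; [|tauto|auto].
        intros b Hb. now apply HX in Hb. }
    apply (meas_up (app U g) g Mg (cap (cap (ms p g) (sep g (fun b => forall z, z ∈ J -> b ∈ ms (app f z) g)))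
      (cap (sep g (fun b => forall t r, finite t -> subset t b -> r ∈ L ->
       b ∈ if excluded_middle_informative (good g r t) then ms (wit f g r t) g else g))
       (sep g (fun b => forall t r, finite t -> subset t b -> r ∈ L ->
       b ∈ if excluded_middle_informative (X g r t ∈ app U g) then X g r t else diff g (X g r t)))))).
    { repeat (apply (meas_cap (app U g) g Mg)); auto using ms_in. }
    2:{ intros b Hb. apply HA in Hb as [Hb _]. now apply (ms_sub p g). }
    intros b Hb. apply in_cap in Hb as [Hb Hb']. apply in_cap in Hb as [Hb B1]. apply in_cap in Hb' as [B2 B3].
    rewrite in_sep in B1 by dclass. rewrite in_sep in B2 by dclass.
    rewrite in_sep in B3 by (apply dclass_intro; dfn; apply DX; dfn).
    destruct B1 as [Hbg B1], B2 as [_ B2], B3 as [_ B3].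
    apply HA. split; [auto|]. split; [|split].
    - intros c r t Hc Hcg Hgd. specialize (B1 (opair c (opair r t))). apply B1.
      unfold J. rewrite in_sep by dclass. rewrite fst_opair, !snd_opair, fst_opair. split; [|auto].
      pose proof Hgd as (q & Hq & E1 & E2 & _).
      apply opair_in_prod. split; [auto|]. apply opair_in_prod. split.
      + rewrite <- E1. apply low_part_bound; auto. intros d Hd' Hdc. apply Bm; auto.
        apply (ord_mem_trans g d c); auto using S_ord.
      + apply in_pow. rewrite <- E2. eapply subset_trans; [apply (st_sub q c); auto|].
        apply (proj1 Om). auto.
    - intros t r Ht Htb Hgd. specialize (B2 t r Ht Htb).
      destruct (excluded_middle_informative (good g r t)); [|tauto]. apply B2. apply HL.
      destruct Hgd as (q & Hq & E & _). eauto.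
    - intros t r Ht Htb Hr. apply HL in Hr. specialize (B3 t r Ht Htb Hr).
      destruct (excluded_middle_informative (X g r t ∈ app U g)); [tauto|]. apply in_diff in B3. tauto. }
  destruct (mk_cond (fun a => st p a) (fun a => if excluded_middle_informative (k ∈ a) then A' a else ms p a)) as (p' & Hp' & Ep').
  { dfn. } { dfn. }
  { intros a Ha. destruct (P_cond p a Hp Ha) as (C1 & C2 & C3 & C4).
    destruct (excluded_middle_informative (k ∈ a)); [|split; auto]. split; [auto|]. split; [auto|]. split; [auto|].
    intros b c Hb Hc. apply HA in Hc as [Hc _]. auto. }
  { now apply P_supp. }
  assert (Est : forall a, a ∈ S -> st p' a = st p a). { intros a Ha. now apply Ep'. }
  assert (Ems : forall a, a ∈ S -> k ∈ a -> ms p' a = A' a).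
  { intros a Ha Hk. destruct (Ep' a Ha) as [_ ->]. destruct (excluded_middle_informative (k ∈ a)); tauto. }
  assert (Ems' : forall a, a ∈ S -> subset (ms p' a) (ms p a)).
  { intros a Ha b. destruct (Ep' a Ha) as [_ ->]. destruct (excluded_middle_informative (k ∈ a)); [|auto]. intros Hb. now apply HA in Hb. }
  assert (Lp' : le p' p).
  { apply le_iff; auto. intros a Ha. rewrite Est by auto. split; [split; [apply subset_refl|tauto]|]. split; [tauto|auto]. }
  assert (Pp' : pure_above k p'). { intros a Ha Hk. rewrite Est by auto. auto. }
  destruct (classic (exists q, q ∈ P /\ le q p' /\ O q)) as [(q0 & Hq0 & Lq0 & Oq0)|N].
  2:{ exists p'. split; [auto|]. split; [auto|]. split; [auto|]. right. intros r Hr Lr Or. apply N. eauto. }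
  (* The quantity that decreases: all stem points at coordinates above [k]. *)
  set (pts := fun q => sep (prod S (un S)) (fun z => k ∈ fst z /\ snd z ∈ st q (fst z))).
  assert (Dp : Dt1 V (fun _ e => pts (e 0))) by (unfold pts; dfn).
  assert (Hpts : forall q a b, q ∈ P -> opair a b ∈ pts q <-> a ∈ S /\ k ∈ a /\ b ∈ st q a).
  { intros q a b Hq. unfold pts. rewrite in_sep by dclass. rewrite fst_opair, snd_opair, opair_in_prod. split; [tauto|].
    intros (H1 & H2 & H3). split; [|auto]. split; [auto|]. apply in_un. exists a. split; [auto|]. apply (st_sub q a); auto. }
  (* removing the largest point of the stem at the largest impure coordinate *)
  assert (Key : forall q, q ∈ P -> le q p' -> dense_below O q -> ~ pure_above k q ->
    exists q' z, q' ∈ P /\ le q' p' /\ dense_below O q' /\ z ∈ pts q /\ subset (pts q') (diff (pts q) (sing z))).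
  { intros q Hq Lq Dq Nq.
    destruct (P_supp q Hq) as (F & HF & KF).
    destruct (finite_max (sep (cap F S) (fun a => k ∈ a /\ st q a <> emp))) as (g & Hg & Mg).
    { eapply finite_sub; [|exact HF]. intros a Ha. rewrite in_sep in Ha by dclass. destruct Ha as [Ha _]. now apply in_cap in Ha. }
    { intros a Ha. rewrite in_sep in Ha by dclass. destruct Ha as [Ha _]. apply in_cap in Ha as []. now apply S_ord. }
    { apply NNPP. intros N. apply Nq. intros a Ha Hk. apply NNPP. intros Ne. apply N. exists a.
      rewrite in_sep by dclass. split; [|auto]. apply in_cap. split; [|auto]. apply NNPP. intros NF. auto. }
    rewrite in_sep in Hg by dclass. destruct Hg as (Hg & Hkg & Neg). apply in_cap in Hg as [_ Hg].
    assert (Og : ordinal g) by now apply S_ord.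
    assert (Pg : pure_above g q).
    { intros a Ha Hga. apply NNPP. intros Ne. pose proof (S_ord a Ha) as Oa.
      destruct (Mg a) as [->|K].
      - rewrite in_sep by dclass. split; [|split; [|auto]].
        + apply in_cap. split; [|auto]. apply NNPP. intros NF. auto.
        + apply (ord_mem_trans a k g); auto.
      - now apply (mem_irrefl g).
      - now apply (mem_asym g a). }
    set (s := st q g).
    assert (Os : forall b, b ∈ s -> ordinal b). { intros b Hb. apply (ord_elem g); auto. apply (st_sub q g); auto. }
    destruct (finite_max s) as (b & Hb & Mb); auto.
    { apply st_fin; auto. }
    { destruct (emp_or_inhabited s); [contradiction|auto]. }
    set (t := diff s (sing b)).
    assert (Es : s = cup t (sing b)) by now apply diff_cup_sing.
    assert (Ht : finite t). { apply (finite_sub t s); [|now apply st_fin]. intros x Hx. now apply in_diff in Hx. }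
    assert (Htb : subset t b). { intros x Hx. apply in_diff in Hx as [Hx Nx]. rewrite in_sing in Nx. destruct (Mb x Hx); tauto. }
    assert (Hts : subset t s). { intros x Hx. now apply in_diff in Hx. }
    set (r := restr q g).
    assert (Gs : good g r s). { exists q. auto 6. }
    assert (Lqa := proj1 (le_iff q p' Hq Hp') Lq).
    assert (Esp : st p' g = emp) by (apply Pp'; auto).
    assert (HsA : forall x, x ∈ s -> x ∈ A' g).
    { intros x Hx. destruct (Lqa g Hg) as (_ & K & _). rewrite <- Ems by auto. apply K; [auto|]. rewrite Esp. apply in_emp. }
    (* The old top point [b] is on the good side, so by homogeneity the good side has measure one,
       and every other admissible point could have been used instead of [b]. *)
    assert (HX' : X g r t ∈ app U g).
    { pose proof (HsA b Hb) as K. apply HA in K as (_ & _ & _ & K).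
      apply (K t r Ht Htb); [eauto|]. apply HX. rewrite <- Es. split; [|auto]. apply (st_sub q g); auto. }
    assert (Gb : forall x, x ∈ A' g -> subset t x -> good g r (cup t (sing x))).
    { intros x Hx Htx. apply HA in Hx as (_ & _ & _ & K). apply (K t r Ht Htx) in HX'; [|eauto]. now apply HX in HX'. }
    assert (Hbg : b ∈ g) by (apply (st_sub q g); auto).
    destruct (mk_cond
      (fun a => if excluded_middle_informative (a ∈ g) then st q a else if excluded_middle_informative (a = g) then t else emp)
      (fun a => if excluded_middle_informative (a ∈ g) then ms q a else if excluded_middle_informative (a = g) then sep (A' g) (fun c => subset t c) else A' a)) as (q' & Hq' & Eq').
    { dfn. } { dfn. }
    { intros a Ha. destruct (excluded_middle_informative (a ∈ g)); [now apply P_cond|].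
      destruct (excluded_middle_informative (a = g)) as [->|Na].
      - split; [auto|]. split; [eapply subset_trans; [exact Hts|apply (st_sub q g); auto]|]. split.
        + apply (meas_up (app U g) g (S_meas g Hg) (cap (A' g) (sep g (fun c => b ∈ c)))).
          * apply (meas_cap _ g); auto using S_meas. apply meas_final; auto using S_card, S_omega, S_meas.
          * intros c Hc. apply in_cap in Hc as [Hc Hc']. rewrite in_sep in Hc' by dclass. destruct Hc' as [Hcg Hbc].
            rewrite in_sep by dclass. split; [auto|]. intros x Hx. apply (ord_mem_trans c x b); auto. apply (ord_elem g); auto.
          * intros c Hc. rewrite in_sep in Hc by dclass. destruct Hc as [Hc _]. apply HA in Hc as [Hc _]. apply (ms_sub p g); auto.
        + intros x c Hx Hc. rewrite in_sep in Hc by dclass. destruct Hc as [_ Hc]. auto.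
      - split; [apply finite_emp|]. split; [intros x Hx; now apply in_emp in Hx|]. split; [now apply HAU|].
        intros x c Hx. now apply in_emp in Hx. }
    { exists (cup F (sing g)). split; [now apply finite_add|]. intros a Ha Na. rewrite in_cup, in_sing in Na.
      destruct (excluded_middle_informative (a ∈ g)); [apply KF; tauto|].
      destruct (excluded_middle_informative (a = g)); [tauto|auto]. }
    assert (E1 : forall a, a ∈ S -> a ∈ g -> st q' a = st q a /\ ms q' a = ms q a).
    { intros a Ha Hag. destruct (Eq' a Ha) as [-> ->]. destruct (excluded_middle_informative (a ∈ g)); tauto. }
    assert (E2 : st q' g = t /\ ms q' g = sep (A' g) (fun c => subset t c)).
    { destruct (Eq' g Hg) as [-> ->]. destruct (excluded_middle_informative (g ∈ g)) as [K|_]; [now apply mem_irrefl in K|].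
      destruct (excluded_middle_informative (g = g)); tauto. }
    assert (E3 : forall a, a ∈ S -> g ∈ a -> st q' a = emp /\ ms q' a = A' a).
    { intros a Ha Hga. destruct (Eq' a Ha) as [-> ->]. destruct (excluded_middle_informative (a ∈ g)) as [K|_]; [now apply mem_asym in K|].
      destruct (excluded_middle_informative (a = g)) as [->|_]; [now apply mem_irrefl in Hga|auto]. }
    assert (Hms : forall x, x ∈ ms q' g <-> x ∈ A' g /\ subset t x).
    { intros x. destruct E2 as [_ ->]. rewrite in_sep by dclass. tauto. }
    assert (Tri : forall a, a ∈ S -> a ∈ g \/ a = g \/ g ∈ a). { intros a Ha. apply ord_trichotomy; auto using S_ord. }
    assert (Hkt : forall a, a ∈ S -> g ∈ a -> k ∈ a). { intros a Ha Hga. apply (ord_mem_trans a k g); auto using S_ord. }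
    exists q', (opair g b). split; [auto|]. split; [|split; [|split]].
    - apply le_iff; auto. intros a Ha. destruct (Tri a Ha) as [K|[->|K]].
      + destruct (E1 a Ha K) as [-> ->]. auto.
      + rewrite Esp, Ems by auto. destruct E2 as [-> _]. split; [split|split].
        * intros x Hx. now apply in_emp in Hx.
        * intros x y _ _ Hy. now apply in_emp in Hy.
        * auto.
        * intros x Hx. now apply Hms in Hx.
      + rewrite Pp', Ems by auto. destruct (E3 a Ha K) as [-> ->]. apply prikry_le_refl.
    - intros x Hx Lx.
      (* Below the new condition some point beyond [t] eventually appears at [g]. The least such
         point [b'] tells which witness applies: the one for [t] with [b'] added lies above the
         extension. *)
      assert (Ex : exists x1, x1 ∈ P /\ le x1 x /\ exists c, c ∈ st x1 g /\ c ∉ t).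
      { assert (Lxa := proj1 (le_iff x q' Hx Hq') Lx g Hg). destruct E2 as [E2 _]. rewrite E2 in Lxa.
        destruct (classic (exists c, c ∈ st x g /\ c ∉ t)) as [Hc|Nc]; [exists x; auto using le_refl|].
        destruct (add_point x g Hx Hg) as (x1 & c & Hx1 & L1 & Hc & Ncx). exists x1. split; [auto|]. split; [auto|].
        exists c. split; [auto|]. intros Hct. apply Ncx. apply (proj1 (proj1 Lxa)). auto. }
      destruct Ex as (x1 & Hx1 & L1 & Hc).
      assert (L1' : le x1 q') by (apply (le_trans x1 x q'); auto).
      assert (Lxa := proj1 (le_iff x1 q' Hx1 Hq') L1').
      destruct (foundation (diff (st x1 g) t)) as (b' & Hb' & Mb').
      { destruct Hc as (c & Hc & Nc). exists c. now apply in_diff. }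
      apply in_diff in Hb' as [Hb' Nb'].
      destruct (Lxa g Hg) as ((I1 & I2) & I3 & I4). destruct E2 as [E2 _]. rewrite E2 in I1, I2, I3.
      assert (Hb'A : b' ∈ A' g /\ subset t b') by (apply Hms; auto).
      destruct Hb'A as [Hb'A Htb'].
      pose proof (Gb b' Hb'A Htb') as Gd. set (t' := cup t (sing b')) in *.
      assert (Ft' : finite t') by now apply finite_add.
      assert (Ht'x : forall c, c ∈ ms q' g -> subset t' c -> c ∈ ms (wit f g r t') g).
      { intros c Hc' Htc. apply Hms in Hc' as [Hc' _]. apply HA in Hc' as (_ & _ & K & _). now apply K. }
      destruct (Hf g r t' Hg Gd) as (W1 & W2 & W3 & W4 & W5). set (w := wit f g r t') in *.
      (* Below [g] the witness has the lower part of [q]; at [g] its measure one set contains the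
         later points by the diagonal requirement; above [g] it has empty stems and contains [A'] by
         the first requirement. *)
      assert (Lw : le x1 w).
      { apply le_iff; auto. intros a Ha. destruct (Tri a Ha) as [K|[->|K]].
        - assert (Ea : app w a = app q a).
          { apply app_val with S; [now apply P_fun|]. apply (restr_sub w g). rewrite W2. apply in_restr. split; [|auto].
            apply app_mem with S; auto using P_fun. }
          assert (Est' : st w a = st q a /\ ms w a = ms q a).
          { rewrite (P_app w), (P_app q) in Ea by auto. now apply opair_inj in Ea. }
          destruct Est' as [-> ->]. destruct (E1 a Ha K) as [<- <-]. auto.
        - rewrite W3. split; [split|split].
          + intros y Hy. apply in_cup in Hy as [Hy|Hy]; [auto|]. apply in_sing in Hy. now subst.
          + intros y c Hy Ny Hc'. unfold t' in Ny, Hc'. rewrite in_cup, in_sing in Ny, Hc'.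
            destruct Hc' as [Hc'|Hc']; [apply I2; tauto|]. subst c.
            assert (Hyg : ordinal y) by (apply (ord_elem g); auto; apply (st_sub x1 g); auto).
            assert (Hb'g : ordinal b') by (apply (ord_elem g); auto; apply (st_sub x1 g); auto).
            destruct (ord_trichotomy b' y) as [T|[T|T]]; auto; exfalso; [now subst; tauto|].
            apply (Mb' y); [|auto]. apply in_diff. tauto.
          + intros y Hy Ny. unfold t' in Ny. rewrite in_cup, in_sing in Ny. apply Ht'x; [apply I3; tauto|].
            intros c Hc'. unfold t' in Hc'. rewrite in_cup, in_sing in Hc'.
            destruct Hc' as [Hc'|Hc']; [apply I2; tauto|]. subst c.
            assert (Hyg : ordinal y) by (apply (ord_elem g); auto; apply (st_sub x1 g); auto).
            assert (Hb'g : ordinal b') by (apply (ord_elem g); auto; apply (st_sub x1 g); auto).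
            destruct (ord_trichotomy b' y) as [T|[T|T]]; auto; exfalso; [now subst; tauto|].
            apply (Mb' y); [|auto]. apply in_diff. tauto.
          + intros c Hc'. apply Ht'x; [auto|]. intros y Hy. apply (st_ms x1 g); auto.
            apply in_cup in Hy as [Hy|Hy]; [auto|]. apply in_sing in Hy. now subst.
        - rewrite W4 by auto. destruct (Lxa a Ha) as (_ & J3 & J4). destruct (E3 a Ha K) as [E3a E3b]. rewrite E3a in J3. rewrite E3b in J3, J4.
          assert (HAw : forall c, c ∈ A' a -> c ∈ ms w a).
          { intros c Hc'. apply HA in Hc' as (_ & K1 & _). now apply K1. }
          split; [split|split].
          + intros y Hy. now apply in_emp in Hy.
          + intros y c _ _ Hc'. now apply in_emp in Hc'.
          + auto.
          + intros c Hc'. auto. }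
      destruct (W5 x1 Hx1 Lw) as (y & Hy & Ly & Oy). exists y. split; [auto|]. split; [|auto].
      apply (le_trans y x1 x); auto.
    - apply Hpts; auto.
    - intros z Hz.
      assert (Hz' : exists a c, z = opair a c).
      { unfold pts in Hz. rewrite in_sep in Hz by dclass. destruct Hz as [Hz _]. apply in_prod in Hz as (a & c & _ & _ & ->). eauto. }
      destruct Hz' as (a & c & ->). apply Hpts in Hz as (Ha & Hka & Hc); [|auto].
      apply in_diff. rewrite in_sing. destruct (Tri a Ha) as [K|[->|K]].
      + destruct (E1 a Ha K) as [E _]. rewrite E in Hc. split; [now apply Hpts|]. intros E'. apply opair_inj in E' as [-> _]. now apply mem_irrefl in K.
      + destruct E2 as [E2 _]. rewrite E2 in Hc. split; [apply Hpts; auto|]. intros E'. apply opair_inj in E' as [_ ->].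
        apply in_diff in Hc as [_ Hc]. apply Hc. now apply in_sing.
      + destruct (E3 a Ha K) as [E _]. rewrite E in Hc. now apply in_emp in Hc. }
  assert (Fin : forall n, n ∈ omega -> forall q, q ∈ P -> le q p' -> dense_below O q -> card_le (pts q) n ->
    exists q', q' ∈ P /\ le q' p' /\ pure_above k q' /\ dense_below O q').
  { apply (nat_induction (fun n => forall q, q ∈ P -> le q p' -> dense_below O q -> card_le (pts q) n ->
      exists q', q' ∈ P /\ le q' p' /\ pure_above k q' /\ dense_below O q')).
    - apply dclass_intro. unfold dense_below, pure_above. dfn.
    - intros q Hq Lq Dq Cq. exists q. split; [auto|]. split; [auto|]. split; [|auto].
      intros a Ha Hk. apply card_le_emp in Cq. destruct (emp_or_inhabited (st q a)) as [E|[b Hb]]; [auto|exfalso].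
      apply (in_emp (opair a b)). rewrite <- Cq. now apply Hpts.
    - intros n Hn' IH q Hq Lq Dq Cq. destruct (classic (pure_above k q)) as [Pq|Nq]; [eauto 6|].
      destruct (Key q Hq Lq Dq Nq) as (q' & z & Hq' & Lq' & Dq' & Hz & Sz).
      apply (IH q'); auto. eapply card_le_trans; [apply card_le_sub; exact Sz|]. apply card_le_remove; auto. }
  assert (Fq : finite (pts q0)).
  { destruct (P_supp q0 Hq0) as (F & HF & KF).
    apply (finite_sub _ (un (img (cap F S) (fun a => prod (sing a) (st q0 a))))).
    - intros z Hz. unfold pts in Hz. rewrite in_sep in Hz by dclass. destruct Hz as (Hz & Hk & Hs).
      apply in_prod in Hz as (a & b & Ha & Hb & ->). rewrite fst_opair, snd_opair in *.
      apply in_un. exists (prod (sing a) (st q0 a)). rewrite in_img by dclass. split.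
      + exists a. split; [|auto]. apply in_cap. split; [|auto]. apply NNPP. intros NF. rewrite KF in Hs by auto. now apply in_emp in Hs.
      + apply opair_in_prod. split; [now apply in_sing|auto].
    - apply finite_Union; [dfn|eapply finite_sub; [|exact HF]; intros a Ha; now apply in_cap in Ha|].
      intros a Ha. apply in_cap in Ha as [_ Ha]. apply finite_le with (st q0 a); [|now apply st_fin].
      apply card_le_fun with (fun z => snd z); [dfn| |].
      + intros z Hz. apply in_prod in Hz as (x & y & _ & Hy & ->). now rewrite snd_opair.
      + intros z z' Hz Hz'. apply in_prod in Hz as (x & y & Hx & Hy & ->), Hz' as (x' & y' & Hx' & Hy' & ->).
        rewrite !snd_opair. apply in_sing in Hx, Hx'. congruence. }
  apply finite_iff in Fq as (n & Hn' & Cq).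
  destruct (Fin n Hn' q0 Hq0 Lq0) as (q' & Hq' & Lq' & Pq' & Dq').
  - intros r Hr Lr. exists r. split; [auto|]. split; [now apply le_refl|]. now apply (Oopen q0).
  - auto.
  - exists q'. split; [auto|]. split; [apply (le_trans q' p' p); auto|]. auto.
Qed.

End PrikryProperty.

(** * Splitting conditions at [k]; simultaneous decisions by pure upper parts *)

Section PureDecision.
Variable k : V.
Hypotheses (Ok : ordinal k) (NkS : k ∉ S).

(** As [k] is not in [S], the coordinates outside [k] are exactly those above it, see [S_up]. *)
Definition glue p u : V := lam S (fun a => if excluded_middle_informative (a ∈ k) then app p a else app u a).

Lemma glue_app p u a : a ∈ S -> app (glue p u) a = if excluded_middle_informative (a ∈ k) then app p a else app u a.
Proof. intros Ha. unfold glue. rewrite app_lam; [auto|dfn|auto]. Qed.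

Lemma glue_low p u a : a ∈ S -> a ∈ k -> st (glue p u) a = st p a /\ ms (glue p u) a = ms p a.
Proof.
  intros Ha Hk. Transparent st ms. unfold st, ms. rewrite glue_app by auto.
  destruct (excluded_middle_informative (a ∈ k)); tauto.
Qed.

Lemma glue_up p u a : a ∈ S -> a ∉ k -> st (glue p u) a = st u a /\ ms (glue p u) a = ms u a.
Proof.
  intros Ha Hk. unfold st, ms. rewrite glue_app by auto.
  destruct (excluded_middle_informative (a ∈ k)); tauto.
Qed.
Opaque st ms.

Lemma glue_P p u : p ∈ P -> u ∈ P -> glue p u ∈ P.
Proof.
  intros Hp Hu. apply in_P. split; [|split].
  - unfold glue. apply lam_function. dfn.
  - intros a Ha. rewrite glue_app by auto. destruct (excluded_middle_informative (a ∈ k)) as [K|K].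
    + destruct (glue_low p u a Ha K) as [-> ->]. auto using P_app, P_cond.
    + destruct (glue_up p u a Ha K) as [-> ->]. auto using P_app, P_cond.
  - destruct (P_supp p Hp) as (F & HF & KF), (P_supp u Hu) as (F' & HF' & KF'). exists (cup F F').
    split; [now apply finite_cup|]. intros a Ha Na. rewrite in_cup in Na.
    destruct (classic (a ∈ k)) as [K|K].
    + destruct (glue_low p u a Ha K) as [-> _]. apply KF; tauto.
    + destruct (glue_up p u a Ha K) as [-> _]. apply KF'; tauto.
Qed.

Lemma S_up a : a ∈ S -> a ∉ k <-> k ∈ a.
Proof.
  intros Ha. split.
  - intros H. destruct (ord_trichotomy a k) as [K|[K|K]]; auto using S_ord; [tauto|]. now subst.
  - intros H K. now apply (mem_asym a k).
Qed.

Definition le_low p q : Prop := forall a, a ∈ S -> a ∈ k -> prikry_le (st p a) (ms p a) (st q a) (ms q a).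
Definition le_up p q : Prop := forall a, a ∈ S -> k ∈ a -> prikry_le (st p a) (ms p a) (st q a) (ms q a).

Lemma le_split p q : p ∈ P -> q ∈ P -> le p q <-> le_low p q /\ le_up p q.
Proof.
  intros Hp Hq. rewrite le_iff by auto. split.
  - intros H. split; intros a Ha _; auto.
  - intros [H1 H2] a Ha. destruct (classic (a ∈ k)) as [K|K]; [auto|]. apply H2; auto. now apply S_up.
Qed.

Lemma glue_le_low p u q : le_low (glue p u) q <-> le_low p q.
Proof.
  split; intros H a Ha K; specialize (H a Ha K); destruct (glue_low p u a Ha K) as [E1 E2];
    rewrite ?E1, ?E2 in *; auto.
Qed.
Lemma glue_le_low_r p u q : le_low q (glue p u) <-> le_low q p.
Proof.
  split; intros H a Ha K; specialize (H a Ha K); destruct (glue_low p u a Ha K) as [E1 E2];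
    rewrite ?E1, ?E2 in *; auto.
Qed.
Lemma glue_le_up p u q : le_up (glue p u) q <-> le_up u q.
Proof.
  split; intros H a Ha K; specialize (H a Ha K); destruct (glue_up p u a Ha (proj2 (S_up a Ha) K)) as [E1 E2];
    rewrite ?E1, ?E2 in *; auto.
Qed.
Lemma glue_le_up_r p u q : le_up q (glue p u) <-> le_up q u.
Proof.
  split; intros H a Ha K; specialize (H a Ha K); destruct (glue_up p u a Ha (proj2 (S_up a Ha) K)) as [E1 E2];
    rewrite ?E1, ?E2 in *; auto.
Qed.

Lemma le_up_trans p q r : le_up p q -> le_up q r -> le_up p r.
Proof. intros H1 H2 a Ha K. eapply prikry_le_trans; eauto. Qed.
Lemma le_low_refl p : le_low p p. Proof. intros a Ha K. apply prikry_le_refl. Qed.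
Lemma le_up_refl p : le_up p p. Proof. intros a Ha K. apply prikry_le_refl. Qed.

Lemma glue_restr p q u : p ∈ P -> q ∈ P -> restr p k = restr q k -> glue p u = glue q u.
Proof.
  intros Hp Hq E. apply function_ext with S; try (unfold glue; apply lam_function; dfn).
  intros a Ha. rewrite !glue_app by auto. destruct (excluded_middle_informative (a ∈ k)); [|auto].
  apply app_val with S; [now apply P_fun|]. apply (restr_sub p k). rewrite E. apply in_restr. split; [|auto].
  apply app_mem with S; auto using P_fun.
Qed.

Lemma glue_self p : p ∈ P -> glue p p = p.
Proof.
  intros Hp. apply function_ext with S; [unfold glue; apply lam_function; dfn|now apply P_fun|].
  intros a Ha. rewrite glue_app by auto. destruct (excluded_middle_informative (a ∈ k)); auto.
Qed.

Lemma glue_pure p u : pure_above k u -> pure_above k (glue p u).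
Proof. intros H a Ha K. destruct (glue_up p u a Ha (proj2 (S_up a Ha) K)) as [-> _]. auto. Qed.

Lemma P_trivial : exists p, p ∈ P /\ forall a, a ∈ S -> st p a = emp /\ ms p a = a.
Proof.
  apply mk_cond; [dfn|dfn| |].
  - intros a Ha. split; [apply finite_emp|]. split; [intros x Hx; now apply in_emp in Hx|].
    split; [apply (meas_top _ a); now apply S_meas|]. intros b c Hb. now apply in_emp in Hb.
  - exists emp. split; [apply finite_emp|auto].
Qed.

(* Intersect the measure one sets. *)
Lemma pure_lower_bound B (w : V -> V) : Dt1 V (fun _ e => w (e 0)) ->
  (forall a, a ∈ S -> k ∈ a -> small a B) -> (forall z, z ∈ B -> w z ∈ P /\ pure_above k (w z)) ->
  exists u, u ∈ P /\ pure_above k u /\ forall z, z ∈ B -> le_up u (w z).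
Proof.
  intros Dw HB Hw. destruct P_trivial as (o & Ho & Eo).
  set (A := fun a => sep a (fun b => forall z, z ∈ B -> b ∈ ms (w z) a)).
  assert (DA : Dt1 V (fun _ e => A (e 0))) by (unfold A; dfn).
  destruct (mk_cond (fun a => emp) (fun a => if excluded_middle_informative (k ∈ a) then A a else a)) as (u & Hu & Eu).
  - dfn.
  - dfn.
  - intros a Ha. split; [apply finite_emp|]. split; [intros x Hx; now apply in_emp in Hx|]. split.
    + destruct (excluded_middle_informative (k ∈ a)); [|apply (meas_top _ a); now apply S_meas].
      apply meas_inter with (C := fun z => ms (w z) a); auto using S_card, S_omega, S_meas.
      * dfn.
      * intros z Hz. apply ms_in; auto. now apply Hw.
    + intros b c Hb. now apply in_emp in Hb.
  - exists emp. split; [apply finite_emp|auto].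
  - exists u. split; [auto|]. split; [intros a Ha _; now apply Eu|]. intros z Hz a Ha K.
    destruct (Eu a Ha) as [-> ->]. destruct (Hw z Hz) as [_ Pz]. rewrite (Pz a Ha K).
    destruct (excluded_middle_informative (k ∈ a)); [|tauto].
    split; [split; [apply subset_refl|intros b c Hb; now apply in_emp in Hb]|].
    split; [intros b Hb; now apply in_emp in Hb|]. intros b Hb. unfold A in Hb. rewrite in_sep in Hb by dclass.
    destruct Hb as [_ Hb]. auto.
Qed.

(** [Y] codes a family of open sets indexed by [I]. For every lower part and every index a pure
    upper part that decides is chosen, if there is one, and [u] is a lower bound of the chosen ones.
    That enough lower parts have one is the Prikry property: whatever [q] it yields below [x], the
    pair of its lower part and [i] was among those considered. *)
Theorem pure_decision Y I : (forall q r i, q ∈ P -> r ∈ P -> le r q -> opair q i ∈ Y -> opair r i ∈ Y) ->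
  (forall a, a ∈ S -> k ∈ a -> small a (prod (img P (fun q => restr q k)) I)) ->
  exists u, u ∈ P /\ pure_above k u /\ forall i x, i ∈ I -> x ∈ P -> exists q, q ∈ P /\ le_low q x /\
    (dense_below (fun r => opair r i ∈ Y) (glue q u) \/ forall r, r ∈ P -> le r (glue q u) -> opair r i ∉ Y).
Proof.
  intros HY HI.
  set (Dec := fun i q => dense_below (fun r => opair r i ∈ Y) q \/ forall r, r ∈ P -> le r q -> opair r i ∉ Y).
  assert (DD : Dfn1 V (fun _ e => Dec (e 0) (e 1))) by (unfold Dec, dense_below; dfn).
  assert (Dec_le : forall i q r, r ∈ P -> q ∈ P -> le r q -> Dec i q -> Dec i r).
  { intros i q r Hr Hq L [H|H]; [left|right].
    - intros x Hx Lx. apply H; auto. apply (le_trans x r q); auto.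
    - intros x Hx Lx. apply H; auto. apply (le_trans x r q); auto. }
  set (phi := fun z v => pure_above k v /\ exists q, q ∈ P /\ restr q k = fst z /\ Dec (snd z) (glue q v)).
  assert (Dphi : Dfn1 V (fun _ e => phi (e 0) (e 1))) by (unfold phi, pure_above, glue; dfn).
  set (B0 := prod (img P (fun q => restr q k)) I).
  set (B := sep B0 (fun z => exists v, v ∈ P /\ phi z v)).
  destruct (choice_fun B P phi Dphi) as (f & Hf & Kf).
  { intros z Hz. unfold B in Hz. rewrite in_sep in Hz by dclass. tauto. }
  destruct (pure_lower_bound B (fun z => app f z)) as (u & Hu & Pu & Lu).
  { dfn. }
  { intros a Ha K. eapply small_le; [|apply (HI a Ha K)]. apply card_le_sub. intros z Hz. unfold B in Hz. rewrite in_sep in Hz by dclass. tauto. }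
  { intros z Hz. destruct (Kf z Hz) as [K1 [K2 _]]. auto. }
  exists u. split; [auto|]. split; [auto|]. intros i x Hi Hx. destruct P_trivial as (o & Ho & Eo).
  assert (Po : pure_above k o) by (intros a Ha _; now apply Eo).
  destruct (prikry_property (fun r => opair r i ∈ Y) k (glue x o)) as (q & Hq & Lq & Pq & Dq).
  { dfn. } { intros r r' Hr Hr' L. apply HY; auto. } { now apply glue_P. } { now apply glue_pure. }
  exists q. split; [auto|]. split.
  { apply (glue_le_low_r x o). apply le_split in Lq; auto using glue_P. tauto. }
  assert (Hz : opair (restr q k) i ∈ B).
  { unfold B. rewrite in_sep by dclass. split.
    - apply opair_in_prod. split; [|auto]. rewrite in_img by dclass. eauto.
    - exists q. split; [auto|]. split; [auto|]. exists q. rewrite fst_opair, snd_opair. rewrite glue_self by auto. auto. }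
  destruct (Kf _ Hz) as [K1 [K2 (q' & Hq' & E' & D')]]. rewrite fst_opair in E'. rewrite snd_opair in D'.
  rewrite (glue_restr q' q _ Hq' Hq E') in D'. apply (Dec_le i _ (glue q u)) in D'; auto using glue_P.
  apply le_split; auto using glue_P. rewrite glue_le_low, glue_le_low_r, glue_le_up, glue_le_up_r.
  split; [apply le_low_refl|]. now apply (Lu (opair (restr q k) i)).
Qed.

End PureDecision.

End Product.
Global Opaque st ms.

(** * Elementary transfer *)

Fixpoint vbound (phi : formula) : nat :=
  match phi with
  | FMem m n | FEq m n => S (max m n)
  | FFalse => 0
  | FImp p q => max (vbound p) (vbound q)
  | FAll p => vbound p
  end.

Lemma sat_agree (V : structure) phi : forall e e' : nat -> V,
  (forall n, n < vbound phi -> e n = e' n) -> sat V e phi <-> sat V e' phi.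
Proof.
  induction phi; intros e e' H; simpl in *.
  - rewrite !H by lia. tauto.
  - rewrite !H by lia. tauto.
  - tauto.
  - rewrite (IHphi1 e e'), (IHphi2 e e'); [tauto| |]; intros; apply H; lia.
  - split; intros K x; specialize (K x); revert K; apply IHphi; intros [|n] Hn; simpl; auto;
      first [apply H; lia | symmetry; apply H; lia].
Qed.

Fixpoint fall (n : nat) (phi : formula) : formula :=
  match n with O => phi | S m => FAll (fall m phi) end.

Lemma sat_fall (V : structure) n : forall phi (e : nat -> V),
  sat V e (fall n phi) <-> forall e', (forall k, e' (n + k) = e k) -> sat V e' phi.
Proof.
  induction n as [|n IH]; intros phi e; simpl.
  - split.
    + intros H e' E. replace e' with e; [auto|]. apply functional_extensionality. auto.
    + intros H. apply H. auto.
  - split.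
    + intros H e' E. specialize (H (e' n)). rewrite IH in H. apply H. intros [|k]; simpl.
      * f_equal. lia.
      * rewrite <- E. f_equal. lia.
    + intros H x. apply IH. intros e' E. apply H. intros k. specialize (E (S k)). simpl in E.
      rewrite <- E. f_equal. lia.
Qed.

(** Environments of [B] need not come from [A], so the universal closure over the occurring
    variables is transferred. *)
Lemma elementary_valid (A B : structure) (j : A -> B) psi : elementary_embedding A B j ->
  inhabited A -> (forall e, sat A e psi) -> forall e, sat B e psi.
Proof.
  intros Hj [a] H e. set (N := vbound psi).
  assert (K : sat A (fun _ => a) (fall N psi)). { apply sat_fall. auto. }
  apply (Hj _ (fun _ => a)) in K. rewrite sat_fall in K.
  (* Beyond the bound the environment has to be that of the closed formula, which is constantly
     [j a]. *)
  specialize (K (fun n => if n <? N then e n else j a)).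
  rewrite (sat_agree B psi _ e) in K.
  - apply K. intros k. destruct (Nat.ltb_spec (N + k) N); [lia|auto].
  - intros n Hn. unfold N. destruct (Nat.ltb_spec n (vbound psi)); [auto|lia].
Qed.

Definition two (A B : structure) (b : bool) : structure := if b then A else B.

Lemma Dfn_closed {I} {Vs : I -> structure} P : @Dfn I Vs (fun _ => False) P ->
  exists phi, forall i e, P i e <-> sat (Vs i) e phi.
Proof.
  induction 1 as [m n|m n|c m Hc| |P Q _ IHP _ IHQ|P _ IHP|P r _ IHP|P Q E _ IHP].
  - exists (FMem m n). simpl; tauto.
  - exists (FEq m n). simpl; tauto.
  - destruct Hc.
  - exists FFalse. simpl; tauto.
  - destruct IHP as [p Hp], IHQ as [q Hq]. exists (FImp p q). intros. simpl. now rewrite Hp, Hq.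
  - destruct IHP as [p Hp]. exists (FAll p). intros. simpl. split; intros H x; apply Hp; auto.
  - destruct IHP as [p Hp]. exists (ren r p). intros. now rewrite sat_ren, <- Hp.
  - destruct IHP as [p Hp]. exists p. intros. now rewrite <- E, Hp.
Qed.

(** Two structures and no parameters: a single formula works in both, which is what elementarity
    compares. *)
Notation Dfn2 A B := (@Dfn bool (two A B) (fun _ => False)).

Section Transfer.
Context {A B : structure} (j : A -> B) (Hj : elementary_embedding A B j).

Lemma transfer (P : forall b, (nat -> two A B b) -> Prop) : Dfn2 A B P ->
  forall e : nat -> A, P true e <-> P false (fun n => j (e n)).
Proof.
  intros HP e. apply Dfn_closed in HP as [phi Hphi].
  rewrite (Hphi true e), (Hphi false). apply Hj.
Qed.

Lemma transfer_valid (P : forall b, (nat -> two A B b) -> Prop) : Dfn2 A B P -> inhabited A ->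
  (forall e, P true e) -> forall e, P false e.
Proof.
  intros HP Hi H e. apply Dfn_closed in HP as [phi Hphi]. apply (Hphi false).
  apply (elementary_valid A B j phi Hj Hi). intros e'. apply (Hphi true). auto.
Qed.

Lemma elementary_mem x y : j x ∈ j y <-> x ∈ y.
Proof. symmetry. exact (Hj (FMem 0 1) (scons x (fun _ => y))). Qed.

(** In the two schemas the class has parameters from [B]; each instance is transferred with its
    parameters universally quantified. *)
Lemma elementary_ZFC : ZFC A -> ZFC B.
Proof.
  intros ZA. pose proof (ZFC_inhabited A ZA) as Hi. constructor.
  - apply (transfer_valid (fun b _ => forall x y : two A B b, (forall z, z ∈ x <-> z ∈ y) -> x = y)).
    + dfn. + exact Hi. + intros _. exact (zfc_extensionality A ZA). + exact (fun n => j (epsilon Hi (fun _ => True))).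
  - apply (transfer_valid (fun b _ => forall x : two A B b, (exists y, y ∈ x) ->
      exists y, y ∈ x /\ forall z, z ∈ y -> z ∉ x)).
    + dfn. + exact Hi. + intros _. exact (zfc_foundation A ZA). + exact (fun n => j (epsilon Hi (fun _ => True))).
  - apply (transfer_valid (fun b _ => forall x y : two A B b, exists z, is_upair x y z)).
    + unfold is_upair. dfn. + exact Hi. + intros _. exact (zfc_pairing A ZA). + exact (fun n => j (epsilon Hi (fun _ => True))).
  - apply (transfer_valid (fun b _ => forall x : two A B b, exists z, is_union x z)).
    + unfold is_union. dfn. + exact Hi. + intros _. exact (zfc_union A ZA). + exact (fun n => j (epsilon Hi (fun _ => True))).
  - apply (transfer_valid (fun b _ => forall x : two A B b, exists z, is_powerset x z)).
    + unfold is_powerset, subset. dfn. + exact Hi. + intros _. exact (zfc_powerset A ZA). + exact (fun n => j (epsilon Hi (fun _ => True))).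
  - apply (transfer_valid (fun b _ => exists x : two A B b, inductive x)).
    + dfn. + exact Hi. + intros _. exact (zfc_infinity A ZA). + exact (fun n => j (epsilon Hi (fun _ => True))).
  - intros C (phi & e & E) a.
    pose proof (transfer_valid (fun b e => forall a : two A B b, exists c, forall x, x ∈ c <-> x ∈ a /\ sat (two A B b) (scons x e) phi)) as T.
    destruct T with (e := e) (a := a) as [c Hc].
    + dfn. eapply D_ext; [|apply (Dfn_sat phi (fun n b e => match n with 0 => e 0 | S m => e (S (S (S m))) end))].
      * intros b e'. apply sat_ext. intros [|n]; reflexivity.
      * intros [|n]; dfn.
    + exact Hi.
    + intros e' a'. apply (zfc_separation A ZA). exists phi, e'. tauto.
    + exists c. intros x. now rewrite E.
  - intros R (phi & e & E) a Hf.
    pose proof (transfer_valid (fun b e => forall a : two A B b,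
      (forall x y y', x ∈ a -> sat (two A B b) (scons x (scons y e)) phi -> sat (two A B b) (scons x (scons y' e)) phi -> y = y') ->
      exists c, forall y, y ∈ c <-> exists x, x ∈ a /\ sat (two A B b) (scons x (scons y e)) phi)) as T.
    destruct T with (e := e) (a := a) as [c Hc].
    + dfn.
      * eapply D_ext; [|apply (Dfn_sat phi (fun n b e => match n with 0 => e 2 | 1 => e 1 | S (S m) => e (4 + m) end))].
        -- intros b e'. apply sat_ext. intros [|[|n]]; reflexivity.
        -- intros [|[|n]]; dfn.
      * eapply D_ext; [|apply (Dfn_sat phi (fun n b e => match n with 0 => e 2 | 1 => e 0 | S (S m) => e (4 + m) end))].
        -- intros b e'. apply sat_ext. intros [|[|n]]; reflexivity.
        -- intros [|[|n]]; dfn.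
      * eapply D_ext; [|apply (Dfn_sat phi (fun n b e => match n with 0 => e 0 | 1 => e 1 | S (S m) => e (4 + m) end))].
        -- intros b e'. apply sat_ext. intros [|[|n]]; reflexivity.
        -- intros [|[|n]]; dfn.
    + exact Hi.
    + intros e' a' Hf'. apply (zfc_replacement A ZA); [|auto]. exists phi, e'. tauto.
    + intros x y y' Hx H1 H2. apply E in H1, H2. eauto.
    + exists c. intros y. rewrite Hc. split; intros (x & Hx & K); exists x; (split; [auto|]); now apply E.
  - apply (transfer_valid (fun b _ => forall x : two A B b,
      (forall y, y ∈ x -> exists z, z ∈ y) ->
      (forall y y' z, y ∈ x -> y' ∈ x -> z ∈ y -> z ∈ y' -> y = y') ->
      exists c, forall y, y ∈ x -> exists! z, z ∈ y /\ z ∈ c)).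
    + dfn. + exact Hi. + intros _. exact (zfc_choice A ZA). + exact (fun n => j (epsilon Hi (fun _ => True))).
Qed.

End Transfer.

(** Transparent, so that the instance at each truth value reduces to the given proof and terms over
    [two A B b] match those over the single structures. *)
Lemma two_ZFC A B : ZFC A -> ZFC B -> forall b, ZFC (two A B b).
Proof. intros ZA ZB [|]; assumption. Defined.

(** * End embeddings *)

(** Covers the three passages between models: [M] into [V], [V] into [W], and the collapsed
    ultrapower into [W]. The lemmas that follow are instances of the absoluteness of bounded
    notions. *)
Record end_embedding (A B : structure) (h : A -> B) : Prop := {
  ee_inj : forall x y, h x = h y -> x = y;
  ee_mem : forall x y, h x ∈ h y <-> x ∈ y;
  ee_trans : forall x w, w ∈ h x -> exists y, w = h y
}.

Lemma substructure_end (V : structure) (M : V -> Prop) : (forall x y, M x -> y ∈ x -> M y) ->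
  end_embedding (substructure V M) V (@proj1_sig V M).
Proof.
  intros HM. split.
  - intros [x Hx] [y Hy] E. simpl in E. subst. f_equal. apply proof_irrelevance.
  - intros x y. reflexivity.
  - intros [x Hx] w Hw. exists (exist _ w (HM x w Hx Hw)). reflexivity.
Qed.

Section EndEmbedding.
Context {A B : structure} {ZA : ZFC A} {ZB : ZFC B} (h : A -> B) (Hh : end_embedding A B h).

Local Notation inj := (ee_inj A B h Hh).
Local Notation hm := (ee_mem A B h Hh).
Local Notation ht := (ee_trans A B h Hh).

Lemma h_trans x w : w ∈ h x -> exists y, w = h y.
Proof. apply ht. Qed.

Lemma h_mem_iff w x : w ∈ h x <-> exists y, w = h y /\ y ∈ x.
Proof.
  split.
  - intros H. destruct (ht _ _ H) as [y ->]. exists y. split; [auto|]. now apply hm.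
  - intros (y & -> & H). now apply hm.
Qed.

Lemma h_ext x b : (forall y, y ∈ x <-> h y ∈ b) -> (forall w, w ∈ b -> exists y, w = h y) -> h x = b.
Proof.
  intros H1 H2. apply ext_eq. intros w. rewrite h_mem_iff. split.
  - intros (y & -> & Hy). now apply H1.
  - intros Hw. destruct (H2 w Hw) as [y ->]. exists y. split; [auto|]. now apply H1.
Qed.

Lemma h_subset x y : subset (h x) (h y) <-> subset x y.
Proof.
  split.
  - intros H z Hz. apply hm, H, hm, Hz.
  - intros H w Hw. apply h_mem_iff in Hw as (z & -> & Hz). apply hm. auto.
Qed.

Lemma h_emp : h emp = emp.
Proof.
  apply h_ext.
  - intros y. split; intros H; now apply in_emp in H.
  - intros w H; now apply in_emp in H.
Qed.

Lemma h_upair x y : h (upair x y) = upair (h x) (h y).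
Proof.
  apply h_ext.
  - intros z. rewrite !in_upair. split; [intros [-> | ->]; auto|]. intros [E|E]; apply inj in E; auto.
  - intros w. rewrite in_upair. intros [-> | ->]; eauto.
Qed.

Lemma sing_upair {V : structure} {Z : ZFC V} (x : V) : sing x = upair x x.
Proof. apply ext_eq. intros z. rewrite in_sing, in_upair. tauto. Qed.

Lemma opair_upair {V : structure} {Z : ZFC V} (x y : V) : opair x y = upair (sing x) (upair x y).
Proof. symmetry. apply is_opair_iff. exists (sing x), (upair x y).
  split; [intros z; apply in_sing|split; intros z; apply in_upair]. Qed.

Lemma h_opair x y : h (opair x y) = opair (h x) (h y).
Proof. rewrite !opair_upair, !sing_upair. now rewrite !h_upair. Qed.

Lemma h_opair_inv u v z : opair u v = h z -> exists x y, u = h x /\ v = h y /\ z = opair x y.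
Proof.
  intros E. assert (H1 : upair u v ∈ h z) by (rewrite <- E; apply upair_in_opair).
  destruct (ht _ _ H1) as [s Es].
  assert (Hu : u ∈ h s) by (rewrite <- Es; apply in_upair; auto).
  assert (Hv : v ∈ h s) by (rewrite <- Es; apply in_upair; auto).
  destruct (ht _ _ Hu) as [x ->], (ht _ _ Hv) as [y ->]. exists x, y. split; [auto|]. split; [auto|].
  apply inj. now rewrite h_opair.
Qed.

Lemma h_opair_mem x y f : opair (h x) (h y) ∈ h f <-> opair x y ∈ f.
Proof. rewrite <- h_opair. apply hm. Qed.

Lemma h_pair_inv u v f : opair u v ∈ h f -> exists x y, u = h x /\ v = h y /\ opair x y ∈ f.
Proof.
  intros H. destruct (ht _ _ H) as [z Ez]. destruct (h_opair_inv _ _ _ Ez) as (x & y & -> & -> & ->).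
  exists x, y. split; [auto|]. split; [auto|]. now apply h_opair_mem.
Qed.

Lemma h_sing x : h (sing x) = sing (h x).
Proof. rewrite !sing_upair. apply h_upair. Qed.

Lemma h_succ x : h (succ x) = succ (h x).
Proof.
  apply h_ext.
  - intros z. rewrite !in_succ, !hm. split; (intros [H|H]; [auto|right]); [congruence|now apply inj].
  - intros w. rewrite in_succ. intros [H| ->]; eauto using h_trans.
Qed.

Lemma h_function_on f a : function_on (h f) (h a) <-> function_on f a.
Proof.
  split; intros Hf.
  - apply function_on_intro.
    + intros z Hz. apply hm in Hz. destruct (function_on_elem _ _ _ Hf Hz) as (u & v & Hu & E).
      symmetry in E. destruct (h_opair_inv _ _ _ E) as (x & y & -> & -> & ->). exists x, y. split; [now apply hm|auto].
    + intros x Hx. apply hm in Hx. pose proof (app_mem _ _ _ Hf Hx) as K.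
      apply h_pair_inv in K as (x' & y & E & _ & K). apply inj in E. subst. eauto.
    + intros x y y' H1 H2. apply h_opair_mem in H1, H2. apply inj. eapply function_on_uniq; eauto.
  - apply function_on_intro.
    + intros z Hz. apply h_mem_iff in Hz as (w & -> & Hw). destruct (function_on_elem _ _ _ Hf Hw) as (x & y & Hx & ->).
      exists (h x), (h y). rewrite h_opair. split; [now apply hm|auto].
    + intros w Hw. apply h_mem_iff in Hw as (x & -> & Hx). exists (h (app f x)). apply h_opair_mem. eapply app_mem; eauto.
    + intros u v v' H1 H2. apply h_pair_inv in H1 as (x & y & -> & -> & H1), H2 as (x' & y' & E & -> & H2).
      apply inj in E. subst. f_equal. eapply function_on_uniq; eauto.
Qed.

Lemma h_app f a x : function_on f a -> x ∈ a -> app (h f) (h x) = h (app f x).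
Proof.
  intros Hf Hx. apply app_val with (h a); [now apply h_function_on|]. apply h_opair_mem. eapply app_mem; eauto.
Qed.

Lemma h_prod x y : h (prod x y) = prod (h x) (h y).
Proof.
  apply h_ext.
  - intros z. rewrite !in_prod. split.
    + intros (u & v & Hu & Hv & ->). exists (h u), (h v). rewrite !hm, h_opair. auto.
    + intros (u & v & Hu & Hv & E). symmetry in E. destruct (h_opair_inv _ _ _ E) as (x' & y' & -> & -> & ->).
      apply hm in Hu, Hv. eauto 6.
  - intros w Hw. apply in_prod in Hw as (u & v & Hu & Hv & ->).
    apply h_mem_iff in Hu as (x' & -> & _), Hv as (y' & -> & _). exists (opair x' y'). now rewrite h_opair.
Qed.

Lemma h_transitive x : transitive (h x) <-> transitive x.
Proof.
  split; intros H.
  - intros y Hy. apply h_subset. apply H. now apply hm.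
  - intros w Hw. apply h_mem_iff in Hw as (y & -> & Hy). apply h_subset. auto.
Qed.

Lemma h_ordinal x : ordinal (h x) <-> ordinal x.
Proof.
  unfold ordinal. rewrite h_transitive. split; intros [H1 H2]; (split; [auto|]).
  - intros y Hy. apply h_transitive, H2. now apply hm.
  - intros w Hw. apply h_mem_iff in Hw as (y & -> & Hy). apply h_transitive. auto.
Qed.

Lemma nat_cases {V : structure} {Z : ZFC V} (n : V) : n ∈ omega -> n = emp \/ exists m, m ∈ omega /\ n = succ m.
Proof.
  revert n. apply nat_induction; [dclass| |]; [auto|]. intros n Hn _. right. eauto.
Qed.

(** Foundation of [B] applies to [h omega], so a least element outside [omega] would exist; it is
    the image of zero or of a successor, and neither is possible. *)
Lemma h_omega : h omega = omega.
Proof.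
  apply subset_antisym.
  - intros w Hw. apply NNPP. intros N.
    destruct (foundation (diff (h omega) omega)) as (m & Hm & Hmin).
    { exists w. now apply in_diff. }
    apply in_diff in Hm as [Hm Nm]. apply h_mem_iff in Hm as (n & -> & Hn). apply Nm.
    destruct (nat_cases n Hn) as [->|(m & Hm & ->)].
    + rewrite h_emp. apply nat_0.
    + rewrite h_succ. apply nat_succ. apply NNPP. intros N'. apply (Hmin (h m)).
      * apply in_diff. split; [now apply hm|auto].
      * apply hm. apply in_succ; auto.
  - apply nat_ind_set.
    + rewrite <- h_emp. apply hm, nat_0.
    + intros n _ Hn. apply h_mem_iff in Hn as (m & -> & Hm). rewrite <- h_succ. now apply hm, nat_succ.
Qed.

Lemma h_injection f a b : injection (h f) (h a) (h b) <-> injection f a b.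
Proof.
  rewrite !injection_iff, h_function_on. split; intros (H1 & H2 & H3); (split; [auto|]).
  - split.
    + intros x Hx. apply hm. rewrite <- (h_app f a) by auto. apply H2. now apply hm.
    + intros x x' Hx Hx' E. apply inj. apply H3; try (now apply hm). rewrite !(h_app f a) by auto. now rewrite E.
  - split.
    + intros w Hw. apply h_mem_iff in Hw as (x & -> & Hx). rewrite (h_app f a) by auto. apply hm. auto.
    + intros w w' Hw Hw'. apply h_mem_iff in Hw as (x & -> & Hx), Hw' as (x' & -> & Hx').
      rewrite !(h_app f a) by auto. intros E. apply inj in E. f_equal. auto.
Qed.

Lemma h_card_le a b : card_le a b -> card_le (h a) (h b).
Proof. intros [f Hf]. exists (h f). now apply h_injection. Qed.

Lemma h_finite a : finite a -> finite (h a).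
Proof.
  rewrite !finite_iff. intros (n & Hn & H). exists (h n). split; [rewrite <- h_omega; now apply hm|now apply h_card_le].
Qed.

Lemma h_coord p a s X : coord (h p) (h a) (h s) (h X) <-> coord p a s X.
Proof.
  unfold coord. setoid_rewrite is_opair_iff. setoid_rewrite pair_mem_iff. split.
  - intros (c & -> & H). exists (opair s X). rewrite <- h_opair in H. split; [auto|]. now apply h_opair_mem.
  - intros (c & -> & H). exists (opair (h s) (h X)). split; [auto|]. rewrite <- h_opair. now apply h_opair_mem.
Qed.

Lemma h_coord_inv p a s X : coord (h p) a s X -> exists a' s' X', a = h a' /\ s = h s' /\ X = h X' /\ coord p a' s' X'.
Proof.
  intros (c & Hc & H). apply is_opair_iff in Hc. subst c. apply pair_mem_iff in H.
  destruct (h_pair_inv _ _ _ H) as (a' & y & -> & E & K). destruct (h_opair_inv _ _ _ E) as (s' & X' & -> & -> & ->).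
  exists a', s', X'. repeat (split; [auto|]).
  exists (opair s' X'). split; [now apply is_opair_iff|now apply pair_mem_iff].
Qed.

Lemma h_prikry_le s X t Y : prikry_le (h s) (h X) (h t) (h Y) <-> prikry_le s X t Y.
Proof.
  unfold prikry_le, end_extends. rewrite !h_subset. split.
  - intros ((H1 & H2) & H3 & H4). split; [split; [auto|]|split; [|auto]].
    + intros b c Hb Nb Hc. apply hm, H2; rewrite ?hm; auto.
    + intros b Hb Nb. apply hm, H3; rewrite ?hm; auto.
  - intros ((H1 & H2) & H3 & H4). split; [split; [auto|]|split; [|auto]].
    + intros b c Hb Nb Hc. apply h_mem_iff in Hb as (b' & -> & Hb), Hc as (c' & -> & Hc). rewrite hm in *. auto.
    + intros b Hb Nb. apply h_mem_iff in Hb as (b' & -> & Hb). rewrite hm in *. auto.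
Qed.

Lemma h_product_le S p q : prikry_product_le (h S) (h p) (h q) <-> prikry_product_le S p q.
Proof.
  unfold prikry_product_le. split.
  - intros H a s X t Y Ha C1 C2. apply h_prikry_le. apply (H (h a)); [now apply hm| |]; now apply h_coord.
  - intros H a s X t Y Ha C1 C2.
    apply h_coord_inv in C1 as (a' & s' & X' & -> & -> & -> & C1).
    apply h_coord_inv in C2 as (a'' & t' & Y' & E & -> & -> & C2). apply inj in E. subst a''.
    apply h_prikry_le. apply (H a'); auto. now apply hm.
Qed.

Lemma h_restr f a : h (restr f a) = restr (h f) (h a).
Proof.
  apply h_ext.
  - intros z. rewrite !in_restr_iff, hm. split; intros [Hz H]; (split; [auto|]).
    + destruct H as (x & y & Hx & ->). exists (h x), (h y). rewrite h_opair. split; [now apply hm|auto].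
    + destruct H as (u & v & Hu & E). symmetry in E.
      destruct (h_opair_inv _ _ _ E) as (x & y & -> & -> & ->). apply hm in Hu. eauto.
  - intros w Hw. apply restr_sub in Hw. eauto using h_trans.
Qed.

End EndEmbedding.

(** * The ground model embedding *)

Record setup := {
  gV :> structure;
  gZ : ZFC gV;
  gGCH : GCH gV;
  kap : gV;
  gM : gV -> Prop;
  gj : gV -> substructure gV gM;
  kap_card : cardinal kap;
  gM_def : definable_class gM;
  gj_def : definable_relation (fun x y => proj1_sig (gj x) = y);
  gM_trans : forall x y, gM x -> y ∈ x -> gM y;
  gj_elem : elementary_embedding gV (substructure gV gM) gj;
  kap_crit : critical_point gV (fun x => proj1_sig (gj x)) kap;
  gM_H : forall l x, is_plus3 kap l -> in_H l x -> gM x;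
  gS : gV;
  gS_meas : forall a, a ∈ gS -> measurable a /\ a ∈ kap;
  gS_disc : discrete gS;
  gU : gV;
  gU_fun : function_on gU gS;
  gU_norm : forall a u, pair_mem a u gU -> normal_measure u a;
  gP : gV;
  gP_prod : is_prikry_product gS gU gP
}.
#[export] Existing Instance gZ.

Section Embedding.
Context (X : setup).
Local Notation V := (gV X).
Local Notation M := (substructure (gV X) (gM X)).
Local Notation j := (gj X).
Local Notation k := (kap X).
Definition hM : M -> V := @proj1_sig _ (gM X).
Definition jj (x : V) : V := hM (j x).

#[export] Instance ZM : ZFC M := elementary_ZFC j (gj_elem X) (gZ X).

Lemma hM_end : end_embedding M V hM. Proof. apply substructure_end, gM_trans. Qed.

Lemma hM_up (x y : M) : x ∈ y -> hM x ∈ hM y. Proof. intros H. exact H. Qed.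
Lemma hM_down (x y : M) : hM x ∈ hM y -> x ∈ y. Proof. intros H. exact H. Qed.

#[local] Instance Z2 : forall b, ZFC (two V M b) | 100 := two_ZFC V M (gZ X) ZM.

Local Notation tr := (transfer j (gj_elem X)).

Lemma jj_mem x y : jj x ∈ jj y <-> x ∈ y.
Proof. exact (elementary_mem j (gj_elem X) x y). Qed.
Lemma Dt_jj0 : Dt1 V (fun _ e => jj (e 0)).
Proof.
  pose proof (relation_Dfn _ (gj_def X)) as H.
  unfold Dt. apply D_ext with (fun _ e => jj (e 1) = e 0).
  - intros; split; auto.
  - exact (D_ren _ (fun n => match n with 0 => 1 | 1 => 0 | _ => n end) H).
Qed.

Lemma gM_Dfn : Dfn1 V (fun _ e => gM X (e 0)).
Proof. apply class_Dfn, gM_def. Qed.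

Lemma M_of (x : M) : gM X (hM x). Proof. exact (proj2_sig x). Qed.

(** Off [M] the value is a dummy, which makes elements of [M] accessible through a total definable
    term of [V]. *)
Definition toM (x : V) : M :=
  match excluded_middle_informative (gM X x) with left H => exist _ x H | right _ => j emp end.

Lemma hM_toM x : gM X x -> hM (toM x) = x.
Proof. intros H. unfold toM. destruct (excluded_middle_informative (gM X x)); [reflexivity|tauto]. Qed.

Lemma toM_hM x : toM (hM x) = x.
Proof. apply (ee_inj _ _ _ hM_end). apply hM_toM, M_of. Qed.

Lemma toM_jj x : toM (jj x) = j x. Proof. exact (toM_hM (j x)). Qed.

Lemma Dt_hM_toM t : Dt1 V t -> Dt1 V (fun i e => hM (toM (t i e))).
Proof.
  intros Ht. apply (Dt_sub1 (fun _ x => hM (toM x)) t); [|exact Ht]. pose proof gM_Dfn. pose proof Dt_jj0.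
  apply Dt_spec with (fun _ x e => (gM X (e 0) /\ x = e 0) \/ (~ gM X (e 0) /\ x = jj emp)).
  - intros i e x. unfold toM. destruct (excluded_middle_informative (gM X (e 0))); simpl; tauto.
  - dfn.
Qed.

Lemma relativize_sat phi : Dfn1 V (fun i e => sat M (fun n => toM (e n)) phi).
Proof.
  induction phi; cbn [sat].
  - apply D_ext with (fun _ e => hM (toM (e m)) ∈ hM (toM (e n))).
    + intros; reflexivity.
    + apply D_mem; apply Dt_hM_toM; dfn.
  - apply D_ext with (fun _ e => hM (toM (e m)) = hM (toM (e n))).
    + intros i e. split; [apply (ee_inj _ _ _ hM_end)|congruence].
    + apply D_eq; apply Dt_hM_toM; dfn.
  - apply D_False.
  - apply D_imp; auto.
  - apply D_ext with (fun _ e => forall x, gM X x -> sat M (fun n => toM (scons x e n)) phi).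
    + intros i e. split.
      * intros H x. specialize (H (hM x) (M_of x)). revert H. apply sat_ext.
        intros [|n]; simpl; [symmetry; apply toM_hM|reflexivity].
      * intros H x Hx. specialize (H (toM x)). revert H. apply sat_ext. intros [|n]; reflexivity.
    + apply D_all. apply D_imp; [exact gM_Dfn|].
      eapply D_ext; [|exact IHphi]. intros i e. apply sat_ext. intros [|n]; reflexivity.
Qed.

(** What [M] satisfies is definable in [V] because [M] is a definable class. Decisions are made in
    [M], but dense sets and names built from them must be sets of [V]. *)
Lemma relativize (P : forall b, (nat -> two V M b) -> Prop) : Dfn2 V M P ->
  Dfn1 V (fun _ e => P false (fun n => toM (e n))).
Proof.
  intros H. apply Dfn_closed in H as [phi Hphi].
  apply D_ext with (fun _ e => sat M (fun n => toM (e n)) phi).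
  - intros i e. symmetry. apply (Hphi false).
  - apply relativize_sat.
Qed.

Lemma j_omega : j omega = omega.
Proof.
  apply (proj1 (tr (fun b e => e 0 = @omega _ (Z2 b)) ltac:(dfn) (fun _ => omega))). reflexivity.
Qed.

Lemma jj_nat n : n ∈ omega -> jj n = n.
Proof.
  pose proof Dt_jj0. revert n. apply nat_induction; [dclass| |].
  - transitivity (hM emp); [|apply (h_emp hM hM_end)]. unfold jj. f_equal.
    apply (proj1 (tr (fun b e => e 0 = @emp _ (Z2 b)) ltac:(dfn) (fun _ => emp))). reflexivity.
  - intros n Hn IH. transitivity (hM (succ (j n))).
    + unfold jj. f_equal. apply (proj1 (tr (fun b e => e 0 = @succ _ (Z2 b) (e 1)) ltac:(dfn) (scons (succ n) (fun _ => n)))). reflexivity.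
    + rewrite (h_succ hM hM_end). f_equal. exact IH.
Qed.

Lemma k_ord : ordinal k. Proof. apply kap_crit. Qed.
Lemma k_fix a : a ∈ k -> jj a = a. Proof. apply kap_crit. Qed.
Lemma k_moved : jj k <> k. Proof. apply kap_crit. Qed.

Lemma jj_ord a : ordinal a -> ordinal (jj a).
Proof.
  intros H. apply (h_ordinal hM hM_end).
  apply (proj1 (tr (fun b e => ordinal (e 0)) ltac:(dfn) (fun _ => a))). exact H.
Qed.

Lemma k_in_jk : k ∈ jj k.
Proof.
  destruct (ord_subset_mem k (jj k) k_ord (jj_ord k k_ord)) as [H|H]; auto.
  - intros x Hx. rewrite <- (k_fix x Hx). now apply jj_mem.
  - exfalso. now apply k_moved.
Qed.

Lemma k_omega : omega ∈ k.
Proof.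
  destruct (ord_trichotomy omega k ord_omega k_ord) as [H|[H|H]]; auto; exfalso; apply k_moved.
  - rewrite <- H. unfold jj. rewrite j_omega. apply (h_omega hM hM_end).
  - now apply jj_nat.
Qed.

Lemma j_app f a x : function_on f a -> x ∈ a -> app (jj f) (jj x) = jj (app f x).
Proof.
  intros Hf Hx.
  assert (E : j (app f x) = app (j f) (j x)).
  { apply (proj1 (tr (fun b e => e 0 = @app _ (Z2 b) (e 1) (e 2)) ltac:(dfn) (scons (app f x) (scons f (fun _ => x))))). reflexivity. }
  unfold jj at 3. rewrite E. apply (h_app hM hM_end (j f) (j a)).
  - apply (proj1 (tr (fun b e => @function_on _ (e 0) (e 1)) ltac:(dfn) (scons f (fun _ => a)))). exact Hf.
  - now apply (elementary_mem j (gj_elem X)).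
Qed.

Lemma jj_injection f a b : injection f a b -> injection (jj f) (jj a) (jj b).
Proof.
  intros H. apply (h_injection hM hM_end).
  apply (proj1 (tr (fun b e => @injection _ (e 0) (e 1) (e 2)) ltac:(dfn) (scons f (scons a (fun _ => b))))). exact H.
Qed.

Lemma jj_ran f y : (exists x, opair x (jj y) ∈ jj f) -> exists x, opair x y ∈ f.
Proof.
  intros (x & Hx).
  apply (proj2 (tr (fun b e => exists x, @opair _ (Z2 b) x (e 0) ∈ e 1) ltac:(dfn) (scons y (fun _ => f)))).
  cbn. destruct (h_pair_inv hM hM_end _ _ _ Hx) as (x' & y' & -> & E & K). exists x'.
  assert (j y = y') by now apply (ee_inj _ _ _ hM_end). now subst.
Qed.

(** For such an injection [g], the value of [j g] at [k] is fixed by [j], so by elementarity it is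
    in the range of [g], say at [x] below [k]. Then [j g] takes this value both at [x] and at
    [k]. *)
Lemma crit_no_inj a : (forall z, z ∈ jj a -> jj z = z) -> ~ card_le k a.
Proof.
  intros Ha [g Hg]. pose proof (jj_injection _ _ _ Hg) as Hj.
  apply injection_iff in Hg as (F1 & F2 & F3), Hj as (G1 & G2 & G3).
  pose proof (G2 k k_in_jk) as K. destruct (jj_ran g (app (jj g) k)) as (x & Hx).
  { exists k. rewrite (Ha _ K). apply app_mem with (jj k); auto using k_in_jk. }
  pose proof (function_on_dom _ _ _ _ F1 Hx) as Hxk. apply (app_val _ _ _ _ F1) in Hx.
  apply (mem_irrefl k). rewrite <- (G3 x k) at 1; auto.
  - rewrite <- (k_fix x Hxk) at 1. now apply jj_mem.
  - apply k_in_jk.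
  - rewrite <- (k_fix x Hxk) at 1. rewrite (j_app g k) by auto. rewrite Hx. now apply Ha.
Qed.

Lemma jj_subset x y : subset x y -> subset (jj x) (jj y).
Proof.
  intros H. apply (h_subset hM hM_end).
  apply (proj1 (tr (fun b e => @subset _ (e 0) (e 1)) ltac:(dfn) (scons x (fun _ => y)))). exact H.
Qed.

Lemma jj_sub_fix a m : (forall x, x ∈ m -> jj x = x) -> jj m = m -> subset a m -> jj a = a.
Proof.
  intros Hm Em Ha. apply subset_antisym; intros x Hx.
  - assert (Hxm : x ∈ m). { rewrite <- Em. now apply (jj_subset a m). }
    rewrite <- (Hm x Hxm) in Hx. now apply jj_mem.
  - rewrite <- (Hm x (Ha x Hx)). now apply jj_mem.
Qed.

(** For [m] below [k] the elements of [j (pow m)] are subsets of [m] and hence fixed, so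
    [crit_no_inj] applies to [pow m]. *)
Lemma k_sl : strong_limit k.
Proof.
  split; [apply kap_card|]. split; [apply k_omega|]. intros m Hm.
  apply not_le_small; [apply kap_card|]. apply crit_no_inj. intros z Hz.
  assert (Hfm : forall x, x ∈ m -> jj x = x).
  { intros x Hx. apply k_fix. apply (ord_mem_trans k x m); auto using k_ord. }
  apply (jj_sub_fix z m); auto using k_fix.
  rewrite <- (k_fix m Hm). unfold jj in Hz |- *.
  assert (E : j (pow m) = pow (j m)).
  { apply (proj1 (tr (fun b e => e 0 = @pow _ (Z2 b) (e 1)) ltac:(dfn) (scons (pow m) (fun _ => m)))). reflexivity. }
  rewrite E in Hz. apply (h_mem_iff hM hM_end) in Hz as (y & -> & Hy). apply in_pow in Hy.
  apply (h_subset hM hM_end). exact Hy.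
Qed.

Definition DD : V := Hset k.

(** By induction the elements of [x] are fixed. An injection of [x] into some [m] below [k] has
    fixed values, so [j x] acquires no further elements. *)
Lemma D_fix x : x ∈ DD -> jj x = x.
Proof.
  pose proof Dt_jj0. revert x. apply (mem_induction (fun x => x ∈ DD -> jj x = x)); [dclass|].
  intros x IH Hx. unfold DD in *.
  assert (Hel : forall y, y ∈ x -> jj y = y).
  { intros y Hy. apply IH; auto. apply (Hset_trans k k_ord x); auto. }
  apply in_Hset in Hx as (m & Hm & Hc); [|apply k_ord].
  assert (Hc' : card_le x m). { eapply card_le_trans; [apply card_le_sub, trcl_sub|exact Hc]. }
  destruct Hc' as [g Hg]. pose proof (jj_injection _ _ _ Hg) as Hjg.
  apply injection_iff in Hg as (F1 & F2 & F3), Hjg as (G1 & G2 & G3). rewrite (k_fix m Hm) in G2.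
  apply subset_antisym; intros z Hz.
  - pose proof (G2 z Hz) as K.
    assert (Ke : jj (app (jj g) z) = app (jj g) z). { apply k_fix. apply (ord_mem_trans k _ m); auto using k_ord. }
    destruct (jj_ran g (app (jj g) z)) as (y & Hy).
    { exists z. rewrite Ke. apply app_mem with (jj x); auto. }
    pose proof (function_on_dom _ _ _ _ F1 Hy) as Hyx. apply (app_val _ _ _ _ F1) in Hy.
    replace z with y; [auto|]. apply G3; auto.
    + rewrite <- (Hel y Hyx). now apply jj_mem.
    + rewrite <- (Hel y Hyx) at 1. rewrite (j_app g x) by auto. rewrite Hy. exact Ke.
  - rewrite <- (Hel z Hz). now apply jj_mem.
Qed.

(** The second successor of [k]: membership in [H] of the third successor means that the transitive
    closure has size at most [nu]. *)
Definition nu : V := hartogs (hartogs k).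
Definition lam3 : V := plus3 k.
Definition XX : V := Hset lam3.

Lemma not_finite_k : ~ finite k.
Proof.
  intros H. apply finite_iff in H as (n & Hn & H). apply (proj2 (kap_card X) n); [|auto].
  apply sl_nat; auto using k_sl.
Qed.

Lemma gch_pow (a : V) : cardinal a -> ~ finite a -> card_le (pow a) (hartogs a) /\ card_le (hartogs a) (pow a).
Proof.
  intros Ca Na. destruct (gGCH X a (hartogs a) (pow a) Ca Na) as [f [Hf Hs]].
  - apply succ_card_hartogs; [apply Ca|auto].
  - intros z. apply in_pow.
  - split; [now exists f|]. apply injection_iff in Hf as (F1 & F2 & F3). apply card_le_surj with f; auto.
    intros y Hy. destruct (Hs y Hy) as (x & Hx). apply pair_mem_iff in Hx. exists x. split.
    + eapply function_on_dom; eauto.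
    + eapply app_val; eauto.
Qed.

(** GCH is applied at [k] and at its successor. A double power set is recognised by [M], where [nu]
    itself might have a different meaning. *)
Lemma nu_pow : card_le (pow (pow k)) nu /\ card_le nu (pow (pow k)).
Proof.
  destruct (gch_pow k (kap_card X) not_finite_k) as [A1 A2].
  destruct (gch_pow (hartogs k)) as [B1 B2].
  - apply hartogs_cardinal, k_ord.
  - intros H. apply not_finite_k. apply (finite_sub k (hartogs k)); [|auto].
    intros x Hx. apply (ord_mem_trans _ x k); [apply hartogs_ord|exact Hx|]. apply in_hartogs. split; [apply k_ord|apply card_le_refl].
  - unfold nu. split.
    + eapply card_le_trans; [apply card_le_pow; exact A1|exact B1].
    + eapply card_le_trans; [exact B2|apply card_le_pow; exact A2].
Qed.

Lemma two_elements a : subset k a -> exists x y : V, x ∈ a /\ y ∈ a /\ x <> y.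
Proof.
  intros H. exists emp, omega. split; [apply H|split; [apply H|]].
  - apply sl_nat; auto using k_sl, nat_0.
  - apply k_omega.
  - intros E. apply (@in_emp V _ emp). rewrite E at 2. apply nat_0.
Qed.

Lemma sub_pow_k : subset k (pow k). Proof. apply transitive_pow. exact (proj1 k_ord). Qed.

Lemma pow_k_square : card_le (prod (pow k) (pow k)) (pow k).
Proof. apply card_le_pow_square; [apply two_elements, subset_refl|]. apply sl_square, k_sl. Qed.

Lemma card_square_equiv (a b : V) : card_le a b -> card_le b a -> card_le (prod a a) a -> card_le (prod b b) b.
Proof.
  intros H1 H2 H3. eapply card_le_trans; [apply card_le_prod; exact H2|]. eapply card_le_trans; eauto.
Qed.

Lemma nu_square : card_le (prod nu nu) nu.
Proof.
  destruct nu_pow. apply (card_square_equiv (pow (pow k)) nu); auto.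
  apply card_le_pow_square; [apply two_elements, sub_pow_k|]. apply pow_k_square.
Qed.

Lemma nu_ord : ordinal nu. Proof. apply hartogs_ord. Qed.
Lemma lam3_ord : ordinal lam3. Proof. apply hartogs_ord. Qed.

Lemma k_sub_nu : subset k nu.
Proof.
  assert (H : k ∈ nu).
  { apply (ord_mem_trans nu k (hartogs k)); [apply nu_ord| |]; apply in_hartogs;
    split; [apply k_ord|apply card_le_refl|apply hartogs_ord|apply card_le_refl]. }
  exact (proj1 nu_ord k H).
Qed.

Lemma in_XX x : x ∈ XX <-> card_le (trcl x) nu.
Proof. unfold XX. rewrite in_Hset by apply lam3_ord. apply small_hartogs, nu_ord. Qed.

Lemma XX_M x : x ∈ XX -> gM X x.
Proof.
  intros H. apply (gM_H X lam3); [apply is_plus3_iff; auto using k_ord|].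
  apply in_H_iff; [apply hartogs_cardinal, nu_ord|]. now apply in_Hset; [apply lam3_ord|].
Qed.

Lemma XX_trans : transitive XX. Proof. apply Hset_trans, lam3_ord. Qed.

Lemma XX_transitive_set t : transitive t -> card_le t nu -> t ∈ XX.
Proof.
  intros H1 H2. apply in_XX. eapply card_le_trans; [|exact H2]. apply card_le_sub. apply trcl_min; auto using subset_refl.
Qed.

Lemma nat_nu n : n ∈ omega -> n ∈ nu.
Proof. intros H. apply k_sub_nu. apply sl_nat; auto using k_sl. Qed.

Lemma card_cup_nu (a b : V) : card_le a nu -> card_le b nu -> card_le (cup a b) nu.
Proof.
  intros Ha Hb. eapply card_le_trans; [apply (card_le_cup a b nu nu); auto|].
  eapply card_le_trans; [|exact nu_square]. apply card_le_prod; apply card_le_sub.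
  - apply (proj1 nu_ord). apply nat_nu. auto using nat_succ, nat_0.
  - intros x Hx. apply in_cup in Hx as []; auto.
Qed.

Lemma card_sing_nu (a : V) : card_le (sing a) nu.
Proof.
  apply card_le_fun with (fun _ => emp); [dfn| |].
  - intros. apply nat_nu, nat_0.
  - intros y y' Hy Hy' _. apply in_sing in Hy, Hy'. congruence.
Qed.

(** A union of [nu] many sets of size [nu] has size [nu], because [nu] is equinumerous with its
    square. *)
Lemma XX_intro x : subset x XX -> card_le x nu -> x ∈ XX.
Proof.
  intros H1 H2. apply in_XX. eapply card_le_trans.
  - apply card_le_sub with (b := un (img x (fun y => cup (trcl y) (sing y)))).
    apply trcl_min.
    + intros y Hy z Hz. apply in_un in Hy as (w & Hw & Hy). rewrite in_img in Hw by dclass.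
      destruct Hw as (v & Hv & ->). apply in_un. exists (cup (trcl v) (sing v)). rewrite in_img by dclass.
      split; [eauto|]. apply in_cup. left. apply in_cup in Hy as [Hy|Hy].
      * apply (trcl_trans v y); auto.
      * apply in_sing in Hy. subst. now apply trcl_sub.
    + intros y Hy. apply in_un. exists (cup (trcl y) (sing y)). rewrite in_img by dclass. split; [eauto|].
      apply in_cup. right. now apply in_sing.
  - apply card_le_Union; [dfn|exact nu_square|exact H2|]. intros y Hy. apply card_cup_nu; [|apply card_sing_nu].
    now apply in_XX, H1.
Qed.

Lemma XX_upair x y : x ∈ XX -> y ∈ XX -> upair x y ∈ XX.
Proof.
  intros Hx Hy. apply XX_intro.
  - intros z Hz. apply in_upair in Hz as [-> | ->]; auto.
  - eapply card_le_trans; [apply card_le_sub with (b := cup (sing x) (sing y))|].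
    + intros z Hz. rewrite in_cup, !in_sing. now apply in_upair in Hz.
    + apply card_cup_nu; apply card_sing_nu.
Qed.

Lemma XX_opair x y : x ∈ XX -> y ∈ XX -> opair x y ∈ XX.
Proof.
  intros Hx Hy. rewrite opair_upair, sing_upair. auto using XX_upair.
Qed.

Lemma XX_opair_inv x y : opair x y ∈ XX -> x ∈ XX /\ y ∈ XX.
Proof.
  intros H. assert (K : upair x y ∈ XX) by (apply (XX_trans _ H), upair_in_opair).
  split; apply (XX_trans _ K); apply in_upair; auto.
Qed.

Lemma XX_prod x y : x ∈ XX -> y ∈ XX -> prod x y ∈ XX.
Proof.
  intros Hx Hy. apply XX_intro.
  - intros z Hz. apply in_prod in Hz as (a & b & Ha & Hb & ->). apply XX_opair; [apply (XX_trans x)|apply (XX_trans y)]; auto.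
  - eapply card_le_trans; [|exact nu_square]. apply card_le_prod.
    + eapply card_le_trans; [apply card_le_sub, trcl_sub|now apply in_XX].
    + eapply card_le_trans; [apply card_le_sub, trcl_sub|now apply in_XX].
Qed.

Lemma D_sub_XX : subset DD XX.
Proof.
  intros x Hx. unfold DD in Hx. apply in_Hset in Hx as (m & Hm & Hc); [|apply k_ord].
  apply in_XX. eapply card_le_trans; [exact Hc|]. apply card_le_sub.
  apply (proj1 nu_ord). now apply k_sub_nu.
Qed.

Lemma k_XX : k ∈ XX.
Proof. apply XX_transitive_set; [exact (proj1 k_ord)|]. apply card_le_sub, k_sub_nu. Qed.

Lemma omega_XX : omega ∈ XX. Proof. apply (XX_trans k k_XX), k_omega. Qed.

Lemma card_XX x : x ∈ XX -> card_le x nu.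
Proof. intros H. eapply card_le_trans; [apply card_le_sub, trcl_sub|now apply in_XX]. Qed.

Lemma XX_nu_elem a : a ∈ lam3 -> a ∈ XX.
Proof.
  intros H. pose proof (proj2 (proj1 (in_hartogs _ _) H)) as K.
  apply XX_transitive_set; [|auto]. exact (proj1 (ord_elem lam3 a lam3_ord H)).
Qed.

(* [M] contains an injection of each [x ∈ X] into the double power set of [k] *)
Lemma M_small (b : M) x : strong_limit b -> k ∈ hM b -> x ∈ XX -> small b (toM x).
Proof.
  intros Hb Hk Hx. set (Q := pow (pow k)).
  assert (HQ : Q ∈ XX).
  { apply XX_transitive_set; [|apply nu_pow]. destruct (transitive_pow k (proj1 k_ord)) as [T _]. apply (transitive_pow _ T). }
  assert (Hc : card_le x Q). { eapply card_le_trans; [now apply card_XX|apply nu_pow]. }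
  destruct Hc as [g Hg].
  assert (HgX : g ∈ XX).
  { apply XX_intro.
    - intros z Hz. apply injection_iff in Hg as (F1 & F2 & F3).
      destruct (function_on_elem _ _ _ F1 Hz) as (u & v & Hu & ->). apply XX_opair; [now apply (XX_trans x)|].
      rewrite <- (app_val _ _ _ _ F1 Hz). apply (XX_trans Q); auto.
    - eapply card_le_trans; [|exact (card_XX x Hx)]. apply card_le_surj with (lam x (fun u => opair u (app g u))).
      + apply lam_function. dfn.
      + intros z Hz. apply injection_iff in Hg as (F1 & F2 & F3).
        destruct (function_on_elem _ _ _ F1 Hz) as (u & v & Hu & ->). exists u. split; [auto|].
        rewrite app_lam; [|dfn|auto]. now rewrite (app_val _ _ _ _ F1 Hz). }
  assert (Hk' : toM k ∈ b). { apply hM_down. now rewrite hM_toM by (apply XX_M, k_XX). }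
  apply small_le with (toM Q).
  - exists (toM g). apply (h_injection hM hM_end). now rewrite !hM_toM by auto using XX_M.
  - apply small_le with (pow (pow (toM k))); [|apply sl_pow; [auto|]; apply sl_pow; [auto|]; now apply small_mem].
    apply card_le_sub. intros z Hz. apply in_pow. intros y Hy. apply in_pow. apply (h_subset hM hM_end).
    rewrite hM_toM by (apply XX_M, k_XX). apply hM_up in Hz, Hy. rewrite hM_toM in Hz by now apply XX_M.
    unfold Q in Hz. apply in_pow in Hz. apply Hz in Hy. now apply in_pow in Hy.
Qed.

Lemma jk_sl : strong_limit (j k).
Proof.
  apply (proj1 (tr (fun b e => @strong_limit _ (Z2 b) (e 0)) ltac:(dfn) (fun _ => k))). exact k_sl.
Qed.

Lemma in_jD (x : M) : x ∈ j DD <-> small (j k) (trcl x).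
Proof.
  assert (H : forall y : V, y ∈ DD <-> small k (trcl y)) by (intros; apply in_Hset, k_ord).
  apply (proj1 (tr (fun b e => forall y, y ∈ e 0 <-> @small _ (e 1) (@trcl _ (Z2 b) y)) ltac:(dfn) (scons DD (fun _ => k)))).
  exact H.
Qed.

(** In [M], [j DD] is [H(j k)], and [j k] is a strong limit above [k]. So every element of [XX] can
    serve as the seed of an ultrafilter on [DD]. *)
Lemma XX_jD x : x ∈ XX -> x ∈ jj DD.
Proof.
  intros Hx. rewrite <- (hM_toM x) by now apply XX_M. apply hM_up.
  apply in_jD. assert (Ht : trcl x ∈ XX). { apply XX_transitive_set; [apply trcl_trans|now apply in_XX]. }
  apply small_le with (toM (trcl x)); [|apply M_small; auto using jk_sl, k_in_jk].
  apply card_le_sub, trcl_min.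
  - apply (h_transitive hM hM_end). rewrite hM_toM by now apply XX_M. apply trcl_trans.
  - apply (h_subset hM hM_end). rewrite !hM_toM by now apply XX_M. apply trcl_sub.
Qed.

End Embedding.

(** * Conditions of [j P] and what they decide in [M] *)

Section Forcing.
Context (X : setup).
Local Notation V := (gV X).
Local Notation M := (substructure (gV X) (gM X)).
Local Notation j := (gj X).
Local Notation k := (kap X).
Local Notation S := (gS X).
Local Notation U := (gU X).
Local Notation P := (gP X).
Local Notation hM := (hM X).
Local Notation jj := (jj X).
Local Notation toM := (toM X).
Local Notation DD := (DD X).
Local Notation XX := (XX X).
Local Notation HM := (hM_end X).
Local Notation Sj := (j S).
Local Notation Uj := (j U).
Local Notation Pj := (j P).
Local Notation kM := (toM k).
Local Notation le := (prikry_product_le S).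
Local Notation lej := (prikry_product_le Sj).

#[local] Instance Z2' : forall b, ZFC (two V M b) | 100 := two_ZFC V M (gZ X) (ZM X).
Local Notation tr := (transfer j (gj_elem X)).

Lemma S_meas' a : a ∈ S -> measurable a. Proof. intros H. now apply gS_meas in H. Qed.
Lemma S_k a : a ∈ S -> a ∈ k. Proof. intros H. now apply gS_meas in H. Qed.

Lemma MU : function_on Uj Sj.
Proof. exact (proj1 (tr (fun b e => @function_on _ (e 0) (e 1)) ltac:(dfn) (scons U (fun _ => S))) (gU_fun X)). Qed.
Lemma MP : is_prikry_product Sj Uj Pj.
Proof. exact (proj1 (tr (fun b e => is_prikry_product (e 0) (e 1) (e 2)) ltac:(dfn) (scons S (scons U (fun _ => P)))) (gP_prod X)). Qed.
Lemma MS : forall a, a ∈ Sj -> measurable a.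
Proof. exact (proj1 (tr (fun b e => forall a, a ∈ e 0 -> measurable a) ltac:(dfn) (fun _ => S)) S_meas'). Qed.
Lemma Mn : forall a u, pair_mem a u Uj -> normal_measure u a.
Proof. exact (proj1 (tr (fun b e => forall a u, pair_mem a u (e 0) -> normal_measure u a) ltac:(dfn) (fun _ => U)) (gU_norm X)). Qed.
Lemma Md : discrete Sj.
Proof. exact (proj1 (tr (fun b e => discrete (e 0)) ltac:(dfn) (fun _ => S)) (gS_disc X)). Qed.

Lemma hkM : hM kM = k. Proof. apply hM_toM, XX_M, k_XX. Qed.
Lemma kM_ord : ordinal kM. Proof. apply (h_ordinal hM HM). rewrite hkM. apply k_ord. Qed.

Lemma S_fix a : a ∈ S -> jj a = a. Proof. intros H. apply k_fix, S_k, H. Qed.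

(** Otherwise discreteness of [j S] bounds its part below [k] by some [b < k], which [j] fixes. Then
    no element of [S] exceeds [b], by elementarity none of [j S] does, and yet [k] would. *)
Lemma kM_S : kM ∉ Sj.
Proof.
  intros H. apply (Md kM H). intros b Hb. apply NNPP. intros N.
  assert (Hbk : hM b ∈ k). { rewrite <- hkM. exact Hb. }
  assert (Eb : j (hM b) = b). { apply (ee_inj _ _ _ HM). now apply k_fix. }
  assert (K : forall c, c ∈ S -> ~ hM b ∈ c).
  { intros c Hc Hbc. apply N. exists (j c). split; [|split].
    - now apply (elementary_mem j (gj_elem X)).
    - apply hM_down. rewrite hkM. change (jj c ∈ k). rewrite S_fix by auto. now apply S_k.
    - apply hM_down. change (hM b ∈ jj c). now rewrite S_fix. }
  pose proof (proj1 (tr (fun b e => forall c, c ∈ e 0 -> ~ e 1 ∈ c) ltac:(dfn) (scons S (fun _ => hM b))) K kM H) as K'.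
  cbn in K'. rewrite Eb in K'. now apply K'.
Qed.

Lemma Sj_low a : a ∈ Sj -> a ∈ kM <-> hM a ∈ S.
Proof.
  intros Ha. split.
  - intros H. assert (Hk : hM a ∈ k) by (rewrite <- hkM; exact H).
    apply jj_mem. rewrite (k_fix X _ Hk). exact Ha.
  - intros H. apply hM_down. rewrite hkM. now apply S_k.
Qed.

Lemma S_Sj a : a ∈ S -> toM a ∈ Sj /\ toM a ∈ kM /\ hM (toM a) = a /\ toM a = j a.
Proof.
  intros H. assert (E : toM a = j a). { rewrite <- (S_fix a H) at 1. apply toM_jj. }
  assert (E' : hM (toM a) = a). { rewrite E. now apply S_fix. }
  assert (Ha : toM a ∈ Sj). { rewrite E. now apply (elementary_mem j (gj_elem X)). }
  split; [auto|]. split; [|auto]. apply Sj_low; [auto|]. now rewrite E'.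
Qed.

Lemma k_bound_D a : a ∈ k -> forall x, subset x a -> x ∈ DD.
Proof.
  intros Ha x Hx. apply (Hset_subset k x a); auto using k_ord. apply Hset_ord; auto using k_sl.
Qed.

Lemma U_D a : a ∈ S -> app U a ∈ DD.
Proof.
  intros Ha. apply (Hset_subset k _ (pow (pow a))); [apply k_ord| |].
  - intros A HA. apply in_pow. intros b Hb. apply in_pow.
    assert (Hm : measure_on (app U a) a).
    { apply (gU_norm X a). apply pair_mem_iff. eapply app_mem; eauto using gU_fun. }
    pose proof (meas_sub _ _ Hm _ HA) as K.
    assert (Oa : ordinal a) by (apply (ord_elem k); auto using k_ord, S_k).
    apply (proj1 Oa). auto.
  - apply Hset_pow; [apply k_sl|]. apply Hset_pow; [apply k_sl|]. apply Hset_ord; auto using k_sl, S_k.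
Qed.

(** A measure on an ordinal below [k] is an element of [H(k)] and thus fixed, which makes lower
    parts of conditions of [j P] conditions of [P]. *)
Lemma Uj_app a : a ∈ S -> hM (app Uj (toM a)) = app U a.
Proof.
  intros Ha. destruct (S_Sj a Ha) as (H1 & H2 & H3 & H4). rewrite H4.
  rewrite <- (D_fix X (app U a)) by now apply U_D. rewrite <- (j_app X U S) by auto using gU_fun.
  symmetry. apply (h_app hM HM Uj Sj); [apply MU|]. now rewrite <- H4.
Qed.

Lemma P_coord_D p a : p ∈ P -> a ∈ S -> app p a ∈ DD.
Proof.
  intros Hp Ha. rewrite (P_app S U P (gU_fun X) (gP_prod X)) by auto.
  apply Hset_opair; [apply k_sl| |]; apply (k_bound_D a); auto using S_k.
  - apply (st_sub S U P (gU_fun X) (gP_prod X)); auto.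
  - apply (ms_sub S U P (gU_fun X) (gP_prod X) (gU_norm X)); auto.
Qed.

Definition low (r : M) : V := restr (hM r) k.

Lemma in_low r a c : opair a c ∈ low r <-> opair a c ∈ hM r /\ a ∈ k.
Proof. apply in_restr. Qed.

Lemma Pj_fun r : r ∈ Pj -> function_on r Sj. Proof. apply (P_fun Sj Uj Pj MU MP). Qed.

Lemma low_fun r : r ∈ Pj -> function_on (low r) S.
Proof.
  intros Hr. pose proof (Pj_fun r Hr) as Hf. apply function_on_intro.
  - intros z Hz. apply in_restr_iff in Hz as (Hz & a & c & Ha & ->).
    destruct (h_pair_inv hM HM _ _ _ Hz) as (a' & c' & -> & -> & K). exists (hM a'), (hM c'). split; [|auto].
    apply Sj_low; [eapply function_on_dom; eauto|]. apply hM_down. now rewrite hkM.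
  - intros a Ha. destruct (S_Sj a Ha) as (H1 & H2 & H3 & H4). exists (hM (app r (toM a))). apply in_low.
    split; [|now apply S_k]. rewrite <- H3 at 1. apply (h_opair_mem hM HM). eapply app_mem; eauto.
  - intros x y y' H1 H2. apply in_low in H1 as [H1 _], H2 as [H2 _].
    assert (Hf' : function_on (hM r) (hM Sj)) by now apply (h_function_on hM HM).
    eapply function_on_uniq; eauto.
Qed.

Lemma low_app r a : r ∈ Pj -> a ∈ S -> app (low r) a = hM (app r (toM a)).
Proof.
  intros Hr Ha. destruct (S_Sj a Ha) as (H1 & H2 & H3 & H4). apply app_val with S; [now apply low_fun|].
  apply in_low. split; [|now apply S_k]. rewrite <- H3 at 1. apply (h_opair_mem hM HM). eapply app_mem; eauto using Pj_fun.
Qed.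

Lemma low_st r a : r ∈ Pj -> a ∈ S -> st (low r) a = hM (st r (toM a)) /\ ms (low r) a = hM (ms r (toM a)).
Proof.
  intros Hr Ha. destruct (S_Sj a Ha) as (H1 & H2 & H3 & H4).
  Transparent st ms. unfold st at 1, ms at 1. Opaque st ms. rewrite low_app by auto.
  rewrite (P_app Sj Uj Pj MU MP) by auto. rewrite (h_opair hM HM). now rewrite fst_opair, snd_opair.
Qed.

Lemma low_P r : r ∈ Pj -> low r ∈ P.
Proof.
  intros Hr. apply (in_P S U P (gU_fun X) (gP_prod X)). split; [now apply low_fun|]. split.
  - intros a Ha. destruct (S_Sj a Ha) as (H1 & H2 & H3 & H4). destruct (low_st r a Hr Ha) as [E1 E2]. rewrite E1, E2.
    rewrite low_app by auto. rewrite (P_app Sj Uj Pj MU MP) by auto. rewrite (h_opair hM HM). split; [auto|].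
    destruct (P_cond Sj Uj Pj MU MP r (toM a) Hr H1) as (K1 & K2 & K3 & K4). split; [|split; [|split]].
    + now apply (h_finite hM HM).
    + apply (h_subset hM HM) in K2. now rewrite H3 in K2.
    + rewrite <- (Uj_app a) by auto. exact K3.
    + intros b c Hb Hc. apply (h_mem_iff hM HM) in Hb as (b' & -> & Hb), Hc as (c' & -> & Hc).
      apply hM_up. auto.
  - destruct (P_supp Sj Uj Pj MU MP r Hr) as (F & HF & K). exists (hM F). split; [now apply (h_finite hM HM)|].
    intros a Ha Na. destruct (S_Sj a Ha) as (H1 & H2 & H3 & H4). destruct (low_st r a Hr Ha) as [-> _].
    rewrite K; [apply (h_emp hM HM)|auto|]. intros HaF. apply Na. rewrite <- H3. exact HaF.
Qed.

Lemma j_P p : p ∈ P -> j p ∈ Pj. Proof. apply (elementary_mem j (gj_elem X)). Qed.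

Lemma low_j p : p ∈ P -> low (j p) = p.
Proof.
  intros Hp. pose proof (P_fun S U P (gU_fun X) (gP_prod X) p Hp) as Fp.
  apply function_ext with S; [apply low_fun; now apply j_P|auto|].
  intros a Ha. destruct (S_Sj a Ha) as (H1 & H2 & H3 & H4). rewrite low_app by auto using j_P. rewrite H4.
  rewrite <- (h_app hM HM (j p) Sj); [|apply Pj_fun; now apply j_P|now rewrite <- H4].
  change (app (jj p) (jj a) = app p a). rewrite (j_app X p S) by auto. apply D_fix. now apply P_coord_D.
Qed.

(** By finiteness the nonempty stems of [p] occur below some [m < k], and [j] fixes [m]. *)
Lemma j_pure p : p ∈ P -> pure_above Sj kM (j p).
Proof.
  intros Hp. destruct (P_supp S U P (gU_fun X) (gP_prod X) p Hp) as (F & HF & K).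
  destruct (finite_bounded k (cap F S)) as (m & Hm & Km).
  - apply k_ord.
  - apply sl_nat; auto using k_sl, nat_0.
  - intros m Hm. apply sl_succ; auto using k_sl.
  - eapply finite_sub; [|exact HF]. intros x Hx. now apply in_cap in Hx.
  - intros x Hx. apply in_cap in Hx as [_ Hx]. now apply S_k.
  - assert (K' : forall a, a ∈ S -> a ∉ m -> st p a = emp).
    { intros a Ha Na. apply K; auto. intros HaF. apply Na, Km, in_cap. auto. }
    pose proof (proj1 (tr (fun b e => forall a, a ∈ e 0 -> a ∉ e 1 -> @st _ (Z2' b) (e 2) a = @emp _ (Z2' b)) ltac:(dfn)
      (scons S (scons m (fun _ => p)))) K') as K2. cbn in K2.
    intros a Ha Hka. apply K2; [auto|]. intros Ham.
    apply (mem_irrefl k). apply (ord_mem_trans k k m); [apply k_ord| |auto].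
    apply (ord_mem_trans m k (hM a)); [apply (ord_elem k); auto using k_ord| |].
    + rewrite <- hkM. exact Hka.
    + rewrite <- (k_fix X m Hm). exact Ham.
Qed.

Lemma le_low_iff r r' : r ∈ Pj -> r' ∈ Pj -> le_low Sj kM r r' <-> le (low r) (low r').
Proof.
  intros Hr Hr'. rewrite (le_iff S U P (gU_fun X) (gP_prod X)) by auto using low_P. unfold le_low. split.
  - intros H a Ha. destruct (S_Sj a Ha) as (H1 & H2 & H3 & H4).
    destruct (low_st r a Hr Ha) as [-> ->], (low_st r' a Hr' Ha) as [-> ->]. apply (h_prikry_le hM HM). auto.
  - intros H a Ha Hk. apply Sj_low in Hk; [|auto]. specialize (H (hM a) Hk).
    destruct (low_st r (hM a) Hr Hk) as [E1 E2], (low_st r' (hM a) Hr' Hk) as [E3 E4]. rewrite E1, E2, E3, E4, toM_hM in H.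
    now apply (h_prikry_le hM HM) in H.
Qed.

Local Notation gl := (glue Sj kM).
Local Notation leup := (le_up Sj kM).

Lemma gl_P r u : r ∈ Pj -> u ∈ Pj -> gl r u ∈ Pj. Proof. apply (glue_P Sj Uj Pj MU MP). Qed.

Lemma low_gl r u : r ∈ Pj -> u ∈ Pj -> low (gl r u) = low r.
Proof.
  intros Hr Hu. apply (P_ext S U P (gU_fun X) (gP_prod X)); auto using low_P, gl_P.
  intros a Ha. destruct (S_Sj a Ha) as (H1 & H2 & H3 & H4).
  destruct (low_st r a Hr Ha) as [-> ->], (low_st (gl r u) a (gl_P r u Hr Hu) Ha) as [-> ->].
  destruct (glue_low Sj kM r u (toM a) H1 H2) as [-> ->]. auto.
Qed.

(** Below [k] the orders of [P] and [j P] agree, so a condition of [j P] may be treated as a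
    condition of [P] together with an upper part. *)
Lemma lej_iff r r' : r ∈ Pj -> r' ∈ Pj -> lej r r' <-> le (low r) (low r') /\ leup r r'.
Proof.
  intros Hr Hr'. rewrite (le_split Sj Uj Pj MU MP MS kM kM_ord kM_S) by auto. now rewrite le_low_iff.
Qed.

Lemma lej_gl r p u : r ∈ Pj -> p ∈ P -> u ∈ Pj -> lej r (gl (j p) u) <-> le (low r) p /\ leup r u.
Proof.
  intros Hr Hp Hu. rewrite lej_iff by auto using gl_P, j_P. rewrite low_gl, low_j by auto using j_P.
  now rewrite (glue_le_up_r Sj MS kM kM_ord kM_S).
Qed.

Lemma gl_lej p u r : r ∈ Pj -> p ∈ P -> u ∈ Pj -> lej (gl (j p) u) r <-> le p (low r) /\ leup u r.
Proof.
  intros Hr Hp Hu. rewrite lej_iff by auto using gl_P, j_P. rewrite low_gl, low_j by auto using j_P.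
  now rewrite (glue_le_up Sj MS kM kM_ord kM_S).
Qed.

Lemma lej_refl r : r ∈ Pj -> lej r r. Proof. apply (le_refl Sj Uj Pj MU MP). Qed.
Lemma lej_trans r s t : s ∈ Pj -> lej r s -> lej s t -> lej r t. Proof. apply (le_trans Sj Uj Pj MU MP). Qed.
Lemma le_reflP p : p ∈ P -> le p p. Proof. apply (le_refl S U P (gU_fun X) (gP_prod X)). Qed.
Lemma le_transP p q r : q ∈ P -> le p q -> le q r -> le p r. Proof. apply (le_trans S U P (gU_fun X) (gP_prod X)). Qed.
Lemma leup_trans r s t : leup r s -> leup s t -> leup r t. Proof. apply le_up_trans. Qed.
Lemma leup_refl r : leup r r. Proof. apply le_up_refl. Qed.

Definition upper (u : M) : Prop := u ∈ Pj /\ pure_above Sj kM u.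

Lemma j_upper p : p ∈ P -> upper (j p). Proof. intros H. split; [now apply j_P|now apply j_pure]. Qed.

Lemma upper_meet u v : upper u -> upper v -> exists w, upper w /\ leup w u /\ leup w v.
Proof.
  intros [Hu Pu] [Hv Pv].
  destruct (pure_lower_bound Sj Uj Pj MU MP MS Mn kM (upair u v) (fun z => z)) as (w & Hw & Pw & Lw).
  - dfn.
  - intros a Ha Hk. assert (SL : strong_limit a) by (apply (S_sl Sj Uj MU MS Mn); auto).
    apply small_le with (cup (sing u) (sing v)).
    + apply card_le_sub. intros z Hz. rewrite in_cup, !in_sing. now apply in_upair in Hz.
    + apply sl_cup; auto using sl_sing.
  - intros z Hz. apply in_upair in Hz as [-> | ->]; auto.
  - exists w. split; [now split|]. split; apply Lw; apply in_upair; auto.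
Qed.

(* [DB y a p u]: in M, the condition [p ⌢ u] forces [a ∈ j y] (as a name);
   [NG]: it forces the opposite. *)
Definition DB (y a p : V) (u : M) : Prop :=
  dense_below Sj Pj (fun r => opair r (toM a) ∈ j y) (gl (j p) u).
Definition NG (y a p : V) (u : M) : Prop :=
  forall r, r ∈ Pj -> lej r (gl (j p) u) -> opair r (toM a) ∉ j y.
(** The upper part may be quantified away since any two pure upper parts have a common lower bound,
    [upper_meet]; what remains behaves like a forcing relation over [P]. *)
Definition RR (p y a : V) : Prop := exists u, upper u /\ DB y a p u.

(** The relation is written as a statement of [M] about [j p], [j y], [a], [j P], [j S] and [k], and
    this statement is relativized. *)
Lemma D_RR : Dfn1 V (fun _ e => RR (e 0) (e 1) (e 2)).
Proof.
  pose proof (Dt_jj0 X) as DJ.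
  set (Q := fun b (e : nat -> two V M b) => exists u, (u ∈ e 3 /\ @pure_above _ (Z2' b) (e 4) (e 5) u) /\
    dense_below (e 4) (e 3) (fun r => @opair _ (Z2' b) r (e 2) ∈ e 1) (@glue _ (Z2' b) (e 4) (e 5) (e 0) u)).
  assert (DQ : Dfn2 V M Q). { unfold Q, pure_above, dense_below, glue. dfn. }
  apply relativize in DQ.
  set (t := fun n (i : unit) (e : nat -> V) => match n with 0 => jj (e 0) | 1 => jj (e 1) | 2 => e 2 | 3 => jj P | 4 => jj S | _ => k end).
  assert (Dt' : forall n, Dt1 V (t n)). { intros [|[|[|[|[|n]]]]]; unfold t; dfn. }
  apply D_ext with (fun i e => Q false (fun n => toM (t n i e))).
  - intros i e. unfold Q, RR, upper, DB, t. rewrite !toM_jj. reflexivity.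
  - apply (Dfn_sub_all (fun i e => Q false (fun n => toM (e n))) t); auto.
Qed.

(** A name of a subset of a ground model set: pairs of a condition and an element, closed under
    strengthening of the condition. The elements stand for themselves and are not evaluated. *)
Definition open_name (y : V) : Prop :=
  forall q r i, q ∈ P -> r ∈ P -> le r q -> opair q i ∈ y -> opair r i ∈ y.

Lemma D_open_name : Dfn1 V (fun _ e => open_name (e 0)).
Proof. unfold open_name. dfn. Qed.

Lemma j_open y : open_name y -> forall q r i, q ∈ Pj -> r ∈ Pj -> lej r q -> opair q i ∈ j y -> opair r i ∈ j y.
Proof.
  intros H.
  exact (proj1 (tr (fun b e => forall q r i, q ∈ e 0 -> r ∈ e 0 -> prikry_product_le (e 1) r q ->
    @opair _ (Z2' b) q i ∈ e 2 -> @opair _ (Z2' b) r i ∈ e 2) ltac:(dfn) (scons P (scons S (fun _ => y)))) H).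
Qed.

Lemma P_elem_XX p : p ∈ P -> p ∈ XX.
Proof.
  intros Hp. pose proof (P_fun S U P (gU_fun X) (gP_prod X) p Hp) as Fp. apply XX_intro.
  - intros z Hz. destruct (function_on_elem _ _ _ Fp Hz) as (a & c & Ha & ->). apply XX_opair; apply D_sub_XX.
    + apply Hset_ord; auto using k_sl, S_k.
    + rewrite <- (app_val _ _ _ _ Fp Hz). now apply P_coord_D.
  - eapply card_le_trans; [|apply card_le_sub, (k_sub_nu X)].
    apply card_le_fun with (fun z => fst z); [dfn| |].
    + intros z Hz. destruct (function_on_elem _ _ _ Fp Hz) as (a & c & Ha & ->). rewrite fst_opair. now apply S_k.
    + intros z z' Hz Hz'. destruct (function_on_elem _ _ _ Fp Hz) as (a & c & Ha & ->).
      destruct (function_on_elem _ _ _ Fp Hz') as (a' & c' & Ha' & ->). rewrite !fst_opair. intros <-.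
      f_equal. eapply function_on_uniq; eauto.
Qed.

Lemma pow_k_nu : card_le (pow k) (nu X).
Proof.
  eapply card_le_trans; [|apply nu_pow]. apply card_le_sub.
  exact (proj2 (transitive_pow _ (proj1 (transitive_pow _ (proj1 (k_ord X)))))).
Qed.

(** The stems and the measure one sets of a condition are coded by two subsets of [k × k]. *)
Lemma P_card : card_le P (pow k).
Proof.
  eapply card_le_trans; [|apply pow_k_square].
  assert (Hkk : card_le (pow (prod k k)) (pow k)) by apply card_le_pow, sl_square, k_sl.
  eapply card_le_trans; [|apply card_le_prod; exact Hkk].
  set (F := fun p => sep (prod k k) (fun z => fst z ∈ S /\ snd z ∈ st p (fst z))).
  set (G := fun p => sep (prod k k) (fun z => fst z ∈ S /\ snd z ∈ ms p (fst z))).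
  assert (DF : Dt1 V (fun _ e => F (e 0))) by (unfold F; dfn).
  assert (DG : Dt1 V (fun _ e => G (e 0))) by (unfold G; dfn).
  apply card_le_fun with (fun p => opair (F p) (G p)).
  - dfn.
  - intros p Hp. apply opair_in_prod. split; apply in_pow; intros z Hz; unfold F, G in Hz; rewrite in_sep in Hz by dclass; tauto.
  - intros p q Hp Hq E. apply opair_inj in E as [E1 E2]. apply (P_ext S U P (gU_fun X) (gP_prod X)); auto.
    assert (KF : forall p a b, p ∈ P -> a ∈ S -> b ∈ st p a <-> opair a b ∈ F p).
    { clear - X. intros p a b Hp Ha. unfold F. rewrite in_sep by dclass. rewrite fst_opair, snd_opair, opair_in_prod. split; [|tauto].
      intros Hb. repeat split; auto using S_k. apply (ord_mem_trans k b a); auto using k_ord, S_k.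
      apply (st_sub S U P (gU_fun X) (gP_prod X) p); auto. }
    assert (KG : forall p a b, p ∈ P -> a ∈ S -> b ∈ ms p a <-> opair a b ∈ G p).
    { clear - X. intros p a b Hp Ha. unfold G. rewrite in_sep by dclass. rewrite fst_opair, snd_opair, opair_in_prod. split; [|tauto].
      intros Hb. repeat split; auto using S_k. apply (ord_mem_trans k b a); auto using k_ord, S_k.
      apply (ms_sub S U P (gU_fun X) (gP_prod X) (gU_norm X) p); auto. }
    intros a Ha. split; apply ext_eq; intros b.
    + now rewrite !KF, E1 by auto.
    + now rewrite !KG, E2 by auto.
Qed.

Lemma P_XX : P ∈ XX.
Proof.
  apply XX_intro; [exact P_elem_XX|]. eapply card_le_trans; [apply P_card|apply pow_k_nu].
Qed.

Lemma Pj_restr_low r : r ∈ Pj -> hM (restr r kM) = low r.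
Proof. intros Hr. unfold low. rewrite (h_restr hM HM). now rewrite hkM. Qed.

(** [pure_decision] inside [M], where the lower parts and [I] are small below every coordinate above
    [k]. The lower part found in [M] is brought back to [V] by [low]. *)
Theorem PD y I : open_name y -> I ∈ XX -> exists u, upper u /\ forall i x, i ∈ I -> x ∈ P ->
  exists q, q ∈ P /\ le q x /\ (DB y i q u \/ NG y i q u).
Proof.
  intros Hy HI.
  destruct (pure_decision Sj Uj Pj MU MP MS Mn Md kM kM_ord kM_S (j y) (toM I)) as (u & Hu & Pu & K).
  - now apply j_open.
  - intros a Ha Hk. assert (SL : strong_limit a) by (apply (S_sl Sj Uj MU MS Mn); auto).
    assert (Hk' : k ∈ hM a) by (rewrite <- hkM; exact Hk). apply sl_prod; [auto| |now apply M_small].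
    apply small_le with (toM P); [|apply M_small; auto using P_XX].
    apply card_le_sub. intros z Hz. rewrite in_img in Hz by dclass. destruct Hz as (q & Hq & ->).
    apply hM_down. rewrite Pj_restr_low by auto. rewrite hM_toM by (apply XX_M, P_XX). now apply low_P.
  - exists u. split; [now split|]. intros i x Hi Hx.
    assert (Hi' : toM i ∈ toM I). { apply hM_down. rewrite !hM_toM; auto using XX_M. apply XX_M. apply (XX_trans X I); auto. }
    destruct (K (toM i) (j x) Hi' (j_P x Hx)) as (q & Hq & Lq & Dq).
    exists (low q). split; [now apply low_P|]. split.
    + apply le_low_iff in Lq; auto using j_P. now rewrite low_j in Lq.
    + assert (E : gl (j (low q)) u = gl q u).
      { apply (glue_restr Sj Uj Pj MU MP); auto using j_P, low_P. apply (ee_inj _ _ _ HM).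
        rewrite !Pj_restr_low by auto using j_P, low_P. apply low_j. now apply low_P. }
      unfold DB, NG. rewrite E. exact Dq.
Qed.

Lemma DB_mono y a p u p' u' : p ∈ P -> p' ∈ P -> upper u -> upper u' -> le p' p -> leup u' u -> DB y a p u -> DB y a p' u'.
Proof.
  intros Hp Hp' [Hu _] [Hu' _] L Lu H r Hr Lr. apply H; [auto|].
  apply lej_gl in Lr as [L1 L2]; auto. apply lej_gl; auto. split; [|eapply leup_trans; eauto].
  apply (le_transP _ p'); auto.
Qed.

Lemma DB_inst y a p u : open_name y -> p ∈ P -> upper u -> DB y a p u ->
  exists r, r ∈ Pj /\ lej r (gl (j p) u) /\ opair r (toM a) ∈ j y.
Proof.
  intros Hy Hp [Hu _] H. destruct (H (gl (j p) u)) as (r & Hr & L & K); eauto.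
  - apply gl_P; auto using j_P.
  - apply lej_refl. apply gl_P; auto using j_P.
Qed.

(** Both statements persist to [q] with a common pure upper part, where they contradict each
    other. *)
Lemma DB_NG y a p u p' u' q : p ∈ P -> p' ∈ P -> q ∈ P -> upper u -> upper u' -> le q p -> le q p' ->
  DB y a p u -> NG y a p' u' -> False.
Proof.
  intros Hp Hp' Hq Hu Hu' L L' H N. destruct (upper_meet u u' Hu Hu') as (w & Hw & Lw & Lw').
  assert (HD : DB y a q w) by (eapply (DB_mono y a p u); eauto).
  pose proof Hw as [Hw1 _]. pose proof Hu' as [Hu1 _].
  destruct (HD (gl (j q) w)) as (r & Hr & Lr & K).
  - apply gl_P; auto using j_P.
  - apply lej_refl, gl_P; auto using j_P.
  - apply (N r); auto. apply lej_gl in Lr as [L1 L2]; auto. apply lej_gl; auto. split.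
    + apply (le_transP _ q); auto.
    + eapply leup_trans; eauto.
Qed.

(* a name forced to contain [a] is nonempty, by elementarity of [j] *)
Lemma reflect_inter y y' a p u p' u' q : open_name y -> open_name y' -> a ∈ XX -> p ∈ P -> p' ∈ P -> q ∈ P -> upper u -> upper u' ->
  le q p -> le q p' -> DB y a p u -> DB y' a p' u' ->
  exists r x, r ∈ P /\ le r q /\ x ∈ DD /\ opair r x ∈ y /\ opair r x ∈ y'.
Proof.
  intros Hy Hy' Ha Hp Hp' Hq Hu Hu' L L' H H'.
  destruct (upper_meet u u' Hu Hu') as (w & Hw & Lw & Lw').
  destruct (upper_meet w (j q) Hw (j_upper q Hq)) as (v & Hv & Lv & Lv').
  assert (H1 : DB y a q v). { apply (DB_mono y a p u); auto. apply (leup_trans v w); auto. }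
  assert (H2 : DB y' a q v). { apply (DB_mono y' a p' u'); auto. apply (leup_trans v w); auto. }
  destruct (DB_inst y a q v Hy Hq Hv H1) as (r & Hr & Lr & K).
  destruct (H2 r Hr Lr) as (r' & Hr' & Lr' & K').
  apply (proj2 (tr (fun b e => exists r x, r ∈ e 0 /\ prikry_product_le (e 1) r (e 2) /\ x ∈ e 3 /\
    @opair _ (Z2' b) r x ∈ e 4 /\ @opair _ (Z2' b) r x ∈ e 5) ltac:(dfn)
    (scons P (scons S (scons q (scons DD (scons y (fun _ => y')))))))).
  cbn. exists r', (toM a). split; [auto|]. split; [|split; [|split]].
  - apply (lej_trans r' r); auto. pose proof Hv as [Hv1 _].
    apply lej_gl in Lr as [L1 L2]; auto. apply lej_iff; auto using j_P. rewrite low_j by auto. split; [auto|].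
    eapply leup_trans; eauto.
  - apply hM_down. rewrite hM_toM by now apply XX_M. now apply XX_jD.
  - apply (j_open y Hy r r'); auto.
  - auto.
Qed.

Lemma DB_ext y a y' b p u : (forall r, r ∈ Pj -> opair r (toM a) ∈ j y -> opair r (toM b) ∈ j y') ->
  DB y a p u -> DB y' b p u.
Proof.
  intros H K r Hr Lr. destruct (K r Hr Lr) as (r' & Hr' & Lr' & K'). exists r'. auto.
Qed.

(** All pairs [(c, b)] with [b] in [a] are decided by one pure upper part, so that the choice of [b]
    comes to depend on the lower condition alone. This is what will make the class of [(id, a)]
    collapse to [a]. *)
Lemma decide_value y c a p0 u0 : open_name y -> c ∈ XX -> a ∈ XX -> p0 ∈ P -> upper u0 ->
  (forall r, r ∈ Pj -> lej r (gl (j p0) u0) -> exists r' b, r' ∈ Pj /\ lej r' r /\ b ∈ a /\ opair r' (toM (opair c b)) ∈ j y) ->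
  forall p, p ∈ P -> le p p0 -> exists p' b, p' ∈ P /\ le p' p /\ b ∈ a /\ RR p' y (opair c b).
Proof.
  intros Hy Hc Ha Hp0 Hu0 H p Hp Lp.
  assert (HI : prod (sing c) a ∈ XX). { apply XX_prod; [|auto]. rewrite sing_upair. now apply XX_upair. }
  destruct (PD y (prod (sing c) a) Hy HI) as (u & Hu & K).
  destruct (upper_meet u u0 Hu Hu0) as (v & Hv & Lv & Lv').
  pose proof Hv as [Hv1 _]. pose proof Hu0 as [Hu01 _]. pose proof Hu as [Hu1 _].
  destruct (H (gl (j p) v)) as (r & b & Hr & Lr & Hb & Kr).
  { apply gl_P; auto using j_P. }
  { apply lej_gl; auto using gl_P, j_P. rewrite low_gl, low_j by auto using j_P. split; [auto|].
    apply (glue_le_up Sj MS kM kM_ord kM_S). auto. }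
  destruct (lej_gl r p v Hr Hp Hv1) as [HL _]. destruct (HL Lr) as [L1 L2].
  destruct (K (opair c b) (low r)) as (p' & Hp' & Lp' & D').
  { apply opair_in_prod. split; [now apply in_sing|auto]. } { now apply low_P. }
  exists p', b. split; [auto|]. split; [apply (le_transP _ (low r)); auto using low_P|]. split; [auto|].
  destruct D' as [D'|N]; [exists u; auto|exfalso].
  apply (N (gl (j p') r)).
  - apply gl_P; auto using j_P.
  - apply lej_gl; auto using gl_P, j_P. rewrite low_gl, low_j by auto using j_P. split; [now apply le_reflP|].
    apply (glue_le_up Sj MS kM kM_ord kM_S). eapply leup_trans; eauto.
  - apply (j_open y Hy r); auto using gl_P, j_P. apply gl_lej; auto. split; [auto|apply leup_refl].
Qed.

(** Here [p] is taken as an element of [M] and not moved by [j]. The order compares coordinates at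
    which both sides have a value, so [p] constrains only coordinates in [S]. *)
Lemma lej_toM r p : r ∈ Pj -> p ∈ P -> lej r (toM p) <-> le (low r) p.
Proof.
  intros Hr Hp. rewrite <- (h_product_le hM HM). rewrite hM_toM by (apply XX_M; now apply P_elem_XX).
  pose proof (P_fun S U P (gU_fun X) (gP_prod X) p Hp) as Fp.
  assert (Hco : forall a s A, a ∈ S -> coord (hM r) a s A <-> coord (low r) a s A).
  { intros a s A Ha. unfold coord. setoid_rewrite is_opair_iff. setoid_rewrite pair_mem_iff.
    split; intros (c & -> & H); exists (opair s A); (split; [auto|]).
    - apply in_low. split; [auto|now apply S_k].
    - now apply in_low in H. }
  assert (HaS : forall a s A, coord p a s A -> a ∈ S).
  { intros a s A (c & Hc & H). apply pair_mem_iff in H. eapply function_on_dom; eauto. }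
  unfold prikry_product_le. split.
  - intros H a s A t B Ha C1 C2. apply (H a); [|now apply Hco|auto].
    destruct (S_Sj a Ha) as (H1 & H2 & H3 & H4). rewrite <- H3. exact H1.
  - intros H a s A t B _ C1 C2. pose proof (HaS _ _ _ C2) as Ha. apply (H a); auto. now apply Hco.
Qed.

(** [t] names a sequence in [X] whose consecutive terms are related by what [y] names. The
    conclusion speaks of [P], [S], [p], [DD] and [y] only, so it may be checked in [M] for their
    images; there [t] itself serves as [t'], since [X] is included in [j DD], and [q] is [j p] with
    a suitable pure upper part. *)
Lemma reflect_sequence y t p : open_name y -> t ∈ XX -> p ∈ P ->
  (forall r1 n a, opair r1 (opair n a) ∈ t -> r1 ∈ P) ->
  (forall n r, n ∈ omega -> r ∈ P -> le r p -> exists r' r1 a, r' ∈ P /\ le r' r /\ opair r1 (opair n a) ∈ t /\ le r' r1) ->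
  (forall n r1 r2 a b r, n ∈ omega -> opair r1 (opair n a) ∈ t -> opair r2 (opair (succ n) b) ∈ t -> r ∈ P -> le r p ->
     le r r1 -> le r r2 -> exists r', r' ∈ P /\ le r' r /\ RR r' y (opair n (opair a b))) ->
  exists q t', q ∈ P /\ le q p /\
   (forall n q', n ∈ omega -> q' ∈ P -> le q' q -> exists q'' r1 a, q'' ∈ P /\ le q'' q' /\ a ∈ DD /\ opair r1 (opair n a) ∈ t' /\ le q'' r1) /\
   (forall n r1 r2 a b q', n ∈ omega -> opair r1 (opair n a) ∈ t' -> opair r2 (opair (succ n) b) ∈ t' -> a ∈ DD -> b ∈ DD -> q' ∈ P -> le q' q ->
     le q' r1 -> le q' r2 -> exists q'', q'' ∈ P /\ le q'' q' /\ opair q'' (opair n (opair a b)) ∈ y).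
Proof.
  intros Hy Ht Hp HtP H1 H2.
  apply (proj2 (tr (fun b e => exists q t', q ∈ e 0 /\ prikry_product_le (e 1) q (e 2) /\
   (forall n q', n ∈ @omega _ (Z2' b) -> q' ∈ e 0 -> prikry_product_le (e 1) q' q -> exists q'' r1 a, q'' ∈ e 0 /\ prikry_product_le (e 1) q'' q' /\ a ∈ e 3 /\ @opair _ (Z2' b) r1 (@opair _ (Z2' b) n a) ∈ t' /\ prikry_product_le (e 1) q'' r1) /\
   (forall n r1 r2 a c q', n ∈ @omega _ (Z2' b) -> @opair _ (Z2' b) r1 (@opair _ (Z2' b) n a) ∈ t' -> @opair _ (Z2' b) r2 (@opair _ (Z2' b) (@succ _ (Z2' b) n) c) ∈ t' -> a ∈ e 3 -> c ∈ e 3 -> q' ∈ e 0 -> prikry_product_le (e 1) q' q ->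
     prikry_product_le (e 1) q' r1 -> prikry_product_le (e 1) q' r2 -> exists q'', q'' ∈ e 0 /\ prikry_product_le (e 1) q'' q' /\ @opair _ (Z2' b) q'' (@opair _ (Z2' b) n (@opair _ (Z2' b) a c)) ∈ e 4)) ltac:(dfn)
    (scons P (scons S (scons p (scons DD (fun _ => y))))))).
  cbn [scons].
  (* Four unions lead from [(r1, (n, a))] down to [a], so all triples that have to be decided lie in
     one element of [X]. *)
  set (rt := cup (un (un (un (un t)))) omega).
  assert (Hun : forall z, z ∈ XX -> un z ∈ XX).
  { intros z Hz. apply in_XX in Hz. apply in_XX. eapply card_le_trans; [|exact Hz]. apply card_le_sub, trcl_min; [apply trcl_trans|].
    intros w Hw. apply in_un in Hw as (v & Hv & Hw). apply (trcl_trans z v); [now apply trcl_sub|auto]. }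
  assert (Hrt : rt ∈ XX).
  { apply XX_intro.
    - intros z Hz. apply in_cup in Hz as [Hz|Hz]; [apply (XX_trans X (un (un (un (un t)))))|apply (XX_trans X omega)]; auto using omega_XX.
    - apply card_cup_nu; apply card_XX; auto using omega_XX. }
  assert (Hta : forall r1 n a, opair r1 (opair n a) ∈ t -> a ∈ rt /\ a ∈ XX).
  { intros r1 n a H. split.
    - apply in_cup. left. apply in_un. exists (upair n a). split; [|apply in_upair; auto].
      apply in_un. exists (opair n a). split; [|apply upair_in_opair].
      apply in_un. exists (upair r1 (opair n a)). split; [|apply in_upair; auto].
      apply in_un. exists (opair r1 (opair n a)). split; [auto|apply upair_in_opair].
    - apply (XX_trans X t) in H; [|auto]. apply XX_opair_inv in H as [_ H]. now apply XX_opair_inv in H. }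
  destruct (PD y (prod rt (prod rt rt)) Hy) as (u & Hu & K). { auto using XX_prod. }
  destruct (upper_meet u (j p) Hu (j_upper p Hp)) as (v & Hv & Lv & Lv').
  pose proof Hv as [Hv1 _]. pose proof Hu as [Hu1 _].
  assert (Hq : gl (j p) v ∈ Pj) by auto using gl_P, j_P.
  assert (Hno : forall n, n ∈ @omega M _ -> hM n ∈ @omega V _). { intros n Hn. rewrite <- (h_omega hM HM). now apply hM_up. }
  assert (Hop : forall r1 n a, opair r1 (opair n a) ∈ toM t -> opair (hM r1) (opair (hM n) (hM a)) ∈ t).
  { intros r1 n a H. apply hM_up in H. now rewrite hM_toM, !(h_opair hM HM) in H by now apply XX_M. }
  exists (gl (j p) v), (toM t). split; [auto|]. split; [|split].
  - apply gl_lej; auto using j_P. rewrite low_j by auto. split; [now apply le_reflP|auto].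
  - intros n q' Hn Hq' Lq'. apply lej_gl in Lq' as [L1 L2]; auto.
    destruct (H1 (hM n) (low q')) as (r' & r1 & a & Hr' & Lr' & Hr1 & Lr1); auto using low_P.
    destruct (Hta _ _ _ Hr1) as [_ HaX]. pose proof (HtP _ _ _ Hr1) as Hr1P.
    exists (gl (j r') q'), (toM r1), (toM a). split; [auto using gl_P, j_P|]. split; [|split; [|split]].
    + apply gl_lej; auto. split; [auto|apply leup_refl].
    + apply hM_down. rewrite hM_toM by now apply XX_M. now apply XX_jD.
    + apply hM_down. rewrite !(h_opair hM HM), !hM_toM; auto using XX_M, P_elem_XX.
    + apply lej_toM; auto using gl_P, j_P. now rewrite low_gl, low_j by auto using j_P.
  - intros n r1 r2 a b q' Hn Hr1 Hr2 _ _ Hq' Lq' Lr1 Lr2.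
    apply Hop in Hr1, Hr2. rewrite (h_succ hM HM) in Hr2.
    destruct (Hta _ _ _ Hr1) as [HaR HaX], (Hta _ _ _ Hr2) as [HbR HbX].
    pose proof (HtP _ _ _ Hr1) as Hr1P. pose proof (HtP _ _ _ Hr2) as Hr2P.
    rewrite <- (toM_hM X r1) in Lr1. rewrite <- (toM_hM X r2) in Lr2.
    apply lej_toM in Lr1, Lr2; auto. apply lej_gl in Lq' as [L1 L2]; auto.
    destruct (H2 (hM n) (hM r1) (hM r2) (hM a) (hM b) (low q')) as (r' & Hr' & Lr' & u' & Hu' & D'); auto using low_P.
    destruct (K (opair (hM n) (opair (hM a) (hM b))) r') as (p' & Hp' & Lp' & D''); auto.
    { apply opair_in_prod. split; [apply in_cup; right; auto|]. apply opair_in_prod. auto. }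
    destruct D'' as [D''|N].
    2:{ exfalso. apply (DB_NG y (opair (hM n) (opair (hM a) (hM b))) r' u' p' u p'); auto using le_reflP. }
    destruct (D'' (gl (j p') q')) as (r & Hr & Lr & Kr).
    { auto using gl_P, j_P. }
    { apply lej_gl; auto using gl_P, j_P. rewrite low_gl, low_j by auto using j_P. split; [now apply le_reflP|].
      apply (glue_le_up Sj MS kM kM_ord kM_S). eapply leup_trans; eauto. }
    exists r. split; [auto|]. split.
    + apply (lej_trans r (gl (j p') q')); auto using gl_P, j_P. apply gl_lej; auto. split; [|apply leup_refl].
      apply (le_transP _ r'); auto.
    + replace (opair n (opair a b)) with (toM (opair (hM n) (opair (hM a) (hM b)))); [auto|].
      apply (ee_inj _ _ _ HM). rewrite !(h_opair hM HM), hM_toM; [auto|]. apply XX_M, XX_opair; [apply (XX_trans X omega (omega_XX X)); auto|auto using XX_opair].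
Qed.

End Forcing.

(** * Evaluation and names *)

Section Evaluation.
Context {V : structure} {Z : ZFC V}.
Implicit Types G f p r t u v w x y z : V.

Definition tc x : V := cup (trcl x) (sing x).

Lemma tc_self x : x ∈ tc x. Proof. apply in_cup. right. now apply in_sing. Qed.
Lemma tc_trans x : transitive (tc x).
Proof.
  intros y Hy z Hz. apply in_cup. left. apply in_cup in Hy as [Hy|Hy]; [apply (trcl_trans x y); auto|].
  apply in_sing in Hy. subst. now apply trcl_sub.
Qed.

Lemma trcl_cases x y : y ∈ trcl x -> exists z, z ∈ x /\ y ∈ tc z.
Proof.
  intros H.
  assert (K : subset (trcl x) (sep (trcl x) (fun y => exists z, z ∈ x /\ y ∈ tc z))).
  { apply trcl_min.
    - intros u Hu v Hv. unfold tc in *. rewrite in_sep in * by dclass. destruct Hu as (Hu & z & Hz & Huz).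
      split; [apply (trcl_trans x u); auto|]. exists z. split; [auto|]. apply (tc_trans z u); auto.
    - intros u Hu. unfold tc. rewrite in_sep by dclass. split; [now apply trcl_sub|]. exists u. split; [auto|apply tc_self]. }
  apply K in H. unfold tc in H. rewrite in_sep in H by dclass. apply H.
Qed.

(** A subname is reached through a Kuratowski pair, several membership steps down, so induction has
    to run along transitive closures. *)
Lemma trcl_induction (C : V -> Prop) : definable_class C ->
  (forall x, (forall y, y ∈ trcl x -> C y) -> C x) -> forall x, C x.
Proof.
  intros HC H x. apply class_Dfn in HC.
  assert (K : forall x, forall y, y ∈ tc x -> C y).
  { apply (mem_induction (fun x => forall y, y ∈ tc x -> C y)).
    - unfold tc. dclass.
    - intros u IH.
      assert (Hu : forall y, y ∈ trcl u -> C y).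
      { intros y Hy. apply trcl_cases in Hy as (z & Hz & Hy). eauto. }
      intros y Hy. apply in_cup in Hy as [Hy|Hy]; [auto|]. apply in_sing in Hy. subst. auto. }
  apply (K x x), tc_self.
Qed.

Lemma opair_trcl r p u : opair r p ∈ u -> r ∈ trcl u /\ p ∈ trcl u.
Proof.
  intros H. assert (K : upair r p ∈ trcl u).
  { apply (trcl_trans u (opair r p)); [now apply trcl_sub|apply upair_in_opair]. }
  split; apply (trcl_trans u (upair r p)); auto; apply in_upair; auto.
Qed.

Lemma evaluates_iff G x y : evaluates G x y <-> exists f t, transitive t /\ function_on f t /\
  (forall u v, opair u v ∈ f -> forall z, z ∈ v <-> exists r p, p ∈ G /\ opair r p ∈ u /\ opair r z ∈ f) /\
  x ∈ t /\ opair x y ∈ f.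
Proof.
  unfold evaluates. split; intros (f & t & H1 & H2 & H3 & H4 & H5); exists f, t;
    (split; [auto|split; [auto|split; [|split; [auto|now apply pair_mem_iff]]]]).
  - intros u v Huv z. rewrite (H3 u v) by now apply pair_mem_iff. now setoid_rewrite pair_mem_iff.
  - intros u v Huv z. apply pair_mem_iff in Huv. rewrite (H3 u v) by auto. now setoid_rewrite pair_mem_iff.
Qed.

Lemma evaluates_exists G x : exists y, evaluates G x y.
Proof.
  set (t := tc x).
  destruct (wf_rec t (fun r u => exists p, opair r p ∈ u)
    (fun u h => sep (ran h) (fun z => exists r p, p ∈ G /\ opair r p ∈ u /\ opair r z ∈ h))) as (F & FF & HF).
  { dfn. } { dfn. }
  { intros b Hb [m Hm]. apply NNPP. intros N. revert m Hm.
    apply (trcl_induction (fun m => ~ m ∈ b)); [dclass|]. intros m IH Hm. apply N. exists m. split; [auto|].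
    intros y Hy (p & Hp). apply (IH y); [|auto]. now apply opair_trcl in Hp. }
  exists (app F x). apply evaluates_iff. exists F, t. split; [apply tc_trans|]. split; [auto|].
  assert (Hx : x ∈ t) by apply tc_self.
  split; [|split; [auto|eapply app_mem; eauto]].
  intros u v Huv z. pose proof (function_on_dom _ _ _ _ FF Huv) as Hu. rewrite <- (app_val _ _ _ _ FF Huv).
  rewrite HF by auto. set (h := restr F (sep t (fun r => exists p, opair r p ∈ u))).
  assert (Hh : forall r w, opair r w ∈ h <-> opair r w ∈ F /\ exists p, opair r p ∈ u).
  { intros r w. unfold h. rewrite in_restr, in_sep by dclass. split; [tauto|]. intros [H1 H2].
    split; [auto|]. split; [eapply function_on_dom; eauto|auto]. }
  rewrite in_sep by dclass. rewrite in_ran. split.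
  - intros (_ & r & p & Hp & Hr & Hz). exists r, p. apply Hh in Hz. tauto.
  - intros (r & p & Hp & Hr & Hz). assert (K : opair r z ∈ h) by (apply Hh; eauto). split; eauto 6.
Qed.

Lemma evaluates_uniq G x y y' : evaluates G x y -> evaluates G x y' -> y = y'.
Proof.
  intros H H'. apply evaluates_iff in H as (f & t & T1 & F1 & E1 & X1 & Y1), H' as (f' & t' & T2 & F2 & E2 & X2 & Y2).
  assert (K : forall x, x ∈ t -> x ∈ t' -> app f x = app f' x).
  { apply (trcl_induction (fun x => x ∈ t -> x ∈ t' -> app f x = app f' x)); [dclass|].
    intros u IH Hu Hu'. pose proof (app_mem _ _ _ F1 Hu) as A1. pose proof (app_mem _ _ _ F2 Hu') as A2.
    assert (K : forall r p, opair r p ∈ u -> r ∈ t /\ r ∈ t' /\ app f r = app f' r).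
    { intros r p Hr. apply opair_trcl in Hr as [Hr _].
      assert (r ∈ t) by (apply (trcl_min u t); auto; intros z Hz; eapply T1; eauto).
      assert (r ∈ t') by (apply (trcl_min u t'); auto; intros z Hz; eapply T2; eauto). auto. }
    apply ext_eq. intros z. rewrite (E1 _ _ A1), (E2 _ _ A2). split; intros (r & p & Hp & Hr & Hz); exists r, p;
      (split; [auto|split; [auto|]]); destruct (K r p Hr) as (K1 & K2 & K3).
    - apply (app_val _ _ _ _ F1) in Hz. subst z. rewrite K3. eapply app_mem; eauto.
    - apply (app_val _ _ _ _ F2) in Hz. subst z. rewrite <- K3. eapply app_mem; eauto. }
  rewrite <- (app_val _ _ _ _ F1 Y1), <- (app_val _ _ _ _ F2 Y2). auto.
Qed.

Lemma evaluates_mem G x y : evaluates G x y ->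
  forall z, z ∈ y <-> exists r p, p ∈ G /\ opair r p ∈ x /\ evaluates G r z.
Proof.
  intros H z. pose proof H as H'. apply evaluates_iff in H' as (f & t & T1 & F1 & E1 & X1 & Y1). rewrite (E1 _ _ Y1).
  assert (K : forall r p, opair r p ∈ x -> r ∈ t).
  { intros r p Hr. apply opair_trcl in Hr as [Hr _]. apply (trcl_min x t); auto. }
  assert (K' : forall r w, opair r w ∈ f -> evaluates G r w).
  { intros r w Hr. apply evaluates_iff. exists f, t. pose proof (function_on_dom _ _ _ _ F1 Hr). auto 7. }
  split; intros (r & p & Hp & Hr & Hz); exists r, p; (split; [auto|split; [auto|]]).
  - auto.
  - pose proof (app_mem _ _ _ F1 (K r p Hr)) as A1. rewrite (evaluates_uniq G r z (app f r)); auto.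
Qed.

End Evaluation.

Section DfnEvaluates.
Context {I : Type} {Vs : I -> structure} {Cst : (forall i, Vs i) -> Prop} {Zf : forall i, ZFC (Vs i)}.
Lemma D_evaluates t u v : @Dt I Vs Cst t -> @Dt I Vs Cst u -> @Dt I Vs Cst v -> @Dfn I Vs Cst (fun i e => evaluates (t i e) (u i e) (v i e)).
Proof. intros. unfold evaluates. dfn. Qed.
End DfnEvaluates.
Ltac dfn_userH := lazymatch goal with |- Dfn (fun _ _ => evaluates _ _ _) => apply D_evaluates end.
Ltac dfn_user ::= first [dfn_userB | dfn_userB2 | dfn_userC | dfn_userD | dfn_userF | dfn_userH].

Lemma evaluates_up {A B : structure} {ZA : ZFC A} {ZB : ZFC B} (h : A -> B) (Hh : end_embedding A B h) G x y :
  evaluates G x y -> evaluates (h G) (h x) (h y).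
Proof.
  intros H. apply evaluates_iff in H as (f & t & T1 & F1 & E1 & X1 & Y1). apply evaluates_iff. exists (h f), (h t).
  split; [now apply (h_transitive h Hh)|]. split; [now apply (h_function_on h Hh)|].
  split; [|split; [now apply (ee_mem _ _ _ Hh)|now apply (h_opair_mem h Hh)]].
  intros u v Huv z. apply (h_pair_inv h Hh) in Huv as (u' & v' & -> & -> & Huv). rewrite (h_mem_iff h Hh). split.
  - intros (z' & -> & Hz). apply (E1 _ _ Huv) in Hz as (r & p & Hp & Hr & Hz). exists (h r), (h p).
    split; [now apply (ee_mem _ _ _ Hh)|]. split; now apply (h_opair_mem h Hh).
  - intros (r & p & Hp & Hr & Hz). apply (h_pair_inv h Hh) in Hr as (r' & p' & -> & -> & Hr).
    apply (h_pair_inv h Hh) in Hz as (r'' & z' & E & -> & Hz). apply (ee_inj _ _ _ Hh) in E. subst r''.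
    exists z'. split; [auto|]. apply (E1 _ _ Huv). exists r', p'. split; [now apply (ee_mem _ _ _ Hh)|auto].
Qed.

Record setupW := {
  wX :> setup;
  wW : structure;
  wi : gV wX -> wW;
  wG : wW;
  wgen : generic_extension (gV wX) (gP wX) (prikry_product_le (gS wX)) wW wi wG
}.

(** * Genericity and names for subsets of ground model sets *)

Section Names.
Context (Y : setupW).
Local Notation V := (gV (wX Y)).
Local Notation W := (wW Y).
Local Notation i := (wi Y).
Local Notation G := (wG Y).
Local Notation P := (gP (wX Y)).
Local Notation S := (gS (wX Y)).
Local Notation U := (gU (wX Y)).
Local Notation le := (prikry_product_le S).

#[export] Instance ZW : ZFC W := ge_ZFC _ _ _ _ _ _ (wgen Y).

Lemma Hi : end_embedding V W i.
Proof. split; [apply (ge_inj _ _ _ _ _ _ (wgen Y))|apply (ge_mem _ _ _ _ _ _ (wgen Y))|apply (ge_trans _ _ _ _ _ _ (wgen Y))]. Qed.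

Lemma i_mem x y : i x ∈ i y <-> x ∈ y. Proof. apply Hi. Qed.
Lemma i_inj x y : i x = i y -> x = y. Proof. apply Hi. Qed.

Lemma G_elem g : g ∈ G -> exists p, g = i p /\ p ∈ P.
Proof.
  intros H. apply (ge_sub _ _ _ _ _ _ (wgen Y)) in H. now apply (h_mem_iff i Hi).
Qed.
Lemma G_P p : i p ∈ G -> p ∈ P.
Proof. intros H. apply G_elem in H as (q & E & H). apply i_inj in E. now subst. Qed.
Lemma G_up p q : q ∈ P -> i p ∈ G -> le p q -> i q ∈ G.
Proof. intros Hq Hp L. apply (ge_up _ _ _ _ _ _ (wgen Y) p q); auto. now apply G_P. Qed.
Lemma G_meet p q : i p ∈ G -> i q ∈ G -> exists r, i r ∈ G /\ r ∈ P /\ le r p /\ le r q.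
Proof.
  intros Hp Hq. destruct (ge_directed _ _ _ _ _ _ (wgen Y) p q Hp Hq) as (r & Hr & L1 & L2). exists r. auto using G_P.
Qed.
Lemma G_inh : exists p, i p ∈ G.
Proof. destruct (ge_nonempty _ _ _ _ _ _ (wgen Y)) as (p & _ & H). eauto. Qed.

Local Notation lrefl := (le_reflP (wX Y)).
Local Notation ltrans := (le_transP (wX Y)).

(** Adding the conditions incompatible with [p] makes the set dense everywhere, and the filter
    cannot contain such a condition together with [p]. *)
Lemma gen_below (C : V -> Prop) p : Dfn1 V (fun _ e => C (e 0)) -> i p ∈ G ->
  (forall q, q ∈ P -> le q p -> exists r, r ∈ P /\ le r q /\ C r) ->
  exists r, i r ∈ G /\ r ∈ P /\ le r p /\ C r.
Proof.
  intros HC Hp H.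
  set (D := sep P (fun r => (le r p /\ C r) \/ ~ exists q, q ∈ P /\ le q r /\ le q p)).
  assert (HD : forall r, r ∈ D <-> r ∈ P /\ ((le r p /\ C r) \/ ~ exists q, q ∈ P /\ le q r /\ le q p)).
  { intros r. unfold D. rewrite in_sep; [tauto|]. dclass. }
  destruct (ge_generic _ _ _ _ _ _ (wgen Y) D) as (d & Hd & HG).
  - split; [intros r Hr; now apply HD in Hr|]. intros q Hq.
    destruct (classic (exists r, r ∈ P /\ le r q /\ le r p)) as [(r & Hr & L1 & L2)|N].
    + destruct (H r Hr L2) as (r' & Hr' & L3 & K). exists r'. split; [|apply (ltrans _ r); auto].
      apply HD. split; [auto|]. left. split; [apply (ltrans _ r); auto|auto].
    + exists q. split; [apply HD; auto|now apply lrefl].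
  - apply HD in Hd as [Hd [[L K]|N]]; [exists d; auto|exfalso]. apply N.
    destruct (G_meet d p HG Hp) as (r & _ & Hr & L1 & L2). eauto.
Qed.

Lemma gen_dense (C : V -> Prop) : Dfn1 V (fun _ e => C (e 0)) ->
  (forall q, q ∈ P -> exists r, r ∈ P /\ le r q /\ C r) -> exists r, i r ∈ G /\ r ∈ P /\ C r.
Proof.
  intros HC H. destruct G_inh as [p Hp]. destruct (gen_below C p HC Hp) as (r & H1 & H2 & _ & H3); eauto.
Qed.

(* [F] is the set of all [(p, π, e)], [π ∈ t], [e ∈ t'], such that [p] forces the
   value of [π] to be the ground model set [e].  Existence: greatest fixed point. *)
Local Definition step (F z : V) : Prop := exists p n e, z = opair p (opair n e) /\
  (forall n' s q, opair n' s ∈ n -> s ∈ P -> q ∈ P -> le q p -> le q s ->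
     exists r e', r ∈ P /\ le r q /\ e' ∈ e /\ opair r (opair n' e') ∈ F) /\
  (forall e' q, e' ∈ e -> q ∈ P -> le q p ->
     exists r n' s, r ∈ P /\ le r q /\ opair n' s ∈ n /\ s ∈ P /\ le r s /\ opair r (opair n' e') ∈ F).

Lemma step_mono F F' z : subset F F' -> step F z -> step F' z.
Proof.
  intros HF (p & n & e & -> & H1 & H2). exists p, n, e. split; [auto|]. split.
  - intros n' s q A1 A2 A3 A4 A5. destruct (H1 n' s q A1 A2 A3 A4 A5) as (r & e' & B1 & B2 & B3 & B4). eauto 8.
  - intros e' q A1 A2 A3. destruct (H2 e' q A1 A2 A3) as (r & n' & s & B1 & B2 & B3 & B4 & B5 & B6).
    exists r, n', s. auto 8.
Qed.

Lemma value_forcing t t' : exists F, forall p n e, opair p (opair n e) ∈ F <->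
  p ∈ P /\ n ∈ t /\ e ∈ t' /\ step F (opair p (opair n e)).
Proof.
  assert (DS : Dfn1 V (fun _ e => step (e 0) (e 1))) by (unfold step; dfn).
  set (K := prod P (prod t t')).
  set (B := sep (pow K) (fun R => forall z, z ∈ R -> step R z)).
  assert (HB : forall R, R ∈ B <-> subset R K /\ forall z, z ∈ R -> step R z).
  { intros R. unfold B. rewrite in_sep by dclass. now rewrite in_pow. }
  assert (H1 : forall z, z ∈ un B -> z ∈ K /\ step (un B) z).
  { intros z Hz. apply in_un in Hz as (R & HR & Hz). pose proof HR as HR'. apply HB in HR as [HR HS]. split; [auto|].
    apply (step_mono R); auto. intros w Hw. apply in_un. eauto. }
  assert (H2 : forall z, z ∈ K -> step (un B) z -> z ∈ un B).
  { intros z Hz Hs. apply in_un. exists (cup (un B) (sing z)). split; [|apply in_cup; right; now apply in_sing].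
    apply HB. split.
    - intros w Hw. apply in_cup in Hw as [Hw|Hw]; [now apply H1|]. apply in_sing in Hw. now subst.
    - intros w Hw. apply (step_mono (un B)); [intros v Hv; apply in_cup; auto|].
      apply in_cup in Hw as [Hw|Hw]; [now apply H1|]. apply in_sing in Hw. now subst. }
  exists (un B). intros p n e. split.
  - intros H. apply H1 in H as [H Hs]. unfold K in H. rewrite !opair_in_prod in H. tauto.
  - intros (A1 & A2 & A3 & A4). apply H2; [|auto]. unfold K. rewrite !opair_in_prod. auto.
Qed.

(** Induction on names, carried out in [W], where [G] lives. If the value is [e], genericity has to
    exclude the two ways of preventing this: under [C2] a member of the name avoids [e], under [C3]
    an element of [e] is never reached. *)
Lemma value_truth t t' F : transitive t -> transitive t' ->
  (forall p n e, opair p (opair n e) ∈ F <-> p ∈ P /\ n ∈ t /\ e ∈ t' /\ step F (opair p (opair n e))) ->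
  forall n e, n ∈ t -> e ∈ t' -> evaluates G (i n) (i e) <-> exists p, i p ∈ G /\ opair p (opair n e) ∈ F.
Proof.
  intros Tt Tt' HF.
  assert (Fdown : forall p q n e, q ∈ P -> le q p -> opair p (opair n e) ∈ F -> opair q (opair n e) ∈ F).
  { intros p q n e Hq L H. apply HF in H as (A1 & A2 & A3 & p0 & n0 & e0 & E & S1 & S2).
    apply opair_inj in E as [<- E]. apply opair_inj in E as [<- <-].
    apply HF. split; [auto|]. split; [auto|]. split; [auto|]. exists q, n, e. split; [auto|]. split.
    - intros n' s r B1 B2 B3 B4 B5. apply (S1 n' s r); auto. apply (ltrans _ q); auto.
    - intros e' r B1 B2 B3. apply S2; auto. apply (ltrans _ q); auto. }
  assert (Main : forall w, w ∈ i t -> forall v, v ∈ i t' -> evaluates G w v <-> exists p, p ∈ G /\ opair p (opair w v) ∈ i F).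
  2:{ intros n e Hn He. rewrite (Main (i n)) by now apply i_mem. split.
      - intros (g & Hg & H). apply G_elem in Hg as Hg'. destruct Hg' as (p & -> & Hp).
        rewrite <- !(h_opair i Hi) in H. apply i_mem in H. eauto.
      - intros (p & Hp & H). exists (i p). rewrite <- !(h_opair i Hi), i_mem. auto. }
  apply (trcl_induction (fun w => w ∈ i t -> forall v, v ∈ i t' -> evaluates G w v <-> exists p, p ∈ G /\ opair p (opair w v) ∈ i F)); [dclass|].
  intros w IH Hw v Hv. apply (h_mem_iff i Hi) in Hw as (n & -> & Hn), Hv as (e & -> & He).
  assert (IH' : forall n' s e', opair n' s ∈ n -> e' ∈ e ->
    evaluates G (i n') (i e') <-> exists p, i p ∈ G /\ opair p (opair n' e') ∈ F).
  { intros n' s e' Hs He'. rewrite (IH (i n')).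
    - split.
      + intros (g & Hg & H). apply G_elem in Hg as Hg'. destruct Hg' as (p & -> & Hp).
        rewrite <- !(h_opair i Hi) in H. apply i_mem in H. eauto.
      + intros (p & Hp & H). exists (i p). rewrite <- !(h_opair i Hi), i_mem. auto.
    - apply (opair_trcl _ (i s)). now apply (h_opair_mem i Hi).
    - apply i_mem. apply opair_trcl in Hs as [Hs _]. apply (trcl_min n t); auto.
    - apply i_mem. apply (Tt' e); auto. }
  transitivity (exists p, i p ∈ G /\ opair p (opair n e) ∈ F).
  2:{ split.
      - intros (p & Hp & H). exists (i p). rewrite <- !(h_opair i Hi), i_mem. auto.
      - intros (g & Hg & H). apply G_elem in Hg as Hg'. destruct Hg' as (p & -> & Hp).
        rewrite <- !(h_opair i Hi) in H. apply i_mem in H. eauto. }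
  split.
  - intros Hev.
    set (C1 := fun r => opair r (opair n e) ∈ F).
    set (C2 := fun r => exists n' s, opair n' s ∈ n /\ s ∈ P /\ le r s /\ forall r' e', r' ∈ P -> le r' r -> e' ∈ e -> ~ opair r' (opair n' e') ∈ F).
    set (C3 := fun r => exists e', e' ∈ e /\ forall r' n' s, r' ∈ P -> le r' r -> opair n' s ∈ n -> s ∈ P -> le r' s -> ~ opair r' (opair n' e') ∈ F).
    destruct (gen_dense (fun r => C1 r \/ C2 r \/ C3 r)) as (r & Gr & Hr & C).
    { unfold C1, C2, C3. dfn. }
    { intros q Hq. apply NNPP. intros N.
      assert (N1 : ~ exists r, r ∈ P /\ le r q /\ C2 r) by (intros (r & ? & ? & ?); apply N; eauto 6).
      assert (N2 : ~ exists r, r ∈ P /\ le r q /\ C3 r) by (intros (r & ? & ? & ?); apply N; eauto 6).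
      apply N. exists q. split; [auto|]. split; [now apply lrefl|]. left. apply HF. split; [auto|]. split; [auto|]. split; [auto|].
      exists q, n, e. split; [auto|]. split.
      - intros n' s q' A1 A2 A3 A4 A5. apply NNPP. intros N'. apply N1. exists q'. split; [auto|]. split; [auto|].
        exists n', s. split; [auto|]. split; [auto|]. split; [auto|]. intros r' e' B1 B2 B3 B4. apply N'. eauto 6.
      - intros e' q' A1 A2 A3. apply NNPP. intros N'. apply N2. exists q'. split; [auto|]. split; [auto|].
        exists e'. split; [auto|]. intros r' n' s B1 B2 B3 B4 B5 B6. apply N'. exists r', n', s. auto 7. }
    destruct C as [C|[(n' & s & Hs & HsP & L & C)|(e' & He' & C)]].
    + exists r. auto.
    + exfalso. assert (Gs : i s ∈ G) by (apply (G_up r); auto).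
      destruct (evaluates_exists G (i n')) as [w Hw].
      assert (Hwe : w ∈ i e). { apply (evaluates_mem _ _ _ Hev). exists (i n'), (i s). rewrite (h_opair_mem i Hi). auto. }
      apply (h_mem_iff i Hi) in Hwe as (e' & -> & He'). apply (IH' n' s e' Hs He') in Hw as (p & Gp & HpF).
      destruct (G_meet p r Gp Gr) as (r' & _ & Hr' & L1 & L2). apply (C r' e'); auto. apply (Fdown p); auto.
    + exfalso. assert (K : i e' ∈ i e) by now apply i_mem. apply (evaluates_mem _ _ _ Hev) in K as (a & b & Hb & Hab & Hw).
      apply (h_pair_inv i Hi) in Hab as (n' & s & -> & -> & Hs). apply (IH' n' s e' Hs He') in Hw as (p & Gp & HpF).
      destruct (G_meet p r Gp Gr) as (r1 & G1 & Hr1 & L1 & L2). destruct (G_meet r1 s G1 Hb) as (r' & _ & Hr' & L3 & L4).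
      apply (C r' n' s); auto using G_P.
      * apply (ltrans _ r1); auto.
      * apply (Fdown p); auto. apply (ltrans _ r1); auto.
  - intros (p & Gp & Hp). apply HF in Hp as (A1 & A2 & A3 & p0 & n0 & e0 & E & S1 & S2).
    apply opair_inj in E as [<- E]. apply opair_inj in E as [<- <-].
    destruct (evaluates_exists G (i n)) as [y Hy]. replace (i e) with y; [auto|].
    apply ext_eq. intros w. rewrite (evaluates_mem _ _ _ Hy). split.
    + intros (a & b & Hb & Hab & Hw). apply (h_pair_inv i Hi) in Hab as (n' & s & -> & -> & Hs).
      destruct (G_meet p s Gp Hb) as (q & Gq & Hq & L1 & L2).
      destruct (gen_below (fun r => exists e', e' ∈ e /\ opair r (opair n' e') ∈ F) q) as (r & Gr & _ & _ & e' & He' & K).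
      { dfn. } { auto. }
      { intros q' Hq' L'. destruct (S1 n' s q' Hs (G_P s Hb) Hq') as (r & e' & B1 & B2 & B3 & B4).
        - apply (ltrans _ q); auto.
        - apply (ltrans _ q); auto.
        - exists r. eauto. }
      rewrite (evaluates_uniq G (i n') w (i e')); [now apply i_mem|auto|]. apply (IH' n' s e'); eauto.
    + intros Hw. apply (h_mem_iff i Hi) in Hw as (e' & -> & He').
      destruct (gen_below (fun r => exists n' s, opair n' s ∈ n /\ s ∈ P /\ le r s /\ opair r (opair n' e') ∈ F) p) as (r & Gr & Hr & _ & n' & s & B1 & B2 & B3 & B4).
      { dfn. } { auto. }
      { intros q Hq L. destruct (S2 e' q He' Hq L) as (r & n' & s & B1 & B2 & B3 & B4 & B5 & B6). exists r. eauto 10. }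
      exists (i n'), (i s). split; [apply (G_up r); auto|]. split; [now apply (h_opair_mem i Hi)|]. apply (IH' n' s e'); eauto.
Qed.

Local Notation open_name := (open_name (wX Y)).

(* the set named by [y], a set of pairs (condition, ground model element) *)
Definition nval (y : V) : W := sep (ran (i y)) (fun w => exists g, g ∈ G /\ opair g w ∈ i y).

Lemma in_nval y w : w ∈ nval y <-> exists p d, w = i d /\ i p ∈ G /\ opair p d ∈ y.
Proof.
  unfold nval. rewrite in_sep by dclass. rewrite in_ran. split.
  - intros (_ & g & Hg & H). apply (h_pair_inv i Hi) in H as (p & d & -> & -> & H). eauto 6.
  - intros (p & d & -> & Hp & H). apply (h_opair_mem i Hi) in H. split; eauto.
Qed.

Lemma nval_i y d : i d ∈ nval y <-> exists p, i p ∈ G /\ opair p d ∈ y.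
Proof.
  rewrite in_nval. split.
  - intros (p & d' & E & H). apply i_inj in E. subst. eauto.
  - intros (p & H). eauto.
Qed.

(** Stands in for the forcing theorem. A condition [p] puts [d] into the new name when it is below a
    condition attached to some [n] in an arbitrary name of the set and forces the value of [n] to be
    [d]. *)
Theorem subset_name B (A : W) : subset A (i B) -> exists y, open_name y /\ subset y (prod P B) /\ nval y = A.
Proof.
  intros HA. destruct (ge_generated _ _ _ _ _ _ (wgen Y) A) as [x Hx].
  set (t := tc x). set (t' := trcl B).
  destruct (value_forcing t t') as [F HF].
  pose proof (value_truth t t' F (tc_trans x) (trcl_trans B) HF) as T.
  set (y := sep (prod P B) (fun z => exists p d n s, z = opair p d /\ opair n s ∈ x /\ s ∈ P /\ le p s /\ opair p (opair n d) ∈ F)).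
  assert (Hy : forall p d, opair p d ∈ y <-> p ∈ P /\ d ∈ B /\ exists n s, opair n s ∈ x /\ s ∈ P /\ le p s /\ opair p (opair n d) ∈ F).
  { intros p d. unfold y. rewrite in_sep by dclass. rewrite opair_in_prod. split.
    - intros ((H1 & H2) & p' & d' & n & s & E & K). apply opair_inj in E as [<- <-]. eauto 8.
    - intros (H1 & H2 & n & s & K). split; [auto|]. exists p, d, n, s. auto. }
  assert (Hnt : forall n s, opair n s ∈ x -> n ∈ t). { intros n s H. apply in_cup. left. now apply opair_trcl in H. }
  exists y. split; [|split].
  - intros q r d Hq Hr L H. apply Hy in H as (_ & Hd & n & s & H1 & H2 & H3 & H4). apply Hy. split; [auto|]. split; [auto|].
    exists n, s. split; [auto|]. split; [auto|]. split; [apply (ltrans _ q); auto|].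
    apply HF in H4 as (A1 & A2 & A3 & p0 & n0 & e0 & E & S1 & S2).
    apply opair_inj in E as [<- E]. apply opair_inj in E as [<- <-].
    apply HF. split; [auto|]. split; [auto|]. split; [auto|]. exists r, n, d. split; [auto|]. split.
    + intros n' s' r' B1 B2 B3 B4 B5. apply (S1 n' s' r'); auto. apply (ltrans _ r); auto.
    + intros e' r' B1 B2 B3. apply S2; auto. apply (ltrans _ r); auto.
  - intros z Hz. unfold y in Hz. rewrite in_sep in Hz by dclass. tauto.
  - apply ext_eq. intros w. rewrite in_nval. split.
    + intros (p & d & -> & Gp & H). apply Hy in H as (Hp & Hd & n & s & H1 & H2 & H3 & H4).
      apply (evaluates_mem _ _ _ Hx). exists (i n), (i s). split; [apply (G_up p); auto|].
      split; [now apply (h_opair_mem i Hi)|]. apply (T n d); eauto. now apply trcl_sub.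
    + intros Hw. pose proof (HA w Hw) as HwB. apply (h_mem_iff i Hi) in HwB as (d & -> & Hd).
      apply (evaluates_mem _ _ _ Hx) in Hw as (a & b & Hb & Hab & Hw).
      apply (h_pair_inv i Hi) in Hab as (n & s & -> & -> & Hs).
      apply (T n d) in Hw as (p & Gp & Hp); [|eauto|now apply trcl_sub].
      destruct (G_meet p s Gp Hb) as (q & Gq & Hq & L1 & L2). exists q, d. split; [auto|]. split; [auto|].
      apply Hy. split; [auto|]. split; [auto|]. exists n, s. split; [auto|]. split; [now apply G_P|]. split; [auto|].
      apply HF in Hp as (A1 & A2 & A3 & p0 & n0 & e0 & E & S1 & S2).
      apply opair_inj in E as [<- E]. apply opair_inj in E as [<- <-].
      apply HF. split; [auto|]. split; [auto|]. split; [auto|]. exists q, n, d. split; [auto|]. split.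
      * intros n' s' r' B1 B2 B3 B4 B5. apply (S1 n' s' r'); auto. apply (ltrans _ q); auto.
      * intros e' r' B1 B2 B3. apply S2; auto. apply (ltrans _ q); auto.
Qed.

End Names.

(** * The extender in the generic extension *)

Section Extender.
Context (Y : setupW).
Local Notation X := (wX Y).
Local Notation V := (gV (wX Y)).
Local Notation M := (substructure (gV (wX Y)) (gM (wX Y))).
Local Notation W := (wW Y).
Local Notation i := (wi Y).
Local Notation G := (wG Y).
Local Notation P := (gP (wX Y)).
Local Notation S := (gS (wX Y)).
Local Notation j := (gj (wX Y)).
Local Notation k := (kap (wX Y)).
Local Notation le := (prikry_product_le S).
Local Notation lej := (prikry_product_le (j S)).
Local Notation Pj := (j P).
Local Notation DD := (DD (wX Y)).
Local Notation XX := (XX (wX Y)).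
Local Notation toM := (toM (wX Y)).
Local Notation hM := (hM (wX Y)).
Local Notation jj := (jj (wX Y)).
Local Notation RR := (RR (wX Y)).
Local Notation DB := (DB (wX Y)).
Local Notation NG := (NG (wX Y)).
Local Notation upper := (upper (wX Y)).
Local Notation open_name := (open_name (wX Y)).
Local Notation nval := (nval Y).
Local Notation lrefl := (le_reflP (wX Y)).
Local Notation ltrans := (le_transP (wX Y)).
Local Notation Hi := (Hi Y).
Local Notation HM := (hM_end (wX Y)).

#[local] Instance Z2'' : forall b, ZFC (two V M b) | 100 := two_ZFC V M (gZ X) (ZM X).
Local Notation tr := (transfer j (gj_elem X)).
Local Notation "<< x , y >>" := (@opair _ (Z2'' _) x y) (at level 0, x at level 99).

Definition pname (y : V) : Prop := open_name y /\ subset y (prod P DD).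

Lemma D_pname : Dfn1 V (fun _ e => pname (e 0)).
Proof. pose proof (D_open_name X). unfold pname. dfn. Qed.

(** [j] and [M] are classes of [V] which [W] need not be able to define. The ultrafilters involve
    only names included in [P × D] and seeds in [X], so the relevant part of [RR] is a set, and its
    image under [i] is a parameter available in [W]. *)
Definition R0 : V := sep (prod P (prod (pow (prod P DD)) XX))
  (fun z => exists p y a, z = opair p (opair y a) /\ pname y /\ RR p y a).

Lemma in_R0 p y a : opair p (opair y a) ∈ R0 <-> p ∈ P /\ a ∈ XX /\ pname y /\ RR p y a.
Proof.
  pose proof D_pname. pose proof (D_RR X).
  unfold R0. rewrite in_sep by dclass. rewrite !opair_in_prod, in_pow. split.
  - intros ((H1 & H2 & H3) & p' & y' & a' & E & H4). apply opair_inj in E as [<- E]. apply opair_inj in E as [<- <-]. tauto.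
  - intros (H1 & H2 & H3 & H4). split; [split; [auto|split; [apply H3|auto]]|]. exists p, y, a. auto.
Qed.

Definition EE (A a : W) : Prop := exists p y, p ∈ G /\ opair p (opair y a) ∈ i R0 /\
  A = sep (ran y) (fun w => exists g, g ∈ G /\ opair g w ∈ y).

Lemma D_EE : Dfn1 W (fun _ e => EE (e 0) (e 1)).
Proof. unfold EE. dfn. Qed.

Lemma EE_iff A a : EE A (i a) <-> a ∈ XX /\ exists p y, i p ∈ G /\ pname y /\ RR p y a /\ A = nval y.
Proof.
  unfold EE. split.
  - intros (g & w & Hg & H & E). apply (h_pair_inv i Hi) in H as (p & z & -> & Ez & H).
    apply (h_opair_inv i Hi) in Ez as (y & a' & -> & Ea & ->). apply (i_inj Y) in Ea. subst a'.
    apply in_R0 in H as (H1 & H2 & H3 & H4). split; [auto|]. exists p, y. auto.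
  - intros (Ha & p & y & Hp & Hy & HR & ->). exists (i p), (i y). split; [auto|]. split; [|reflexivity].
    rewrite <- !(h_opair i Hi). apply (i_mem Y). apply in_R0. eauto using G_P.
Qed.

Lemma nval_sub y : subset y (prod P DD) -> subset (nval y) (i DD).
Proof.
  intros H w Hw. apply in_nval in Hw as (p & d & -> & _ & Hd). apply (i_mem Y). apply H in Hd.
  now apply opair_in_prod in Hd.
Qed.

Lemma EE_sub A a : EE A (i a) -> subset A (i DD) /\ a ∈ XX.
Proof. intros H. apply EE_iff in H as (Ha & p & y & _ & [_ Hy] & _ & ->). split; [now apply nval_sub|auto]. Qed.

Lemma RR_mono p p' y a : p ∈ P -> p' ∈ P -> le p' p -> RR p y a -> RR p' y a.
Proof.
  intros Hp Hp' L (u & Hu & H). exists u. split; [auto|]. apply (DB_mono X y a p u); auto. apply leup_refl.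
Qed.

Lemma subset_pname A : subset A (i DD) -> exists y, pname y /\ nval y = A.
Proof. intros H. destruct (subset_name Y DD A H) as (y & H1 & H2 & H3). exists y. split; [now split|auto]. Qed.

Definition neg (y : V) : V := sep (prod P DD) (fun z => exists p d, z = opair p d /\ forall r, r ∈ P -> le r p -> opair r d ∉ y).

Lemma in_neg y p d : opair p d ∈ neg y <-> p ∈ P /\ d ∈ DD /\ forall r, r ∈ P -> le r p -> opair r d ∉ y.
Proof.
  unfold neg. rewrite in_sep by dclass. rewrite opair_in_prod. split.
  - intros ((H1 & H2) & p' & d' & E & H). apply opair_inj in E as [<- <-]. auto.
  - intros (H1 & H2 & H). split; [auto|]. eauto.
Qed.

Lemma neg_pname y : pname (neg y).
Proof.
  split.
  - intros q r d Hq Hr L H. apply in_neg in H as (_ & Hd & H). apply in_neg. split; [auto|]. split; [auto|].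
    intros r' Hr' L'. apply H; auto. apply (ltrans _ r); auto.
  - intros z Hz. unfold neg in Hz. rewrite in_sep in Hz by dclass. tauto.
Qed.

Lemma nval_neg y : pname y -> nval (neg y) = diff (i DD) (nval y).
Proof.
  intros [Hy Sy]. apply ext_eq. intros w. rewrite in_diff, in_nval. split.
  - intros (p & d & -> & Gp & H). apply in_neg in H as (Hp & Hd & H). split; [now apply (i_mem Y)|].
    rewrite nval_i. intros (q & Gq & Hq). destruct (G_meet Y p q Gp Gq) as (r & _ & Hr & L1 & L2).
    apply (H r Hr L1). apply (Hy q r); auto using G_P.
  - intros [Hw Nw]. apply (h_mem_iff i Hi) in Hw as (d & -> & Hd).
    destruct (gen_dense Y (fun p => opair p d ∈ y \/ opair p d ∈ neg y)) as (p & Gp & Hp & [H|H]).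
    { dfn. }
    { intros q Hq. destruct (classic (exists r, r ∈ P /\ le r q /\ opair r d ∈ y)) as [(r & Hr & L & H)|N]; [eauto|].
      exists q. split; [auto|]. split; [now apply lrefl|]. right. apply in_neg. split; [auto|]. split; [auto|].
      intros r Hr L H. apply N. eauto. }
    + exfalso. apply Nw. apply nval_i. eauto.
    + exists p, d. auto.
Qed.

Lemma j_neg y r d : opair r d ∈ j (neg y) <-> r ∈ Pj /\ d ∈ j DD /\ forall r', r' ∈ Pj -> lej r' r -> opair r' d ∉ j y.
Proof.
  exact (proj1 (tr (fun b e => forall p d, << p, d >> ∈ e 0 <-> p ∈ e 1 /\ d ∈ e 2 /\ forall r, r ∈ e 1 -> prikry_product_le (e 3) r p -> << r, d >> ∉ e 4)
    ltac:(dfn) (scons (neg y) (scons P (scons DD (scons S (fun _ => y)))))) (in_neg y) r d).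
Qed.

Lemma toM_jD a : a ∈ XX -> toM a ∈ j DD.
Proof. intros H. apply hM_down. rewrite hM_toM by now apply XX_M. now apply XX_jD. Qed.

Lemma NG_DB y a p u : a ∈ XX -> p ∈ P -> upper u -> NG y a p u -> DB (neg y) a p u.
Proof.
  intros Ha Hp [Hu _] H r Hr L. exists r. split; [auto|]. split; [now apply lej_refl|]. apply j_neg.
  split; [auto|]. split; [now apply toM_jD|]. intros r' Hr' L'. apply H; auto.
  apply (lej_trans X r' r); auto.
Qed.

Lemma sing_XX a : a ∈ XX -> sing a ∈ XX.
Proof. intros H. rewrite sing_upair. now apply XX_upair. Qed.

(** The pure upper part from [PD] makes the deciding conditions dense in [P], and genericity finds
    one in [G]. *)
Lemma E_dich y a : pname y -> a ∈ XX -> exists p, i p ∈ G /\ (RR p y a \/ RR p (neg y) a).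
Proof.
  intros [Hy Sy] Ha. pose proof (D_RR X).
  destruct (PD X y (sing a) Hy (sing_XX a Ha)) as (u & Hu & K).
  destruct (gen_dense Y (fun p => RR p y a \/ RR p (neg y) a)) as (p & Gp & Hp & H1).
  { dfn. }
  { intros q Hq. destruct (K a q) as (r & Hr & L & D); [now apply in_sing|auto|]. exists r. split; [auto|]. split; [auto|].
    destruct D as [D|D]; [left|right]; exists u; auto using NG_DB. }
  exists p. auto.
Qed.

Lemma E_inhab A a : EE A (i a) -> exists d, d ∈ DD /\ i d ∈ A.
Proof.
  intros H. apply EE_iff in H as (Ha & p & y & Gp & [Hy Sy] & (u & Hu & H) & ->).
  destruct (gen_below Y (fun r => exists d, d ∈ DD /\ opair r d ∈ y) p) as (r & Gr & Hr & _ & d & Hd & K).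
  { dfn. } { auto. }
  { intros q Hq L. destruct (reflect_inter X y y a p u p u q) as (r & x & H1 & H2 & H3 & H4 & _); auto using G_P.
    exists r. eauto. }
  exists d. split; [auto|]. apply nval_i. eauto.
Qed.

Lemma nval_cap y y' : open_name y -> open_name y' -> nval (cap y y') = cap (nval y) (nval y').
Proof.
  intros Hy Hy'. apply ext_eq. intros w. rewrite in_cap, !in_nval. split.
  - intros (p & d & -> & Gp & H). apply in_cap in H as [H1 H2]. split; exists p, d; auto.
  - intros ((p & d & -> & Gp & H) & (p' & d' & E & Gp' & H')). apply (i_inj Y) in E. subst d'.
    destruct (G_meet Y p p' Gp Gp') as (r & Gr & Hr & L1 & L2). exists r, d. split; [auto|]. split; [auto|].
    apply in_cap. split; [apply (Hy p)|apply (Hy' p')]; auto using G_P.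
Qed.

Lemma E_inter A B a : EE A (i a) -> EE B (i a) -> EE (cap A B) (i a).
Proof.
  intros H1 H2. apply EE_iff in H1 as (Ha & p & y & Gp & [Hy Sy] & (u & Hu & H1) & ->).
  apply EE_iff in H2 as (_ & p' & y' & Gp' & [Hy' Sy'] & (u' & Hu' & H2) & ->).
  apply EE_iff. split; [auto|]. destruct (G_meet Y p p' Gp Gp') as (q & Gq & Hq & L1 & L2).
  exists q, (cap y y'). split; [auto|]. split; [|split; [|symmetry; now apply nval_cap]].
  - split.
    + intros s r d Hs Hr L H. apply in_cap in H as [H H']. apply in_cap. split; [apply (Hy s)|apply (Hy' s)]; auto.
    + intros z Hz. apply in_cap in Hz as [Hz _]. auto.
  - destruct (upper_meet X u u' Hu Hu') as (w & Hw & Lw & Lw'). exists w. split; [auto|].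
    assert (K1 : DB y a q w) by (apply (DB_mono X y a p u); auto using G_P).
    assert (K2 : DB y' a q w) by (apply (DB_mono X y' a p' u'); auto using G_P).
    intros r Hr L. destruct (K1 r Hr L) as (r1 & Hr1 & L1' & I1).
    destruct (K2 r1 Hr1) as (r2 & Hr2 & L2' & I2). { apply (lej_trans X r1 r); auto. }
    exists r2. split; [auto|]. split; [apply (lej_trans X r2 r1); auto|].
    apply (proj2 (proj1 (tr (fun b e => forall z, z ∈ e 0 <-> z ∈ e 1 /\ z ∈ e 2) ltac:(dfn) (scons (cap y y') (scons y (fun _ => y'))))
      (in_cap y y') (opair r2 (toM a)))). cbn [scons]. split; [|auto]. apply (j_open X y Hy r1); auto.
Qed.

Lemma E_up A B a : EE A (i a) -> subset A B -> subset B (i DD) -> EE B (i a).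
Proof.
  intros H HAB HB. destruct (subset_pname B HB) as (y' & [Hy' Sy'] & <-).
  apply EE_iff in H as (Ha & p & y & Gp & [Hy Sy] & (u & Hu & H) & ->).
  (* The union of the names contains [y] outright, so what is forced about [y] carries over by
     [DB_ext]; as the first set is included in the second, the union still names the second. *)
  apply EE_iff. split; [auto|]. exists p, (cup y y'). split; [auto|]. split; [|split].
  - split.
    + intros s r d Hs Hr L K. apply in_cup in K. apply in_cup. destruct K; [left; apply (Hy s)|right; apply (Hy' s)]; auto.
    + intros z Hz. apply in_cup in Hz as []; auto.
  - exists u. split; [auto|]. apply (DB_ext X y a); auto. intros r Hr K.
    apply (proj2 (proj1 (tr (fun b e => forall z, z ∈ e 0 <-> z ∈ e 1 \/ z ∈ e 2) ltac:(dfn) (scons (cup y y') (scons y (fun _ => y'))))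
      (in_cup y y') (opair r (toM a)))). cbn [scons]. auto.
  - apply ext_eq. intros w. split; intros Hw.
    + apply in_nval in Hw as (q & d & -> & Gq & K). apply in_nval. exists q, d. rewrite in_cup. auto.
    + apply in_nval in Hw as (q & d & -> & Gq & K). apply in_cup in K as [K|K].
      * apply HAB. apply in_nval. eauto.
      * apply in_nval. eauto.
Qed.

Lemma E_ultra A a : subset A (i DD) -> a ∈ XX -> EE A (i a) \/ EE (diff (i DD) A) (i a).
Proof.
  intros HA Ha. destruct (subset_pname A HA) as (y & Hy & <-). destruct (E_dich y a Hy Ha) as (p & Gp & [H|H]); [left|right].
  - apply EE_iff. split; [auto|]. exists p, y. auto.
  - rewrite <- nval_neg by auto. apply EE_iff. split; [auto|]. exists p, (neg y). auto using neg_pname.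
Qed.

Lemma E_disjoint A B a : EE A (i a) -> EE B (i a) -> exists d, d ∈ DD /\ i d ∈ A /\ i d ∈ B.
Proof.
  intros H1 H2. destruct (E_inhab _ _ (E_inter _ _ _ H1 H2)) as (d & Hd & K). apply in_cap in K as []. eauto.
Qed.

(** Membership was defined through some name; every other name of the same set works too, since
    otherwise the complement would belong to the ultrafilter as well. *)
Lemma E_any y a : pname y -> EE (nval y) (i a) -> exists p, i p ∈ G /\ RR p y a.
Proof.
  intros Hy H. destruct (EE_sub _ _ H) as [_ Ha]. destruct (E_dich y a Hy Ha) as (p & Gp & [K|K]); [eauto|exfalso].
  assert (K' : EE (nval (neg y)) (i a)). { apply EE_iff. split; [auto|]. exists p, (neg y). auto using neg_pname. }
  rewrite nval_neg in K' by auto. destruct (E_disjoint _ _ _ H K') as (d & _ & H1 & H2). apply in_diff in H2. tauto.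
Qed.

(** The ultrafilters extend those derived from [j] in [V]; the constant name [P × B] shows this. *)
Lemma E_ground B a : subset B DD -> a ∈ XX -> a ∈ jj B -> EE (i B) (i a).
Proof.
  intros HB Ha Haj. apply EE_iff. split; [auto|]. destruct (G_inh Y) as [p Gp]. pose proof (G_P Y p Gp) as Hp.
  exists p, (prod P B). split; [auto|]. split; [|split].
  - split.
    + intros q r d Hq Hr L H. apply opair_in_prod in H as [_ H]. now apply opair_in_prod.
    + intros z Hz. apply in_prod in Hz as (q & d & Hq & Hd & ->). apply opair_in_prod. auto.
  - exists (j p). split; [now apply j_upper|]. intros r Hr L. exists r. split; [auto|]. split; [now apply lej_refl|].
    apply (proj2 (proj1 (tr (fun b e => forall x y, << x, y >> ∈ e 0 <-> x ∈ e 1 /\ y ∈ e 2) ltac:(dfn) (scons (prod P B) (scons P (fun _ => B))))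
      (opair_in_prod P B) r (toM a))). cbn [scons]. split; [auto|]. apply hM_down. now rewrite hM_toM by now apply XX_M.
  - apply ext_eq. intros w. rewrite (h_mem_iff i Hi), in_nval. split.
    + intros (d & -> & Hd). exists p, d. rewrite opair_in_prod. auto.
    + intros (q & d & -> & _ & H). apply opair_in_prod in H as []. eauto.
Qed.

Definition preim (r : V) (A : W) : W := sep (i DD) (fun x => exists v, v ∈ A /\ opair x v ∈ i r).

Lemma in_preim r A x : x ∈ preim r A <-> x ∈ i DD /\ exists v, v ∈ A /\ opair x v ∈ i r.
Proof. unfold preim. rewrite in_sep; [tauto|dclass]. Qed.

Lemma E_proj1 r A a b : a ∈ XX -> opair a b ∈ jj r -> EE A (i b) -> EE (preim r A) (i a).
Proof.
  intros Ha Hab H. apply EE_iff in H as (Hb & p & y & Gp & [Hy Sy] & (u & Hu & H) & ->).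
  set (y' := sep (prod P DD) (fun z => exists q x v, z = opair q x /\ opair x v ∈ r /\ opair q v ∈ y)).
  assert (Hy' : forall q x, opair q x ∈ y' <-> q ∈ P /\ x ∈ DD /\ exists v, opair x v ∈ r /\ opair q v ∈ y).
  { intros q x. unfold y'. rewrite in_sep by dclass. rewrite opair_in_prod. split.
    - intros ((H1 & H2) & q' & x' & v & E & K). apply opair_inj in E as [<- <-]. eauto.
    - intros (H1 & H2 & v & K). split; [auto|]. exists q, x, v. auto. }
  apply EE_iff. split; [auto|]. exists p, y'. split; [auto|]. split; [|split].
  - split.
    + intros s q d Hs Hq L K. apply Hy' in K as (_ & Hd & v & K1 & K2). apply Hy'. split; [auto|]. split; [auto|].
      exists v. split; [auto|]. apply (Hy s); auto.
    + intros z Hz. unfold y' in Hz. rewrite in_sep in Hz by dclass. tauto.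
  - exists u. split; [auto|]. apply (DB_ext X y b); auto. intros s Hs K.
    apply (proj2 (proj1 (tr (fun c e => forall q x, << q, x >> ∈ e 0 <-> q ∈ e 1 /\ x ∈ e 2 /\ exists v, << x, v >> ∈ e 3 /\ << q, v >> ∈ e 4)
      ltac:(dfn) (scons y' (scons P (scons DD (scons r (fun _ => y)))))) Hy' s (toM a))).
    cbn [scons]. split; [auto|]. split; [now apply toM_jD|]. exists (toM b). split; [|auto].
    apply hM_down. rewrite (h_opair hM HM), !hM_toM; auto using XX_M.
  - apply ext_eq. intros w. rewrite in_preim, in_nval. split.
    + intros (Hw & v & Hv & K). apply (h_pair_inv i Hi) in K as (x & v' & -> & -> & K).
      apply nval_i in Hv as (q & Gq & Hq). exists q, x. split; [auto|]. split; [auto|]. apply Hy'.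
      split; [now apply (G_P Y)|]. split; [now apply (i_mem Y)|]. eauto.
    + intros (q & x & -> & Gq & K). apply Hy' in K as (_ & Hx & v & K1 & K2). split; [now apply (i_mem Y)|].
      exists (i v). split; [apply nval_i; eauto|now apply (h_opair_mem i Hi)].
Qed.

(** Coherence. For the direction not covered by [E_proj1], the complement would pull back as well,
    but for functional [r] the two preimages are disjoint. *)
Lemma E_proj r A a b : (forall x v v', opair x v ∈ r -> opair x v' ∈ r -> v = v') -> subset A (i DD) ->
  a ∈ XX -> b ∈ XX -> opair a b ∈ jj r -> EE (preim r A) (i a) <-> EE A (i b).
Proof.
  intros Hr HA Ha Hb Hab. split; [|now apply E_proj1]. intros H.
  destruct (E_ultra A b HA Hb) as [K|K]; [auto|exfalso].
  apply (E_proj1 r _ a b Ha Hab) in K. destruct (E_disjoint _ _ _ H K) as (d & _ & H1 & H2).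
  apply in_preim in H1 as (_ & v & Hv & H1), H2 as (_ & v' & Hv' & H2).
  apply in_diff in Hv' as [_ Hv']. apply Hv'.
  apply (h_pair_inv i Hi) in H1 as (x & z & E & -> & H1). apply (h_pair_inv i Hi) in H2 as (x' & z' & E' & -> & H2).
  apply (i_inj Y) in E, E'. subst. now rewrite (Hr _ _ _ H2 H1).
Qed.

Lemma DD_opair x y : opair x y ∈ DD <-> x ∈ DD /\ y ∈ DD.
Proof.
  split.
  - intros H. assert (K : upair x y ∈ DD) by (apply (Hset_trans k (k_ord X) _ H), upair_in_opair).
    split; apply (Hset_trans k (k_ord X) _ K); apply in_upair; auto.
  - intros [H1 H2]. apply Hset_opair; auto using k_sl.
Qed.

Lemma DD_trans : transitive DD. Proof. apply Hset_trans, k_ord. Qed.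

Lemma XX_toM_elem a b : a ∈ XX -> b ∈ toM a -> exists b', b = toM b' /\ b' ∈ a.
Proof.
  intros Ha Hb. apply hM_up in Hb. rewrite hM_toM in Hb by now apply XX_M. exists (hM b). split; [symmetry; apply toM_hM|auto].
Qed.

Lemma toM_opair a b : a ∈ XX -> b ∈ XX -> toM (opair a b) = opair (toM a) (toM b).
Proof.
  intros Ha Hb. apply (ee_inj _ _ _ HM). rewrite (h_opair hM HM), !hM_toM; auto using XX_M, XX_opair.
Qed.

(** In terms of the ultrapower: a class below that of the identity at [a] is the class of the
    identity at some [b] in [a]. The element [b] is decided by a condition in [G] through
    [decide_value]. *)
Lemma E_value A c a : subset A (i DD) -> c ∈ XX -> a ∈ XX ->
  EE (sep (i DD) (fun z => exists x' x v, z = opair x' x /\ v ∈ x /\ opair x' v ∈ A)) (i (opair c a)) ->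
  exists b, b ∈ a /\ EE A (i (opair c b)).
Proof.
  intros HA Hc Ha H. destruct (subset_pname A HA) as (y & [Hy Sy] & <-).
  set (y' := sep (prod P DD) (fun z => exists q x' x v, z = opair q (opair x' x) /\ v ∈ x /\ opair q (opair x' v) ∈ y)).
  assert (Hy' : forall q x' x, opair q (opair x' x) ∈ y' <-> q ∈ P /\ opair x' x ∈ DD /\ exists v, v ∈ x /\ opair q (opair x' v) ∈ y).
  { intros q x' x. unfold y'. rewrite in_sep by dclass. rewrite opair_in_prod. split.
    - intros ((H1 & H2) & q0 & x0' & x0 & v & E & K). apply opair_inj in E as [<- E]. apply opair_inj in E as [<- <-]. eauto.
    - intros (H1 & H2 & v & K). split; [auto|]. exists q, x', x, v. auto. }
  assert (Ny' : pname y').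
  { split.
    - intros s q d Hs Hq L K. pose proof K as K'. unfold y' in K'. rewrite in_sep in K' by dclass.
      destruct K' as (_ & q0 & x' & x & v & E & _). apply opair_inj in E as [_ ->].
      apply Hy' in K as (_ & Hd & v' & K1 & K2). apply Hy'. split; [auto|]. split; [auto|]. exists v'. split; [auto|]. apply (Hy s); auto.
    - intros z Hz. unfold y' in Hz. rewrite in_sep in Hz by dclass. tauto. }
  assert (Ey' : nval y' = sep (i DD) (fun z => exists x' x v, z = opair x' x /\ v ∈ x /\ opair x' v ∈ nval y)).
  { apply ext_eq. intros w. rewrite in_nval, in_sep by dclass. split.
    - intros (q & d & -> & Gq & K). pose proof K as K'. unfold y' in K'. rewrite in_sep in K' by dclass.
      destruct K' as (_ & q0 & x' & x & v & E & _). apply opair_inj in E as [_ ->]. clear v.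
      apply Hy' in K as (_ & Hd & v & K1 & K2). split; [now apply (i_mem Y)|].
      exists (i x'), (i x), (i v). rewrite (h_opair i Hi). split; [auto|]. split; [now apply (i_mem Y)|].
      rewrite <- (h_opair i Hi). apply nval_i. eauto.
    - intros (Hw & u' & u & v & -> & Hv & K). apply (h_mem_iff i Hi) in Hw as (d & E & Hd).
      apply (h_opair_inv i Hi) in E as (x' & x & -> & -> & ->). apply (h_mem_iff i Hi) in Hv as (v' & -> & Hv).
      rewrite <- (h_opair i Hi) in K. apply nval_i in K as (q & Gq & Hq). exists q, (opair x' x).
      rewrite (h_opair i Hi). split; [auto|]. split; [auto|]. apply Hy'. split; [now apply (G_P Y)|eauto]. }
  rewrite <- Ey' in H. destruct (E_any y' (opair c a) Ny' H) as (p & Gp & u & Hu & D).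
  pose proof (D_RR X) as DR.
  destruct (gen_below Y (fun q => exists b, b ∈ a /\ RR q y (opair c b)) p) as (q & Gq & Hq & _ & b & Hb & K).
  { dfn. } { auto. }
  { intros q Hq L.
    destruct (decide_value X y c a p u Hy Hc Ha (G_P Y p Gp) Hu) with (p := q) as (p' & b & H1 & H2 & H3 & H4); [|auto|auto|exists p'; eauto].
    intros r Hr Lr. destruct (D r Hr Lr) as (r' & Hr' & Lr' & K). rewrite toM_opair in K by auto.
    apply (proj1 (proj1 (tr (fun b e => forall q x' x, << q, << x', x >> >> ∈ e 0 <-> q ∈ e 1 /\ << x', x >> ∈ e 2 /\ exists v, v ∈ x /\ << q, << x', v >> >> ∈ e 3)
      ltac:(dfn) (scons y' (scons P (scons DD (fun _ => y))))) Hy' r' (toM c) (toM a))) in K.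
    destruct K as (_ & _ & v & Hv & K). cbn [scons] in K. apply XX_toM_elem in Hv as (b & -> & Hb); [|auto].
    exists r', b. split; [auto|]. split; [auto|]. split; [auto|]. rewrite toM_opair; auto. apply (XX_trans X a); auto. }
  exists b. split; [auto|]. apply EE_iff. split; [apply XX_opair; auto; apply (XX_trans X a); auto|].
  exists q, y. split; [auto|]. split; [now split|]. auto.
Qed.

(** The seed is the condition [p] itself. A condition of [j P] puts [p] into [j y] exactly when its
    lower part is below [p], so the ultrafilter at [p] knows whether [p] is in [G]; this will
    recover [G] in the ultrapower. *)
Lemma E_G : exists y, pname y /\ (forall x, x ∈ DD -> i x ∈ nval y <-> exists q, i q ∈ G /\ le q x) /\
  forall p, p ∈ P -> EE (nval y) (i p) <-> i p ∈ G.
Proof.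
  set (y := sep (prod P DD) (fun z => exists r x, z = opair r x /\ le r x)).
  assert (Hy : forall r x, opair r x ∈ y <-> r ∈ P /\ x ∈ DD /\ le r x).
  { intros r x. unfold y. rewrite in_sep by dclass. rewrite opair_in_prod. split.
    - intros ((H1 & H2) & r' & x' & E & K). apply opair_inj in E as [<- <-]. auto.
    - intros (H1 & H2 & K). split; [auto|]. eauto. }
  assert (Ny : pname y).
  { split.
    - intros q r x Hq Hr L H. apply Hy in H as (_ & Hx & H). apply Hy. split; [auto|]. split; [auto|]. apply (ltrans _ q); auto.
    - intros z Hz. unfold y in Hz. rewrite in_sep in Hz by dclass. tauto. }
  pose proof (proj1 (tr (fun b e => forall r x, << r, x >> ∈ e 0 <-> r ∈ e 1 /\ x ∈ e 2 /\ prikry_product_le (e 3) r x)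
      ltac:(dfn) (scons y (scons P (scons DD (fun _ => S))))) Hy) as Hj. cbn [scons] in Hj.
  exists y. split; [auto|]. split.
  - intros x Hx. rewrite nval_i. split.
    + intros (q & Gq & Hq). apply Hy in Hq. exists q. tauto.
    + intros (q & Gq & L). exists q. split; [auto|]. apply Hy. auto using G_P.
  - intros p Hp. assert (HpX : p ∈ XX) by now apply P_elem_XX. split; intros H.
    + apply NNPP. intros N.
      destruct (gen_dense Y (fun q => le q p \/ ~ exists r, r ∈ P /\ le r q /\ le r p)) as (q & Gq & Hq & [K|K]).
      { dfn. }
      { intros q Hq. destruct (classic (exists r, r ∈ P /\ le r q /\ le r p)) as [(r & Hr & L1 & L2)|N']; [eauto|].
        exists q. split; [auto|]. split; [now apply lrefl|]. auto. }
      { apply N. apply (G_up Y q); auto. }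
      assert (HN : EE (nval (neg y)) (i p)).
      { apply EE_iff. split; [auto|]. exists q, (neg y). split; [auto|]. split; [apply neg_pname|]. split; [|auto].
        exists (j q). pose proof (j_upper X q Hq) as Hu. split; [auto|]. apply NG_DB; auto.
        intros r Hr L HrY. apply Hj in HrY as (_ & _ & L'). apply (lej_toM X) in L'; auto.
        apply (lej_gl X) in L as [L _]; auto using j_P. apply K. exists (low X r). auto using low_P. }
      rewrite nval_neg in HN by auto. destruct (E_disjoint _ _ _ H HN) as (d & _ & H1 & H2). apply in_diff in H2. tauto.
    + apply EE_iff. split; [auto|]. exists p, y. split; [auto|]. split; [auto|]. split; [|auto].
      exists (j p). pose proof (j_upper X p Hp) as Hu. split; [auto|]. intros r Hr L. exists r. split; [auto|].
      split; [now apply lej_refl|]. apply Hj. split; [auto|]. split; [now apply toM_jD|].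
      apply (lej_toM X); auto. apply (lej_gl X) in L as [L _]; auto using j_P.
Qed.

(** Otherwise a condition in [G] puts two different values at one argument into the name, and both
    are realized. *)
Lemma functional_name t B A : open_name t -> subset t (prod P (prod A B)) ->
  (forall n a b, opair n a ∈ nval t -> opair n b ∈ nval t -> a = b) ->
  exists p, i p ∈ G /\ p ∈ P /\ forall r n a b, r ∈ P -> le r p -> opair r (opair n a) ∈ t -> opair r (opair n b) ∈ t -> a = b.
Proof.
  intros Ht St Hf.
  destruct (gen_dense Y (fun p => (forall r n a b, r ∈ P -> le r p -> opair r (opair n a) ∈ t -> opair r (opair n b) ∈ t -> a = b) \/
    exists n a b, a <> b /\ opair p (opair n a) ∈ t /\ opair p (opair n b) ∈ t)) as (p & Gp & Hp & [H|(n & a & b & Ne & H1 & H2)]).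
  - dfn.
  - intros q Hq. apply NNPP. intros N. apply N. exists q. split; [auto|]. split; [now apply lrefl|]. left.
    intros r n a b Hr L H1 H2. apply NNPP. intros Ne. apply N. exists r. split; [auto|]. split; [auto|]. right. exists n, a, b. auto.
  - eauto.
  - exfalso. apply Ne. apply (i_inj Y). apply (Hf (i n)); rewrite <- (h_opair i Hi); apply nval_i; eauto.
Qed.

(** Below [p] a condition and an argument determine the value, so the restricted name has at most as
    many elements as [P × A]. *)
Lemma small_name t p A : A ∈ XX -> subset t (prod P (prod A XX)) -> p ∈ P ->
  (forall r n a b, r ∈ P -> le r p -> opair r (opair n a) ∈ t -> opair r (opair n b) ∈ t -> a = b) ->
  sep t (fun z => le (fst z) p) ∈ XX.
Proof.
  intros HA St Hp Hf. apply XX_intro.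
  - intros z Hz. rewrite in_sep in Hz by dclass. destruct Hz as [Hz _]. apply St in Hz.
    apply in_prod in Hz as (r & y & Hr & Hy & ->). apply in_prod in Hy as (n & a & Hn & Ha & ->).
    apply XX_opair; [now apply P_elem_XX|]. apply XX_opair; [apply (XX_trans X A); auto|auto].
  - eapply card_le_trans; [|apply (card_XX X (prod P A)); apply XX_prod; auto using P_XX].
    apply card_le_fun with (fun z => opair (fst z) (fst (snd z))).
    + dfn.
    + intros z Hz. rewrite in_sep in Hz by dclass. destruct Hz as [Hz _]. apply St in Hz.
      apply in_prod in Hz as (r & y & Hr & Hy & ->). apply in_prod in Hy as (n & a & Hn & Ha & ->).
      rewrite fst_opair, snd_opair, fst_opair. now apply opair_in_prod.
    + intros z z' Hz Hz'. rewrite in_sep in Hz, Hz' by dclass. destruct Hz as [Hz L], Hz' as [Hz' L'].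
      pose proof (St _ Hz) as K. pose proof (St _ Hz') as K'.
      apply in_prod in K as (r & y & Hr & Hy & ->), K' as (r' & y' & Hr' & Hy' & ->).
      apply in_prod in Hy as (n & a & Hn & Ha & ->), Hy' as (n' & a' & Hn' & Ha' & ->).
      rewrite !fst_opair, !snd_opair, !fst_opair in *. intros E. apply opair_inj in E as [<- <-]. f_equal. f_equal. eauto.
Qed.

(** The countable completeness behind well-foundedness. The sequence of seeds may be new in [W], so
    a name of it in [X] is taken and reflected by [reflect_sequence], densely below a condition in
    [G] that forces the hypotheses. *)
Lemma E_seq (T B : W) : function_on T omega -> (forall n, n ∈ omega -> app T n ∈ i XX) -> subset B (prod omega (i DD)) ->
  (forall n, n ∈ omega -> EE (sep (i DD) (fun z => opair n z ∈ B)) (opair (app T n) (app T (succ n)))) ->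
  exists T', subset T' (prod omega (i DD)) /\ (forall n, n ∈ omega -> exists a, opair n a ∈ T') /\
    forall n a b, opair n a ∈ T' -> opair (succ n) b ∈ T' -> opair n (opair a b) ∈ B.
Proof.
  intros FT HT HB HE. pose proof (h_omega i Hi) as Eo.
  assert (SB : subset B (i (prod omega DD))) by now rewrite (h_prod i Hi), Eo.
  destruct (subset_name Y _ _ SB) as (y & Hy & Sy & Ey).
  assert (ST : subset T (i (prod omega XX))).
  { intros z Hz. destruct (function_on_elem _ _ _ FT Hz) as (n & v & Hn & ->). rewrite (h_prod i Hi), Eo. apply opair_in_prod.
    split; [auto|]. rewrite <- (app_val _ _ _ _ FT Hz). auto. }
  destruct (subset_name Y _ _ ST) as (t & Ht & St & Et).
  destruct (functional_name t XX omega Ht St) as (p0 & G0 & Hp0 & F0).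
  { intros n a b H1 H2. rewrite Et in *. eapply function_on_uniq; eauto. }
  set (t0 := sep t (fun z => le (fst z) p0)).
  assert (Ht0 : t0 ∈ XX) by (apply (small_name t p0 omega); auto using omega_XX).
  assert (In0 : forall r1 n a, opair r1 (opair n a) ∈ t0 <-> opair r1 (opair n a) ∈ t /\ le r1 p0).
  { intros. unfold t0. rewrite in_sep by dclass. rewrite fst_opair. tauto. }
  assert (P0 : forall r1 n a, opair r1 (opair n a) ∈ t0 -> r1 ∈ P /\ n ∈ omega /\ a ∈ XX).
  { intros r1 n a H. apply In0 in H as [H _]. apply St in H. rewrite !opair_in_prod in H. tauto. }
  assert (Tn : forall r1 n a, i r1 ∈ G -> opair r1 (opair n a) ∈ t0 -> app T (i n) = i a).
  { intros r1 n a Gr H. apply In0 in H as [H _]. apply app_val with omega; [auto|]. rewrite <- Et, <- (h_opair i Hi). apply nval_i. eauto. }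
  assert (Ino : forall n, n ∈ omega -> i n ∈ omega). { intros n Hn. rewrite <- Eo. now apply (i_mem Y). }
  pose proof (D_RR X) as DR.
  (* [H1] says that the sequence is forced to be total, [H2] that consecutive terms are forced to
     satisfy the measure one condition. Each holds for some condition in [G], because a condition
     deciding the contrary would conflict with the actual sequence. *)
  set (H1 := fun p => forall n r, n ∈ omega -> r ∈ P -> le r p -> exists r' r1 a, r' ∈ P /\ le r' r /\ opair r1 (opair n a) ∈ t0 /\ le r' r1).
  set (H2 := fun p => forall n r1 r2 a b r, n ∈ omega -> opair r1 (opair n a) ∈ t0 -> opair r2 (opair (succ n) b) ∈ t0 -> r ∈ P -> le r p ->
     le r r1 -> le r r2 -> exists r', r' ∈ P /\ le r' r /\ RR r' y (opair n (opair a b))).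
  assert (D1 : Dfn1 V (fun _ e => H1 (e 0))) by (unfold H1; dfn).
  assert (D2 : Dfn1 V (fun _ e => H2 (e 0))) by (unfold H2; dfn).
  assert (Ex1 : exists p, i p ∈ G /\ p ∈ P /\ H1 p).
  { destruct (gen_dense Y (fun p => H1 p \/ exists n, n ∈ omega /\ forall r' r1 a, r' ∈ P -> le r' p -> opair r1 (opair n a) ∈ t0 -> ~ le r' r1)) as (p & Gp & Hp & [K|(n & Hn & K)]).
    - dfn.
    - intros q Hq. apply NNPP. intros N. apply N. exists q. split; [auto|]. split; [now apply lrefl|]. left.
      intros n r Hn Hr L. apply NNPP. intros N'. apply N. exists r. split; [auto|]. split; [auto|]. right. exists n. split; [auto|].
      intros r' r1 a Hr' L' H L''. apply N'. exists r', r1, a. auto.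
    - eauto.
    - exfalso. pose proof (app_mem _ _ _ FT (Ino n Hn)) as Hap. pose proof (HT _ (Ino n Hn)) as Hx.
      apply (h_mem_iff i Hi) in Hx as (a & Ea & Ha). rewrite Ea in Hap.
      rewrite <- Et, <- (h_opair i Hi) in Hap. apply nval_i in Hap as (r & Gr & Hr).
      destruct (G_meet Y r p0 Gr G0) as (r1 & Gr1 & Hr1 & L1 & L2). destruct (G_meet Y r1 p Gr1 Gp) as (r' & _ & Hr' & L3 & L4).
      apply (K r' r1 a); auto. apply In0. split; [|auto]. apply (Ht r); auto using G_P. }
  assert (Ex2 : exists p, i p ∈ G /\ p ∈ P /\ H2 p).
  { destruct (gen_dense Y (fun p => H2 p \/ exists n r1 r2 a b, n ∈ omega /\ opair r1 (opair n a) ∈ t0 /\ opair r2 (opair (succ n) b) ∈ t0 /\ le p r1 /\ le p r2 /\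
      forall r', r' ∈ P -> le r' p -> ~ RR r' y (opair n (opair a b)))) as (p & Gp & Hp & [K|(n & r1 & r2 & a & b & Hn & K1 & K2 & L1 & L2 & K)]).
    - dfn.
    - intros q Hq. apply NNPP. intros N. apply N. exists q. split; [auto|]. split; [now apply lrefl|]. left.
      intros n r1 r2 a b r Hn A1 A2 Hr L L1 L2. apply NNPP. intros N'. apply N. exists r. split; [auto|]. split; [auto|]. right.
      exists n, r1, r2, a, b. repeat (split; [auto|]). intros r' Hr' L' HR. apply N'. eauto.
    - eauto.
    - exfalso. destruct (P0 _ _ _ K1) as (Hr1 & _ & Ha), (P0 _ _ _ K2) as (Hr2 & _ & Hb).
      assert (Gr1 : i r1 ∈ G) by (apply (G_up Y p); auto). assert (Gr2 : i r2 ∈ G) by (apply (G_up Y p); auto).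
      specialize (HE (i n) (Ino n Hn)). rewrite (Tn _ _ _ Gr1 K1), <- (h_succ i Hi), (Tn _ _ _ Gr2 K2), <- (h_opair i Hi) in HE.
      set (yn := sep (prod P DD) (fun z => exists q x, z = opair q x /\ opair q (opair n x) ∈ y)).
      assert (Hyn : forall q x, opair q x ∈ yn <-> q ∈ P /\ x ∈ DD /\ opair q (opair n x) ∈ y).
      { intros q x. unfold yn. rewrite in_sep by dclass. rewrite opair_in_prod. split.
        - intros ((A1 & A2) & q' & x' & E & A3). apply opair_inj in E as [<- <-]. auto.
        - intros (A1 & A2 & A3). split; [auto|]. eauto. }
      assert (Nyn : pname yn).
      { split.
        - intros s q x Hs Hq L H. apply Hyn in H as (_ & A2 & A3). apply Hyn. split; [auto|]. split; [auto|]. apply (Hy s); auto.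
        - intros z Hz. unfold yn in Hz. rewrite in_sep in Hz by dclass. tauto. }
      assert (Eyn : nval yn = sep (i DD) (fun z => opair (i n) z ∈ B)).
      { apply ext_eq. intros w. rewrite in_nval, in_sep by dclass. split.
        - intros (q & x & -> & Gq & H). apply Hyn in H as (_ & A2 & A3). split; [now apply (i_mem Y)|].
          rewrite <- Ey, <- (h_opair i Hi). apply nval_i. eauto.
        - intros [Hw Hb']. apply (h_mem_iff i Hi) in Hw as (x & -> & Hx). rewrite <- Ey, <- (h_opair i Hi) in Hb'.
          apply nval_i in Hb' as (q & Gq & H). exists q, x. split; [auto|]. split; [auto|]. apply Hyn. auto using G_P. }
      rewrite <- Eyn in HE. destruct (E_any yn _ Nyn HE) as (p' & Gp' & u & Hu & HD).
      destruct (G_meet Y p p' Gp Gp') as (r' & _ & Hr' & L3 & L4). apply (K r'); auto.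
      apply (RR_mono p'); auto using G_P. exists u. split; [auto|]. apply (DB_ext X yn (opair a b)); auto.
      intros r Hr HrY.
      apply (proj1 (proj1 (tr (fun b e => forall q x, << q, x >> ∈ e 0 <-> q ∈ e 1 /\ x ∈ e 2 /\ << q, << e 3, x >> >> ∈ e 4)
        ltac:(dfn) (scons yn (scons P (scons DD (scons n (fun _ => y)))))) Hyn r (toM (opair a b)))) in HrY.
      destruct HrY as (_ & _ & HrY). cbn [scons] in HrY.
      rewrite toM_opair by (auto using XX_opair; apply (XX_trans X omega); auto using omega_XX).
      replace (toM n) with (j n); [auto|]. rewrite <- (toM_jj X n). f_equal. now apply jj_nat. }
  destruct Ex1 as (p1 & Gp1 & Hp1 & K1), Ex2 as (p2 & Gp2 & Hp2 & K2).
  destruct (G_meet Y p1 p2 Gp1 Gp2) as (p & Gp & Hp & L1 & L2).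
  set (C := fun q t' =>
    (forall n q', n ∈ omega -> q' ∈ P -> le q' q -> exists q'' r1 a, q'' ∈ P /\ le q'' q' /\ a ∈ DD /\ opair r1 (opair n a) ∈ t' /\ le q'' r1) /\
   (forall n r1 r2 a b q', n ∈ omega -> opair r1 (opair n a) ∈ t' -> opair r2 (opair (succ n) b) ∈ t' -> a ∈ DD -> b ∈ DD -> q' ∈ P -> le q' q ->
     le q' r1 -> le q' r2 -> exists q'', q'' ∈ P /\ le q'' q' /\ opair q'' (opair n (opair a b)) ∈ y)).
  assert (DC : Dfn1 V (fun _ e => C (e 0) (e 1))) by (unfold C; dfn).
  destruct (gen_below Y (fun q => exists t', C q t') p) as (q & Gq & Hq & _ & t' & C1 & C2).
  { dfn. } { auto. }
  { intros q Hq L. destruct (reflect_sequence X y t0 q Hy Ht0 Hq) as (q' & t' & Hq' & Lq' & A1 & A2).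
    - intros r1 n a H. now apply P0 in H.
    - intros n r Hn Hr Lr. apply K1; auto. apply (ltrans _ q); auto. apply (ltrans _ p); auto.
    - intros n r1 r2 a b r Hn A1 A2 Hr Lr A3 A4. apply (K2 n r1 r2); auto. apply (ltrans _ q); auto. apply (ltrans _ p); auto.
    - exists q'. split; [auto|]. split; [auto|]. exists t'. split; auto. }
  (* The object [r1] comes from elementarity and is not known to be a condition, hence some [g] in
     [G] below [r1] in place of [r1] in [G]. [T'] may have several values at one argument; any of
     them will do. *)
  set (T' := sep (i (prod omega DD)) (fun z => exists r1 g, g ∈ G /\ prikry_product_le (i S) g r1 /\ opair r1 z ∈ i t')).
  assert (HT' : forall n a, opair (i n) (i a) ∈ T' <-> n ∈ omega /\ a ∈ DD /\ exists r1 g, i g ∈ G /\ le g r1 /\ opair r1 (opair n a) ∈ t').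
  { intros n a. unfold T'. rewrite in_sep by dclass. rewrite (h_prod i Hi), opair_in_prod, !(i_mem Y). split.
    - intros ((A1 & A2) & r1 & g & Gg & L & H). split; [auto|]. split; [auto|].
      rewrite <- (h_opair i Hi) in H. apply (h_pair_inv i Hi) in H as (r' & z & -> & E & H). apply (i_inj Y) in E. subst z.
      destruct (G_elem Y g Gg) as (g' & -> & _). apply (h_product_le i Hi) in L. eauto.
    - intros (A1 & A2 & r1 & g & Gg & L & H). split; [auto|]. exists (i r1), (i g). split; [auto|].
      split; [now apply (h_product_le i Hi)|]. rewrite <- (h_opair i Hi). now apply (h_opair_mem i Hi). }
  assert (ST' : subset T' (i (prod omega DD))). { intros z Hz. unfold T' in Hz. rewrite in_sep in Hz by dclass. tauto. }
  assert (El : forall z w, opair z w ∈ T' -> exists n a, z = i n /\ w = i a).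
  { intros z w H. apply ST' in H. apply (h_pair_inv i Hi) in H as (n & a & -> & -> & _). eauto. }
  exists T'. split; [now rewrite (h_prod i Hi), Eo in ST'|]. split.
  - intros w Hw. rewrite <- Eo in Hw. apply (h_mem_iff i Hi) in Hw as (n & -> & Hn).
    destruct (gen_below Y (fun q'' => exists r1 a, a ∈ DD /\ opair r1 (opair n a) ∈ t' /\ le q'' r1) q) as (q'' & Gq'' & Hq'' & _ & r1 & a & Ha & A1 & A2).
    { dfn. } { auto. }
    { intros q' Hq' L. destruct (C1 n q' Hn Hq' L) as (q'' & r1 & a & A1 & A2 & A3 & A4 & A5). exists q''. eauto 8. }
    exists (i a). apply HT'. split; [auto|]. split; [auto|]. eauto.
  - intros z w w' Hz Hz'. destruct (El _ _ Hz) as (n & a & -> & ->). rewrite <- (h_succ i Hi) in Hz'.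
    destruct (El _ _ Hz') as (n' & b & E & ->). apply HT' in Hz as (Hn & Ha & r1 & g & Gg & L & A1).
    apply HT' in Hz' as (_ & Hb & r2 & g' & Gg' & L' & A2).
    destruct (G_meet Y g g' Gg Gg') as (g1 & Gg1 & Hg1 & L3 & L4). destruct (G_meet Y g1 q Gg1 Gq) as (g2 & Gg2 & Hg2 & L5 & L6).
    destruct (gen_below Y (fun q'' => opair q'' (opair n (opair a b)) ∈ y) g2) as (q'' & Gq'' & _ & _ & A3).
    { dfn. } { auto. }
    { intros q' Hq' Lq'.
      assert (Lg1 : le q' g1) by (apply (ltrans _ g2); auto).
      apply (C2 n r1 r2 a b q'); auto.
      - apply (ltrans _ g2); auto.
      - apply (ltrans _ g); auto using G_P. apply (ltrans _ g1); auto.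
      - apply (ltrans _ g'); auto using G_P. apply (ltrans _ g1); auto. }
    rewrite <- Ey, <- !(h_opair i Hi). apply nval_i. eauto.
Qed.

End Extender.

(** * The ultrapower of the generic extension *)

(* Pairing terms in three variables describe the projections along which the
   ultrafilters cohere. *)
Inductive shape := Sv (n : nat) | Sp (s t : shape).

Fixpoint ev {V : structure} {Z : ZFC V} (s : shape) (x y z : V) : V :=
  match s with
  | Sv 0 => x
  | Sv 1 => y
  | Sv _ => z
  | Sp s t => opair (ev s x y z) (ev t x y z)
  end.

Section DfnShape.
Context {I : Type} {Vs : I -> structure} {Cst : (forall i, Vs i) -> Prop} {Zf : forall i, ZFC (Vs i)}.
Lemma Dt_ev s t u v : @Dt I Vs Cst t -> @Dt I Vs Cst u -> @Dt I Vs Cst v ->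
  @Dt I Vs Cst (fun i e => ev s (t i e) (u i e) (v i e)).
Proof. intros. induction s as [[|[|n]]|s1 IH1 s2 IH2]; cbn [ev]; auto. apply Dt_opair; auto. Qed.
End DfnShape.
Ltac dt_userO := lazymatch goal with |- Dt (fun _ _ => ev _ _ _ _) => apply Dt_ev end.
Ltac dt_user ::= first [dt_userB | dt_userB2 | dt_userC | dt_userF | dt_userO].

Lemma h_ev {A B : structure} {ZA : ZFC A} {ZB : ZFC B} (h : A -> B) (Hh : end_embedding A B h) s x y z :
  h (ev s x y z) = ev s (h x) (h y) (h z).
Proof. induction s as [[|[|n]]|s1 IH1 s2 IH2]; cbn [ev]; auto. rewrite (h_opair h Hh). congruence. Qed.

Section Ultrapower.
Context (Y : setupW).
Local Notation X := (wX Y).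
Local Notation V := (gV (wX Y)).
Local Notation M := (substructure (gV (wX Y)) (gM (wX Y))).
Local Notation W := (wW Y).
Local Notation i := (wi Y).
Local Notation j := (gj (wX Y)).
Local Notation DD := (DD (wX Y)).
Local Notation XX := (XX (wX Y)).
Local Notation toM := (toM (wX Y)).
Local Notation hM := (hM (wX Y)).
Local Notation jj := (jj (wX Y)).
Local Notation Hi := (Hi Y).
Local Notation HM := (hM_end (wX Y)).
Local Notation EE := (EE Y).

#[local] Instance Z2o : forall b, ZFC (two V M b) | 100 := two_ZFC V M (gZ X) (ZM X).
Local Notation tr := (transfer j (gj_elem X)).

Definition dd : W := i DD.
Definition xi : W := i XX.

Lemma DD_ev s x y z : x ∈ DD -> y ∈ DD -> z ∈ DD -> ev s x y z ∈ DD.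
Proof. intros. induction s as [[|[|n]]|s1 IH1 s2 IH2]; cbn [ev]; auto. apply DD_opair. auto. Qed.
Lemma XX_ev s x y z : x ∈ XX -> y ∈ XX -> z ∈ XX -> ev s x y z ∈ XX.
Proof. intros. induction s as [[|[|n]]|s1 IH1 s2 IH2]; cbn [ev]; auto using XX_opair. Qed.

Lemma dd_opair x y : opair x y ∈ dd <-> x ∈ dd /\ y ∈ dd.
Proof.
  unfold dd. split.
  - intros H. apply (h_pair_inv i Hi) in H as (a & b & -> & -> & H). apply DD_opair in H. now rewrite !(i_mem Y).
  - intros [H1 H2]. apply (h_mem_iff i Hi) in H1 as (a & -> & H1), H2 as (b & -> & H2).
    rewrite <- (h_opair i Hi). apply (i_mem Y). now apply DD_opair.
Qed.

Lemma dd_ev s x y z : x ∈ dd -> y ∈ dd -> z ∈ dd -> ev s x y z ∈ dd.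
Proof. intros. induction s as [[|[|n]]|s1 IH1 s2 IH2]; cbn [ev]; auto. apply dd_opair. auto. Qed.

Lemma xi_opair x y : x ∈ xi -> y ∈ xi -> opair x y ∈ xi.
Proof.
  unfold xi. intros H1 H2. apply (h_mem_iff i Hi) in H1 as (a & -> & H1), H2 as (b & -> & H2).
  rewrite <- (h_opair i Hi). apply (i_mem Y). now apply XX_opair.
Qed.

Lemma in_sepd (C : W -> Prop) x : Dfn1 W (fun _ e => C (e 0)) -> x ∈ sep dd C <-> x ∈ dd /\ C x.
Proof. intros H. rewrite in_sep; [tauto|dclass]. Qed.
Lemma sepd_sub (C : W -> Prop) : Dfn1 W (fun _ e => C (e 0)) -> subset (sep dd C) dd.
Proof. intros H x Hx. apply in_sepd in Hx; tauto. Qed.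

Section Filter.
Variable a : W.
Hypothesis Ha : a ∈ xi.
Lemma idx : exists a', a = i a' /\ a' ∈ XX. Proof. now apply (h_mem_iff i Hi) in Ha. Qed.

Lemma F_up A B : EE A a -> subset A B -> subset B dd -> EE B a.
Proof. destruct idx as (a' & -> & _). apply E_up. Qed.
Lemma F_inter A B : EE A a -> EE B a -> EE (cap A B) a.
Proof. destruct idx as (a' & -> & _). apply E_inter. Qed.
Lemma F_inhab A : EE A a -> exists x, x ∈ dd /\ x ∈ A.
Proof.
  destruct idx as (a' & -> & _). intros H. destruct (E_inhab Y A a' H) as (d & Hd & K).
  exists (i d). split; [now apply (i_mem Y)|auto].
Qed.
Lemma F_ultra A : subset A dd -> EE A a \/ EE (diff dd A) a.
Proof. destruct idx as (a' & -> & Ha'). intros H. now apply E_ultra. Qed.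

Lemma F_mono (C C' : W -> Prop) : Dfn1 W (fun _ e => C (e 0)) -> Dfn1 W (fun _ e => C' (e 0)) ->
  (forall x, x ∈ dd -> C x -> C' x) -> EE (sep dd C) a -> EE (sep dd C') a.
Proof.
  intros D1 D2 H K. apply (F_up _ _ K); [|now apply sepd_sub].
  intros x Hx. apply in_sepd in Hx as []; auto. apply in_sepd; auto.
Qed.

Lemma F_and (C C' : W -> Prop) : Dfn1 W (fun _ e => C (e 0)) -> Dfn1 W (fun _ e => C' (e 0)) ->
  EE (sep dd C) a -> EE (sep dd C') a -> EE (sep dd (fun x => C x /\ C' x)) a.
Proof.
  intros D1 D2 H K. apply (F_up _ _ (F_inter _ _ H K)).
  - intros x Hx. apply in_cap in Hx as [A1 A2]. apply in_sepd in A1, A2; auto. apply in_sepd; [dfn|tauto].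
  - apply sepd_sub. dfn.
Qed.

Lemma F_not (C : W -> Prop) : Dfn1 W (fun _ e => C (e 0)) ->
  EE (sep dd (fun x => ~ C x)) a <-> ~ EE (sep dd C) a.
Proof.
  intros DC. assert (DC' : Dfn1 W (fun _ e => ~ C (e 0))) by dfn. split.
  - intros H K. destruct (F_inhab _ (F_and _ _ DC DC' K H)) as (x & Hx & K').
    apply in_sepd in K'; [tauto|dfn].
  - intros H. destruct (F_ultra (sep dd C)) as [K|K]; [now apply sepd_sub|tauto|].
    apply (F_up _ _ K); [|now apply sepd_sub]. intros x Hx. apply in_diff in Hx as [Hx N]. rewrite in_sepd in N by auto.
    apply in_sepd; [auto|tauto].
Qed.

Lemma F_all (C : W -> Prop) : Dfn1 W (fun _ e => C (e 0)) -> (forall x, x ∈ dd -> C x) -> EE (sep dd C) a.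
Proof.
  intros DC H. apply NNPP. intros N. apply F_not in N; auto. destruct (F_inhab _ N) as (x & Hx & K).
  apply in_sepd in K; [|dfn]. destruct K. auto.
Qed.

End Filter.

(** The relation [r] sends a value of the shape [s] to the value of [t] that it determines; [j r]
    does the same with the seeds, so [E_proj] applies. *)
Lemma E_shape (s t : shape) (C : W -> Prop) a b c :
  (forall x y z x' y' z' : V, ev s x y z = ev s x' y' z' -> ev t x y z = ev t x' y' z') ->
  Dfn1 W (fun _ e => C (e 0)) -> a ∈ xi -> b ∈ xi -> c ∈ xi ->
  EE (sep dd C) (ev t a b c) <->
  EE (sep dd (fun w => exists x y z, x ∈ dd /\ y ∈ dd /\ z ∈ dd /\ w = ev s x y z /\ C (ev t x y z))) (ev s a b c).
Proof.
  intros Hst DC Ha Hb Hc.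
  destruct (idx a Ha) as (a' & -> & Ha'), (idx b Hb) as (b' & -> & Hb'), (idx c Hc) as (c' & -> & Hc').
  rewrite <- !(h_ev i Hi).
  set (r := sep (prod DD DD) (fun u => exists x y z, x ∈ DD /\ y ∈ DD /\ z ∈ DD /\ u = opair (ev s x y z) (ev t x y z))).
  assert (Hr : forall u v, opair u v ∈ r <-> exists x y z, x ∈ DD /\ y ∈ DD /\ z ∈ DD /\ u = ev s x y z /\ v = ev t x y z).
  { intros u v. unfold r. rewrite in_sep by dclass. rewrite opair_in_prod. split.
    - intros (_ & x & y & z & H1 & H2 & H3 & E). apply opair_inj in E as [-> ->]. exists x, y, z. auto.
    - intros (x & y & z & H1 & H2 & H3 & -> & ->). split; [auto using DD_ev|]. exists x, y, z. auto. }
  rewrite <- (E_proj Y r (sep dd C) (ev s a' b' c') (ev t a' b' c')); auto using XX_ev.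
  - enough (E : preim Y r (sep dd C) = sep dd (fun w => exists x y z, x ∈ dd /\ y ∈ dd /\ z ∈ dd /\ w = ev s x y z /\ C (ev t x y z))) by (rewrite E; tauto).
    apply ext_eq. intros w. rewrite in_preim, in_sep by dclass. unfold dd at 2. split.
    + intros (Hw & v & Hv & K). split; [auto|]. apply in_sepd in Hv as [Hv Cv]; [|auto].
      apply (h_pair_inv i Hi) in K as (u & v' & -> & -> & K). apply Hr in K as (x & y & z & H1 & H2 & H3 & -> & ->).
      exists (i x), (i y), (i z). rewrite <- !(h_ev i Hi). unfold dd. rewrite !(i_mem Y). auto 6.
    + intros (Hw & x & y & z & H1 & H2 & H3 & -> & Cv). split; [auto|]. exists (ev t x y z).
      apply (h_mem_iff i Hi) in H1 as (x' & -> & H1), H2 as (y' & -> & H2), H3 as (z' & -> & H3).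
      rewrite <- !(h_ev i Hi) in *. split.
      * apply in_sepd; [auto|]. split; [|auto]. unfold dd. apply (i_mem Y). auto using DD_ev.
      * apply (h_opair_mem i Hi). apply Hr. exists x', y', z'. auto.
  - intros u v v' H1 H2. apply Hr in H1 as (x & y & z & _ & _ & _ & -> & ->), H2 as (x' & y' & z' & _ & _ & _ & E & ->). eauto.
  - now apply sepd_sub.
  - rewrite <- (hM_toM X (opair _ _)) by (apply XX_M, XX_opair; auto using XX_ev). apply hM_up.
    rewrite toM_opair by auto using XX_ev.
    apply (proj2 (proj1 (tr (fun b e => forall u v, @opair _ (Z2o b) u v ∈ e 0 <-> exists x y z, x ∈ e 1 /\ y ∈ e 1 /\ z ∈ e 1 /\ u = @ev _ (Z2o b) s x y z /\ v = @ev _ (Z2o b) t x y z)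
      ltac:(dfn) (scons r (fun _ => DD))) Hr (toM (ev s a' b' c')) (toM (ev t a' b' c')))).
    cbn [scons]. exists (toM a'), (toM b'), (toM c'). repeat (split; [now apply toM_jD|]).
    split; apply (ee_inj _ _ _ HM); rewrite (h_ev hM HM), !hM_toM; auto using XX_M, XX_ev.
Qed.

(** The relation induced by [R] on the ultrapower, computed at the common seed [(a, b)] of the two
    classes. *)
Definition relE (R : W -> W -> Prop) (f a g b : W) : Prop :=
  EE (sep dd (fun w => exists x y, x ∈ dd /\ y ∈ dd /\ w = opair x y /\ R (app f x) (app g y))) (opair a b).

Lemma relE_shape (R : W -> W -> Prop) (s t1 t2 : shape) f g a b c :
  Dfn1 W (fun _ e => R (e 0) (e 1)) ->
  (forall x y z x' y' z' : V, ev s x y z = ev s x' y' z' -> ev t1 x y z = ev t1 x' y' z' /\ ev t2 x y z = ev t2 x' y' z') ->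
  a ∈ xi -> b ∈ xi -> c ∈ xi ->
  relE R f (ev t1 a b c) g (ev t2 a b c) <->
  EE (sep dd (fun w => exists x y z, x ∈ dd /\ y ∈ dd /\ z ∈ dd /\ w = ev s x y z /\ R (app f (ev t1 x y z)) (app g (ev t2 x y z)))) (ev s a b c).
Proof.
  intros DR Hs Ha Hb Hc. unfold relE. change (opair (ev t1 a b c) (ev t2 a b c)) with (ev (Sp t1 t2) a b c).
  rewrite (E_shape s (Sp t1 t2)); auto.
  - assert (Hsi : ev s a b c ∈ xi).
    { destruct (idx a Ha) as (a' & -> & Ha'), (idx b Hb) as (b' & -> & Hb'), (idx c Hc) as (c' & -> & Hc').
      rewrite <- (h_ev i Hi). apply (i_mem Y). auto using XX_ev. }
    split; apply F_mono; auto; try dfn; intros w Hw (x & y & z & H1 & H2 & H3 & -> & H).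
    + destruct H as (x' & y' & _ & _ & E & K). cbn [ev] in E. apply opair_inj in E as [<- <-]. exists x, y, z. auto.
    + exists x, y, z. repeat (split; [auto|]). exists (ev t1 x y z), (ev t2 x y z).
      auto using dd_ev.
  - intros x y z x' y' z' E. cbn [ev]. destruct (Hs _ _ _ _ _ _ E). congruence.
  - dfn.
Qed.

Definition s0 := Sv 0.
Definition s01 := Sp (Sv 0) (Sv 1).
Definition s012 := Sp s01 (Sv 2).

Ltac shp := let E := fresh in intros ? ? ? ? ? ? E; cbn [ev s0 s01 s012] in *;
  repeat (apply opair_inj in E; destruct E as [E ?]); subst; auto.

Lemma s012_xi a b c : a ∈ xi -> b ∈ xi -> c ∈ xi -> ev s012 a b c ∈ xi.
Proof. intros. cbn. auto using xi_opair. Qed.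

Lemma xi_inh : i emp ∈ xi.
Proof. unfold xi. apply (i_mem Y). apply D_sub_XX. apply Hset_ord; [apply k_sl|]. apply sl_nat; [apply k_sl|apply nat_0]. Qed.

Local Notation mem' := (fun x y : W => x ∈ y).
Local Notation eq' := (fun x y : W => x = y).

Lemma relE_diag (R : W -> W -> Prop) f g a : Dfn1 W (fun _ e => R (e 0) (e 1)) -> a ∈ xi ->
  relE R f a g a <-> EE (sep dd (fun x => R (app f x) (app g x))) a.
Proof.
  intros DR Ha. pose proof (relE_shape R s0 (Sv 0) (Sv 0) f g a a a DR ltac:(shp) Ha Ha Ha) as H. cbn [ev s0] in H.
  rewrite H. split; apply F_mono; auto; try dfn.
  - intros w Hw (x & y & z & H1 & H2 & H3 & -> & K). auto.
  - intros w Hw K. exists w, w, w. auto.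
Qed.

Lemma relE_12 (R : W -> W -> Prop) f g a b c : Dfn1 W (fun _ e => R (e 0) (e 1)) -> a ∈ xi -> b ∈ xi -> c ∈ xi ->
  relE R f a g b <-> EE (sep dd (fun w => exists x y z, x ∈ dd /\ y ∈ dd /\ z ∈ dd /\ w = ev s012 x y z /\ R (app f x) (app g y))) (ev s012 a b c).
Proof. intros DR Ha Hb Hc. exact (relE_shape R s012 (Sv 0) (Sv 1) f g a b c DR ltac:(shp) Ha Hb Hc). Qed.
Lemma relE_13 (R : W -> W -> Prop) f g a b c : Dfn1 W (fun _ e => R (e 0) (e 1)) -> a ∈ xi -> b ∈ xi -> c ∈ xi ->
  relE R f a g c <-> EE (sep dd (fun w => exists x y z, x ∈ dd /\ y ∈ dd /\ z ∈ dd /\ w = ev s012 x y z /\ R (app f x) (app g z))) (ev s012 a b c).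
Proof. intros DR Ha Hb Hc. exact (relE_shape R s012 (Sv 0) (Sv 2) f g a b c DR ltac:(shp) Ha Hb Hc). Qed.
Lemma relE_23 (R : W -> W -> Prop) f g a b c : Dfn1 W (fun _ e => R (e 0) (e 1)) -> a ∈ xi -> b ∈ xi -> c ∈ xi ->
  relE R f b g c <-> EE (sep dd (fun w => exists x y z, x ∈ dd /\ y ∈ dd /\ z ∈ dd /\ w = ev s012 x y z /\ R (app f y) (app g z))) (ev s012 a b c).
Proof. intros DR Ha Hb Hc. exact (relE_shape R s012 (Sv 1) (Sv 2) f g a b c DR ltac:(shp) Ha Hb Hc). Qed.

(** All three relations are moved to the seed [((a, b), c)], where they hold on a common measure one
    set. *)
Lemma relE_comp (R1 R2 R3 : W -> W -> Prop) f g h a b c :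
  Dfn1 W (fun _ e => R1 (e 0) (e 1)) -> Dfn1 W (fun _ e => R2 (e 0) (e 1)) -> Dfn1 W (fun _ e => R3 (e 0) (e 1)) ->
  (forall x y z, R1 x y -> R2 y z -> R3 x z) -> a ∈ xi -> b ∈ xi -> c ∈ xi ->
  relE R1 f a g b -> relE R2 g b h c -> relE R3 f a h c.
Proof.
  intros D1 D2 D3 H Ha Hb Hc H1 H2. apply (relE_12 R1 f g a b c) in H1; auto. apply (relE_23 R2 g h a b c) in H2; auto.
  apply (relE_13 R3 f h a b c); auto. pose proof (s012_xi a b c Ha Hb Hc) as Hi3.
  refine (F_mono _ Hi3 _ _ _ _ _ (F_and _ Hi3 _ _ _ _ H1 H2)); try dfn.
  intros w Hw [(x & y & z & A1 & A2 & A3 & E & K) (x' & y' & z' & _ & _ & _ & E' & K')].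
  rewrite E in E'. cbn in E'. apply opair_inj in E' as [E' <-]. apply opair_inj in E' as [<- <-].
  exists x, y, z. eauto 8.
Qed.

Lemma relE_sym (R R' : W -> W -> Prop) f g a b : Dfn1 W (fun _ e => R (e 0) (e 1)) -> Dfn1 W (fun _ e => R' (e 0) (e 1)) ->
  (forall x y, R x y -> R' y x) -> a ∈ xi -> b ∈ xi -> relE R f a g b -> relE R' g b f a.
Proof.
  intros D1 D2 H Ha Hb K. pose proof (relE_shape R' s01 (Sv 1) (Sv 0) g f a b a D2 ltac:(shp) Ha Hb Ha) as H'. cbn [ev] in H'.
  apply H'. refine (F_mono _ (xi_opair _ _ Ha Hb) _ _ _ _ _ K); try dfn.
  intros w Hw (x & y & A1 & A2 & -> & K'). exists x, y, x. cbn. auto 6.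
Qed.

Definition memE (f a g b : W) : Prop := relE (fun x y => x ∈ y) f a g b.
Definition eqE (f a g b : W) : Prop := relE (fun x y => x = y) f a g b.

Lemma memE_eq_l f a f' a' g b : a ∈ xi -> a' ∈ xi -> b ∈ xi -> eqE f' a' f a -> memE f a g b -> memE f' a' g b.
Proof. intros Ha Ha' Hb. apply relE_comp; auto; try dfn. intros x y z -> H. exact H. Qed.
Lemma memE_eq_r f a g b g' b' : a ∈ xi -> b ∈ xi -> b' ∈ xi -> memE f a g b -> eqE g b g' b' -> memE f a g' b'.
Proof. intros Ha Ha' Hb. apply relE_comp; auto; try dfn. intros x y z H ->. exact H. Qed.
Lemma eqE_sym f a g b : a ∈ xi -> b ∈ xi -> eqE f a g b -> eqE g b f a.
Proof. intros Ha Hb. apply relE_sym; auto; dfn. Qed.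
Lemma eqE_refl f a : a ∈ xi -> eqE f a f a.
Proof. intros Ha. apply relE_diag; [dfn|auto|]. apply F_all; [auto|dfn|auto]. Qed.

Lemma F_pair a b (C : W -> Prop) : a ∈ xi -> b ∈ xi -> Dfn1 W (fun _ e => C (e 0)) -> EE (sep dd C) a ->
  EE (sep dd (fun w => exists x y, x ∈ dd /\ y ∈ dd /\ w = opair x y /\ C x)) (opair a b).
Proof.
  intros Ha Hb DC H. pose proof (proj1 (E_shape s01 (Sv 0) C a b a ltac:(shp) DC Ha Hb Ha) H) as K.
  refine (F_mono _ (xi_opair _ _ Ha Hb) _ _ _ _ _ K); try dfn.
  intros w Hw (x & y & z & H1 & H2 & H3 & -> & HC). exists x, y. auto.
Qed.

Lemma F_pairs a b : a ∈ xi -> b ∈ xi ->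
  EE (sep dd (fun w => exists x y, x ∈ dd /\ y ∈ dd /\ w = opair x y)) (opair a b).
Proof.
  intros Ha Hb. assert (H : EE (sep dd (fun _ => True)) a) by (apply F_all; auto; dfn).
  apply (F_pair a b) in H; auto; [|dfn]. refine (F_mono _ (xi_opair _ _ Ha Hb) _ _ _ _ _ H); try dfn.
  intros w Hw (x & y & H1 & H2 & -> & _). eauto.
Qed.

Lemma D_relE (R : W -> W -> Prop) t u v w : Dfn1 W (fun _ e => R (e 0) (e 1)) -> Dt1 W t -> Dt1 W u -> Dt1 W v -> Dt1 W w ->
  Dfn1 W (fun x e => relE R (t x e) (u x e) (v x e) (w x e)).
Proof. intros. pose proof (D_EE Y). unfold relE. dfn. Qed.

Lemma relE_not (R : W -> W -> Prop) f a g b : Dfn1 W (fun _ e => R (e 0) (e 1)) -> a ∈ xi -> b ∈ xi ->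
  relE (fun x y => ~ R x y) f a g b <-> ~ relE R f a g b.
Proof.
  intros DR Ha Hb. pose proof (xi_opair _ _ Ha Hb) as Hab. unfold relE. rewrite <- (F_not _ Hab) by dfn. split.
  - apply (F_mono _ Hab); try dfn. intros w Hw (x & y & H1 & H2 & -> & N) (x' & y' & _ & _ & E & K).
    apply opair_inj in E as [<- <-]. auto.
  - intros H. refine (F_mono _ Hab _ _ _ _ _ (F_and _ Hab _ _ _ _ (F_pairs a b Ha Hb) H)); try dfn.
    intros w Hw [(x & y & H1 & H2 & ->) N]. exists x, y. repeat (split; [auto|]). intros K. apply N. exists x, y. auto.
Qed.

End Ultrapower.

Lemma omega_iterate {V : structure} {Z : ZFC V} (m s : V) :
  exists f : V, function_on f omega /\ app f emp = m /\ forall n, n ∈ omega -> app f (succ n) = app s (app f n).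
Proof.
  set (G := fun n h : V => if excluded_middle_informative (n = emp) then m else app s (app h (un n))).
  assert (DG : Dt1 V (fun _ e => G (e 0) (e 1))) by (unfold G; dfn).
  destruct (wf_rec omega (fun x y => x ∈ y) G ltac:(dfn) DG) as (f & Hf & E).
  { intros b _ Hb. now apply foundation. }
  exists f. split; [auto|]. split.
  - rewrite E by apply nat_0. unfold G. destruct excluded_middle_informative; tauto.
  - intros n Hn. rewrite E by now apply nat_succ. unfold G. destruct excluded_middle_informative as [e|_].
    + exfalso. apply (in_emp n). rewrite <- e. apply in_succ. auto.
    + assert (U : un (succ n) = n).
      { apply ext_eq. intros z. rewrite in_un. split.
        - intros (y & Hy & Hz). apply in_succ in Hy as [Hy| ->]; [|auto]. exact (nat_transitive n Hn y Hy z Hz).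
        - intros Hz. exists n. split; [apply in_succ; auto|auto]. }
      rewrite U. f_equal. apply (app_restr f omega); auto.
      * intros x Hx. rewrite in_sep in Hx by dclass. tauto.
      * rewrite in_sep by dclass. split; [auto|]. apply in_succ. auto.
Qed.

(** * Well-foundedness and transitive collapse of the ultrapower *)

Section Collapse.
Context (Y : setupW).
Local Notation V := (gV (wX Y)).
Local Notation W := (wW Y).
Local Notation EE := (EE Y).
Local Notation dd := (dd Y).
Local Notation xi := (xi Y).
Local Notation relE := (relE Y).
Local Notation memE := (memE Y).
Local Notation eqE := (eqE Y).

Ltac shp := let E := fresh in intros ? ? ? ? ? ? E; cbn [ev s0 s01 s012] in *;
  repeat (apply opair_inj in E; destruct E as [E ?]); subst; auto.

Lemma relE_p1 (R : W -> W -> Prop) h f a b : Dfn1 W (fun _ e => R (e 0) (e 1)) -> a ∈ xi -> b ∈ xi ->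
  relE R h (opair a b) f a <-> EE (sep dd (fun w => exists x y, x ∈ dd /\ y ∈ dd /\ w = opair x y /\ R (app h w) (app f x))) (opair a b).
Proof.
  intros DR Ha Hb. pose proof (relE_shape Y R s01 s01 (Sv 0) h f a b a DR ltac:(shp) Ha Hb Ha) as H. cbn [ev s01] in H. rewrite H.
  split; apply (F_mono Y _ (xi_opair Y _ _ Ha Hb)); try dfn.
  - intros w Hw (x & y & z & H1 & H2 & H3 & -> & K). exists x, y. auto.
  - intros w Hw (x & y & H1 & H2 & -> & K). exists x, y, x. auto 6.
Qed.

Lemma relE_p2 (R : W -> W -> Prop) h g a b : Dfn1 W (fun _ e => R (e 0) (e 1)) -> a ∈ xi -> b ∈ xi ->
  relE R h (opair a b) g b <-> EE (sep dd (fun w => exists x y, x ∈ dd /\ y ∈ dd /\ w = opair x y /\ R (app h w) (app g y))) (opair a b).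
Proof.
  intros DR Ha Hb. pose proof (relE_shape Y R s01 s01 (Sv 1) h g a b a DR ltac:(shp) Ha Hb Ha) as H. cbn [ev s01] in H. rewrite H.
  split; apply (F_mono Y _ (xi_opair Y _ _ Ha Hb)); try dfn.
  - intros w Hw (x & y & z & H1 & H2 & H3 & -> & K). exists x, y. auto.
  - intros w Hw (x & y & H1 & H2 & -> & K). exists x, y, x. auto 6.
Qed.

Lemma separating_half f a g b : a ∈ xi -> b ∈ xi ->
  relE (fun x y => exists v, v ∈ x /\ ~ v ∈ y) f a g b ->
  exists h, function_on h dd /\ memE h (opair a b) f a /\ ~ memE h (opair a b) g b.
Proof.
  intros Ha Hb H. pose proof (xi_opair Y _ _ Ha Hb) as Hab.
  destruct (choice_class dd (fun w v => (exists v', v' ∈ app f (fst w) /\ ~ v' ∈ app g (snd w)) -> v ∈ app f (fst w) /\ ~ v ∈ app g (snd w)))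
    as (h & Hh & K); [dfn| |].
  { intros x _. destruct (classic (exists v', v' ∈ app f (fst x) /\ ~ v' ∈ app g (snd x))) as [[v Hv]|N]; [exists v; auto|].
    exists x. tauto. }
  exists h. split; [auto|].
  assert (A : EE (sep dd (fun w => exists x y, x ∈ dd /\ y ∈ dd /\ w = opair x y /\ app h w ∈ app f x /\ ~ app h w ∈ app g y)) (opair a b)).
  { refine (F_mono Y _ Hab _ _ _ _ _ H); try dfn.
    intros w Hw (x & y & H1 & H2 & -> & Hv). exists x, y. do 3 (split; [auto|]). specialize (K _ Hw).
    rewrite fst_opair, snd_opair in K. now apply K. }
  split.
  - apply relE_p1; auto; [dfn|]. refine (F_mono Y _ Hab _ _ _ _ _ A); try dfn.
    intros w Hw (x & y & H1 & H2 & E & H3 & H4). exists x, y. auto.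
  - apply (relE_not Y (fun x y => x ∈ y)); auto; [dfn|]. apply relE_p2; auto; [dfn|]. refine (F_mono Y _ Hab _ _ _ _ _ A); try dfn.
    intros w Hw (x & y & H1 & H2 & E & H3 & H4). exists x, y. auto.
Qed.

(** Extensionality of the ultrapower: if the values differ, one of the two differences is nonempty
    on a measure one set, and Choice in [W] gives a function with values in it. *)
Lemma eqE_separate f a g b : a ∈ xi -> b ∈ xi -> ~ eqE f a g b ->
  exists h c, function_on h dd /\ c ∈ xi /\ (memE h c f a /\ ~ memE h c g b \/ memE h c g b /\ ~ memE h c f a).
Proof.
  intros Ha Hb N.
  destruct (classic (relE (fun x y => exists v, v ∈ x /\ ~ v ∈ y) f a g b)) as [H|N1].
  { destruct (separating_half f a g b Ha Hb H) as (h & H1 & H2 & H3). exists h, (opair a b). auto using xi_opair. }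
  destruct (classic (relE (fun x y => exists v, v ∈ x /\ ~ v ∈ y) g b f a)) as [H|N2].
  { destruct (separating_half g b f a Hb Ha H) as (h & H1 & H2 & H3). exists h, (opair b a). auto 6 using xi_opair. }
  exfalso. apply N. pose proof (xi_opair Y _ _ Ha Hb) as Hab.
  apply relE_not in N1; auto; [|dfn]. apply relE_not in N2; auto; [|dfn].
  apply (relE_sym Y _ (fun x y => ~ exists v, v ∈ y /\ ~ v ∈ x)) in N2; auto; try dfn.
  refine (F_mono Y _ Hab _ _ _ _ _ (F_and Y _ Hab _ _ _ _ N1 N2)); try dfn.
  intros w Hw [(x & y & H1 & H2 & -> & K1) (x' & y' & _ & _ & E & K2)]. apply opair_inj in E as [<- <-].
  exists x, y. do 3 (split; [auto|]). apply ext_eq. intros z. split; intros Hz; apply NNPP; eauto.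
Qed.

(** The functions on [dd] form a proper class. This confines the members of a class with values in
    [t] to representatives with values in [t]; [emp] is the default where [g] leaves [t]. *)
Lemma memE_bounded f a g b t : a ∈ xi -> b ∈ xi -> transitive t -> emp ∈ t -> (forall x, x ∈ dd -> app f x ∈ t) ->
  memE g b f a -> exists g', function_on g' dd /\ (forall x, x ∈ dd -> app g' x ∈ t) /\ eqE g' b g b.
Proof.
  intros Ha Hb Ht H0 Hf H.
  destruct (choice_fun dd t (fun x v => app g x ∈ t -> v = app g x)) as (g' & Hg & K); [dfn| |].
  { intros x _. destruct (classic (app g x ∈ t)); [eauto|]. exists emp. tauto. }
  exists g'. split; [auto|]. split; [intros x Hx; now apply K|].
  pose proof (relE_shape Y (fun x y => x = y) s01 (Sv 0) (Sv 0) g' g b a a ltac:(dfn) ltac:(shp) Hb Ha Ha) as E. apply E. clear E.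
  refine (F_mono Y _ (xi_opair Y _ _ Hb Ha) _ _ _ _ _ H); try dfn.
  intros w Hw (x & y & H1 & H2 & -> & Hm). exists x, y, x. do 4 (split; [auto|]). cbn. apply K; [auto|].
  exact (Ht _ (Hf y H2) _ Hm).
Qed.

Definition memZ (y z : W) := memE (fst y) (snd y) (fst z) (snd z).
Definition eqZ (y z : W) := eqE (fst y) (snd y) (fst z) (snd z).

Lemma D_memZ : Dfn1 W (fun _ e => memZ (e 0) (e 1)).
Proof. apply (D_relE Y (fun x y => x ∈ y)); dfn. Qed.

(** Representatives with values in [t]; they form a set, on which well-founded recursion is
    available. *)
Definition KK (t : W) : W := sep (prod (pow (prod dd t)) xi) (fun z => function_on (fst z) dd).

Lemma in_KK t z : z ∈ KK t <-> exists f a, z = opair f a /\ function_on f dd /\ (forall x, x ∈ dd -> app f x ∈ t) /\ a ∈ xi.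
Proof.
  unfold KK. rewrite in_sep by dclass. rewrite in_prod. split.
  - intros ((f & a & Hf & Ha & ->) & K). rewrite fst_opair in K. exists f, a. do 2 (split; [auto|]).
    split; [|auto]. intros x Hx. apply in_pow in Hf. pose proof (Hf _ (app_mem f dd x K Hx)) as H. now apply opair_in_prod in H.
  - intros (f & a & -> & Hf & K & Ha). rewrite fst_opair. split; [|auto]. exists f, a. split; [|auto]. apply in_pow.
    intros z Hz. destruct (function_on_elem f dd z Hf Hz) as (x & y & Hx & ->). apply opair_in_prod. split; [auto|].
    rewrite <- (app_val f dd x y) by auto. auto.
Qed.

Lemma Dt_KK : Dt1 W (fun _ e => KK (e 0)).
Proof. unfold KK. dfn. Qed.

(** A descending sequence of classes gives, by [E_seq], points of [dd] at which the chosen functions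
    take values descending in [∈], against Foundation in [W]. *)
Lemma memZ_wf t b : subset b (KK t) -> (exists x, x ∈ b) -> exists m, m ∈ b /\ forall y, y ∈ b -> ~ memZ y m.
Proof.
  intros Hb [m0 Hm0]. apply NNPP. intros N. pose proof D_memZ as DM.
  assert (N' : forall m, m ∈ b -> exists y, y ∈ b /\ memZ y m).
  { intros m Hm. apply NNPP. intros N'. apply N. exists m. split; [auto|]. intros y Hy K. eauto. }
  destruct (choice_fun b b (fun m y => memZ y m)) as (s & Hs & Ks); [dfn|auto|].
  destruct (omega_iterate m0 s) as (q & Hq & q0 & qs).
  assert (Kq : forall n, n ∈ omega -> app q n ∈ b).
  { apply nat_induction; [dclass|now rewrite q0|]. intros n Hn K. rewrite qs by auto. now apply Ks. }
  assert (Mq : forall n, n ∈ omega -> memZ (app q (succ n)) (app q n)).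
  { intros n Hn. rewrite qs by auto. now apply Ks, Kq. }
  assert (Xq : forall n, n ∈ omega -> snd (app q n) ∈ xi).
  { intros n Hn. apply Kq, Hb, in_KK in Hn as (f & a & -> & _ & _ & Ha). now rewrite snd_opair. }
  set (T := lam omega (fun n => snd (app q n))).
  assert (ET : forall n, n ∈ omega -> app T n = snd (app q n)). { intros n Hn. unfold T. rewrite app_lam; auto. dfn. }
  set (B := sep (prod omega dd) (fun z => exists n x y, z = opair n (opair x y) /\ app (fst (app q (succ n))) y ∈ app (fst (app q n)) x)).
  assert (HB : forall n x y, n ∈ omega -> x ∈ dd -> y ∈ dd -> opair n (opair x y) ∈ B <-> app (fst (app q (succ n))) y ∈ app (fst (app q n)) x).
  { intros n x y Hn Hx Hy. unfold B. rewrite in_sep by dclass. rewrite opair_in_prod, dd_opair. split.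
    - intros (_ & n' & x' & y' & E & H). apply opair_inj in E as [<- E]. apply opair_inj in E as [<- <-]. auto.
    - intros H. split; [auto|]. exists n, x, y. auto. }
  destruct (E_seq Y T B) as (T' & T1 & T2 & T3).
  - unfold T. apply lam_function. dfn.
  - intros n Hn. rewrite ET by auto. now apply Xq.
  - unfold B. intros z Hz. rewrite in_sep in Hz by dclass. tauto.
  - intros n Hn. rewrite !ET by auto using nat_succ.
    pose proof (Mq n Hn : relE (fun x y => x ∈ y) _ _ _ _) as H.
    apply (relE_sym Y _ (fun x y => y ∈ x)) in H; auto using nat_succ; try dfn.
    refine (F_mono Y _ (xi_opair Y _ _ (Xq _ Hn) (Xq _ (nat_succ _ Hn))) _ _ _ _ _ H); try dfn.
    intros w Hw (x & y & H1 & H2 & -> & K). apply HB; auto.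
  - destruct (choice_class omega (fun n a => opair n a ∈ T')) as (A & HA & KA); [dfn|auto|].
    set (v := fun n => app (fst (app q n)) (app A n)). assert (Dv : Dt1 W (fun _ e => v (e 0))) by (unfold v; dfn).
    destruct (foundation (img omega v)) as (m & Hm & Hmin).
    { exists (v emp). rewrite in_img by dclass. exists emp. split; [apply nat_0|auto]. }
    rewrite in_img in Hm by dclass. destruct Hm as (n & Hn & ->).
    apply (Hmin (v (succ n))); [rewrite in_img by dclass; exists (succ n); auto using nat_succ|].
    pose proof (KA n Hn) as A1. pose proof (KA (succ n) (nat_succ n Hn)) as A2.
    pose proof (T3 n _ _ A1 A2) as K. apply HB in K; auto.
    + apply T1 in A1. now apply opair_in_prod in A1.
    + apply T1 in A2. now apply opair_in_prod in A2.
Qed.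

Definition collapse (t q : W) : Prop := transitive t /\ emp ∈ t /\ function_on q (KK t) /\
  forall x z, x ∈ KK t -> z ∈ app q x <-> exists y, y ∈ KK t /\ memZ y x /\ z = app q y.

Lemma collapse_exists t : transitive t -> emp ∈ t -> exists q, collapse t q.
Proof.
  intros Ht H0. pose proof D_memZ as DM.
  assert (DG : Dt1 W (fun _ e => ran (e 1))) by (apply Dt_ran; dfn).
  destruct (wf_rec (KK t) memZ (fun _ h => ran h) DM DG (memZ_wf t)) as (q & Hq & E).
  exists q. do 3 (split; [auto|]). intros x z Hx. rewrite (E x Hx), in_ran. split.
  - intros [y Hy]. apply in_restr in Hy as [H1 H2]. rewrite in_sep in H2 by dclass. exists y. split; [tauto|]. split; [tauto|].
    now rewrite (app_val q (KK t) y z).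
  - intros (y & H1 & H2 & ->). exists y. apply in_restr. split; [now apply (app_mem q (KK t))|]. rewrite in_sep by dclass. auto.
Qed.

Lemma memZ_eq_l y y' z : snd y ∈ xi -> snd y' ∈ xi -> snd z ∈ xi -> eqZ y' y -> memZ y z -> memZ y' z.
Proof. intros H1 H2 H3. unfold eqZ, memZ. now apply memE_eq_l. Qed.
Lemma memZ_eq_r y z z' : snd y ∈ xi -> snd z ∈ xi -> snd z' ∈ xi -> memZ y z -> eqZ z z' -> memZ y z'.
Proof. intros H1 H2 H3. unfold eqZ, memZ. now apply memE_eq_r. Qed.
Lemma eqZ_sym y z : snd y ∈ xi -> snd z ∈ xi -> eqZ y z -> eqZ z y.
Proof. unfold eqZ. now apply eqE_sym. Qed.
Lemma KK_snd t z : z ∈ KK t -> snd z ∈ xi.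
Proof. intros H. apply in_KK in H as (f & a & -> & _ & _ & Ha). now rewrite snd_opair. Qed.

Lemma KK_bounded t y z : transitive t -> emp ∈ t -> z ∈ KK t -> snd y ∈ xi -> memZ y z -> exists y', y' ∈ KK t /\ eqZ y' y.
Proof.
  intros Ht H0 Hz Hy H. apply in_KK in Hz as (f & a & -> & Hf & Kf & Ha). unfold memZ in H. rewrite fst_opair, snd_opair in H.
  destruct (memE_bounded f a (fst y) (snd y) t Ha Hy Ht H0 Kf H) as (g' & H1 & H2 & H3).
  exists (opair g' (snd y)). split; [apply in_KK; exists g', (snd y); auto|]. unfold eqZ. now rewrite fst_opair, snd_opair.
Qed.

(** The collapse does not depend on the chosen bound. At a minimal disagreement, members on one side
    are moved to representatives bounded by the other transitive set; unequal classes are separated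
    by such a member. *)
Lemma collapse_eq t q t' q' : collapse t q -> collapse t' q' -> forall y, y ∈ KK t -> forall y', y' ∈ KK t' ->
  app q y = app q' y' <-> eqZ y y'.
Proof.
  intros (Tt & T0 & Hq & E) (Tt' & T0' & Hq' & E') y Hy. apply NNPP. intros N. pose proof D_memZ as DM.
  assert (DE : Dfn1 W (fun _ e => eqZ (e 0) (e 1))). { apply (D_relE Y (fun x y => x = y)); dfn. }
  set (Bad := sep (KK t) (fun y => ~ forall y', y' ∈ KK t' -> app q y = app q' y' <-> eqZ y y')).
  destruct (memZ_wf t Bad) as (m & Hm & Hmin).
  { intros x Hx. unfold Bad in Hx. rewrite in_sep in Hx by dclass. tauto. }
  { exists y. unfold Bad. rewrite in_sep by dclass. auto. }
  unfold Bad in Hm. rewrite in_sep in Hm by dclass. destruct Hm as [Hm Nm]. apply Nm. clear Nm N y Hy.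
  assert (IH : forall x x', x ∈ KK t -> memZ x m -> x' ∈ KK t' -> app q x = app q' x' <-> eqZ x x').
  { intros x x' Hx Hxm. revert x'. apply NNPP. intros N. apply (Hmin x); [|auto]. unfold Bad. rewrite in_sep by dclass. split; [auto|].
    intros K. apply N. intros x' Hx'. now apply K. }
  intros m' Hm'. pose proof (KK_snd _ _ Hm) as S1. pose proof (KK_snd _ _ Hm') as S2. split.
  - intros Eq. apply NNPP. intros N.
    destruct (eqE_separate (fst m) (snd m) (fst m') (snd m') S1 S2 N) as (h & c & Hh & Hc & [[K1 K2]|[K1 K2]]).
    + destruct (KK_bounded t (opair h c) m Tt T0 Hm) as (x & Hx & Ex); try (unfold memZ; rewrite ?fst_opair, ?snd_opair; auto).
      assert (S3 : snd (opair h c) ∈ xi) by now rewrite snd_opair.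
      assert (Mx : memZ x m). { apply (memZ_eq_l (opair h c)); eauto using KK_snd. unfold memZ. now rewrite fst_opair, snd_opair. }
      assert (Q : app q x ∈ app q' m'). { rewrite <- Eq. apply E; [auto|]. eauto. }
      apply E' in Q as (x' & Hx' & Mx' & Q); [|auto]. apply IH in Q; auto.
      apply K2. rewrite <- (fst_opair h c) at 1. rewrite <- (snd_opair h c) at 2. fold (memZ (opair h c) m').
      apply (memZ_eq_l x); eauto using KK_snd; [apply eqZ_sym; eauto using KK_snd|]. apply (memZ_eq_l x'); eauto using KK_snd.
    + destruct (KK_bounded t' (opair h c) m' Tt' T0' Hm') as (x & Hx & Ex); try (unfold memZ; rewrite ?fst_opair, ?snd_opair; auto).
      assert (S3 : snd (opair h c) ∈ xi) by now rewrite snd_opair.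
      assert (Mx : memZ x m'). { apply (memZ_eq_l (opair h c)); eauto using KK_snd. unfold memZ. now rewrite fst_opair, snd_opair. }
      assert (Q : app q' x ∈ app q m). { rewrite Eq. apply E'; [auto|]. eauto. }
      apply E in Q as (x' & Hx' & Mx' & Q); [|auto]. symmetry in Q. apply IH in Q; auto.
      apply K2. rewrite <- (fst_opair h c) at 1. rewrite <- (snd_opair h c) at 2. fold (memZ (opair h c) m).
      apply (memZ_eq_l x); eauto using KK_snd; [apply eqZ_sym; eauto using KK_snd|]. apply (memZ_eq_l x'); eauto using KK_snd.
      apply eqZ_sym; eauto using KK_snd.
  - intros Eq. apply ext_eq. intros z. rewrite E, E' by auto. split.
    + intros (x & Hx & Mx & ->). assert (Mx' : memZ x m') by (apply (memZ_eq_r x m); eauto using KK_snd).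
      destruct (KK_bounded t' x m' Tt' T0' Hm' (KK_snd _ _ Hx) Mx') as (x' & Hx' & Ex).
      exists x'. split; [auto|]. split; [apply (memZ_eq_l x); eauto using KK_snd|]. apply IH; auto. apply eqZ_sym; eauto using KK_snd.
    + intros (x & Hx & Mx & ->).
      assert (Mx' : memZ x m) by (apply (memZ_eq_r x m'); eauto using KK_snd; apply eqZ_sym; eauto using KK_snd).
      destruct (KK_bounded t x m Tt T0 Hm (KK_snd _ _ Hx) Mx') as (x' & Hx' & Ex).
      assert (Mx2 : memZ x' m) by (apply (memZ_eq_l x); eauto using KK_snd).
      exists x'. split; [auto|]. split; [auto|]. symmetry. now apply IH.
Qed.

Definition PI (f a v : W) : Prop := exists t q, collapse t q /\ opair f a ∈ KK t /\ v = app q (opair f a).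
Definition rep f a := function_on f dd /\ a ∈ xi.
(** The collapsed class of [(f, a)], with [emp] as default off the representatives so that the term
    is total and definable. *)
Definition pi (f a : W) : W := the (fun v => (rep f a -> PI f a v) /\ (~ rep f a -> v = emp)).

Lemma PI_exists f a : rep f a -> exists v, PI f a v.
Proof.
  intros [Hf Ha]. set (t := trcl (cup (ran f) (sing emp))).
  destruct (collapse_exists t) as (q & Hq); [apply trcl_trans|apply trcl_sub, in_cup; right; now apply in_sing|].
  exists (app q (opair f a)), t, q. split; [auto|]. split; [|auto]. apply in_KK. exists f, a. do 2 (split; [auto|]). split; [|auto].
  intros x Hx. apply trcl_sub, in_cup. left. apply in_ran. exists x. now apply (app_mem f dd).
Qed.

Lemma PI_uniq f a v w : PI f a v -> PI f a w -> v = w.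
Proof.
  intros (t & q & C1 & K1 & ->) (t' & q' & C2 & K2 & ->). apply (collapse_eq t q t' q' C1 C2 _ K1 _ K2).
  apply eqE_refl. now apply KK_snd in K1.
Qed.

Lemma pi_total f a : exists v, (rep f a -> PI f a v) /\ (~ rep f a -> v = emp).
Proof. destruct (classic (rep f a)) as [H|H]; [destruct (PI_exists f a H) as [v Hv]; exists v|exists emp]; tauto. Qed.

Lemma pi_spec f a : rep f a -> PI f a (pi f a).
Proof. apply (the_spec (fun v => (rep f a -> PI f a v) /\ (~ rep f a -> v = emp))). apply pi_total. Qed.

Lemma Dt_pi : Dt1 W (fun _ e => pi (e 0) (e 1)).
Proof.
  pose proof D_memZ. pose proof Dt_KK. unfold pi. apply Dt_the; [intros; apply pi_total| |unfold PI, collapse, rep; dfn].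
  intros _ e x y H1 H2. destruct (classic (rep (e 0) (e 1))) as [K|K]; [|destruct H1 as [_ H1], H2 as [_ H2]; rewrite H1, H2; auto].
  apply (PI_uniq (e 0) (e 1)); tauto.
Qed.

Lemma pi_eq f a g b : rep f a -> rep g b -> pi f a = pi g b <-> eqE f a g b.
Proof.
  intros H1 H2. destruct (pi_spec f a H1) as (t & q & C1 & K1 & ->), (pi_spec g b H2) as (t' & q' & C2 & K2 & ->).
  rewrite (collapse_eq t q t' q' C1 C2 _ K1 _ K2). unfold eqZ. now rewrite !fst_opair, !snd_opair.
Qed.

Lemma pi_elem w g b : rep g b -> w ∈ pi g b -> exists f a, rep f a /\ w = pi f a /\ memE f a g b.
Proof.
  intros H2 Hw. destruct (pi_spec g b H2) as (t' & q' & C2 & K2 & E). rewrite E in Hw.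
  destruct C2 as (C21 & C22 & C23 & C24). destruct (proj1 (C24 _ _ K2) Hw) as (y & Hy & My & ->).
  assert (C2 : collapse t' q') by (unfold collapse; auto).
  apply in_KK in Hy as Hy'. destruct Hy' as (f & a & -> & Hf & _ & Ha). exists f, a. split; [now split|].
  unfold memZ in My. rewrite !fst_opair, !snd_opair in My. split; [|auto].
  destruct (pi_spec f a (conj Hf Ha)) as (t & q & C1 & K1 & ->). apply (collapse_eq t' q' t q C2 C1 _ Hy _ K1).
  unfold eqZ. rewrite fst_opair, snd_opair. now apply eqE_refl.
Qed.

Lemma pi_mem f a g b : rep f a -> rep g b -> pi f a ∈ pi g b <-> memE f a g b.
Proof.
  intros H1 H2. split.
  - intros H. apply pi_elem in H as (f' & a' & H3 & E & K); [|auto]. apply pi_eq in E; auto.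
    apply (memE_eq_l Y f' a'); auto; [apply H3|apply H1|apply H2].
  - intros H. destruct (pi_spec f a H1) as (t & q & C1 & K1 & E1), (pi_spec g b H2) as (t' & q' & C2 & K2 & E2).
    assert (Mz : memZ (opair f a) (opair g b)) by (unfold memZ; now rewrite !fst_opair, !snd_opair).
    destruct (KK_bounded t' (opair f a) (opair g b)) as (y & Hy & Ey); eauto using KK_snd; try apply C2.
    rewrite E2. apply (proj2 (proj2 (proj2 (proj2 C2)) _ _ K2)). exists y. split; [auto|]. split; [apply (memZ_eq_l (opair f a)); eauto using KK_snd|].
    rewrite E1. apply (collapse_eq t q t' q' C1 C2); auto. apply eqZ_sym; eauto using KK_snd.
Qed.

(** * The collapsed ultrapower and Łoś's theorem *)

Definition NN (v : W) : Prop := exists f a, rep f a /\ v = pi f a.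
Local Notation N := (substructure W NN).

Lemma NN_pi f a : rep f a -> NN (pi f a).
Proof. intros H. exists f, a. auto. Qed.

Lemma NN_trans x y : NN x -> y ∈ x -> NN y.
Proof. intros (g & b & H & ->) K. apply pi_elem in K as (f & a & H1 & -> & _); auto. now apply NN_pi. Qed.

Lemma D_NN : Dfn1 W (fun _ e => NN (e 0)).
Proof. pose proof Dt_pi. unfold NN, rep. dfn. Qed.

Lemma D_los phi (fs : nat -> W) : Dfn1 W (fun _ e => sat W (fun n => app (fs n) (e 0)) phi).
Proof. apply (Dfn_sat (Vs := fun _ : unit => W) (Cst := fun _ => True) phi (fun n _ e => app (fs n) (e 0))). intros n. dfn. Qed.

Lemma D_los_all phi (fs : nat -> W) : Dfn1 W (fun _ e => sat W (scons (e 0) (fun n => app (fs n) (e 1))) phi).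
Proof.
  pose proof (Dfn_sat (Vs := fun _ : unit => W) (Cst := fun _ => True) phi (fun n _ e => match n with O => e 0 | S n => app (fs n) (e 1) end)) as H.
  apply H. intros [|n]; dfn.
Qed.

Theorem los phi : forall (fs : nat -> W) c (es : nat -> N), c ∈ xi -> (forall n, function_on (fs n) dd) ->
  (forall n, proj1_sig (es n) = pi (fs n) c) ->
  sat N es phi <-> EE (sep dd (fun x => sat W (fun n => app (fs n) x) phi)) c.
Proof.
  induction phi as [m n|m n| |phi IH1 psi IH2|phi IH]; intros fs c es Hc Hf He; cbn [sat].
  - change (proj1_sig (es m) ∈ proj1_sig (es n) <-> EE (sep dd (fun x => app (fs m) x ∈ app (fs n) x)) c).
    rewrite !He, pi_mem by (split; auto). apply relE_diag; auto. dfn.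
  - assert (E : es m = es n <-> pi (fs m) c = pi (fs n) c).
    { rewrite <- !He. split; [congruence|]. destruct (es m), (es n). cbn. intros ->. f_equal. apply proof_irrelevance. }
    rewrite E, pi_eq by (split; auto). apply relE_diag; auto. dfn.
  - split; [tauto|]. intros H. destruct (F_inhab Y c Hc _ H) as (x & _ & Hx). apply in_sepd in Hx; [tauto|dfn].
  - pose proof (D_los phi fs) as D1. pose proof (D_los psi fs) as D2.
    rewrite (IH1 fs c es), (IH2 fs c es) by auto. split.
    + intros H. apply NNPP. intros K. apply F_not in K; auto; [|dfn].
      assert (A : EE (sep dd (fun x => sat W (fun n => app (fs n) x) phi)) c).
      { refine (F_mono Y _ Hc _ _ _ _ _ K); try dfn. intros x _ Hx. tauto. }
      destruct (F_inhab Y c Hc _ (F_and Y c Hc _ _ D2 (D_not _ (D_imp _ _ D1 D2)) (H A) K)) as (x & Hx & Q).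
      apply in_sepd in Q; [|dfn]. tauto.
    + intros H1 H2. refine (F_mono Y _ Hc _ _ _ D2 _ (F_and Y c Hc _ _ _ D1 H1 H2)); [dfn|tauto|dfn].
  - pose proof (D_los_all phi fs) as DA. pose proof (D_los (FAll phi) fs) as D1. cbn [sat] in D1. split.
    + intros H. apply NNPP. intros K. apply F_not in K; auto.
      (* Choice in [W] picks a counterexample at every point that has one; its class refutes the
         universal statement in the ultrapower. *)
      destruct (choice_class dd (fun x v => (exists v, ~ sat W (scons v (fun n => app (fs n) x)) phi) -> ~ sat W (scons v (fun n => app (fs n) x)) phi))
        as (g & Hg & Kg).
      { apply D_imp; [apply D_ex|]; apply D_not; [exact (D_ren _ (fun n => match n with 0 => 0 | S n => 1 end) DA)|exact (D_ren _ (fun n => match n with 0 => 1 | S n => 0 end) DA)]. }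
      { intros x _. destruct (classic (exists v, ~ sat W (scons v (fun n => app (fs n) x)) phi)) as [[v Hv]|Nv]; [exists v; auto|exists x; tauto]. }
      assert (R : rep g c) by (split; auto).
      pose proof (proj1 (IH (scons g fs) c (scons (exist _ (pi g c) (NN_pi g c R) : N) es) Hc
        ltac:(intros [|n]; cbn; auto) ltac:(intros [|n]; cbn; auto)) (H _)) as A.
      pose proof (D_los phi (scons g fs)) as D2.
      destruct (F_inhab Y c Hc _ (F_and Y c Hc _ _ D2 (D_not _ D1) A K)) as (x & Hx & Q).
      apply in_sepd in Q; [|dfn]. destruct Q as (_ & Q1 & Q2).
      apply not_all_ex_not in Q2. apply (Kg x Hx Q2).
      revert Q1. apply sat_ext. intros [|n]; reflexivity.
    (* The new element may have a different seed [b], so all classes are first rewritten at the seed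
       [(c, b)] by composing with projections. *)
    + intros H [v Hv]. destruct Hv as (g & b & [Hg Hb] & E).
      pose proof (xi_opair Y c b Hc Hb) as Hd.
      set (fs' := fun n => lam dd (fun w => app (fs n) (fst w))). set (g' := lam dd (fun w => app g (snd w))).
      assert (Hf' : forall n, function_on (fs' n) dd) by (intros n; apply lam_function; dfn).
      assert (Hg' : function_on g' dd) by (apply lam_function; dfn).
      apply (IH (scons g' fs') (opair c b)); [auto|intros [|n]; cbn; auto| |].
      * intros [|n]; cbn.
        -- rewrite E. apply pi_eq; try split; auto. apply eqE_sym; auto. apply relE_p2; auto; [dfn|].
           refine (F_mono Y _ Hd _ _ _ _ _ (F_pairs Y c b Hc Hb)); try dfn. intros w Hw (x & y & H1 & H2 & ->). exists x, y.
           do 3 (split; [auto|]). unfold g'. rewrite app_lam by (auto; dfn). now rewrite snd_opair.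
        -- rewrite He. apply pi_eq; try split; auto. apply eqE_sym; auto. apply relE_p1; auto; [dfn|].
           refine (F_mono Y _ Hd _ _ _ _ _ (F_pairs Y c b Hc Hb)); try dfn. intros w Hw (x & y & H1 & H2 & ->). exists x, y.
           do 3 (split; [auto|]). unfold fs'. rewrite app_lam by (auto; dfn). now rewrite fst_opair.
      * refine (F_mono Y _ Hd _ _ _ (D_los phi (scons g' fs')) _ (F_pair Y c b _ Hc Hb D1 H)).
        { dfn. exact (D_ren _ (fun n => match n with 0 => 0 | S _ => 2 end) DA). }
        intros w Hw (x & y & H1 & H2 & -> & K). specialize (K (app g y)). revert K. apply sat_ext.
        intros [|n]; cbn; unfold fs', g'; rewrite app_lam by (auto; dfn); now rewrite ?fst_opair, ?snd_opair.
Qed.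

End Collapse.

(** * Cardinals and names of hereditarily small sets *)

Section Final.
Context (Y : setupW).
Local Notation X := (wX Y).
Local Notation V := (gV (wX Y)).
Local Notation W := (wW Y).
Local Notation i := (wi Y).
Local Notation G := (wG Y).
Local Notation P := (gP (wX Y)).
Local Notation S := (gS (wX Y)).
Local Notation k := (kap (wX Y)).
Local Notation le := (prikry_product_le S).
Local Notation DD := (DD (wX Y)).
Local Notation XX := (XX (wX Y)).
Local Notation nu := (nu (wX Y)).
Local Notation lam3 := (lam3 (wX Y)).
Local Notation jj := (jj (wX Y)).
Local Notation Hi := (Hi Y).
Local Notation EE := (EE Y).
Local Notation dd := (dd Y).
Local Notation xi := (xi Y).
Local Notation nval := (nval Y).
Local Notation NN := (NN Y).
Local Notation pi := (pi Y).
Local Notation N := (substructure W NN).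
Local Notation M := (substructure (gV (wX Y)) (gM (wX Y))).
Local Notation j := (gj (wX Y)).
Local Notation toM := (toM (wX Y)).
#[local] Instance Z2q : forall b, ZFC (two V M b) | 100 := two_ZFC V M (gZ X) (ZM X).

(** All stems of a condition as one subset of [k × k], for counting. *)
Definition stem (p : V) : V := sep (prod k k) (fun z => exists a x, z = opair a x /\ a ∈ S /\ x ∈ st p a).

Lemma in_stem p a x : p ∈ P -> opair a x ∈ stem p <-> a ∈ S /\ x ∈ st p a.
Proof.
  intros Hp. unfold stem. rewrite in_sep by dclass. rewrite opair_in_prod. split.
  - intros (_ & a' & x' & E & H). apply opair_inj in E as [<- <-]. auto.
  - intros [Ha Hx]. pose proof (S_k X a Ha) as Hk. split; [|exists a, x; auto]. split; [auto|].
    apply (ord_mem_trans k x a (k_ord X)); [|auto]. exact (st_sub S (gU X) P (gU_fun X) (gP_prod X) p a Hp Ha x Hx).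
Qed.

Lemma stem_compat p q : p ∈ P -> q ∈ P -> stem p = stem q -> exists r, r ∈ P /\ le r p /\ le r q.
Proof.
  intros Hp Hq E. apply (same_stem_compat S (gU X) P (gU_fun X) (gP_prod X) (gU_norm X)); auto.
  intros a Ha. apply ext_eq. intros x. pose proof (in_stem p a x Hp) as H1. pose proof (in_stem q a x Hq) as H2.
  rewrite E in H1. tauto.
Qed.

Lemma stem_bounded p : p ∈ P -> exists m, m ∈ k /\ subset (stem p) (prod m m).
Proof.
  intros Hp. destruct (P_supp S (gU X) P (gU_fun X) (gP_prod X) p Hp) as (F & HF & K).
  pose proof (k_sl X) as sl. pose proof (k_ord X) as Ok.
  destruct (finite_bounded k (cap F k) Ok) as (m & Hm & Hs).
  - apply sl_nat; auto using nat_0.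
  - intros m Hm. now apply sl_succ.
  - apply (finite_sub _ F); auto. intros z Hz. now apply in_cap in Hz.
  - intros z Hz. now apply in_cap in Hz.
  - exists m. split; [auto|]. intros z Hz. assert (Hz' := Hz). unfold stem in Hz'. rewrite in_sep in Hz' by dclass.
    destruct Hz' as (_ & a & x & -> & Ha & Hx). apply opair_in_prod.
    assert (Ham : a ∈ m).
    { apply Hs, in_cap. split; [|now apply S_k]. apply NNPP. intros Na. rewrite (K a Ha Na) in Hx. now apply in_emp in Hx. }
    split; [auto|]. apply (ord_mem_trans m x a); auto; [apply (ord_elem k); auto|].
    exact (st_sub S (gU X) P (gU_fun X) (gP_prod X) p a Hp Ha x Hx).
Qed.

(** Finite support confines the stems of a condition to some [m × m] with [m] below the strong limit
    [k]. *)
Lemma stems_card : card_le (img P stem) k.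
Proof.
  assert (DS : Dt1 V (fun _ e => stem (e 0))) by (unfold stem; dfn). pose proof (k_sl X) as sl.
  apply (card_le_trans _ (un (img k (fun m => pow (prod m m))))).
  - apply card_le_sub. intros z Hz. rewrite in_img in Hz by dclass. destruct Hz as (p & Hp & ->).
    destruct (stem_bounded p Hp) as (m & Hm & Hs). apply in_un. exists (pow (prod m m)). split; [|now apply in_pow].
    rewrite in_img by dclass. eauto.
  - apply card_le_Union; [dfn|now apply sl_square|apply card_le_refl|]. intros m Hm.
    destruct (sl_pow k (prod m m) sl (sl_prod k m m sl (small_mem k m Hm) (small_mem k m Hm))) as (b & Hb & K).
    apply (card_le_trans _ b); [auto|]. apply card_le_sub. exact (proj1 (k_ord X) b Hb).
Qed.

(* conditions with the same stem are compatible, so a name for a function can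
   take only [k] many values at each argument *)
Lemma no_collapse m d : card_le (prod m m) m -> card_le k m -> card_le (i d) (i m) -> card_le d m.
Proof.
  intros Hsq Hkm [f Hf]. apply injection_iff in Hf as (F1 & F2 & F3).
  (* The inverse of [f] gets the name: as a partial function from [m] onto [d] it reaches every
     element of [d], and a possible value is identified by an argument and a stem. *)
  set (A := sep (prod (i m) (i d)) (fun z => exists b x, z = opair b x /\ x ∈ i d /\ app f x = b)).
  assert (HA : forall b x, opair b x ∈ A <-> x ∈ i d /\ app f x = b).
  { intros b x. unfold A. rewrite in_sep by dclass. rewrite opair_in_prod. split.
    - intros (_ & b' & x' & E & H). apply opair_inj in E as [<- <-]. auto.
    - intros [Hx <-]. split; [auto|]. exists (app f x), x. auto. }
  destruct (subset_name Y (prod m d) A) as (t & Ot & St & Et).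
  { intros z Hz. unfold A in Hz. rewrite in_sep in Hz by dclass. rewrite (h_prod i Hi). tauto. }
  destruct (functional_name Y t d m Ot St) as (p & Gp & Hp & Fp).
  { intros b x y H1 H2. rewrite Et in H1, H2. apply HA in H1 as [H1 E1], H2 as [H2 E2]. apply F3; congruence. }
  assert (DS : Dt1 V (fun _ e => stem (e 0))) by (unfold stem; dfn).
  destruct (choice_fun d (prod m (img P stem))
    (fun x z => exists r b, r ∈ P /\ le r p /\ opair r (opair b x) ∈ t /\ z = opair b (stem r))) as (g & Hg & Kg); [dfn| |].
  { intros x Hx. assert (H : opair (app f (i x)) (i x) ∈ A) by (apply HA; split; [now apply (i_mem Y)|auto]).
    assert (Hb : app f (i x) ∈ i m) by (apply F2; now apply (i_mem Y)).
    apply (h_mem_iff i Hi) in Hb as (b & Eb & Hb). rewrite Eb, <- (h_opair i Hi), <- Et in H.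
    apply nval_i in H as (q & Gq & Hq). destruct (G_meet Y p q Gp Gq) as (r & Gr & Hr & L1 & L2).
    exists (opair b (stem r)). split.
    - apply opair_in_prod. split; [auto|]. rewrite in_img by dclass. eauto.
    - exists r, b. do 2 (split; [auto|]). split; [|auto]. apply (Ot q r); auto. now apply G_P in Gq. }
  apply (card_le_trans _ (prod m (img P stem))).
  - exists g. apply injection_iff. split; [auto|]. split; [intros x Hx; now apply Kg|].
    intros x y Hx Hy E. destruct (Kg x Hx) as (_ & r & b & Hr & L & Ht & Ez), (Kg y Hy) as (_ & r' & b' & Hr' & L' & Ht' & Ez').
    rewrite E, Ez' in Ez. apply opair_inj in Ez as [-> Es].
    destruct (stem_compat r' r Hr' Hr Es) as (s & Hs & L1 & L2). apply (Fp s b x y); auto.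
    + apply (le_transP X _ r); auto.
    + apply (Ot r s); auto.
    + apply (Ot r' s); auto.
  - apply (card_le_trans _ (prod m m)); [|auto]. apply card_le_prod; [apply card_le_refl|].
    apply (card_le_trans _ k); auto using stems_card.
Qed.

Lemma hartogs_preserved m : ordinal m -> card_le (prod m m) m -> card_le k m -> cardinal (i (hartogs m)).
Proof.
  intros Om Hsq Hkm. split; [apply (h_ordinal i Hi), hartogs_ord|]. intros a Ha H.
  apply (h_mem_iff i Hi) in Ha as (a' & -> & Ha). apply in_hartogs in Ha as [_ Ha].
  apply (hartogs_not_le m). apply no_collapse; auto. apply (card_le_trans _ (i a')); [auto|]. now apply (h_card_le i Hi).
Qed.

Lemma k_square : card_le (prod k k) k. Proof. apply sl_square, k_sl. Qed.
Lemma hk_square : card_le (prod (hartogs k) (hartogs k)) (hartogs k).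
Proof.
  destruct (gch_pow X k (kap_card X) (not_finite_k X)). apply (card_square_equiv X (pow k)); auto. apply pow_k_square.
Qed.
Lemma k_hk : card_le k (hartogs k).
Proof. apply card_le_sub. apply (proj1 (hartogs_ord k)). apply in_hartogs. split; [apply k_ord|apply card_le_refl]. Qed.

(** The successor in [W] is minimal, so the preserved ground model cardinal bounds it from above. *)
Lemma succ_card_bound (x y : W) (m : V) : is_succ_card x y -> cardinal x -> ordinal m -> cardinal (i (hartogs m)) -> subset x (i m) ->
  subset y (i (hartogs m)).
Proof.
  intros (Cy & Hx & Hmin) Cx Om Cm Hs. apply Hmin; [auto|].
  assert (Hm : i m ∈ i (hartogs m)) by (apply (i_mem Y), in_hartogs; split; [auto|apply card_le_refl]).
  destruct (ord_subset_mem x (i m)) as [->|H]; auto; [apply Cx|now apply (h_ordinal i Hi)|].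
  apply (ord_mem_trans (i (hartogs m)) x (i m)); auto. apply Cm.
Qed.

Lemma H_small l x : cardinal (i k) -> is_plus3 (i k) l -> in_H l x -> card_le (trcl x) (i nu).
Proof.
  intros Ck (x1 & x2 & H1 & H2 & H3) Hx.
  pose proof (hartogs_preserved k (k_ord X) k_square (card_le_refl k)) as C1.
  pose proof (hartogs_preserved (hartogs k) (hartogs_ord k) hk_square k_hk) as C2.
  pose proof (hartogs_preserved nu (hartogs_ord _) (nu_square X) (card_le_sub _ _ (k_sub_nu X))) as C3.
  pose proof (succ_card_bound (i k) x1 k H1 Ck (k_ord X) C1 (subset_refl _)) as B1.
  pose proof (succ_card_bound x1 x2 (hartogs k) H2 (proj1 H1) (hartogs_ord _) C2 B1) as B2.
  pose proof (succ_card_bound x2 l nu H3 (proj1 H2) (hartogs_ord _) C3 B2) as B3.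
  apply in_H_iff in Hx; [|apply H3]. destruct Hx as (b & Hb & K). apply B3 in Hb.
  apply (h_mem_iff i Hi) in Hb as (b' & -> & Hb). apply in_hartogs in Hb as [_ Hb].
  apply (card_le_trans _ (i b')); [auto|]. now apply (h_card_le i Hi).
Qed.

Lemma nu_XX : nu ∈ XX.
Proof. apply XX_nu_elem. apply in_hartogs. split; [apply nu_ord|apply card_le_refl]. Qed.

(** Names of the elements are enumerated along [nu]. The enumeration has an open name in the ground
    model, which becomes small below a condition forcing it to be a function and is then turned into
    a name of [x]. *)
Lemma small_has_name : forall x, card_le (trcl x) (i nu) -> exists t, t ∈ xi /\ evaluates G t x.
Proof.
  apply (mem_induction (fun x => card_le (trcl x) (i nu) -> exists t, t ∈ xi /\ evaluates G t x)).
  { apply dclass_intro. dfn; apply D_evaluates; dfn. }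
  intros x IH Hx.
  assert (Hx' : card_le x (i nu)) by (apply (card_le_trans _ (trcl x)); [apply card_le_sub, trcl_sub|auto]).
  destruct Hx' as [g Hg]. apply injection_iff in Hg as (G1 & G2 & G3).
  destruct (choice_fun x xi (fun y t => evaluates G t y)) as (n & Hn & Kn).
  { apply D_evaluates; dfn. }
  { intros y Hy. apply IH; [auto|]. apply (card_le_trans _ (trcl x)); [apply card_le_sub, trcl_elem|]; auto. }
  set (A := sep (prod (i nu) xi) (fun z => exists y, y ∈ x /\ z = opair (app g y) (app n y))).
  assert (HA : forall b t, opair b t ∈ A <-> exists y, y ∈ x /\ b = app g y /\ t = app n y).
  { intros b t. unfold A. rewrite in_sep by dclass. rewrite opair_in_prod. split.
    - intros (_ & y & Hy & E). apply opair_inj in E as [-> ->]. eauto.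
    - intros (y & Hy & -> & ->). split; [|eauto]. split; [auto|]. now apply Kn. }
  destruct (subset_name Y (prod nu XX) A) as (t & Ot & St & Et).
  { intros z Hz. unfold A in Hz. rewrite in_sep in Hz by dclass. rewrite (h_prod i Hi). tauto. }
  destruct (functional_name Y t XX nu Ot St) as (p & Gp & Hp & Fp).
  { intros b u v H1 H2. rewrite Et in H1, H2. apply HA in H1 as (y & Hy & -> & ->), H2 as (y' & Hy' & E & ->).
    f_equal. now apply G3. }
  pose proof (small_name Y t p nu nu_XX St Hp Fp) as Ht1. set (t1 := sep t (fun z => le (fst z) p)) in Ht1.
  assert (In1 : forall r b u, opair r (opair b u) ∈ t1 <-> opair r (opair b u) ∈ t /\ le r p).
  { intros r b u. unfold t1. rewrite in_sep by dclass. now rewrite fst_opair. }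
  (* Each name [u] is attached to the conditions that place it somewhere in the enumeration; the
     position [b] is forgotten. *)
  set (T := img t1 (fun z => opair (snd (snd z)) (fst z))).
  assert (InT : forall u r, opair u r ∈ T <-> exists b, opair r (opair b u) ∈ t1).
  { intros u r. unfold T. rewrite in_img by dclass. split.
    - intros (z & Hz & E). assert (Hz' := Hz). unfold t1 in Hz'. rewrite in_sep in Hz' by dclass. destruct Hz' as [Hz' _].
      apply St in Hz'. apply in_prod in Hz' as (r' & w & _ & Hw & ->). apply in_prod in Hw as (b & u' & _ & _ & ->).
      rewrite !snd_opair, fst_opair in E. apply opair_inj in E as [-> ->]. eauto.
    - intros (b & Hb). exists (opair r (opair b u)). split; [auto|]. now rewrite !snd_opair, fst_opair. }
  assert (TX : T ∈ XX).
  { apply XX_intro.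
    - intros z Hz. unfold T in Hz. rewrite in_img in Hz by dclass. destruct Hz as (w & Hw & ->).
      assert (Hw' := Hw). unfold t1 in Hw'. rewrite in_sep in Hw' by dclass. destruct Hw' as [Hw' _].
      apply St in Hw'. apply in_prod in Hw' as (r' & w' & _ & Hw' & ->). apply in_prod in Hw' as (b & u' & _ & _ & ->).
      rewrite !snd_opair, fst_opair. apply (XX_trans X t1 Ht1) in Hw. apply XX_opair_inv in Hw as [A1 A2].
      apply XX_opair_inv in A2 as [A2 A3]. now apply XX_opair.
    - apply (card_le_trans _ t1); [|now apply card_XX]. unfold T. apply card_le_img. dfn. }
  exists (i T). split; [now apply (i_mem Y)|].
  destruct (evaluates_exists G (i T)) as (y & Hy). enough (y = x) by congruence.
  apply ext_eq. intros z. rewrite (evaluates_mem G (i T) y Hy). split.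
  - intros (u & r & Gr & Hur & Ez). apply (h_pair_inv i Hi) in Hur as (u' & r' & -> & -> & Hur).
    apply InT in Hur as (b & Hb). apply In1 in Hb as [Hb _].
    assert (K : opair (i b) (i u') ∈ A). { rewrite <- Et, <- (h_opair i Hi). apply nval_i. eauto. }
    apply HA in K as (y' & Hy' & _ & E). rewrite E in Ez. rewrite (evaluates_uniq G _ z y' Ez); [auto|]. now apply Kn.
  - intros Hz. assert (K : opair (app g z) (app n z) ∈ A) by (apply HA; eauto).
    destruct (Kn z Hz) as [Kx Kz]. apply (h_mem_iff i Hi) in Kx as (u & Eu & _).
    pose proof (G2 z Hz) as Kb. apply (h_mem_iff i Hi) in Kb as (b & Eb & _).
    rewrite Eu, Eb, <- (h_opair i Hi), <- Et in K. apply nval_i in K as (q & Gq & Hq).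
    destruct (G_meet Y p q Gp Gq) as (r & Gr & Hr & L1 & L2).
    exists (i u), (i r). split; [auto|]. split.
    + apply (h_opair_mem i Hi). apply InT. exists b. apply In1. split; [|auto]. apply (Ot q r); auto. now apply G_P in Gq.
    + now rewrite <- Eu.
Qed.

(** * The lifted embedding *)

Definition cst (w : W) : W := lam dd (fun _ => w).
Definition idf : W := lam dd (fun x => x).

Lemma cst_fun w : function_on (cst w) dd. Proof. apply lam_function. dfn. Qed.
Lemma cst_app w x : x ∈ dd -> app (cst w) x = w. Proof. intros. unfold cst. rewrite app_lam; auto. dfn. Qed.
Lemma idf_fun : function_on idf dd. Proof. apply lam_function. dfn. Qed.
Lemma idf_app x : x ∈ dd -> app idf x = x. Proof. intros. unfold idf. rewrite app_lam; auto. dfn. Qed.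

Lemma rep_cst w a : a ∈ xi -> rep Y (cst w) a. Proof. split; [apply cst_fun|auto]. Qed.
Lemma rep_id a : a ∈ xi -> rep Y idf a. Proof. split; [apply idf_fun|auto]. Qed.

(** The seed of a constant function is immaterial, by [js_index]; [i emp] is an arbitrary choice. *)
Definition js (w : W) : N := exist _ (pi (cst w) (i emp)) (NN_pi Y _ _ (rep_cst w _ (xi_inh Y))).

Definition hN : N -> W := @proj1_sig W NN.
Lemma HN : end_embedding N W hN. Proof. exact (substructure_end W NN (NN_trans Y)). Qed.

Lemma js_index w a : a ∈ xi -> hN (js w) = pi (cst w) a.
Proof.
  intros Ha. cbn. pose proof (xi_inh Y) as H0. apply pi_eq; auto using rep_cst.
  refine (F_mono Y _ (xi_opair Y _ _ H0 Ha) _ _ _ _ _ (F_pairs Y _ _ H0 Ha)); try dfn.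
  intros w' Hw (x & y & H1 & H2 & ->). exists x, y. do 3 (split; [auto|]). now rewrite !cst_app.
Qed.

Lemma js_elem : elementary_embedding W N js.
Proof.
  intros phi e. rewrite (los Y phi (fun n => cst (e n)) (i emp) (fun n => js (e n))); auto using xi_inh, cst_fun.
  pose proof (D_los Y phi (fun n => cst (e n))) as DL. split.
  - intros H. apply F_all; auto using xi_inh. intros x Hx. revert H. apply sat_ext. intros n. now rewrite cst_app.
  - intros H. destruct (F_inhab Y _ (xi_inh Y) _ H) as (x & Hx & K). apply in_sepd in K; [|auto]. destruct K as [_ K].
    revert K. apply sat_ext. intros n. now rewrite cst_app.
Qed.

Lemma jj_mem_rel B x y : (forall x y, opair x y ∈ B <-> opair x y ∈ DD /\ x ∈ y) -> x ∈ XX -> y ∈ XX -> x ∈ y ->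
  opair x y ∈ jj B.
Proof.
  intros HB Hx Hy Hxy. rewrite <- (hM_toM X (opair x y)) by now apply XX_M, XX_opair. apply hM_up.
  rewrite toM_opair by auto.
  apply (proj2 (proj1 (transfer j (gj_elem X) (fun b e => forall x y, @opair _ (Z2q b) x y ∈ e 0 <-> @opair _ (Z2q b) x y ∈ e 1 /\ x ∈ y)
    ltac:(dfn) (scons B (fun _ => DD))) HB (toM x) (toM y))).
  cbn [scons]. split.
  - pose proof (toM_jD Y (opair x y) (XX_opair X x y Hx Hy)) as K. rewrite toM_opair in K by auto. exact K.
  - change (hM X (toM x) ∈ hM X (toM y)). rewrite !hM_toM; auto using XX_M.
Qed.

(** A member of the class of [(id, a)] is the class of [(id, b)] for some [b] in [a], by [E_value].
    Conversely, for [b] in [a] the set of pairs related by [∈] is a ground model set of measure one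
    at [(b, a)], by [E_ground]. *)
Lemma pi_id : forall a, a ∈ xi -> pi idf a = a.
Proof.
  pose proof (Dt_pi Y) as DP. apply (mem_induction (fun a => a ∈ xi -> pi idf a = a)); [dclass|].
  intros a IH Ha. assert (Ta : forall z, z ∈ a -> z ∈ xi).
  { unfold xi in Ha |- *. apply (h_mem_iff i Hi) in Ha as (a' & -> & Ha). intros z Hz.
    apply (h_mem_iff i Hi) in Hz as (b & -> & Hb). apply (i_mem Y). exact (XX_trans X a' Ha b Hb). }
  apply ext_eq. intros z. split.
  - intros Hz. apply pi_elem in Hz as (g & c & [Hg Hc] & -> & Hm); auto using rep_id.
    set (A := sep dd (fun w => exists x v, x ∈ dd /\ w = opair x v /\ v = app g x)).
    destruct (idx Y a Ha) as (a' & Ea & Ha'), (idx Y c Hc) as (c' & Ec & Hc').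
    destruct (E_value Y A c' a') as (b & Hb & K); auto.
    + unfold A. apply sepd_sub. dfn.
    + rewrite (h_opair i Hi), <- Ea, <- Ec. refine (F_mono Y _ (xi_opair Y _ _ Hc Ha) _ _ _ _ _ Hm); try dfn.
      intros w Hw (x & y & H1 & H2 & -> & Hm'). rewrite idf_app in Hm' by auto. exists x, y, (app g x).
      split; [auto|]. split; [auto|]. unfold A. apply in_sepd; [dfn|].
      split; [apply dd_opair; split; [auto|]|exists x, (app g x); auto].
      unfold dd in H2 |- *. apply (h_mem_iff i Hi) in H2 as (y' & -> & H2). apply (h_mem_iff i Hi) in Hm' as (v & -> & Hv).
      apply (i_mem Y). exact (DD_trans Y y' H2 v Hv).
    + rewrite (h_opair i Hi), <- Ec in K. assert (Hba : i b ∈ a) by (rewrite Ea; now apply (i_mem Y)).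
      enough (E : pi g c = pi idf (i b)) by (rewrite E, IH; auto).
      apply pi_eq; [now split|now apply rep_id, Ta|]. refine (F_mono Y _ (xi_opair Y _ _ Hc (Ta _ Hba)) _ _ _ _ _ K); try dfn.
      intros w Hw (x & v & Hx & -> & E). apply dd_opair in Hw as [_ Hv]. exists x, v. do 3 (split; [auto|]). now rewrite idf_app.
  - intros Hz. rewrite <- (IH z Hz) by auto. apply pi_mem; auto using rep_id.
    set (B := sep DD (fun w => exists x y, w = opair x y /\ x ∈ y)).
    destruct (idx Y a Ha) as (a' & Ea & Ha'), (idx Y z (Ta z Hz)) as (z' & Ez & Hz').
    assert (Hza : z' ∈ a') by (apply (i_mem Y); now rewrite <- Ea, <- Ez).
    assert (HB : forall x y, opair x y ∈ B <-> opair x y ∈ DD /\ x ∈ y).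
    { intros x y. unfold B. rewrite in_sep by dclass. split.
      - intros (H1 & x' & y' & E & K). apply opair_inj in E as [<- <-]. auto.
      - intros [H1 H2]. split; [auto|]. eauto. }
    assert (E0 : EE (i B) (i (opair z' a'))).
    { apply E_ground; [intros w Hw; unfold B in Hw; rewrite in_sep in Hw by dclass; tauto|now apply XX_opair|].
      now apply jj_mem_rel. }
    rewrite (h_opair i Hi), <- Ea, <- Ez in E0. unfold memE, relE. apply (F_up Y _ (xi_opair Y _ _ (Ta z Hz) Ha) _ _ E0).
    + intros w Hw. apply (h_mem_iff i Hi) in Hw as (w' & -> & Hw). assert (Hw' := Hw). unfold B in Hw'. rewrite in_sep in Hw' by dclass.
      destruct Hw' as (Hd & x & y & -> & Hxy). assert (Hd' := Hd). apply DD_opair in Hd' as [Hx Hy].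
      apply in_sepd; [dfn|]. unfold dd. split; [now apply (i_mem Y)|]. exists (i x), (i y). rewrite !(i_mem Y).
      do 2 (split; [auto|]). split; [apply (h_opair i Hi)|]. rewrite !idf_app by (now apply (i_mem Y)). now apply (i_mem Y).
    + apply sepd_sub. dfn.
Qed.

#[local] Instance ZN : ZFC N := elementary_ZFC js js_elem (ZW Y).
#[local] Instance Z2N : forall b, ZFC (two W N b) | 100 := two_ZFC W N (ZW Y) ZN.
Local Notation trN := (transfer js js_elem).

(** As [j] fixes [x], the singleton of [x] has measure one at the seed [x], and there the constant
    function agrees with the identity. *)
Lemma js_fix x : x ∈ DD -> hN (js (i x)) = i x.
Proof.
  intros Hx. assert (Hxi : i x ∈ xi) by (apply (i_mem Y); now apply D_sub_XX).
  rewrite (js_index (i x) (i x) Hxi). rewrite <- (pi_id (i x) Hxi) at 3.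
  apply pi_eq; auto using rep_cst, rep_id. apply relE_diag; [dfn|auto|].
  assert (E0 : EE (i (sing x)) (i x)).
  { apply E_ground; [intros z Hz; apply in_sing in Hz; now subst|now apply D_sub_XX|].
    rewrite <- (D_fix X x Hx) at 1. apply jj_mem. now apply in_sing. }
  apply (F_up Y _ Hxi _ _ E0).
  - rewrite (h_sing i Hi). intros w Hw. apply in_sing in Hw. subst w. apply in_sepd; [dfn|].
    assert (Hd : i x ∈ dd) by now apply (i_mem Y). split; [auto|]. now rewrite cst_app, idf_app.
  - apply sepd_sub. dfn.
Qed.

Lemma k_DD : subset k DD.
Proof. intros x Hx. apply Hset_ord; [apply k_sl|auto]. Qed.

(** Since [k] lies in [j k], the set [k] has measure one at the seed [k]; on it the identity takes
    values below the constant [k]. *)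
Lemma k_in_js : i k ∈ hN (js (i k)).
Proof.
  assert (Hxi : i k ∈ xi) by (apply (i_mem Y), k_XX).
  rewrite (js_index (i k) (i k) Hxi). rewrite <- (pi_id (i k) Hxi) at 1.
  apply pi_mem; auto using rep_cst, rep_id. apply relE_diag; [dfn|auto|].
  assert (E0 : EE (i k) (i k)) by (apply E_ground; [apply k_DD|apply k_XX|apply k_in_jk]).
  apply (F_up Y _ Hxi _ _ E0).
  - intros w Hw. apply in_sepd; [dfn|].
    assert (Hd : w ∈ dd) by (apply (h_mem_iff i Hi) in Hw as (x & -> & Hx); apply (i_mem Y); now apply k_DD).
    split; [auto|]. now rewrite cst_app, idf_app.
  - apply sepd_sub. dfn.
Qed.

Lemma k_js_fix x : x ∈ i k -> hN (js x) = x.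
Proof. intros Hx. apply (h_mem_iff i Hi) in Hx as (x' & -> & Hx). apply js_fix. now apply k_DD. Qed.

(** The argument of [crit_no_inj], repeated in [W] for [js]: the lifted injection takes its value at
    [k] already at some point below [k]. *)
Lemma ik_cardinal : cardinal (i k).
Proof.
  split; [apply (h_ordinal i Hi), k_ord|]. intros a Ha [g Hg].
  assert (Hj : injection (js g) (js (i k)) (js a)).
  { apply (proj1 (trN (fun b e => @injection _ (e 0) (e 1) (e 2)) ltac:(dfn) (scons g (scons (i k) (fun _ => a))))). exact Hg. }
  apply (h_injection hN HN) in Hj. rewrite (k_js_fix a Ha) in Hj.
  apply injection_iff in Hg as (F1 & F2 & F3), Hj as (G1 & G2 & G3).
  pose proof (G2 _ k_in_js) as Ky. set (y := app (hN (js g)) (i k)) in *.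
  assert (Hyk : y ∈ i k) by (apply (ord_mem_trans (i k) y a); auto; apply (h_ordinal i Hi), k_ord).
  pose proof (app_mem _ _ _ G1 k_in_js) as Kp. fold y in Kp. rewrite <- (k_js_fix y Hyk) in Kp.
  assert (Hx : exists x, opair x y ∈ g).
  { apply (proj2 (trN (fun b e => exists x, @opair _ (Z2N b) x (e 0) ∈ e 1) ltac:(dfn) (scons y (fun _ => g)))). cbn [scons].
    apply (h_pair_inv hN HN) in Kp as (u & v & Eu & Ev & K). exists u. apply (ee_inj _ _ _ HN) in Ev. now rewrite Ev. }
  destruct Hx as (x & Hx). pose proof (function_on_dom _ _ _ _ F1 Hx) as Hxk.
  assert (K : opair x y ∈ hN (js g)).
  { rewrite <- (k_js_fix x Hxk), <- (k_js_fix y Hyk). apply (h_opair_mem hN HN).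
    apply (proj1 (trN (fun b e => @opair _ (Z2N b) (e 0) (e 1) ∈ e 2) ltac:(dfn) (scons x (scons y (fun _ => g))))). exact Hx. }
  apply (mem_irrefl (i k)). rewrite <- (G3 x (i k)) at 1; auto using k_in_js.
  - rewrite <- (k_js_fix x Hxk).
    exact (proj2 (elementary_mem js js_elem x (i k)) Hxk).
  - now apply (app_val _ _ _ _ G1) in K.
Qed.

(* A condition [p] is in [G] iff some element of [js G] is below it. *)
Lemma G_in_N : NN G.
Proof.
  assert (HP : i P ∈ xi) by (apply (i_mem Y), P_XX).
  set (PN := exist NN (pi idf (i P)) (NN_pi Y _ _ (rep_id _ HP)) : N).
  assert (EP : hN PN = i P) by (now apply pi_id).
  assert (D2 : Dfn2 W N (fun b e => exists q, q ∈ e 0 /\ prikry_product_le (e 1) q (e 2))) by dfn.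
  destruct (Dfn_closed _ D2) as [phi Hphi].
  set (C := fun p : N => exists q, q ∈ js G /\ prikry_product_le (js (i S)) q p).
  set (b := sep PN C).
  assert (Hb : forall p, p ∈ b <-> p ∈ PN /\ C p) by (intros p; apply in_sep; unfold C; dclass).
  enough (E : hN b = G) by (rewrite <- E; exact (proj2_sig b)).
  destruct (E_G Y) as (y & Hy & H1 & H2).
  assert (K : forall p (Hp : p ∈ P) (pN : N), hN pN = i p -> C pN <-> i p ∈ G).
  { intros p Hp pN Ep. assert (Hpx : i p ∈ xi) by (apply (i_mem Y); now apply P_elem_XX).
    pose proof (Hphi false (scons (js G) (scons (js (i S)) (fun _ => pN)))) as A1. cbn [scons] in A1.
    unfold C. etransitivity; [exact A1|]. change (two W N false) with N.
    rewrite (los Y phi (scons (cst G) (scons (cst (i S)) (fun _ => idf))) (i p)); auto.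
    - rewrite <- (H2 p Hp).
      pose proof (D_los Y phi (scons (cst G) (scons (cst (i S)) (fun _ => idf)))) as DL.
      (* By Łoś's theorem the question becomes one about the ultrafilter at [p]: pointwise, with
         constants for [G] and [i S] and the identity for [p], the formula defines the set from
         [E_G]. *)
      enough (A : forall x, x ∈ dd -> sat W (fun n => app (scons (cst G) (scons (cst (i S)) (fun _ => idf)) n) x) phi <-> x ∈ nval y).
      { split; intros Q; apply (F_up Y _ Hpx _ _ Q).
        - intros x Hx. apply in_sepd in Hx as [Hx Q']; [|auto]. now apply A.
        - now apply nval_sub, Hy.
        - intros x Hx. apply in_sepd; [auto|]. assert (Hd : x ∈ dd) by (revert x Hx; now apply nval_sub, Hy). split; [auto|]. now apply A.
        - now apply sepd_sub. }
      intros x Hx. etransitivity; [|etransitivity; [symmetry; exact (Hphi true (scons G (scons (i S) (fun _ => x))))|]].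
      + change (two W N true) with W. apply sat_ext. intros [|[|n]]; cbn [scons]; now rewrite ?cst_app, ?idf_app.
      + cbn [scons]. apply (h_mem_iff i Hi) in Hx as (x' & -> & Hx). rewrite (H1 x' Hx). split.
        * intros (q & Gq & L). destruct (G_elem Y q Gq) as (q' & -> & Hq'). apply (h_product_le i Hi) in L. eauto.
        * intros (q & Gq & L). exists (i q). split; [auto|]. now apply (h_product_le i Hi).
    - intros [|[|n]]; cbn [scons]; auto using cst_fun, idf_fun.
    - intros [|[|n]]; cbn [scons]; [now apply js_index|now apply js_index|]. now rewrite pi_id. }
  apply (h_ext hN HN).
  - intros p. rewrite Hb. split.
    + intros [Hp Cp]. apply (ee_mem _ _ _ HN) in Hp. rewrite EP in Hp. apply (h_mem_iff i Hi) in Hp as (p' & E & Hp).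
      rewrite E. now apply (K p' Hp p).
    + intros Gp. destruct (G_elem Y _ Gp) as (p' & E & Hp). split.
      * apply (proj1 (ee_mem _ _ _ HN p PN)). rewrite EP, E. now apply (i_mem Y).
      * apply (K p' Hp p E). now rewrite <- E.
  - intros w Hw. destruct (G_elem Y w Hw) as (p & -> & Hp).
    assert (Hpx : i p ∈ xi) by (apply (i_mem Y); now apply P_elem_XX).
    exists (exist NN (pi idf (i p)) (NN_pi Y _ _ (rep_id _ Hpx)) : N). symmetry. now apply pi_id.
Qed.

(** [N] contains the name and [G]. The name is evaluated inside [N], and absoluteness of the
    recursion gives the same value in [W]. *)
Lemma small_in_N x : card_le (trcl x) (i nu) -> NN x.
Proof.
  intros Hx. destruct (small_has_name x Hx) as (t & Ht & Ev).
  set (tN := exist NN (pi idf t) (NN_pi Y _ _ (rep_id _ Ht)) : N). set (GN := exist NN G G_in_N : N).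
  destruct (evaluates_exists GN tN) as (y & Hy). apply (evaluates_up hN HN) in Hy. cbn in Hy. rewrite pi_id in Hy by auto.
  rewrite (evaluates_uniq G t x (hN y) Ev Hy). exact (proj2_sig y).
Qed.

Theorem lifted_strong : H3_strong W (i k).
Proof.
  split; [apply ik_cardinal|]. exists NN, js. split; [|split; [|split; [|split; [|split]]]].
  - pose proof (D_NN Y). dclass.
  - pose proof (Dt_pi Y). change (definable_relation (fun x y => pi (lam dd (fun _ => x)) (i emp) = y)). dclass.
  - exact (NN_trans Y).
  - exact js_elem.
  - split; [apply (h_ordinal i Hi), k_ord|]. split; [exact k_js_fix|]. intros E. apply (mem_irrefl (i k)). rewrite <- E at 2. exact k_in_js.
  - intros l x Hl Hx. apply small_in_N. apply (H_small l); auto using ik_cardinal.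
Qed.

End Final.

Theorem theorem2p2 (V : structure) (HZFC : ZFC V) (HGCH : GCH V)
  (kappa : V) (Hkappa : H3_strong V kappa)
  (S : V)
  (HS : forall alpha, alpha ∈ S -> measurable alpha /\ alpha ∈ kappa)
  (Hdiscrete : discrete S)
  (U : V) (HU : function_on U S)
  (Hnormal : forall alpha u, pair_mem alpha u U -> normal_measure u alpha)
  (P : V) (HP : is_prikry_product S U P)
  (W : structure) (i : V -> W) (G : W)
  (HW : generic_extension V P (prikry_product_le S) W i G) :
  H3_strong W (i kappa).
Proof.
  destruct Hkappa as (Ck & M & j & DM & Dj & TM & Ej & Cr & HM).
  exact (lifted_strong (Build_setupW (Build_setup V HZFC HGCH kappa M j Ck DM Dj TM Ej Cr HM S HS Hdiscrete U HU Hnormal P HP) W i G HW)).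
Qed.
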